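(* The Martin compactification $\hat\Sigma$ of $\Sigma$ with respect to $\mathcal{L}=\Delta-1$ is homeomorphic to the closed half disk $D=\{(u,v)\in\mathbb{R}^2:u^2+v^2\le1,\ v\ge0\}$, with $\Sigma$ corresponding to $D\setminus\partial D$ (where $\partial D$ is the union of the segment $[-1,1]\times\{0\}$ and the upper semicircle), and every point of the Martin boundary $\partial\hat\Sigma$ is minimal. Under this homeomorphism: (1) for each $\xi\in\mathbb{R}$, points $(\xi',\eta)\in\Sigma$ with $(\xi',\eta)\to(\xi,0)$ in $\mathbb{R}^2$ converge in $\hat\Sigma$ to a boundary point $\omega_\xi$, and $\xi\mapsto\omega_\xi$ is a homeomorphism of $\mathbb{R}$ onto the open segment $\{(u,0):-1<u<1\}$; (2) for fixed $\xi_0>0$, the points $(\xi_0,\eta)$ with $\eta\to\infty$ converge to the boundary point corresponding to $(0,1)$; (3) for each $\theta\in(0,\pi/2)\cup(\pi/2,\pi)$, points $(\xi,\xi\tan\theta)$ with $\xi\tan\theta\to\infty$ converge to the boundary point corresponding to $(\cos\theta,\sin\theta)$; and the boundary points corresponding to $(1,0)$ and $(-1,0)$ are the limits of $\omega_\xi$ as $\xi\to+\infty$, resp. $\xi\to-\infty$ (equivalently the limits of the points in (3) as $\theta\to0$, resp. $\theta\to\pi$); (4) for every $\xi\in\mathbb{R}$ and every boundary point $\omega\in\partial\hat\Sigma$ with $\omega\neq\omega_\xi$, one has $\lim_{(x,y)\to\omega}K(x,y,\omega_\xi)=0$.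
   Context: $\Sigma=\mathbb{R}\times(0,\infty)$ with metric $ds^2=P(y)(dx^2+dy^2)$, $P(y)=\frac{e^{4y}+10e^{2y}+1}{4(e^{2y}-1)^2}$; $\Delta=P^{-1}(\partial_x^2+\partial_y^2)$, $\mathcal{L}=\Delta-1$. $G(x,y,\xi,\eta)$ is the minimal positive Green's function of $\mathcal{L}$ on $\Sigma$ (the increasing limit of the Dirichlet Green's functions of an exhaustion of $\Sigma$ by relatively compact smooth domains; equivalently the minimal positive fundamental solution of $-(\partial_x^2+\partial_y^2-P(y))$ with respect to Lebesgue measure). Fix a reference point $(x_0,y_0)\in\Sigma$ and set $K(x,y,\xi,\eta)=G(x,y,\xi,\eta)/G(x_0,y_0,\xi,\eta)$. The Martin compactification $\hat\Sigma$ is the compactification of $\Sigma$ such that each $K(x,y,\cdot)$ extends continuously to $\hat\Sigma$ and the extended functions separate the points of $\partial\hat\Sigma=\hat\Sigma\setminus\Sigma$ (equivalently: a divergent sequence $q_i$ converges to a boundary point $\omega$ iff $K(\cdot,q_i)\to K(\cdot,\omega)$ locally uniformly). A boundary point $\omega$ is minimal if $K(\cdot,\omega)$ is a minimal positive $\mathcal{L}$-harmonic function, i.e., every $\mathcal{L}$-harmonic $u$ with $0\le u\le K(\cdot,\omega)$ is a constant multiple of it. *)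

(* Defs.v *)
From Stdlib Require Import Reals.
Open Scope R_scope.

Definition pt := (R * R)%type.

Definition dist2 (p q : pt) : R :=
  sqrt ((fst p - fst q) ^ 2 + (snd p - snd q) ^ 2).

Definition Sigma (p : pt) : Prop := 0 < snd p.

(* conformal factor of the metric ds^2 = P(y)(dx^2+dy^2) *)
Definition P (y : R) : R :=
  (exp (4 * y) + 10 * exp (2 * y) + 1) / (4 * (exp (2 * y) - 1) ^ 2).

Definition Dset (z : pt) : Prop := fst z ^ 2 + snd z ^ 2 <= 1 /\ 0 <= snd z.
Definition Dint (z : pt) : Prop := fst z ^ 2 + snd z ^ 2 < 1 /\ 0 < snd z.
Definition Dbd (z : pt) : Prop := Dset z /\ ~ Dint z.
Definition Seg (z : pt) : Prop := -1 < fst z < 1 /\ snd z = 0.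

Definition lim2 (S : pt -> Prop) (f : pt -> pt) (a l : pt) : Prop :=
  forall eps, 0 < eps -> exists del, 0 < del /\
    forall z, S z -> dist2 z a < del -> dist2 (f z) l < eps.
Definition lim2R (S : pt -> Prop) (f : pt -> R) (a : pt) (l : R) : Prop :=
  forall eps, 0 < eps -> exists del, 0 < del /\
    forall z, S z -> dist2 z a < del -> Rabs (f z - l) < eps.
Definition cont2R_on (S : pt -> Prop) (f : pt -> R) : Prop :=
  forall a, S a -> lim2R S f a (f a).
Definition cont2_on (S : pt -> Prop) (f : pt -> pt) : Prop :=
  forall a, S a -> lim2 S f a (f a).
Definition cont12_on (S : R -> Prop) (f : R -> pt) : Prop :=
  forall a, S a -> forall eps, 0 < eps -> exists del, 0 < del /\
    forall t, S t -> Rabs (t - a) < del -> dist2 (f t) (f a) < eps.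
Definition cont21_on (S : pt -> Prop) (f : pt -> R) : Prop := cont2R_on S f.
Definition lim_pinf (f : R -> pt) (l : pt) : Prop :=
  forall eps, 0 < eps -> exists M, forall t, M < t -> dist2 (f t) l < eps.
Definition lim_minf (f : R -> pt) (l : pt) : Prop :=
  forall eps, 0 < eps -> exists M, forall t, t < M -> dist2 (f t) l < eps.

(* u is C^2 on U (classical partial derivatives up to order 2, continuous on U)
   and solves d_xx u + d_yy u = P(y) u there, i.e. L u = (Delta - 1) u = 0
   with Delta = P^{-1}(d_xx + d_yy). *)
Definition Lharmonic_on (U : pt -> Prop) (u : pt -> R) : Prop :=
  exists ux uy uxx uxy uyx uyy : pt -> R,
    (forall p, U p ->
       derivable_pt_lim (fun t => u (t, snd p)) (fst p) (ux p) /\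
       derivable_pt_lim (fun t => u (fst p, t)) (snd p) (uy p) /\
       derivable_pt_lim (fun t => ux (t, snd p)) (fst p) (uxx p) /\
       derivable_pt_lim (fun t => ux (fst p, t)) (snd p) (uxy p) /\
       derivable_pt_lim (fun t => uy (t, snd p)) (fst p) (uyx p) /\
       derivable_pt_lim (fun t => uy (fst p, t)) (snd p) (uyy p)) /\
    cont2R_on U u /\ cont2R_on U ux /\ cont2R_on U uy /\
    cont2R_on U uxx /\ cont2R_on U uxy /\ cont2R_on U uyx /\ cont2R_on U uyy /\
    (forall p, U p -> uxx p + uyy p = P (snd p) * u p).

(* u is a positive fundamental solution of -(d_xx + d_yy - P) with pole q
   (w.r.t. Lebesgue measure): positive and L-harmonic on Sigma \ {q},
   with the logarithmic singularity u(p) = -(1/(2 pi)) ln|p - q| + O(1). *)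
Definition pos_fund_sol (u : pt -> R) (q : pt) : Prop :=
  (forall p, Sigma p -> p <> q -> 0 < u p) /\
  Lharmonic_on (fun p => Sigma p /\ p <> q) u /\
  (exists M del, 0 < del /\ forall p, Sigma p -> p <> q -> dist2 p q < del ->
      Rabs (u p + / (2 * PI) * ln (dist2 p q)) <= M).

Definition is_min_Green (G : pt -> pt -> R) : Prop :=
  forall q, Sigma q ->
    pos_fund_sol (fun p => G p q) q /\
    (forall v, pos_fund_sol v q -> forall p, Sigma p -> p <> q -> G p q <= v p).

Definition Kmartin (G : pt -> pt -> R) (p0 : pt) (p q : pt) : R := G p q / G p0 q.

Definition minimal_pos_Lharmonic (u : pt -> R) : Prop :=
  (forall p, Sigma p -> 0 < u p) /\ Lharmonic_on Sigma u /\
  (forall v, Lharmonic_on Sigma v -> (forall p, Sigma p -> 0 <= v p <= u p) ->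
     exists c, forall p, Sigma p -> v p = c * u p).

(* (D, h) is a model of the Martin compactification of Sigma:
   h : Sigma -> interior of D is a homeomorphism (inverse hinv), every Martin
   kernel K(p, .) extends (via Kext p) continuously to D (away from the
   singular points h p and h p0), and the extended functions separate the
   points of the boundary dD. *)
Definition martin_model (G : pt -> pt -> R) (p0 : pt)
    (h hinv : pt -> pt) (Kext : pt -> pt -> R) : Prop :=
  (forall p, Sigma p -> Dint (h p)) /\
  (forall z, Dint z -> Sigma (hinv z)) /\
  (forall p, Sigma p -> hinv (h p) = p) /\
  (forall z, Dint z -> h (hinv z) = z) /\
  cont2_on Sigma h /\ cont2_on Dint hinv /\
  (forall p, Sigma p -> forall z, Dint z -> z <> h p -> z <> h p0 ->
     Kext p z = Kmartin G p0 p (hinv z)) /\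
  (forall p, Sigma p ->
     cont2R_on (fun z => Dset z /\ z <> h p /\ z <> h p0) (Kext p)) /\
  (forall w1 w2, Dbd w1 -> Dbd w2 -> w1 <> w2 ->
     exists p, Sigma p /\ Kext p w1 <> Kext p w2).

(* Main.v *)
Require Import Defs.
From Stdlib Require Import Reals Lra Lia Psatz ClassicalEpsilon FunctionalExtensionality Factorial.
From Coquelicot Require Import Coquelicot.
Open Scope R_scope.

(** Since [P y = 1/4 + 3 / (4 sinh^2 y)], writing [u = sinh^(3/2) y * g] turns [L u = 0] into an equation for [g] on the
    product of the line with hyperbolic 4-space, [y] being the distance to the origin. A solution depending on [x] and on
    the distance to another point is obtained by descent from hyperbolic 5-space, where the radial equation is solved by
    Bessel functions, and averaging it over the rotations about the origin gives an explicit multiple [green_U q] of the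
    Green function with pole [q], valid also for poles on the boundary line. That [G(., q)] is a multiple of [green_U q]
    follows by subtracting the largest minorant proportional to [green_U q]: Harnack and comparison bound the remainder near
    [q], so half of it can still be subtracted, and minimality of [G] makes it vanish.

    The explicit formula shows that [K] extends continuously to the half disk: at a point of the open segment the kernel is a
    quotient of [green_U (xi, 0)], and at a point [om] of the semicircle it is a quotient of a product solution
    [theta_U om (x, y) = exp (x cos / 2) phi y]. A minorant of [theta_U om] is compared with its translates in [x]; a minorant
    of [green_U (xi, 0)] is controlled at small scales around [(xi, 0)] by Harnack and a Hopf barrier. *)

(** * Plane calculus and the maximum principle *)

(* On the product of the line with hyperbolic [n]-space the operator met here is always the
   Laplacian plus [(n - 1)^2 / 4], with eigenvalue [1 / 4]; this gives the constant 2 for [n = 4]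
   and [15 / 4] for [n = 5]. Since [1 / 4] does not depend on [n], dimensions can be changed by
   operations in [z = cosh (distance)]: a derivative raises [n] by 2, a half-order integral lowers
   it by 1. Only quotients of Green functions enter the Martin kernel, so [green_U] needs no
   normalisation and its singularity is never computed. The delicate points are the corners [(1, 0)]
   and [(-1, 0)]. A sequence tending to one of them may have heights that stay bounded or go to
   infinity, and the rescaled kernels then have different limits. After averaging the limits are
   proportional, because a positive solution [exp (x / 2) * f y] or [exp (- x / 2) * f y] with [f]
   small enough at 0 is unique up to a factor. In the minimality proofs the Harnack constants blow
   up as [y] tends to 0; explicit barriers take over near the boundary line. *)
Tactic Notation "note" uconstr(t) := pose proof t.
Tactic Notation "note" uconstr(t) "as" simple_intropattern(p) := pose proof t as p.

Tactic Notation "weaken" uconstr(t) := generalize t; apply filter_imp.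
Tactic Notation "ball_simpl" := unfold ball; simpl; unfold AbsRing_ball, abs, minus, plus, opp; simpl.
Tactic Notation "ball_simpl" "in" hyp(H) := unfold ball in H; simpl in H; unfold AbsRing_ball, abs, minus, plus, opp in H; simpl in H.

Ltac pos := first [assumption | lra | match goal with
 | |- 0 < _ * _ => apply Rmult_lt_0_compat; pos
 | |- 0 < _ / _ => apply Rdiv_lt_0_compat; pos
 | |- 0 < / _ => apply Rinv_0_lt_compat; pos
 | |- 0 < _ ^ _ => apply pow_lt; pos
 | |- 0 < exp _ => apply exp_pos
 | |- 0 < Rpower _ _ => apply exp_pos
 | |- 0 < sqrt _ => apply sqrt_lt_R0; pos
 | |- 0 < Rmin _ _ => apply Rmin_pos; pos
 | |- 0 < Rabs _ => apply Rabs_pos_lt; pos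
 | |- 0 < _ + _ => first [apply Rplus_lt_le_0_compat; pos | apply Rplus_le_lt_0_compat; pos]
 | |- 0 <= _ ^ 2 => apply pow2_ge_0
 | |- 0 <= Rabs _ => apply Rabs_pos
 | |- 0 <= sqrt _ => apply sqrt_pos
 | |- 0 <= _ * _ => first [apply Rmult_le_pos; pos | left; pos]
 | |- 0 <= _ / _ => apply Rmult_le_pos; pos
 | |- 0 <= _ + _ => apply Rplus_le_le_0_compat; pos
 | |- 0 <= _ ^ _ => apply pow_le; pos
 | |- 0 <= _ => left; pos
 | |- _ >= _ => apply Rle_ge; pos
 | |- _ > _ => apply Rlt_gt; pos
 | |- _ <> 0 => apply Rgt_not_eq; pos
 end].

Ltac fld := field; repeat match goal with |- _ /\ _ => split end; try pos.

Lemma sum_sqr_ge0 (a b : R) : 0 <= a ^ 2 + b ^ 2.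
Proof. note (pow2_ge_0 a). note (pow2_ge_0 b). lra. Qed.

Lemma Rabs_fst_dist2 (p q : pt) : Rabs (fst p - fst q) <= dist2 p q.
Proof.
 unfold dist2. rewrite <- sqrt_Rsqr_abs. apply sqrt_le_1_alt. unfold Rsqr. note (pow2_ge_0 (snd p - snd q)). lra.
Qed.

Lemma Rabs_snd_dist2 (p q : pt) : Rabs (snd p - snd q) <= dist2 p q.
Proof.
 unfold dist2. rewrite <- sqrt_Rsqr_abs. apply sqrt_le_1_alt. unfold Rsqr. note (pow2_ge_0 (fst p - fst q)). lra.
Qed.

Lemma dist2_le_Rabs (p q : pt) :
 dist2 p q <= Rabs (fst p - fst q) + Rabs (snd p - snd q).
Proof.
 unfold dist2. note (Rabs_pos (fst p - fst q)). note (Rabs_pos (snd p - snd q)). apply Rsqr_incr_0_var; [|lra].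
 rewrite Rsqr_sqrt by apply sum_sqr_ge0. note (Rsqr_abs (fst p - fst q)) as E1. note (Rsqr_abs (snd p - snd q)) as E2.
 unfold Rsqr in *. nra.
Qed.

Lemma dist2_pos (p q : pt) : 0 <= dist2 p q.
Proof. apply sqrt_pos. Qed.

Lemma dist2_sym (p q : pt) : dist2 p q = dist2 q p.
Proof. unfold dist2. f_equal. ring. Qed.

Lemma dist2_sqr (p q : pt) : dist2 p q ^ 2 = (fst p - fst q) ^ 2 + (snd p - snd q) ^ 2.
Proof. unfold dist2. rewrite pow2_sqrt; auto using sum_sqr_ge0. Qed.

Lemma dist2_refl (p : pt) : dist2 p p = 0.
Proof. unfold dist2. rewrite <- sqrt_0. f_equal. ring. Qed.

Lemma dist2_gt0 (p q : pt) : p <> q -> 0 < dist2 p q.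
Proof.
 intros H. destruct (dist2_pos p q) as [|E]; auto. exfalso; apply H. note (dist2_sqr p q) as E2. rewrite <- E in E2.
 destruct p as [a b], q as [c d]; simpl in *. note (Rle_0_sqr (a - c)). note (Rle_0_sqr (b - d)). unfold Rsqr in *.
 assert (a - c = 0) by nra. assert (b - d = 0) by nra. f_equal; lra.
Qed.

Lemma dist2_triang (p q r : pt) : dist2 p r <= dist2 p q + dist2 q r.
Proof.
 note (dist2_pos p q). note (dist2_pos q r). apply Rsqr_incr_0_var; [|lra]. note (dist2_sqr p q) as E1. note (dist2_sqr q r) as E2.
 note (dist2_sqr p r) as E3. set (a := fst p - fst q) in *. set (b := snd p - snd q) in *.
 set (c := fst q - fst r) in *. set (d := snd q - snd r) in *. assert (E3' : dist2 p r ^ 2 = (a + c) ^ 2 + (b + d) ^ 2)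
  by (rewrite E3; unfold a, b, c, d; ring).
 assert (HC : a * c + b * d <= dist2 p q * dist2 q r).
 { apply Rsqr_incr_0_var; [|nra]. unfold Rsqr. replace (dist2 p q * dist2 q r * (dist2 p q * dist2 q r))
   with (dist2 p q ^ 2 * dist2 q r ^ 2) by ring.
  rewrite E1, E2. note (pow2_ge_0 (a * d - b * c)). lra. }
 unfold Rsqr. nra.
Qed.

Lemma locally_dist2 (a : pt) (Q : pt -> Prop) :
 locally (a : R * R) Q <-> exists d, 0 < d /\ forall z, dist2 z a < d -> Q z.
Proof.
 split.
 - intros [d H]. exists d; split; [apply cond_pos|]. intros z Hz. apply H. split; [note (Rabs_fst_dist2 z a)|note (Rabs_snd_dist2 z a)];
  unfold ball; simpl; unfold AbsRing_ball, abs, minus, plus, opp; simpl;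
  unfold Rminus in *; lra.
 - intros [d [Hd H]]. assert (Hd2 : 0 < d / 2) by lra. exists (mkposreal _ Hd2). intros z [Hz1 Hz2]. apply H. note (dist2_le_Rabs z a).
  unfold ball in Hz1, Hz2; simpl in *. unfold AbsRing_ball, abs, minus, plus, opp in *; simpl in *. unfold Rminus in *; lra.
Qed.

Definition open2 (U : pt -> Prop) : Prop :=
 forall p, U p -> exists d, 0 < d /\ forall z, dist2 z p < d -> U z.

Lemma open2_locally (U : pt -> Prop) p : open2 U -> U p -> locally (p : R * R) U.
Proof. intros HU Hp. apply locally_dist2. auto. Qed.

Lemma lim2R_filterlim (S : pt -> Prop) (f : pt -> R) (a : pt) (l : R) :
 lim2R S f a l <-> filterlim f (within S (locally (a : R * R))) (locally l).
Proof.
 split.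
 - intros H. apply filterlim_locally. intros eps. destruct (H eps (cond_pos eps)) as [d [Hd H']].
  unfold within. apply locally_dist2. exists d; split; auto. intros z Hz HS. apply H'; auto.
 - intros H eps Heps. note (proj1 (filterlim_locally f l) H (mkposreal _ Heps)) as H'. unfold within in H'. apply locally_dist2 in H'.
  destruct H' as [d [Hd H']]. exists d; split; auto. intros z HS Hz. apply (H' z Hz HS).
Qed.

Lemma cont2R_on_open (U : pt -> Prop) (f : pt -> R) : open2 U ->
 cont2R_on U f <-> (forall a, U a -> continuous (f : R * R -> R) a).
Proof.
 intros HU. split.
 - intros H a Ha. apply filterlim_locally. intros eps. destruct (H a Ha eps (cond_pos eps)) as [d [Hd H']].
  destruct (HU a Ha) as [d' [Hd' H'']]. apply locally_dist2. exists (Rmin d d'); split; [pos|].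
  intros z Hz. apply H'; [apply H''|]; eapply Rlt_le_trans; eauto;
   [apply Rmin_r|apply Rmin_l].
 - intros H a Ha. apply lim2R_filterlim. eapply filterlim_filter_le_1; [apply filter_le_within|]. apply H; auto.
Qed.

Lemma is_derive_continuous (f : R -> R) (x l : R) : is_derive f x l -> continuous f x.
Proof. intros H. apply (ex_derive_continuous f x). exists l. exact H. Qed.

Lemma is_derive_nonneg_incr (f df : R -> R) (a b : R) : a <= b ->
 (forall x, a <= x <= b -> is_derive f x (df x)) ->
 (forall x, a < x < b -> 0 <= df x) -> f a <= f b.
Proof.
 intros [Hab| ->] Hd Hp; [|lra]. destruct (MVT_cor2 f df a b Hab) as [c [E Hc]].
 - intros x Hx. apply is_derive_Reals. auto.
 - note (Hp c Hc). nra.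
Qed.

Lemma is_derive_nonpos_decr (f df : R -> R) (a b : R) : a <= b ->
 (forall x, a <= x <= b -> is_derive f x (df x)) ->
 (forall x, a < x < b -> df x <= 0) -> f b <= f a.
Proof.
 intros Hab Hd Hp. apply Ropp_le_cancel. apply (is_derive_nonneg_incr (fun x => - f x) (fun x => - df x)); auto.
 - intros x Hx. apply (is_derive_opp f). auto.
 - intros x Hx. specialize (Hp x Hx); lra.
Qed.

Lemma derivative_bound_right (f : R -> R) (x l Q d : R) : 0 < d ->
 is_derive f x l -> (forall h, 0 < h < d -> Rabs (f (x + h) - f x) <= Q * h) -> Rabs l <= Q.
Proof.
 intros Hd Hl Hb. apply Rnot_lt_le. intros Hlt. apply is_derive_Reals in Hl. destruct (Hl ((Rabs l - Q) / 2) ltac:(lra)) as [e He].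
 set (h := Rmin d e / 2). note (Rmin_pos d e Hd (cond_pos e)). note (Rmin_l d e). note (Rmin_r d e).
 assert (Hh : 0 < h) by (unfold h; lra). specialize (He h ltac:(lra)). rewrite (Rabs_right h) in He by lra.
 specialize (He ltac:(unfold h; lra)). specialize (Hb h ltac:(unfold h; lra)). set (D := (f (x + h) - f x) / h) in *.
 assert (HD : Rabs D <= Q).
 { unfold D, Rdiv. rewrite Rabs_mult, (Rabs_right (/ h)) by pos.
  apply Rmult_le_reg_r with h; [lra|]. rewrite Rmult_assoc, Rinv_l by lra. lra. }
 note (Rabs_triang_inv l D). rewrite (Rabs_minus_sym l D) in H2. lra.
Qed.

Lemma second_derivative_at_max (f f1 : R -> R) (x0 l : R) :
 locally x0 (fun x => is_derive f x (f1 x) /\ f x <= f x0) ->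
 is_derive f1 x0 l -> l <= 0.
Proof.
 intros [d Hd] Hl. apply Rnot_lt_le. intros Hpos. assert (Hf0 : is_derive f x0 (f1 x0)) by (apply Hd; apply ball_center).
 assert (F0 : f1 x0 = 0).
 { assert (H0 : derivable_pt f x0).
  { exists (f1 x0). apply is_derive_Reals. exact Hf0. }
  note (deriv_maximum f (x0 - d) (x0 + d) x0 H0) as HM. note (cond_pos d). rewrite <- (derive_pt_eq_0 f x0 (f1 x0) H0);
   [apply HM; try lra|apply is_derive_Reals; exact Hf0].
  intros x H1 H2. apply Hd. ball_simpl. apply Rabs_def1; lra. }
 assert (HR : derivable_pt_lim f1 x0 l) by (apply is_derive_Reals; exact Hl). destruct (HR (l / 2) ltac:(lra)) as [e He].
 set (h := Rmin d e / 2). assert (Hh : 0 < h) by (unfold h; note (Rmin_pos d e (cond_pos d) (cond_pos e)); lra).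
 assert (Hhd : h < d) by (unfold h; note (Rmin_l d e); note (Rmin_pos d e (cond_pos d) (cond_pos e)); lra).
 assert (Hhe : h < e) by (unfold h; note (Rmin_r d e); note (Rmin_pos d e (cond_pos d) (cond_pos e)); lra).
 assert (Hball : forall x, x0 <= x <= x0 + h -> ball x0 d x).
 { intros x Hx. ball_simpl. apply Rabs_def1; lra. }
 destruct (MVT_cor2 f f1 x0 (x0 + h)) as [c [E [Hc1 Hc2]]]; [lra| |].
 - intros c Hc. apply is_derive_Reals. apply Hd. apply Hball; lra.
 - assert (f (x0 + h) <= f x0) by (apply Hd, Hball; lra). specialize (He (c - x0) ltac:(lra)). rewrite Rabs_right in He by lra.
  specialize (He ltac:(lra)). replace (x0 + (c - x0)) with c in He by ring. rewrite F0 in He. apply Rabs_def2 in He.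
  assert (0 < (f1 c - 0) / (c - x0)) by lra. assert (0 < f1 c).
  { replace (f1 c) with ((f1 c - 0) / (c - x0) * (c - x0)) by fld. nra. }
  nra.
Qed.

(** Compactness is stated through an adherence value, so that no subsequence appears in the
    conclusion. Inside, [phi] picks indices along which the first coordinate converges at rate
    [/ INR (S N)], and the second coordinate is treated along [phi]. *)
Lemma Bolzano_Weierstrass_plane (z : nat -> pt) (M : R) :
 (forall n, Rabs (fst (z n)) <= M /\ Rabs (snd (z n)) <= M) ->
 exists l : pt, forall d, 0 < d -> forall N, exists n, (N <= n)%nat /\ dist2 (z n) l < d.
Proof.
 intros Hz. assert (Hadh : forall u : nat -> R, (forall n, Rabs (u n) <= M) ->
  exists l, forall d, 0 < d -> forall N, exists n, (N <= n)%nat /\ Rabs (u n - l) < d).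
 { intros u Hu. destruct (Bolzano_Weierstrass u (fun c => - M <= c <= M)) as [l Hl].
  - apply compact_P3.
  - intros n. specialize (Hu n). apply Rabs_le_between in Hu. exact Hu.
  - exists l. intros d Hd N. destruct (Hl (fun x => Rabs (x - l) < d) N) as [n [Hn H]].
   + exists (mkposreal d Hd). intros x Hx. exact Hx.
   + exists n; auto. }
 destruct (Hadh (fun n => fst (z n)) (fun n => proj1 (Hz n))) as [l1 H1].
 assert (Hphi : forall N, exists n, (N <= n)%nat /\ Rabs (fst (z n) - l1) < / INR (S N)).
 { intros N. apply H1. apply Rinv_0_lt_compat, lt_0_INR; lia. }
 set (phi := fun N => proj1_sig (constructive_indefinite_description _ (Hphi N))).
 assert (Hp : forall N, (N <= phi N)%nat /\ Rabs (fst (z (phi N)) - l1) < / INR (S N)).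
 { intros N. unfold phi. destruct (constructive_indefinite_description _ _); auto. }
 destruct (Hadh (fun n => snd (z (phi n))) (fun n => proj2 (Hz (phi n)))) as [l2 H2]. exists (l1, l2). intros d Hd N.
 destruct (archimed_cor1 (d / 2) ltac:(lra)) as [N0 [HN0 HN0']]. destruct (H2 (d / 2) ltac:(lra) (Nat.max N N0)) as [n [Hn Hn']].
 exists (phi n). destruct (Hp n) as [Hp1 Hp2]. split; [lia|]. note (dist2_le_Rabs (z (phi n)) (l1, l2)) as HD. simpl in HD.
 assert (/ INR (S n) < d / 2).
 { eapply Rle_lt_trans; [|exact HN0]. apply Rinv_le_contravar.
  - apply lt_0_INR; lia. - apply le_INR; lia. }
 lra.
Qed.

(** Only the pure second derivatives are recorded: the maximum principle sees nothing else, and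
    barriers are then cheap to supply. *)
Definition C2data (U : pt -> Prop) (w wxx wyy : pt -> R) : Prop :=
 cont2R_on U w /\ exists wx wy : pt -> R, forall p, U p ->
  derivable_pt_lim (fun t => w (t, snd p)) (fst p) (wx p) /\
  derivable_pt_lim (fun t => w (fst p, t)) (snd p) (wy p) /\
  derivable_pt_lim (fun t => wx (t, snd p)) (fst p) (wxx p) /\
  derivable_pt_lim (fun t => wy (fst p, t)) (snd p) (wyy p).

Lemma open2_fst_locally (U : pt -> Prop) (p : pt) : open2 U -> U p ->
 locally (fst p) (fun t => U (t, snd p)).
Proof.
 intros HU Hp. destruct (HU p Hp) as [d [Hd H]]. exists (mkposreal d Hd). intros t Ht. apply H.
 eapply Rle_lt_trans; [apply dist2_le_Rabs|]. simpl. rewrite Rminus_diag, Rabs_R0, Rplus_0_r. exact Ht.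
Qed.

Lemma open2_snd_locally (U : pt -> Prop) (p : pt) : open2 U -> U p ->
 locally (snd p) (fun t => U (fst p, t)).
Proof.
 intros HU Hp. destruct (HU p Hp) as [d [Hd H]]. exists (mkposreal d Hd). intros t Ht. apply H.
 eapply Rle_lt_trans; [apply dist2_le_Rabs|]. simpl. rewrite Rminus_diag, Rabs_R0, Rplus_0_l. exact Ht.
Qed.

(** Neither [U] nor [w] is assumed bounded. The conditions at infinity and at the points outside [U]
    confine a maximising sequence to a compact part of [U], so a positive supremum would be
    attained, where both second derivatives are nonpositive. *)
Lemma max_principle (U : pt -> Prop) (w wxx wyy : pt -> R) :
 open2 U -> C2data U w wxx wyy ->
 (forall p, U p -> 0 < w p -> 0 < wxx p + wyy p) ->
 (forall eta, 0 < eta -> exists M, forall p, U p ->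
   M < Rabs (fst p) + Rabs (snd p) -> w p < eta) ->
 (forall eta, 0 < eta -> forall p, ~ U p -> exists d, 0 < d /\
   forall z, U z -> dist2 z p < d -> w z < eta) ->
 forall p, U p -> w p <= 0.
Proof.
 (* The values [atan (w z)] form a bounded set, so a supremum exists before [w] is known to be
    bounded above. *)
 intros HU [Hc [wx [wy HD]]] Hpde Hinf Hbd p1 Hp1. apply Rnot_lt_le. intros Hpos. set (E := fun r => exists z, U z /\ r = atan (w z)).
 destruct (completeness E) as [s [Hs1 Hs2]].
 { exists (PI / 2). intros r [z [_ ->]]. note (atan_bound (w z)); lra. }
 { exists (atan (w p1)). exists p1; auto. }
 assert (Hseq : forall n : nat, exists z, U z /\ s - / INR (S n) < atan (w z) /\ w p1 <= w z).
 { intros n. assert (Hn : 0 < / INR (S n)) by (apply Rinv_0_lt_compat, lt_0_INR; lia).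
  destruct (excluded_middle_informative (exists z, U z /\ s - / INR (S n) < atan (w z) /\ w p1 <= w z))
   as [H|H]; auto.
  exfalso. assert (Hsp1 : atan (w p1) <= s) by (apply Hs1; exists p1; auto).
  assert (Hub : is_upper_bound E (Rmax (s - / INR (S n)) (atan (w p1)))).
  { intros r [z [Hz ->]]. apply Rnot_lt_le. intros Hlt. apply H. exists z. split; auto. split.
   - eapply Rle_lt_trans; [apply Rmax_l|exact Hlt].
   - apply Rnot_lt_le. intros Hlt2. apply atan_increasing in Hlt2. note (Rmax_r (s - / INR (S n)) (atan (w p1))). lra. }
  apply Hs2 in Hub. apply H. exists p1. split; auto. split; [|lra]. unfold Rmax in Hub. destruct (Rle_dec _ _); lra. }
 set (z := fun n => proj1_sig (constructive_indefinite_description _ (Hseq n))).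
 assert (Hz : forall n, U (z n) /\ s - / INR (S n) < atan (w (z n)) /\ w p1 <= w (z n)).
 { intros n. unfold z. destruct (constructive_indefinite_description _ _); auto. }
 destruct (Hinf (w p1) Hpos) as [M HM]. destruct (Bolzano_Weierstrass_plane z M) as [l Hl].
 { intros n. destruct (Hz n) as [H1 [H2 H3]]. note (Rabs_pos (fst (z n))). note (Rabs_pos (snd (z n))).
  destruct (Rle_lt_dec (Rabs (fst (z n)) + Rabs (snd (z n))) M) as [H4|H4]; [lra|]. specialize (HM _ H1 H4). lra. }
 assert (Ul : U l).
 { apply NNPP. intros Hn. destruct (Hbd (w p1) Hpos l Hn) as [d [Hd H]].
  destruct (Hl d Hd 0%nat) as [n [_ Hn']]. destruct (Hz n) as [H1 [_ H3]]. specialize (H _ H1 Hn'). lra. }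
 assert (Hcl : continuous (fun q : R * R => atan (w q)) l).
 { apply (continuous_comp (w : R * R -> R) atan).
  - apply (proj1 (cont2R_on_open U w HU)); auto.
  - eapply is_derive_continuous. apply is_derive_Reals. apply derivable_pt_lim_atan. }
 assert (Hsl : s <= atan (w l)).
 { apply Rnot_lt_le. intros Hlt. set (e := (s - atan (w l)) / 2). assert (He : 0 < e) by (unfold e; lra).
  note (proj1 (filterlim_locally _ _) Hcl (mkposreal e He)) as HN. apply locally_dist2 in HN. destruct HN as [d [Hd HN]].
  destruct (archimed_cor1 e He) as [N [HN1 HN2]]. destruct (Hl d Hd N) as [n [Hn Hn']].
  specialize (HN _ Hn'). destruct (Hz n) as [_ [H2 _]].
  unfold ball in HN; simpl in HN; unfold AbsRing_ball, abs, minus, plus, opp in HN; simpl in HN. apply Rabs_def2 in HN.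
  assert (/ INR (S n) < e).
  { eapply Rle_lt_trans; [|exact HN1]. apply Rinv_le_contravar.
   - apply lt_0_INR; lia. - apply le_INR; lia. }
  unfold e in *. lra. }
 assert (Hmax : forall q, U q -> w q <= w l).
 { intros q Hq. apply Rnot_lt_le. intros Hlt. apply atan_increasing in Hlt. assert (atan (w q) <= s) by (apply Hs1; exists q; auto). lra. }
 assert (Hwl : 0 < w l) by (specialize (Hmax p1 Hp1); lra). specialize (Hpde l Ul Hwl). assert (wxx l <= 0).
 { apply (second_derivative_at_max (fun t => w (t, snd l)) (fun t => wx (t, snd l)) (fst l)).
  - weaken (open2_fst_locally U l HU Ul). intros t Ht. split.
   + apply is_derive_Reals. apply (HD _ Ht).
   + destruct l; apply Hmax; auto.
  - apply is_derive_Reals. apply (HD _ Ul). }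
 assert (wyy l <= 0).
 { apply (second_derivative_at_max (fun t => w (fst l, t)) (fun t => wy (fst l, t)) (snd l)).
  - weaken (open2_snd_locally U l HU Ul). intros t Ht. split.
   + apply is_derive_Reals. apply (HD _ Ht).
   + destruct l; apply Hmax; auto.
  - apply is_derive_Reals. apply (HD _ Ul). }
 lra.
Qed.

(** * Integrals depending on a parameter *)

(** Heine-Borel for an arbitrary filter: the supremum of the abscissae up to which the property
    holds eventually can be pushed past itself by the neighbourhood available there, hence equals
    [b]. *)
Lemma filter_prod_compact {U : Type} (F : (U -> Prop) -> Prop) (FF : Filter F)
 (Q : U -> R -> Prop) (a b : R) : a <= b ->
 (forall t, a <= t <= b -> filter_prod F (locally t) (fun q => Q (fst q) (snd q))) ->
 F (fun u => forall t, a <= t <= b -> Q u t).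
Proof.
 intros Hab H. set (E := fun x => a <= x <= b /\ F (fun u => forall t, a <= t <= x -> Q u t)).
 assert (Hloc : forall x, a <= x <= b -> exists d : posreal,
  F (fun u => forall t, Rabs (t - x) < d -> Q u t)).
 { intros x Hx. destruct (H x Hx) as [A B HA [d HB] HAB]. exists d. weaken HA. intros u Hu t Ht. apply (HAB u t); auto. }
 assert (Ea : E a).
 { split; [lra|]. destruct (Hloc a ltac:(lra)) as [d Hd]. weaken Hd. intros u Hu t Ht. apply Hu.
  replace (t - a) with 0 by lra. rewrite Rabs_R0. apply cond_pos. }
 destruct (completeness E) as [s [Hs1 Hs2]].
 { exists b. intros x [Hx _]. lra. }
 { exists a; auto. }
 assert (Hsab : a <= s <= b).
 { split; [auto|]. apply Hs2. intros x [Hx _]; lra. }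
 destruct (Hloc s Hsab) as [d Hd]. assert (Hx : exists x, E x /\ s - d < x).
 { apply NNPP. intros Hn. assert (s <= s - d).
  { apply Hs2. intros x Hx. apply Rnot_lt_le. intros Hlt. apply Hn. exists x; auto. }
  note (cond_pos d). lra. }
 destruct Hx as [x [[Hx1 Hx2] Hx3]]. assert (Hxs : x <= s) by (apply Hs1; split; auto). assert (Hy : E (Rmin b (s + d / 2))).
 { note (cond_pos d). split.
  - split; [apply Rmin_glb; lra|apply Rmin_l].
  - weaken (filter_and _ _ Hx2 Hd). intros u [H1 H2] t Ht. destruct (Rle_lt_dec t x); [apply H1; lra|]. apply H2.
   note (Rmin_r b (s + d / 2)). apply Rabs_def1; lra. }
 assert (Hle : Rmin b (s + d / 2) <= s) by auto. destruct Hy as [Hy1 Hy2]. weaken Hy2. intros u Hu t Ht.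
 apply Hu. note (cond_pos d). unfold Rmin in *. destruct (Rle_dec b (s + d / 2)); lra.
Qed.

(** Joint convergence at each [t] is locally uniform in [t], and [filter_prod_compact] makes it
    uniform on the whole interval. The filter is arbitrary because the limits needed later include
    poles escaping to infinity. *)
Lemma RInt_filterlim {U : Type} (F : (U -> Prop) -> Prop) (FF : Filter F)
 (f : U -> R -> R) (g : R -> R) (a b : R) : a <= b ->
 (forall t, a <= t <= b -> filterlim (fun q => f (fst q) (snd q))
   (filter_prod F (locally t)) (locally (g t))) ->
 F (fun u => ex_RInt (f u) a b) ->
 (forall t, a <= t <= b -> continuous g t) ->
 filterlim (fun u => RInt (f u) a b) F (locally (RInt g a b)).
Proof.
 intros Hab Hlim Hex Hg. assert (Hexg : ex_RInt g a b).
 { apply (ex_RInt_continuous g). intros z Hz. rewrite Rmin_left, Rmax_right in Hz by lra. auto. }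
 apply filterlim_locally. intros eps. set (e := eps / (2 * (b - a + 1))).
 assert (He : 0 < e) by (apply Rdiv_lt_0_compat; [apply cond_pos|lra]).
 assert (HF : F (fun u => forall t, a <= t <= b -> Rabs (f u t - g t) < e)).
 { apply (filter_prod_compact F FF (fun u t => Rabs (f u t - g t) < e)); auto. intros t Ht. assert (He2 : 0 < e / 2) by lra.
  note (proj1 (filterlim_locally _ _) (Hlim t Ht) (mkposreal _ He2)) as H1.
  note (proj1 (filterlim_locally _ _) (Hg t Ht) (mkposreal _ He2)) as H2.
  assert (H3 : filter_prod F (locally t) (fun q => ball (g t) (e/2) (g (snd q)))).
  { exact (filterlim_snd (F := F) (G := locally t) _ H2). }
  weaken (filter_and _ _ H1 H3). intros [u x] [A B]. simpl in *.
  unfold ball in A, B; simpl in A, B; unfold AbsRing_ball, abs, minus, plus, opp in A, B; simpl in A, B.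
  apply Rabs_def2 in A. apply Rabs_def2 in B. apply Rabs_def1; lra. }
 weaken (filter_and _ _ HF Hex). intros u [Hu Hxu]. ball_simpl. change (Rabs (RInt (f u) a b - RInt g a b) < eps).
 assert (Em : RInt (fun t => f u t - g t) a b = RInt (f u) a b - RInt g a b)
  by (apply (RInt_minus (f u) g); auto).
 rewrite <- Em. eapply Rle_lt_trans.
 { apply (abs_RInt_le_const (fun t => f u t - g t) a b e); auto.
  - apply (ex_RInt_minus (f u) g); auto.
  - intros t Ht. left; auto. }
 unfold e. note (cond_pos eps). apply Rlt_le_trans with ((b - a + 1) * (eps / (2 * (b - a + 1))) + eps / 2).
 - assert ((b - a + 1) * (eps / (2 * (b - a + 1))) = eps / 2) by fld. fold e in He |- *. fold e in H0. nra.
 - right. field. lra.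
Qed.

Lemma continuous_RInt_param {U : UniformSpace} (f : U -> R -> R) (p : U) (a b : R) : a <= b ->
 (forall t, a <= t <= b -> continuous (fun q : U * R => f (fst q) (snd q)) (p, t)) ->
 locally p (fun u => ex_RInt (f u) a b) ->
 continuous (fun u => RInt (f u) a b) p.
Proof.
 intros Hab Hc Hex. apply (RInt_filterlim (locally p) _ f (f p)); auto.
 - intros t Ht.  eapply filterlim_filter_le_1; [|apply (Hc t Ht)]. intros Q [d HQ]. exists (ball p d) (ball t d).
  + exists d; auto. + exists d; auto.
  + intros x y Hx Hy. apply HQ. split; auto.
 - intros t Ht.  apply (continuous_comp (fun t : R => (p, t)) (fun q : U * R => f (fst q) (snd q))).
  + apply filterlim_locally. intros eps. exists eps. intros y Hy. split; [apply ball_center|pos].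
  + auto.
Qed.

Lemma continuous_2d_snd (f : R -> R -> R) (x t : R) :
 continuous (fun q : R * R => f (fst q) (snd q)) (x, t) -> continuous (f x) t.
Proof.
 intros H. apply (continuous_comp (fun t : R => (x, t)) (fun q : R * R => f (fst q) (snd q))); auto.
 apply filterlim_locally. intros eps. exists eps. intros y Hy. split; [apply ball_center|pos].
Qed.

Lemma is_derive_RInt_under (f df : R -> R -> R) (a b x : R) : a <= b ->
 locally x (fun y => forall t, a <= t <= b -> is_derive (fun u => f u t) y (df y t)) ->
 (forall t, a <= t <= b -> continuous (fun q : R * R => df (fst q) (snd q)) (x, t)) ->
 locally x (fun y => ex_RInt (f y) a b) ->
 is_derive (fun y => RInt (f y) a b) x (RInt (df x) a b).
Proof.
 (* Composing with the clamp [cl] onto [[a, b]] makes the derivative formula valid for [t] in full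
    neighbourhoods of the end points, as the two-dimensional continuity condition of
    [is_derive_RInt_param] requires. *)
 intros Hab Hd Hc Hex. set (cl := fun t => Rmax a (Rmin b t)). assert (Hcl : forall t, a <= cl t <= b).
 { intros t. unfold cl. split; [apply Rmax_l|]. apply Rmax_lub; [lra|apply Rmin_l]. }
 assert (Ecl : forall t, a <= t <= b -> cl t = t).
 { intros t Ht. unfold cl. rewrite Rmin_right, Rmax_right; lra. }
 assert (Lcl : forall t t', Rabs (cl t' - cl t) <= Rabs (t' - t)).
 { intros t t'. unfold cl, Rmax, Rmin. repeat destruct (Rle_dec _ _); unfold Rabs; repeat destruct (Rcase_abs _); lra. }
 assert (HR : forall y (g : R -> R -> R), RInt (g y) a b = RInt (fun t => g y (cl t)) a b).
 { intros y g. apply RInt_ext. intros t Ht. rewrite Rmin_left, Rmax_right in Ht by lra. rewrite Ecl by lra. reflexivity. }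
 rewrite (HR x df). apply (is_derive_ext (fun y => RInt (fun t => f y (cl t)) a b)); [auto|].
 replace (RInt (fun t => df x (cl t)) a b) with (RInt (fun t => Derive (fun u => f u (cl t)) x) a b).
 2:{ apply RInt_ext. intros t _. apply is_derive_unique.
   apply (locally_singleton _ _ Hd). auto. }
 apply (is_derive_RInt_param (fun y t => f y (cl t))).
 - weaken Hd. intros y Hy t _. exists (df y (cl t)). auto.
 - intros t _. apply continuity_2d_pt_ext_loc with (fun u v => df u (cl v)).
  + destruct Hd as [d Hd]. exists d. intros u v Hu Hv. symmetry. apply is_derive_unique. apply Hd; auto.
  + apply continuity_2d_pt_filterlim. apply (filterlim_comp _ _ _ (fun q : R * R => (fst q, cl (snd q)))
    (fun q : R * R => df (fst q) (snd q)) _ (locally (x, cl t))); [|apply (Hc (cl t) (Hcl t))].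
   intros Q [d HQ]. exists d. intros [y1 y2] [H1 H2]. apply HQ. split; [pos|]. eapply Rle_lt_trans; [eauto|pos].
 - weaken Hex. intros y Hy. apply (ex_RInt_ext (f y)); auto. intros t Ht. rewrite Rmin_left, Rmax_right in Ht by lra.
  rewrite Ecl by lra. reflexivity.
Qed.

(** * Rules of calculus stated with the operations of the reals *)

Lemma ex_RInt_cont (f : R -> R) a b : (forall x, continuous f x) -> ex_RInt f a b.
Proof. intros H. apply (ex_RInt_continuous f). auto. Qed.

Lemma is_derive_eq (f : R -> R) (x a b : R) : is_derive f x a -> a = b -> is_derive f x b.
Proof. intros H <-. exact H. Qed.

Lemma is_derive_Rplus (f g : R -> R) (x a b : R) :
 is_derive f x a -> is_derive g x b -> is_derive (fun t => f t + g t) x (a + b).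
Proof. intros. apply (is_derive_plus f g); auto. Qed.

Lemma is_derive_Rminus (f g : R -> R) (x a b : R) :
 is_derive f x a -> is_derive g x b -> is_derive (fun t => f t - g t) x (a - b).
Proof. intros. apply (is_derive_minus f g); auto. Qed.

Lemma is_derive_Rmult (f g : R -> R) (x a b : R) :
 is_derive f x a -> is_derive g x b -> is_derive (fun t => f t * g t) x (a * g x + f x * b).
Proof. intros. apply (is_derive_mult f g); auto. exact Rmult_comm. Qed.

Lemma is_derive_Rconst (c x : R) : is_derive (fun _ : R => c) x 0.
Proof. exact (is_derive_const (V := R_NormedModule) c x). Qed.

Lemma is_derive_Rcmult (c : R) (f : R -> R) (x a : R) :
 is_derive f x a -> is_derive (fun t => c * f t) x (c * a).
Proof.
 intros. apply is_derive_eq with (0 * f x + c * a); [|ring]. apply (is_derive_Rmult (fun _ => c) f); auto using is_derive_Rconst.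
Qed.

Lemma is_derive_Rmultc (c : R) (f : R -> R) (x a : R) :
 is_derive f x a -> is_derive (fun t => f t * c) x (a * c).
Proof.
 intros. apply is_derive_eq with (a * c + f x * 0); [|ring]. apply (is_derive_Rmult f (fun _ => c)); auto using is_derive_Rconst.
Qed.

Lemma is_derive_Rcomp (f g : R -> R) (x a b : R) :
 is_derive f (g x) a -> is_derive g x b -> is_derive (fun t => f (g t)) x (a * b).
Proof.
 intros. eapply is_derive_eq; [apply (is_derive_comp f g); eauto|]. unfold scal; simpl; unfold mult; simpl. ring.
Qed.

Lemma RInt_Rplus (f g : R -> R) (a b : R) : ex_RInt f a b -> ex_RInt g a b ->
 RInt (fun t => f t + g t) a b = RInt f a b + RInt g a b.
Proof. intros. apply (RInt_plus f g); auto. Qed.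

Lemma RInt_Rminus (f g : R -> R) (a b : R) : ex_RInt f a b -> ex_RInt g a b ->
 RInt (fun t => f t - g t) a b = RInt f a b - RInt g a b.
Proof. intros. apply (RInt_minus f g); auto. Qed.

Lemma RInt_Rcmult (c : R) (f : R -> R) (a b : R) : ex_RInt f a b ->
 RInt (fun t => c * f t) a b = c * RInt f a b.
Proof. intros. apply (RInt_scal f); auto. Qed.

Lemma ex_RInt_Rplus (f g : R -> R) (a b : R) : ex_RInt f a b -> ex_RInt g a b ->
 ex_RInt (fun t => f t + g t) a b.
Proof. intros. apply (ex_RInt_plus f g); auto. Qed.

Lemma ex_RInt_Rminus (f g : R -> R) (a b : R) : ex_RInt f a b -> ex_RInt g a b ->
 ex_RInt (fun t => f t - g t) a b.
Proof. intros. apply (ex_RInt_minus f g); auto. Qed.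

Lemma ex_RInt_Rcmult (c : R) (f : R -> R) (a b : R) : ex_RInt f a b ->
 ex_RInt (fun t => c * f t) a b.
Proof. intros. apply (ex_RInt_scal f); auto. Qed.

Lemma RInt_fundamental (f df : R -> R) (a b : R) :
 (forall x, Rmin a b <= x <= Rmax a b -> is_derive f x (df x)) ->
 (forall x, Rmin a b <= x <= Rmax a b -> continuous df x) ->
 RInt df a b = f b - f a.
Proof. intros H1 H2. apply is_RInt_unique. apply (is_RInt_derive f df); auto. Qed.

(* [RInt] makes equations live in a normed module whose carrier is only convertible to [R]. *)
Ltac eqR := match goal with |- @eq _ ?a ?b => change (@eq R a b) end.

Lemma is_derive_Rid (x : R) : is_derive (fun t : R => t) x 1.
Proof. exact (is_derive_id x). Qed.

Lemma ex_RInt_sub (f : R -> R) (a b a' b' : R) : a <= a' <= b' -> b' <= b ->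
 ex_RInt f a b -> ex_RInt f a' b'.
Proof.
 intros H1 H2 H. apply (ex_RInt_Chasles_1 (V := R_CompleteNormedModule) f a' b' b); [lra|].
 apply (ex_RInt_Chasles_2 (V := R_CompleteNormedModule) f a a' b); [lra|auto].
Qed.

(** * Interior gradient estimate *)

(** The body of [Lharmonic_on] with the derivatives as arguments, so that estimates can speak about
    them. *)
Definition harmonic_data (U : pt -> Prop) (u ux uy uxx uxy uyx uyy : pt -> R) : Prop :=
 (forall p, U p ->
   derivable_pt_lim (fun t => u (t, snd p)) (fst p) (ux p) /\
   derivable_pt_lim (fun t => u (fst p, t)) (snd p) (uy p) /\
   derivable_pt_lim (fun t => ux (t, snd p)) (fst p) (uxx p) /\
   derivable_pt_lim (fun t => ux (fst p, t)) (snd p) (uxy p) /\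
   derivable_pt_lim (fun t => uy (t, snd p)) (fst p) (uyx p) /\
   derivable_pt_lim (fun t => uy (fst p, t)) (snd p) (uyy p)) /\
 cont2R_on U u /\ cont2R_on U ux /\ cont2R_on U uy /\
 cont2R_on U uxx /\ cont2R_on U uxy /\ cont2R_on U uyx /\ cont2R_on U uyy /\
 (forall p, U p -> uxx p + uyy p = P (snd p) * u p).

Lemma C1_differentiable (U : pt -> Prop) (f fx fy : pt -> R) (p : pt) :
 open2 U -> U p ->
 (forall q, U q -> derivable_pt_lim (fun t => f (t, snd q)) (fst q) (fx q) /\
          derivable_pt_lim (fun t => f (fst q, t)) (snd q) (fy q)) ->
 continuous (fx : R * R -> R) p -> continuous (fy : R * R -> R) p ->
 differentiable_pt_lim (fun x y => f (x, y)) (fst p) (snd p) (fx p) (fy p).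
Proof.
 intros HU Hp HD Cx Cy eps. assert (He2 : 0 < eps / 2) by (note (cond_pos eps); lra).
 note (proj1 (filterlim_locally _ _) Cx (mkposreal _ He2)) as H1. note (proj1 (filterlim_locally _ _) Cy (mkposreal _ He2)) as H2.
 note (open2_locally U p HU Hp) as H3. destruct (filter_and _ _ (filter_and _ _ H1 H2) H3) as [d Hd]. exists d. intros x y Hx Hy.
 destruct p as [a b]. simpl in *. assert (Hbox : forall s t, Rabs (s - a) < d -> Rabs (t - b) < d ->
  Rabs (fx (s, t) - fx (a, b)) < eps / 2 /\ Rabs (fy (s, t) - fy (a, b)) < eps / 2 /\ U (s, t)).
 { intros s t Hs Ht. destruct (Hd (s, t)) as [[A B] C]; [split; [exact Hs|exact Ht]|]. split; [pos|auto]. }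
 assert (HMV : forall (g dg : R -> R) (s0 s1 : R),
  (forall c, Rabs (c - s0) <= Rabs (s1 - s0) -> derivable_pt_lim g c (dg c)) ->
  exists c, Rabs (c - s0) <= Rabs (s1 - s0) /\ g s1 - g s0 = dg c * (s1 - s0)).
 { intros g dg s0 s1 Hg. destruct (MVT_cor4 g dg s0 (Rabs (s1 - s0))) with (b := s1) as [c [E Hc]].
  - intros c Hc. apply is_derive_Reals. auto.
  - lra.
  - exists c; auto. }
 destruct (HMV (fun s => f (s, y)) (fun s => fx (s, y)) a x) as [c1 [Hc1 E1]].
 { intros c Hc. apply (HD (c, y)). apply Hbox; [lra|lra]. }
 destruct (HMV (fun s => f (a, s)) (fun s => fy (a, s)) b y) as [c2 [Hc2 E2]].
 { intros c Hc. apply (HD (a, c)). apply Hbox; [|lra]. rewrite Rminus_diag, Rabs_R0. apply cond_pos. }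
 destruct (Hbox c1 y) as [A1 _]; [lra|lra|]. destruct (Hbox a c2) as [_ [A2 _]]; [rewrite Rminus_diag, Rabs_R0; apply cond_pos|lra|].
 replace (f (x, y) - f (a, b) - (fx (a, b) * (x - a) + fy (a, b) * (y - b)))
  with ((fx (c1, y) - fx (a, b)) * (x - a) + (fy (a, c2) - fy (a, b)) * (y - b))
  by lra.
 eapply Rle_trans; [apply Rabs_triang|]. rewrite !Rabs_mult. note (Rmax_l (Rabs (x - a)) (Rabs (y - b))).
 note (Rmax_r (Rabs (x - a)) (Rabs (y - b))). note (Rabs_pos (x - a)). note (Rabs_pos (y - b)).
 note (Rabs_pos (fx (c1, y) - fx (a, b))). note (Rabs_pos (fy (a, c2) - fy (a, b))). nra.
Qed.

Lemma C1_chain (U : pt -> Prop) (f fx fy : pt -> R) (a b : R -> R) (s da db : R) :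
 open2 U -> U (a s, b s) ->
 (forall q, U q -> derivable_pt_lim (fun t => f (t, snd q)) (fst q) (fx q) /\
          derivable_pt_lim (fun t => f (fst q, t)) (snd q) (fy q)) ->
 cont2R_on U fx -> cont2R_on U fy ->
 is_derive a s da -> is_derive b s db ->
 is_derive (fun t => f (a t, b t)) s (fx (a s, b s) * da + fy (a s, b s) * db).
Proof.
 intros HU Hp HD Cx Cy Ha Hb. apply is_derive_Reals. apply (derivable_pt_lim_comp_2d (fun x y => f (x, y)) a b).
 - apply (C1_differentiable U f fx fy (a s, b s)); auto.
  + apply (proj1 (cont2R_on_open U fx HU) Cx); auto.
  + apply (proj1 (cont2R_on_open U fy HU) Cy); auto.
 - apply is_derive_Reals; auto.
 - apply is_derive_Reals; auto.
Qed.

Lemma continuous_pair {V : UniformSpace} (a b : V -> R) (q : V) :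
 continuous a q -> continuous b q -> continuous (fun z => (a z, b z) : R * R) q.
Proof.
 intros Ha Hb. apply filterlim_locally. intros eps. note (proj1 (filterlim_locally _ _) Ha eps) as H1.
 note (proj1 (filterlim_locally _ _) Hb eps) as H2. weaken (filter_and _ _ H1 H2). intros z [A B]. split; auto.
Qed.

Lemma continuous_Rmult {V : UniformSpace} (a b : V -> R) (q : V) :
 continuous a q -> continuous b q -> continuous (fun z => a z * b z) q.
Proof. intros. apply (continuous_mult (K := R_AbsRing) a b); auto. Qed.

Lemma continuous_Rplus {V : UniformSpace} (a b : V -> R) (q : V) :
 continuous a q -> continuous b q -> continuous (fun z => a z + b z) q.
Proof. intros. apply (continuous_plus (V := R_NormedModule) a b); auto. Qed.

Lemma continuous_Rminus {V : UniformSpace} (a b : V -> R) (q : V) :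
 continuous a q -> continuous b q -> continuous (fun z => a z - b z) q.
Proof. intros. apply (continuous_minus (V := R_NormedModule) a b); auto. Qed.

Lemma continuous_Ropp {V : UniformSpace} (a : V -> R) (q : V) :
 continuous a q -> continuous (fun z => - a z) q.
Proof. intros. apply (continuous_opp (V := R_NormedModule) a); auto. Qed.

Lemma continuous_Rcomp {V : UniformSpace} (f : R -> R) (a : V -> R) (q : V) :
 continuous a q -> continuous f (a q) -> continuous (fun z => f (a z)) q.
Proof. intros. apply (continuous_comp a f); auto. Qed.

Lemma continuous_of_ex_derive (f : R -> R) (x : R) : ex_derive f x -> continuous f x.
Proof. intros [l H]. exact (is_derive_continuous f x l H). Qed.

Lemma continuous_cos x : continuous cos x.
Proof. apply continuous_of_ex_derive. auto_derive; auto. Qed.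
Lemma continuous_sin x : continuous sin x.
Proof. apply continuous_of_ex_derive. auto_derive; auto. Qed.

Lemma continuous_exp x : continuous exp x.
Proof. apply continuous_of_ex_derive. auto_derive; auto. Qed.
Lemma continuous_sinh x : continuous sinh x.
Proof. eapply is_derive_continuous. apply is_derive_Reals, derivable_pt_lim_sinh. Qed.
Lemma continuous_cosh x : continuous cosh x.
Proof. eapply is_derive_continuous. apply is_derive_Reals, derivable_pt_lim_cosh. Qed.

Lemma continuous_Rpow {V : UniformSpace} (f : V -> R) (n : nat) (q : V) :
 continuous f q -> continuous (fun z => f z ^ n) q.
Proof.
 intros H. induction n as [|n IH]; simpl; [apply continuous_const|]. apply continuous_Rmult; auto.
Qed.

Ltac cont := cbv beta; match goal with
 | H : continuous ?f ?q |- continuous ?f ?q => exact H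
 | |- continuous (fun _ => ?c) ?q => apply (continuous_const c q)
 | |- continuous (fun x => x) ?q => apply (continuous_id q)
 | |- continuous (fun x => @?f x + @?g x) ?q => apply (continuous_Rplus f g q); cont
 | |- continuous (fun x => @?f x - @?g x) ?q => apply (continuous_Rminus f g q); cont
 | |- continuous (fun x => @?f x * @?g x) ?q => apply (continuous_Rmult f g q); cont
 | |- continuous (fun x => - @?f x) ?q => apply (continuous_Ropp f q); cont
 | |- continuous (fun x => @?f x ^ ?n) ?q => apply (continuous_Rpow f n q); cont
 | |- continuous (fun x => cos (@?f x)) ?q => apply (continuous_Rcomp cos f q); [cont|apply continuous_cos]
 | |- continuous (fun x => sin (@?f x)) ?q => apply (continuous_Rcomp sin f q); [cont|apply continuous_sin]
 | |- continuous (fun x => exp (@?f x)) ?q => apply (continuous_Rcomp exp f q); [cont|apply continuous_exp]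
 | |- continuous (fun x => cosh (@?f x)) ?q => apply (continuous_Rcomp cosh f q); [cont|apply continuous_cosh]
 | |- continuous (fun x => sinh (@?f x)) ?q => apply (continuous_Rcomp sinh f q); [cont|apply continuous_sinh]
 | |- continuous (fun x => sqrt (@?f x)) ?q => apply (continuous_Rcomp sqrt f q); [cont|apply continuous_sqrt]
 | |- continuous (fun x => fst x) ?q => apply continuous_fst
 | |- continuous (fun x => snd x) ?q => apply continuous_snd
 | |- continuous (fun x => fst (@?f x)) ?q => apply (continuous_comp f fst q); [cont|apply continuous_fst]
 | |- continuous (fun x => snd (@?f x)) ?q => apply (continuous_comp f snd q); [cont|apply continuous_snd]
 | |- _ => eauto
 end.

(** * Fourier coefficients of a solution on small circles *)

Section Polar.
Context (U : pt -> Prop) (u ux uy uxx uxy uyx uyy : pt -> R) (p : pt) (rho : R).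
Context (HU : open2 U) (HD : harmonic_data U u ux uy uxx uxy uyx uyy).
Context (Hrho : 0 < rho) (Hdisc : forall z, dist2 z p < 2 * rho -> U z).

Let pol (s t : R) : pt := (fst p + s * cos t, snd p + s * sin t).

Lemma polar_in (s t : R) : Rabs s < 2 * rho -> U (pol s t).
Proof.
 intros Hs. apply Hdisc. unfold dist2, pol. simpl. replace ((fst p + s * cos t - fst p) * ((fst p + s * cos t - fst p) * 1) +
   (snd p + s * sin t - snd p) * ((snd p + s * sin t - snd p) * 1)) with (Rsqr s).
 - rewrite sqrt_Rsqr_abs. auto.
 - note (sin2_cos2 t) as E. unfold Rsqr in *. replace (s * s) with (s * s * (sin t * sin t + cos t * cos t)) by nra. ring.
Qed.

Lemma polar_continuous (f : pt -> R) (s t : R) : cont2R_on U f -> Rabs s < 2 * rho ->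
 continuous (fun q : R * R => f (pol (fst q) (snd q))) (s, t).
Proof.
 intros Hf Hs. apply (continuous_comp (fun q : R * R => pol (fst q) (snd q) : R * R) (f : R * R -> R)).
 - unfold pol. apply continuous_pair; apply continuous_Rplus; try apply continuous_const;
  apply continuous_Rmult; try apply continuous_fst; apply continuous_Rcomp;
  try apply continuous_snd; [apply continuous_cos|apply continuous_sin].
 - apply (proj1 (cont2R_on_open U f HU) Hf). apply polar_in. exact Hs.
Qed.

Let wr s t := ux (pol s t) * cos t + uy (pol s t) * sin t.
Let wrr s t := (uxx (pol s t) * cos t + uxy (pol s t) * sin t) * cos t
       + (uyx (pol s t) * cos t + uyy (pol s t) * sin t) * sin t.
Let wt s t := s * (uy (pol s t) * cos t - ux (pol s t) * sin t).
Let wtt s t := s * ((uyx (pol s t) * (- s * sin t) + uyy (pol s t) * (s * cos t)) * cos t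
         - uy (pol s t) * sin t
         - (uxx (pol s t) * (- s * sin t) + uxy (pol s t) * (s * cos t)) * sin t
         - ux (pol s t) * cos t).

Lemma polar_chain_s (f fx fy : pt -> R) (s t : R) :
 (forall q, U q -> derivable_pt_lim (fun t => f (t, snd q)) (fst q) (fx q) /\
          derivable_pt_lim (fun t => f (fst q, t)) (snd q) (fy q)) ->
 cont2R_on U fx -> cont2R_on U fy -> Rabs s < 2 * rho ->
 is_derive (fun s => f (pol s t)) s (fx (pol s t) * cos t + fy (pol s t) * sin t).
Proof.
 intros H Cx Cy Hs. apply (C1_chain U f fx fy (fun s => fst p + s * cos t) (fun s => snd p + s * sin t)); auto.
 - apply polar_in; auto.
 - auto_derive; auto; ring.
 - auto_derive; auto; ring.
Qed.

Lemma polar_chain_t (f fx fy : pt -> R) (s t : R) :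
 (forall q, U q -> derivable_pt_lim (fun t => f (t, snd q)) (fst q) (fx q) /\
          derivable_pt_lim (fun t => f (fst q, t)) (snd q) (fy q)) ->
 cont2R_on U fx -> cont2R_on U fy -> Rabs s < 2 * rho ->
 is_derive (fun t => f (pol s t)) t (fx (pol s t) * (- s * sin t) + fy (pol s t) * (s * cos t)).
Proof.
 intros H Cx Cy Hs. apply (C1_chain U f fx fy (fun t => fst p + s * cos t) (fun t => snd p + s * sin t)); auto.
 - apply polar_in; auto.
 - auto_derive; auto; ring.
 - auto_derive; auto; ring.
Qed.

(** For [k'' = - j k], two integrations by parts over the period turn the angular part of the
    Laplacian into multiplication by [- j], which leaves an Euler equation for the Fourier
    coefficient. Written without division by [s] it includes the centre [s = 0]. *)
Lemma polar_weighted (k k1 : R -> R) (j : R) :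
 (forall t, is_derive k t (k1 t)) -> (forall t, is_derive k1 t (- j * k t)) ->
 k (2 * PI) = k 0 -> k1 (2 * PI) = k1 0 ->
 forall s, Rabs s < 2 * rho ->
 is_derive (fun s => RInt (fun t => u (pol s t) * k t) 0 (2 * PI)) s
      (RInt (fun t => wr s t * k t) 0 (2 * PI)) /\
 is_derive (fun s => RInt (fun t => wr s t * k t) 0 (2 * PI)) s
      (RInt (fun t => wrr s t * k t) 0 (2 * PI)) /\
 s ^ 2 * RInt (fun t => wrr s t * k t) 0 (2 * PI) + s * RInt (fun t => wr s t * k t) 0 (2 * PI)
  - j * RInt (fun t => u (pol s t) * k t) 0 (2 * PI)
 = s ^ 2 * RInt (fun t => P (snd (pol s t)) * u (pol s t) * k t) 0 (2 * PI).
Proof.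
 intros Hk Hk1 Pk Pk1 s Hs. destruct HD as [HD1 [Cu [Cux [Cuy [Cxx [Cxy [Cyx [Cyy Hpde]]]]]]]].
 assert (Du : forall q, U q -> derivable_pt_lim (fun t => u (t, snd q)) (fst q) (ux q) /\
          derivable_pt_lim (fun t => u (fst q, t)) (snd q) (uy q))
  by (intros q Hq; destruct (HD1 q Hq) as [? [? [? [? [? ?]]]]]; auto).
 assert (Dux : forall q, U q -> derivable_pt_lim (fun t => ux (t, snd q)) (fst q) (uxx q) /\
          derivable_pt_lim (fun t => ux (fst q, t)) (snd q) (uxy q))
  by (intros q Hq; destruct (HD1 q Hq) as [? [? [? [? [? ?]]]]]; auto).
 assert (Duy : forall q, U q -> derivable_pt_lim (fun t => uy (t, snd q)) (fst q) (uyx q) /\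
          derivable_pt_lim (fun t => uy (fst q, t)) (snd q) (uyy q))
  by (intros q Hq; destruct (HD1 q Hq) as [? [? [? [? [? ?]]]]]; auto).
 assert (Ck : forall t, continuous k t) by (intros t; eapply is_derive_continuous; auto).
 assert (Ck1 : forall t, continuous k1 t) by (intros t; eapply is_derive_continuous; auto).
 assert (C2k : forall q : R * R, continuous (fun q : R * R => k (snd q)) q)
  by (intros [x y]; apply continuous_Rcomp; [apply continuous_snd|apply Ck]).
 assert (Cc : forall q : R * R, continuous (fun q : R * R => cos (snd q)) q)
  by (intros [x y]; apply continuous_Rcomp; [apply continuous_snd|apply continuous_cos]).
 assert (Cs : forall q : R * R, continuous (fun q : R * R => sin (snd q)) q)
  by (intros [x y]; apply continuous_Rcomp; [apply continuous_snd|apply continuous_sin]).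
 assert (Cf : forall q : R * R, continuous (fun q : R * R => fst q) q)
  by (intros [x y]; apply continuous_fst).
 assert (Hloc : locally s (fun y => Rabs y < 2 * rho)).
 { assert (Hd : 0 < 2 * rho - Rabs s) by lra. exists (mkposreal _ Hd). intros y Hy. ball_simpl in Hy.
  note (Rabs_triang_inv y s). unfold Rminus in *. lra. }
 assert (J0 : forall y t, Rabs y < 2 * rho -> continuous (fun q : R * R => u (pol (fst q) (snd q)) * k (snd q)) (y, t))
  by (intros y t Hy; apply continuous_Rmult; auto; apply polar_continuous; auto).
 assert (J1 : forall y t, Rabs y < 2 * rho -> continuous (fun q : R * R => wr (fst q) (snd q) * k (snd q)) (y, t)).
 { intros y t Hy. apply continuous_Rmult; auto. unfold wr.
  apply continuous_Rplus; apply continuous_Rmult; auto; apply polar_continuous; auto. }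
 assert (J2 : forall y t, Rabs y < 2 * rho -> continuous (fun q : R * R => wrr (fst q) (snd q) * k (snd q)) (y, t)).
 { intros y t Hy. apply continuous_Rmult; auto. unfold wrr.
  assert (CC : forall f g, cont2R_on U f -> cont2R_on U g -> continuous (fun q : R * R =>
   f (pol (fst q) (snd q)) * cos (snd q) + g (pol (fst q) (snd q)) * sin (snd q)) (y, t))
   by (intros f g Hf Hg; apply continuous_Rplus; apply continuous_Rmult; auto; apply polar_continuous; auto).
  apply continuous_Rplus; apply continuous_Rmult; auto. }
 assert (Jp : forall t, continuous (fun t => P (snd (pol s t)) * u (pol s t) * k t) t).
 { intros t. apply continuous_ext with (fun t => (uxx (pol s t) + uyy (pol s t)) * k t).
  - intros x. rewrite Hpde; [lra|]. apply polar_in; auto.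
  - apply continuous_Rmult; auto. apply continuous_Rplus;
   apply (continuous_2d_snd (fun s t => _ (pol s t))); apply polar_continuous; auto. }
 assert (DerU : forall y t, Rabs y < 2 * rho -> is_derive (fun s => u (pol s t)) y (wr y t)).
 { intros y t Hy. unfold wr. apply polar_chain_s; auto. }
 assert (DerW : forall y t, Rabs y < 2 * rho -> is_derive (fun s => wr s t) y (wrr y t)).
 { intros y t Hy. unfold wr, wrr. apply is_derive_Rplus; apply is_derive_Rmultc; apply polar_chain_s; auto. }
 assert (I0 : forall y, Rabs y < 2 * rho -> ex_RInt (fun t => u (pol y t) * k t) 0 (2 * PI)).
 { intros y Hy. apply ex_RInt_cont. intros t. apply (continuous_2d_snd (fun s t => u (pol s t) * k t)). auto. }
 assert (I1 : forall y, Rabs y < 2 * rho -> ex_RInt (fun t => wr y t * k t) 0 (2 * PI)).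
 { intros y Hy. apply ex_RInt_cont. intros t. apply (continuous_2d_snd (fun s t => wr s t * k t)). auto. }
 assert (I2 : ex_RInt (fun t => wrr s t * k t) 0 (2 * PI)).
 { apply ex_RInt_cont. intros t. apply (continuous_2d_snd (fun s t => wrr s t * k t)). auto. }
 split; [|split].
 - apply (is_derive_RInt_under (fun s t => u (pol s t) * k t) (fun s t => wr s t * k t)); [note PI_RGT_0; lra| | |].
  + weaken Hloc. intros y Hy t _. apply is_derive_Rmultc. auto.
  + intros t. auto.
  + weaken Hloc. auto.
 - apply (is_derive_RInt_under (fun s t => wr s t * k t) (fun s t => wrr s t * k t)); [note PI_RGT_0; lra| | |].
  + weaken Hloc. intros y Hy t _. apply is_derive_Rmultc. auto.
  + intros t. auto.
  + weaken Hloc. auto.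
 - assert (Dt : forall t, is_derive (fun t => u (pol s t)) t (wt s t)).
  { intros t. replace (wt s t) with (ux (pol s t) * (- s * sin t) + uy (pol s t) * (s * cos t))
    by (unfold wt; ring). apply polar_chain_t; auto. }
  assert (Dtt : forall t, is_derive (fun t => wt s t) t (wtt s t)).
  { intros t. unfold wt, wtt. apply is_derive_Rcmult.
   assert (B1 : is_derive cos t (- sin t)) by (apply is_derive_Reals, derivable_pt_lim_cos).
   assert (B2 : is_derive sin t (cos t)) by (apply is_derive_Reals, derivable_pt_lim_sin). eapply is_derive_eq.
   - apply is_derive_Rminus; apply is_derive_Rmult; eauto; apply polar_chain_t; eauto.
   - cbv beta; ring. }
  (* The integrand is the derivative of [wt * k - u * k1]; its boundary terms cancel by
     periodicity. *)
  assert (Z : RInt (fun t => wtt s t * k t - u (pol s t) * (- j * k t)) 0 (2 * PI) = 0).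
  { transitivity ((wt s (2 * PI) * k (2 * PI) - u (pol s (2 * PI)) * k1 (2 * PI))
     - (wt s 0 * k 0 - u (pol s 0) * k1 0)).
   1: apply (RInt_fundamental (fun t => wt s t * k t - u (pol s t) * k1 t)).
   3: { rewrite Pk, Pk1. unfold wt, pol. rewrite sin_2PI, cos_2PI, sin_0, cos_0. eqR. ring. }
   - intros t _. eapply is_derive_eq.
    + apply is_derive_Rminus; apply is_derive_Rmult; eauto.
    + cbv beta; ring.
   - intros t _. unfold wtt. assert (forall f, cont2R_on U f -> continuous (fun t => f (pol s t)) t)
     by (intros f Hf; apply (continuous_2d_snd (fun s t => f (pol s t))); apply polar_continuous; auto).
    cont. }
  assert (X4 : ex_RInt (fun t => P (snd (pol s t)) * u (pol s t) * k t) 0 (2 * PI))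
   by (apply ex_RInt_cont; auto).
  rewrite <- !(RInt_Rcmult (s ^ 2)), <- (RInt_Rcmult s), <- (RInt_Rcmult j) by auto.
  rewrite <- RInt_Rplus, <- RInt_Rminus by auto using ex_RInt_Rplus, ex_RInt_Rcmult. apply Rminus_diag_uniq.
  rewrite <- RInt_Rminus by auto using ex_RInt_Rplus, ex_RInt_Rminus, ex_RInt_Rcmult.
  transitivity (-1 * RInt (fun t => wtt s t * k t - u (pol s t) * (- j * k t)) 0 (2 * PI)).
  2:{ rewrite Z. ring. }
  rewrite <- RInt_Rcmult.
  2:{ apply ex_RInt_cont. intros t. unfold wtt.
    assert (forall f, cont2R_on U f -> continuous (fun t => f (pol s t)) t)
     by (intros f Hf; apply (continuous_2d_snd (fun s t => f (pol s t))); apply polar_continuous; auto).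
    cont. }
  apply RInt_ext. intros t _. rewrite <- (Hpde (pol s t)) by (apply polar_in; auto). note (sin2_cos2 t) as SC. unfold Rsqr in SC.
  unfold wtt, wr, wrr. replace (uxx (pol s t) + uyy (pol s t))
   with ((uxx (pol s t) + uyy (pol s t)) * (sin t * sin t + cos t * cos t)) by (rewrite SC; ring).
  eqR. ring.
Qed.

Lemma polar_zero t : pol 0 t = p.
Proof. unfold pol. destruct p as [a b]; simpl. f_equal; ring. Qed.

(** The derivatives at the centre are, up to the factor [PI], the derivatives at 0 of the first
    Fourier coefficients [B] of [u]. By positivity these are dominated by the zeroth coefficient
    [A], and [M * rho ^ 2 <= 1] keeps the potential from inflating [A] by more than [3 / 2] between
    0 and [rho]. *)
Lemma gradient_bound (M : R) :
 (forall z, U z -> 0 <= u z) ->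
 (forall z, dist2 z p < 2 * rho -> 0 <= P (snd z) <= M) -> M * rho ^ 2 <= 1 ->
 Rabs (ux p) <= 4 / rho * u p /\ Rabs (uy p) <= 4 / rho * u p.
Proof.
 intros Hu HP HM. destruct HD as [HD1 [Cu [Cux [Cuy [Cxx [Cxy [Cyx [Cyy Hpde]]]]]]]].
 set (A := fun s => RInt (fun t => u (pol s t) * 1) 0 (2 * PI)). set (A1 := fun s => RInt (fun t => wr s t * 1) 0 (2 * PI)).
 set (A2 := fun s => RInt (fun t => wrr s t * 1) 0 (2 * PI)). note PI_RGT_0 as Hpi.
 assert (HP' : forall s t, Rabs s < 2 * rho -> 0 <= P (snd (pol s t)) <= M).
 { intros s t Hs. apply HP. unfold dist2, pol. simpl. replace ((fst p + s * cos t - fst p) * ((fst p + s * cos t - fst p) * 1) +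
   (snd p + s * sin t - snd p) * ((snd p + s * sin t - snd p) * 1)) with (Rsqr s).
  - rewrite sqrt_Rsqr_abs. auto.
  - note (sin2_cos2 t) as E. unfold Rsqr in *. replace (s * s) with (s * s * (sin t * sin t + cos t * cos t)) by nra. ring. }
 assert (HM0 : 0 <= M).
 { note (HP' 0 0). rewrite Rabs_R0 in H. lra. }
 assert (Hup : forall s t, Rabs s < 2 * rho -> 0 <= u (pol s t))
  by (intros s t Hs; apply Hu, polar_in; auto).
 assert (WA : forall s, Rabs s < 2 * rho -> is_derive A s (A1 s) /\ is_derive A1 s (A2 s) /\
   s ^ 2 * A2 s + s * A1 s - 0 * A s =
   s ^ 2 * RInt (fun t => P (snd (pol s t)) * u (pol s t) * 1) 0 (2 * PI)).
 { apply (polar_weighted (fun _ => 1) (fun _ => 0) 0); auto.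
  - intros t. apply is_derive_Rconst.
  - intros t. eapply is_derive_eq; [apply is_derive_Rconst|ring]. }
 assert (Cpu : forall s t, Rabs s < 2 * rho -> continuous (fun t => u (pol s t)) t).
 { intros s t Hs. apply (continuous_2d_snd (fun s t => u (pol s t))), polar_continuous; auto. }
 assert (CPpu : forall s t, Rabs s < 2 * rho -> continuous (fun t => P (snd (pol s t)) * u (pol s t)) t).
 { intros s t Hs. apply continuous_ext with (fun t => uxx (pol s t) + uyy (pol s t)).
  - intros x. apply Hpde, polar_in; auto.
  - apply continuous_Rplus;
   apply (continuous_2d_snd (fun s t => _ (pol s t))); apply polar_continuous; auto. }
 assert (HA0 : forall s, Rabs s < 2 * rho -> 0 <= A s).
 { intros s Hs. unfold A. apply RInt_ge_0; [lra| |].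
  - apply ex_RInt_cont. intros t. specialize (Cpu s t Hs). cont.
  - intros t _. rewrite Rmult_1_r. auto. }
 assert (HI : forall s, Rabs s < 2 * rho ->
   0 <= RInt (fun t => P (snd (pol s t)) * u (pol s t) * 1) 0 (2 * PI) <= M * A s).
 { intros s Hs. split.
  - apply RInt_ge_0; [lra| |].
   + apply ex_RInt_cont. intros t. apply continuous_Rmult; auto. apply continuous_const.
   + intros t _. rewrite Rmult_1_r. apply Rmult_le_pos; auto. apply HP'; auto.
  - unfold A. rewrite <- RInt_Rcmult by (apply ex_RInt_cont; intros t; specialize (Cpu s t Hs); cont). apply RInt_le; [lra| | |].
   + apply ex_RInt_cont. intros t. apply continuous_Rmult; auto. apply continuous_const.
   + apply ex_RInt_cont. intros t. specialize (Cpu s t Hs). cont.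
   + intros t _. rewrite !Rmult_1_r. apply Rmult_le_compat_r; auto. apply HP'; auto. }
 assert (Hsmall : forall s, 0 <= s <= rho -> Rabs s < 2 * rho)
  by (intros s Hs; rewrite Rabs_right; lra).
 assert (HA1 : forall s, 0 <= s <= rho -> 0 <= s * A1 s).
 { intros s Hs. replace 0 with (0 * A1 0) by ring. apply (is_derive_nonneg_incr (fun s => s * A1 s) (fun s => A1 s + s * A2 s)); [lra| |].
  - intros x Hx. destruct (WA x) as [_ [W _]]; [apply Hsmall; lra|].
   eapply is_derive_eq; [apply is_derive_Rmult; [apply is_derive_id|exact W]|]. unfold one; simpl. ring.
  - intros x Hx. destruct (WA x) as [_ [_ W]]; [apply Hsmall; lra|]. destruct (HI x) as [W1 _]; [apply Hsmall; lra|]. nra. }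
 assert (HD2 : forall s, 0 <= s <= rho -> s * A1 s <= M * s ^ 2 / 2 * A s).
 { intros s Hs. assert (s * A1 s - M * s ^ 2 / 2 * A s <= 0 * A1 0 - M * 0 ^ 2 / 2 * A 0); [|lra].
  apply (is_derive_nonpos_decr (fun s => s * A1 s - M * s ^ 2 / 2 * A s)
   (fun s => A1 s + s * A2 s - M * s * A s - M * s ^ 2 / 2 * A1 s)); [lra| |].
  - intros x Hx. destruct (WA x) as [W0 [W _]]; [apply Hsmall; lra|]. eapply is_derive_eq.
   + apply is_derive_Rminus; [apply is_derive_Rmult; [apply is_derive_id|exact W]|]. apply is_derive_Rmult; [|eauto].
    instantiate (1 := M * x). auto_derive; auto; field.
   + unfold one; simpl. ring.
  - intros x Hx. destruct (WA x) as [_ [_ W]]; [apply Hsmall; lra|].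
   destruct (HI x) as [_ W1]; [apply Hsmall; lra|]. specialize (HA1 x ltac:(lra)).
   assert (A1 x + x * A2 x = x * RInt (fun t => P (snd (pol x t)) * u (pol x t) * 1) 0 (2 * PI)).
   { apply Rmult_eq_reg_l with x; [|lra]. lra. }
   rewrite H. assert (0 <= M * x / 2 * (x * A1 x)) by pos. nra. }
 assert (HAm : forall a b, 0 <= a <= b -> b <= rho -> A a <= A b).
 { intros a b Hab Hb. apply (is_derive_nonneg_incr A A1); [lra| |].
  - intros x Hx. destruct (WA x) as [W _]; [apply Hsmall; lra|pos].
  - intros x Hx. specialize (HA1 x ltac:(lra)). nra. }
 (* [HD2] bounds the logarithmic derivative of [A] by [M s / 2], so [A s * exp (- M s^2 / 4)] is
    nonincreasing. The constant is [2 PI] times [3 / 2], an upper bound for [exp (1 / 4)]. *)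
 assert (HAr : A rho <= 3 * PI * u p).
 { assert (A rho * exp (- (M * rho ^ 2 / 4)) <= A 0 * exp (- (M * 0 ^ 2 / 4))).
  { apply (is_derive_nonpos_decr (fun s => A s * exp (- (M * s ^ 2 / 4)))
    (fun s => (A1 s - M * s / 2 * A s) * exp (- (M * s ^ 2 / 4)))); [lra| |].
   - intros x Hx. destruct (WA x) as [W0 _]; [auto|]. eapply is_derive_eq.
    + apply is_derive_Rmult; [eauto|].
     apply (is_derive_Rcomp exp (fun s => - (M * s ^ 2 / 4)) x (exp (- (M * x ^ 2 / 4))) (- (M * x / 2))).
     * apply is_derive_Reals, derivable_pt_lim_exp.
     * auto_derive; auto; field.
    + cbv beta; field.
   - intros x Hx. specialize (HD2 x ltac:(lra)). note (exp_pos (- (M * x ^ 2 / 4))). assert (A1 x - M * x / 2 * A x <= 0) by nra. nra. }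
  assert (EA : A 0 = 2 * PI * u p).
  { unfold A. rewrite (RInt_ext _ (fun _ => u p * 1)).
   - rewrite RInt_const. unfold scal; simpl; unfold mult; simpl. ring.
   - intros x _. rewrite polar_zero. reflexivity. }
  rewrite EA in H. replace (- (M * 0 ^ 2 / 4)) with 0 in H by field. rewrite exp_0 in H. assert (He : 2 / 3 <= exp (- (M * rho ^ 2 / 4))).
  { assert (Hx : exp (M * rho ^ 2 / 4) <= 3 / 2).
   { assert (Hx4 : exp (M * rho ^ 2 / 4) <= exp (1 / 4)).
    { destruct (Req_dec (M * rho ^ 2) 1) as [E|E]; [rewrite E; lra|]. left; apply exp_increasing; lra. }
    assert (exp (1 / 4) <= 3 / 2); [|lra]. apply Rnot_lt_le; intros Hlt.
    assert (E4 : exp (1/4) * exp (1/4) * (exp (1/4) * exp (1/4)) = exp 1)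
     by (rewrite <- !exp_plus; f_equal; field).
    note exp_le_3. assert (9 / 4 < exp (1/4) * exp (1/4)) by nra. nra. }
   rewrite exp_Ropp. note (exp_pos (M * rho ^ 2 / 4)).
   apply Rmult_le_reg_r with (exp (M * rho ^ 2 / 4)); [lra|]. rewrite Rinv_l by lra. lra. }
  note (Hu p (Hdisc p ltac:(rewrite dist2_refl; lra))). specialize (HA0 rho (Hsmall rho ltac:(lra))). nra. }
 assert (Hmain : forall (k k1 : R -> R), (forall t, is_derive k t (k1 t)) ->
   (forall t, is_derive k1 t (- 1 * k t)) -> k (2 * PI) = k 0 -> k1 (2 * PI) = k1 0 ->
   (forall t, Rabs (k t) <= 1) -> RInt k 0 (2 * PI) = 0 ->
   Rabs (RInt (fun t => wr 0 t * k t) 0 (2 * PI)) <= 4 * PI / rho * u p).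
 { intros k k1 Hk Hk1 Pk Pk1 Kb Kz. set (B := fun s => RInt (fun t => u (pol s t) * k t) 0 (2 * PI)).
  set (B1 := fun s => RInt (fun t => wr s t * k t) 0 (2 * PI)). set (B2 := fun s => RInt (fun t => wrr s t * k t) 0 (2 * PI)).
  set (Rk := fun s => RInt (fun t => P (snd (pol s t)) * u (pol s t) * k t) 0 (2 * PI)).
  assert (WB : forall s, Rabs s < 2 * rho -> is_derive B s (B1 s) /\ is_derive B1 s (B2 s) /\
    s ^ 2 * B2 s + s * B1 s - 1 * B s = s ^ 2 * Rk s)
   by (apply (polar_weighted k k1 1); auto).
  assert (Ck : forall t, continuous k t) by (intros t; eapply is_derive_continuous; auto). set (K := M * A rho).
  assert (HK0 : 0 <= K) by (apply Rmult_le_pos; [auto|apply HA0, Hsmall; lra]).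
  assert (Hdom : forall f : R -> R, (forall t, continuous f t) -> (forall t, 0 <= f t) ->
    Rabs (RInt (fun t => f t * k t) 0 (2 * PI)) <= RInt (fun t => f t * 1) 0 (2 * PI)).
  { intros f Cf Hf. eapply Rle_trans; [apply abs_RInt_le; [lra|apply ex_RInt_cont; intros t; apply continuous_Rmult; auto]|].
   apply RInt_le; [lra| | |].
   - apply ex_RInt_cont. intros t. apply (continuous_Rcomp Rabs); [apply continuous_Rmult; auto|apply continuous_Rabs].
   - apply ex_RInt_cont. intros t. apply continuous_Rmult; auto. apply continuous_const.
   - intros t _. rewrite Rabs_mult, (Rabs_right (f t)) by (apply Rle_ge; auto). apply Rmult_le_compat_l; auto. }
  assert (HR : forall s, 0 <= s <= rho -> Rabs (Rk s) <= K).
  { intros s Hs. note (Hsmall s Hs) as Hs'. apply Rle_trans with (M * A s); [|apply Rmult_le_compat_l; auto; apply HAm; lra].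
   eapply Rle_trans; [|apply HI; auto]. apply Hdom; auto. intros t. apply Rmult_le_pos; auto. apply HP'; auto. }
  assert (HB : forall s, 0 <= s <= rho -> Rabs (B s) <= A s) by (intros s Hs; note (Hsmall s Hs); apply Hdom; auto).
  (* The quantity [s^2 B1 - s B] has derivative [s^2 Rk] and is [s^3] times the derivative of
     [B / s]. So [B / s] has derivative at most [K / 3], and its value at [rho] controls it down to
     0. *)
  assert (HE : forall s, 0 <= s <= rho -> Rabs (s ^ 2 * B1 s - s * B s) <= K * s ^ 3 / 3).
  { intros s Hs. assert (DE : forall x, 0 <= x <= s -> is_derive (fun s => s ^ 2 * B1 s - s * B s) x (x ^ 2 * Rk x)).
   { intros x Hx. destruct (WB x) as [W0 [W1 W2]]; [apply Hsmall; lra|]. eapply is_derive_eq.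
    - apply is_derive_Rminus; [apply is_derive_Rmult; [|exact W1]|apply is_derive_Rmult; [apply is_derive_id|exact W0]].
     instantiate (1 := 2 * x). auto_derive; auto; ring.
    - unfold one; simpl. lra. }
   assert (DK : forall x, is_derive (fun s => K * s ^ 3 / 3) x (K * x ^ 2))
    by (intros x; auto_derive; auto; field).
   apply Rabs_le. split.
   - assert (0 ^ 2 * B1 0 - 0 * B 0 + K * 0 ^ 3 / 3 <= s ^ 2 * B1 s - s * B s + K * s ^ 3 / 3); [|lra].
    apply (is_derive_nonneg_incr (fun s => s ^ 2 * B1 s - s * B s + K * s ^ 3 / 3)
         (fun x => x ^ 2 * Rk x + K * x ^ 2)); [lra| |].
    + intros x Hx. apply is_derive_Rplus; auto.
    + intros x Hx. specialize (HR x ltac:(lra)). apply Rabs_le_between in HR. nra.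
   - assert (s ^ 2 * B1 s - s * B s - K * s ^ 3 / 3 <= 0 ^ 2 * B1 0 - 0 * B 0 - K * 0 ^ 3 / 3); [|lra].
    apply (is_derive_nonpos_decr (fun s => s ^ 2 * B1 s - s * B s - K * s ^ 3 / 3)
         (fun x => x ^ 2 * Rk x - K * x ^ 2)); [lra| |].
    + intros x Hx. apply is_derive_Rminus; auto.
    + intros x Hx. specialize (HR x ltac:(lra)). apply Rabs_le_between in HR. nra. }
  assert (Hq : forall s, 0 < s <= rho -> Rabs (B s) <= (A rho / rho + K * rho / 3) * s).
  { intros s Hs. destruct (MVT_gen (fun s => B s / s) s rho (fun s => (s ^ 2 * B1 s - s * B s) / s ^ 3)) as [c [Hc E]].
   - intros x Hx. rewrite Rmin_left, Rmax_right in Hx by lra. destruct (WB x) as [W0 _]; [apply Hsmall; lra|]. eapply is_derive_eq.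
    + apply is_derive_Rmult; [eauto|]. instantiate (1 := - / x ^ 2). auto_derive; [lra|]. field; lra.
    + field; lra.
   - intros x Hx. rewrite Rmin_left, Rmax_right in Hx by lra. apply continuity_pt_filterlim.
    destruct (WB x) as [W0 _]; [apply Hsmall; lra|]. apply continuous_Rmult; [eapply is_derive_continuous; exact W0|].
    apply (continuous_of_ex_derive Rinv). auto_derive; lra.
   - rewrite Rmin_left, Rmax_right in Hc by lra. assert (Hc3 : 0 < c ^ 3) by pos.
    assert (Hb : Rabs ((c ^ 2 * B1 c - c * B c) / c ^ 3) <= K / 3).
    { unfold Rdiv. rewrite Rabs_mult, (Rabs_right (/ c ^ 3)) by pos.
     apply Rmult_le_reg_r with (c ^ 3); auto. rewrite Rmult_assoc, Rinv_l by lra. specialize (HE c ltac:(lra)). lra. }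
    assert (E2 : Rabs (B s / s) <= A rho / rho + K * rho / 3).
    { replace (B s / s) with (B rho / rho - (c ^ 2 * B1 c - c * B c) / c ^ 3 * (rho - s)) by lra.
     eapply Rle_trans; [apply Rabs_triang|]. rewrite Rabs_Ropp, Rabs_mult. rewrite (Rabs_right (rho - s)) by lra.
     apply Rplus_le_compat.
     - unfold Rdiv. rewrite Rabs_mult, (Rabs_right (/ rho)) by pos. apply Rmult_le_compat_r; [pos|]. apply HB; lra.
     - note (Rabs_pos ((c ^ 2 * B1 c - c * B c) / c ^ 3)). apply Rle_trans with (K / 3 * (rho - s)); [nra|]. nra. }
    replace (B s) with (B s / s * s) by fld. rewrite Rabs_mult, (Rabs_right s) by lra. apply Rmult_le_compat_r; lra. }
  assert (B00 : B 0 = 0).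
  { unfold B. rewrite (RInt_ext _ (fun t => u p * k t)).
   - rewrite RInt_Rcmult by (apply ex_RInt_cont; auto). rewrite Kz. eqR. ring.
   - intros x _. rewrite polar_zero. reflexivity. }
  apply Rle_trans with (A rho / rho + K * rho / 3).
  - apply (derivative_bound_right B 0 (B1 0) _ rho Hrho).
   + destruct (WB 0) as [W _]; [rewrite Rabs_R0; lra|pos].
   + intros h Hh. rewrite B00, Rplus_0_l, Rminus_0_r. apply Hq. lra.
  (* The factor [1 + M rho^2 / 3] is at most [4 / 3]; with [A rho <= 3 PI u p] this produces the
     constant 4. *)
  - unfold K. specialize (HA0 rho (Hsmall rho ltac:(lra))). apply Rmult_le_reg_r with rho; auto.
   replace ((A rho / rho + M * A rho * rho / 3) * rho) with (A rho * (1 + M * rho ^ 2 / 3)) by fld.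
   replace (4 * PI / rho * u p * rho) with (4 * PI * u p) by fld. note (Hu p (Hdisc p ltac:(rewrite dist2_refl; lra))).
   assert (A rho * (1 + M * rho ^ 2 / 3) <= A rho * (4 / 3)) by nra. nra. }
 assert (Dc : forall t, is_derive cos t (- sin t)) by (intros; apply is_derive_Reals, derivable_pt_lim_cos).
 assert (Ds : forall t, is_derive sin t (cos t)) by (intros; apply is_derive_Reals, derivable_pt_lim_sin).
 assert (Ic : RInt cos 0 (2 * PI) = 0).
 { rewrite (RInt_fundamental sin cos); auto using continuous_cos. rewrite sin_2PI, sin_0. eqR; ring. }
 assert (Is : RInt sin 0 (2 * PI) = 0).
 { rewrite (RInt_fundamental (fun t => - cos t) sin); auto using continuous_sin.
  - rewrite cos_2PI, cos_0. eqR; ring.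
  - intros x _. eapply is_derive_eq; [apply (is_derive_opp cos); apply Dc|]. unfold opp; simpl; ring. }
 assert (Icc : RInt (fun t => wr 0 t * cos t) 0 (2 * PI) = PI * ux p).
 { rewrite (RInt_fundamental (fun t => ux p * (t + sin t * cos t) / 2 + uy p * (sin t * sin t) / 2)).
  - rewrite sin_2PI, sin_0. eqR; field.
  - intros t _. unfold wr. rewrite polar_zero. auto_derive; auto. note (sin2_cos2 t) as SC. unfold Rsqr in SC.
   replace (1 + (1 * cos t * cos t + sin t * (1 * - sin t))) with (2 * (cos t * cos t)) by lra. field.
  - intros t _. unfold wr. apply continuous_ext with (fun t => (ux p * cos t + uy p * sin t) * cos t);
    [intros x; rewrite polar_zero; reflexivity|]. cont. }
 assert (Iss : RInt (fun t => wr 0 t * sin t) 0 (2 * PI) = PI * uy p).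
 { rewrite (RInt_fundamental (fun t => uy p * (t - sin t * cos t) / 2 + ux p * (sin t * sin t) / 2)).
  - rewrite sin_2PI, sin_0. eqR; field.
  - intros t _. unfold wr. rewrite polar_zero. auto_derive; auto. note (sin2_cos2 t) as SC. unfold Rsqr in SC.
   replace (1 + - (1 * cos t * cos t + sin t * (1 * - sin t))) with (2 * (sin t * sin t)) by lra. field.
  - intros t _. unfold wr. apply continuous_ext with (fun t => (ux p * cos t + uy p * sin t) * sin t);
    [intros x; rewrite polar_zero; reflexivity|]. cont. }
 assert (Hfin : forall a, Rabs (PI * a) <= 4 * PI / rho * u p -> Rabs a <= 4 / rho * u p).
 { intros a Ha. rewrite Rabs_mult, (Rabs_right PI) in Ha by lra.
  apply Rmult_le_reg_l with PI; auto. replace (PI * (4 / rho * u p)) with (4 * PI / rho * u p) by lra. lra. }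
 split; apply Hfin.
 - rewrite <- Icc. apply (Hmain cos (fun t => - sin t)); auto.
  + intros t. eapply is_derive_eq; [apply (is_derive_opp sin); apply Ds|]. unfold opp; simpl; ring.
  + rewrite cos_2PI, cos_0; auto.
  + rewrite sin_2PI, sin_0; auto.
  + intros t. apply Rabs_le. note (COS_bound t). lra.
 - rewrite <- Iss. apply (Hmain sin cos); auto.
  + intros t. eapply is_derive_eq; [auto|ring].
  + rewrite sin_2PI, sin_0; auto.
  + rewrite cos_2PI, cos_0; auto.
  + intros t. apply Rabs_le. note (SIN_bound t). lra.
Qed.
End Polar.

(** * Bessel profiles and the function s / sinh s *)

(* [besselJ v = (8 / sqrt v) I_1 (sqrt v / 2) / 2] is the entire solution of
  [v m'' + 2 m' = m / 16]; [besselm], obtained from it by reduction of order, is the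
  decaying one, a multiple of [K_1 (sqrt v / 2) / sqrt v]. *)
Definition besselJ_coef (n : nat) : R := / (16 ^ n * INR (fact n) * INR (fact (S n))).
Definition besselJ (v : R) : R := PSeries besselJ_coef v.
Definition besselJ1 (v : R) : R := PSeries (PS_derive besselJ_coef) v.

Lemma besselJ_coef_pos n : 0 < besselJ_coef n.
Proof.
 apply Rinv_0_lt_compat. repeat apply Rmult_lt_0_compat; try apply INR_fact_lt_0. apply pow_lt; lra.
Qed.

Lemma besselJ_coef_S n : INR (S n) * INR (S (S n)) * besselJ_coef (S n) = besselJ_coef n / 16.
Proof.
 unfold besselJ_coef. rewrite (fact_simpl (S n)), (fact_simpl n), !mult_INR. simpl pow.
 note (INR_fact_lt_0 n). note (lt_0_INR (S n) ltac:(lia)). note (lt_0_INR (S (S n)) ltac:(lia)). note (pow_lt 16 n ltac:(lra)).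
 field. repeat split; lra.
Qed.

Lemma besselJ_radius : CV_radius besselJ_coef = p_infty.
Proof.
 apply CV_radius_infinite_DAlembert.
 - intros n. note (besselJ_coef_pos n). lra.
 - apply is_lim_seq_le_le with (fun _ => 0) (fun n => / INR (S n)).
  + intros n. split; [pos|]. note (besselJ_coef_pos n). note (besselJ_coef_pos (S n)). rewrite Rabs_right by pos.
   note (besselJ_coef_S n) as E. note (lt_0_INR (S n) ltac:(lia)) as H1. assert (1 <= INR (S (S n))) by (rewrite S_INR; lra).
   apply Rmult_le_reg_r with (INR (S n) * besselJ_coef n); [pos|].
   replace (besselJ_coef (S n) / besselJ_coef n * (INR (S n) * besselJ_coef n))
    with (INR (S n) * besselJ_coef (S n)) by fld.
   replace (/ INR (S n) * (INR (S n) * besselJ_coef n)) with (besselJ_coef n) by fld.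
   assert (0 < INR (S n) * besselJ_coef (S n)) by pos. nra.
  + apply is_lim_seq_const.
  + replace (Finite 0) with (Rbar_inv p_infty) by reflexivity. apply is_lim_seq_inv; [|discriminate].
   apply (is_lim_seq_incr_1 INR). apply is_lim_seq_INR.
Qed.

Lemma besselJ_inside (v : R) : Rbar_lt (Rabs v) (CV_radius besselJ_coef).
Proof. rewrite besselJ_radius. exact I. Qed.

Lemma is_derive_besselJ v : is_derive besselJ v (besselJ1 v).
Proof. apply is_derive_PSeries, besselJ_inside. Qed.

Lemma besselJ1_derive v : exists l, is_derive besselJ1 v l /\ v * l + 2 * besselJ1 v = besselJ v / 16.
Proof.
 exists (PSeries (PS_derive (PS_derive besselJ_coef)) v). split.
 - apply is_derive_PSeries. rewrite CV_radius_derive. apply besselJ_inside.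
 - unfold besselJ1, besselJ. rewrite <- PSeries_incr_1. rewrite <- (PSeries_scal 2), <- PSeries_plus.
  + replace (PSeries besselJ_coef v / 16) with (/16 * PSeries besselJ_coef v) by field.
   rewrite <- PSeries_scal. apply PSeries_ext. intros n. unfold PS_plus, PS_scal, PS_incr_1, PS_derive.
   unfold plus, scal, zero; simpl; unfold mult; simpl. note (besselJ_coef_S n) as E. unfold Rdiv in E. rewrite Rmult_comm in E.
   destruct n.
   * simpl in *. lra.
   * rewrite (S_INR (S (S n))), (S_INR (S n)) in *.  unfold zero, plus, mult; simpl. simpl in E. lra.
  + apply ex_pseries_incr_1, ex_pseries_derive. rewrite CV_radius_derive. apply besselJ_inside.
  + apply ex_pseries_scal; [apply Rmult_comm|]. apply ex_pseries_derive, besselJ_inside.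
Qed.

Lemma PSeries_ge0 (a : nat -> R) (v : R) : (forall n, 0 <= a n) -> 0 <= v -> ex_pseries a v ->
 0 <= PSeries a v.
Proof.
 intros Ha Hv Hex. assert (E : Series (fun _ => 0 * 0) = 0) by (rewrite Series_scal_l; ring). rewrite <- E. apply Series_le.
 - intros n. split; [lra|]. rewrite Rmult_0_l. apply Rmult_le_pos; auto. apply pow_le; auto.
 - eapply ex_series_ext; [|eauto]. intros n. unfold scal; simpl; unfold mult; simpl. rewrite pow_n_pow. ring.
Qed.

Lemma besselJ1_ge0 v : 0 <= v -> 0 <= besselJ1 v.
Proof.
 intros Hv. apply PSeries_ge0; auto.
 - intros n. unfold PS_derive. apply Rmult_le_pos; [apply pos_INR|left; apply besselJ_coef_pos].
 - apply ex_pseries_derive, besselJ_inside.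
Qed.

Lemma besselJ_ge v : 0 <= v -> 1 + v / 32 <= besselJ v.
Proof.
 intros Hv. unfold besselJ. rewrite PSeries_decr_1 by (apply CV_radius_inside, besselJ_inside).
 assert (X : ex_pseries (PS_decr_1 besselJ_coef) v).
 { apply CV_radius_inside. rewrite CV_radius_decr_1. apply besselJ_inside. }
 rewrite PSeries_decr_1 by auto. assert (0 <= PSeries (PS_decr_1 (PS_decr_1 besselJ_coef)) v).
 { apply PSeries_ge0; auto.
  - intros n. left; apply besselJ_coef_pos.
  - apply CV_radius_inside. rewrite !CV_radius_decr_1. apply besselJ_inside. }
 unfold PS_decr_1 at 1, besselJ_coef at 1 2. simpl. simpl in H. nra.
Qed.

Lemma besselJ_incr a b : 0 <= a <= b -> besselJ a <= besselJ b.
Proof.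
 intros Hab. apply (is_derive_nonneg_incr besselJ besselJ1); [lra| |].
 - intros x _. apply is_derive_besselJ.
 - intros x Hx. apply besselJ1_ge0; lra.
Qed.

(** With [x = / t] this is the reduction-of-order density [dx / (x^2 besselJ x ^ 2)]. The value 0
    for [t <= 0] is its limit as [x] goes to infinity, so that the improper integral from [v] to
    infinity becomes the ordinary integral [besselN v] over [[0, / v]]. *)
Definition bessel_weight (t : R) : R := if Rlt_dec 0 t then / besselJ (/ t) ^ 2 else 0.

Lemma bessel_weight_bound t : 0 < t -> 0 < bessel_weight t <= (32 * t) ^ 2.
Proof.
 intros Ht. unfold bessel_weight. destruct (Rlt_dec 0 t); [|lra]. note (Rinv_0_lt_compat _ Ht) as Hi.
 note (besselJ_ge (/ t) ltac:(lra)) as HJ. assert (Hp : 0 < besselJ (/ t)) by lra. split; [pos|].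
 replace ((32 * t) ^ 2) with (/ (/ t / 32) ^ 2) by fld. apply Rinv_le_contravar; [pos|]. apply pow_incr; lra.
Qed.

Lemma continuous_bessel_weight t : continuous bessel_weight t.
Proof.
 destruct (Rtotal_order t 0) as [H|[H|H]].
 - apply continuous_ext_loc with (fun _ => 0); [|apply continuous_const].
  assert (Hd : 0 < - t) by lra. exists (mkposreal _ Hd). intros y Hy. ball_simpl in Hy.
  apply Rabs_def2 in Hy. unfold bessel_weight. destruct (Rlt_dec 0 y); auto; lra.
 - subst t. apply filterlim_locally. intros eps. set (d := Rmin 1 (eps / 1024)).
  assert (Hd : 0 < d) by (apply Rmin_pos; note (cond_pos eps); lra). exists (mkposreal _ Hd). intros y Hy.
  unfold ball in *; simpl in *; unfold AbsRing_ball, abs, minus, plus, opp in *; simpl in *. apply Rabs_def2 in Hy.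
  unfold bessel_weight at 2. destruct (Rlt_dec 0 0); [lra|]. destruct (Rlt_dec 0 y) as [H|H].
  + destruct (bessel_weight_bound y H) as [B1 B2]. rewrite Rabs_right by lra.
   note (Rmin_l 1 (eps / 1024)). note (Rmin_r 1 (eps / 1024)). fold d in H0, H1. nra.
  + unfold bessel_weight. destruct (Rlt_dec 0 y); [lra|]. rewrite Ropp_0, Rplus_0_r, Rabs_R0. apply cond_pos.
 - apply continuous_ext_loc with (fun t => / besselJ (/ t) ^ 2).
  + assert (Hd : 0 < t) by lra. exists (mkposreal _ Hd). intros y Hy. ball_simpl in Hy.
   apply Rabs_def2 in Hy. unfold bessel_weight. destruct (Rlt_dec 0 y); auto; lra.
  + note (besselJ_ge (/ t) ltac:(left; apply Rinv_0_lt_compat; auto)). note (Rinv_0_lt_compat t H).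
   apply (continuous_Rcomp Rinv (fun t => besselJ (/ t) ^ 2)).
   * apply continuous_Rpow. apply (continuous_Rcomp besselJ Rinv).
    -- apply continuous_of_ex_derive. auto_derive. lra.
    -- eapply is_derive_continuous, is_derive_besselJ.
   * apply continuous_of_ex_derive. auto_derive. apply Rgt_not_eq, pow_lt. lra.
Qed.

Definition besselN (v : R) : R := RInt bessel_weight 0 (/ v).

Lemma is_derive_besselN v : 0 < v -> is_derive besselN v (- / (v ^ 2 * besselJ v ^ 2)).
Proof.
 intros Hv. unfold besselN. note (Rinv_0_lt_compat v Hv) as Hi. note (besselJ_ge v ltac:(lra)).
 apply is_derive_eq with (bessel_weight (/ v) * (- / v ^ 2)).
 - apply (is_derive_Rcomp (fun b => RInt bessel_weight 0 b) Rinv).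
  + apply (is_derive_RInt bessel_weight _ 0).
   * apply filter_forall. intros b. apply (RInt_correct bessel_weight). apply ex_RInt_cont. apply continuous_bessel_weight.
   * apply continuous_bessel_weight.
  + auto_derive; [lra|]. field. lra.
 - unfold bessel_weight. destruct (Rlt_dec 0 (/ v)); [|lra]. rewrite Rinv_inv. field. split; lra.
Qed.

Definition besselm (v : R) : R := besselJ v * besselN v.
Definition besselm1 (v : R) : R := besselJ1 v * besselN v - / (v ^ 2 * besselJ v).
(** This and the next derivative are read off from the differential equation and from its
    derivative, not from the integral. *)
Definition besselm2 (v : R) : R := (besselm v / 16 - 2 * besselm1 v) / v.
Definition besselm3 (v : R) : R := (besselm1 v / 16 - 3 * besselm2 v) / v.

Lemma is_derive_besselm v : 0 < v -> is_derive besselm v (besselm1 v).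
Proof.
 intros Hv. unfold besselm, besselm1. note (besselJ_ge v ltac:(lra)). eapply is_derive_eq;
  [apply is_derive_Rmult; [apply is_derive_besselJ|apply is_derive_besselN; auto]|].
 field. split; lra.
Qed.

Lemma is_derive_besselm1 v : 0 < v -> is_derive besselm1 v (besselm2 v).
Proof.
 intros Hv. note (besselJ_ge v ltac:(lra)) as HJ. destruct (besselJ1_derive v) as [l [Hl E]]. unfold besselm1. eapply is_derive_eq.
 - apply is_derive_Rminus; [apply is_derive_Rmult; [exact Hl|apply is_derive_besselN; auto]|].
  apply (is_derive_Rcomp Rinv (fun v => v ^ 2 * besselJ v) v
   (- / (v ^ 2 * besselJ v) ^ 2) (2 * v * besselJ v + v ^ 2 * besselJ1 v)).
  + auto_derive; [pos|]. field. split; lra.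
  + apply is_derive_Rmult; [auto_derive; auto; ring|apply is_derive_besselJ].
 - unfold besselm2, besselm1, besselm. cbv beta. replace l with ((besselJ v / 16 - 2 * besselJ1 v) / v) by (rewrite <- E; field; lra).
  field. split; lra.
Qed.

Lemma is_derive_besselm2 v : 0 < v -> is_derive besselm2 v (besselm3 v).
Proof.
 intros Hv. unfold besselm2. eapply is_derive_eq.
 - apply is_derive_Rmult.
  + apply is_derive_Rminus.
   * apply is_derive_Rmultc. apply is_derive_besselm; auto.
   * apply is_derive_Rcmult. apply is_derive_besselm1; auto.
  + instantiate (1 := - / v ^ 2). auto_derive; [lra|]. field. lra.
 - unfold besselm3, besselm2. cbv beta. field. lra.
Qed.

Lemma besselm_ode v : 0 < v -> v * besselm2 v + 2 * besselm1 v = besselm v / 16.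
Proof. intros. unfold besselm2. field. lra. Qed.

Lemma besselm_ode1 v : 0 < v -> v * besselm3 v + 3 * besselm2 v = besselm1 v / 16.
Proof. intros. unfold besselm3. field. lra. Qed.

Lemma besselN_bounds v : 0 < v -> 0 < besselN v <= / (v * besselJ v ^ 2).
Proof.
 intros Hv. note (Rinv_0_lt_compat v Hv) as Hi. note (besselJ_ge v ltac:(lra)). assert (Hex : forall b, ex_RInt bessel_weight 0 b)
  by (intros; apply ex_RInt_cont; apply continuous_bessel_weight).
 split.
 - apply RInt_gt_0; auto.
  + intros x Hx. apply bessel_weight_bound; lra.
  + intros x _. apply continuous_bessel_weight.
 - unfold besselN. replace (/ (v * besselJ v ^ 2)) with ((/ v - 0) * / besselJ v ^ 2) by fld. eapply Rle_trans; [apply Rle_abs|].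
  apply (abs_RInt_le_const bessel_weight); auto; [lra|]. intros t Ht. unfold bessel_weight. destruct (Rlt_dec 0 t).
  + assert (v <= / t).
   { rewrite <- (Rinv_inv v). apply Rinv_le_contravar; lra. }
   note (besselJ_incr v (/ t) ltac:(lra)). rewrite Rabs_right by pos. apply Rinv_le_contravar; [pos|nra].
  + rewrite Rabs_R0. left. apply Rinv_0_lt_compat, pow_lt; lra.
Qed.

Lemma besselm_pos v : 0 < v -> 0 < besselm v.
Proof.
 intros Hv. destruct (besselN_bounds v Hv). note (besselJ_ge v ltac:(lra)). apply Rmult_lt_0_compat; lra.
Qed.

Lemma besselm_le v : 0 < v -> besselm v <= / v.
Proof.
 intros Hv. destruct (besselN_bounds v Hv). note (besselJ_ge v ltac:(lra)). apply Rle_trans with (besselJ v * / (v * besselJ v ^ 2)).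
 - apply Rmult_le_compat_l; lra.
 - replace (besselJ v * / (v * besselJ v ^ 2)) with (/ (v * besselJ v)) by fld. apply Rinv_le_contravar; nra.
Qed.

Lemma besselm1_lower v : 0 < v -> - / v ^ 2 <= besselm1 v.
Proof.
 intros Hv. destruct (besselN_bounds v Hv). note (besselJ_ge v ltac:(lra)). note (besselJ1_ge0 v ltac:(lra)). unfold besselm1.
 assert (0 <= besselJ1 v * besselN v) by pos. assert (/ (v ^ 2 * besselJ v) <= / v ^ 2).
 { assert (0 < v ^ 2) by pos. apply Rinv_le_contravar; nra. }
 lra.
Qed.

(** The equation in divergence form: [(v^2 m')' = v m / 16 > 0]. *)
Lemma besselm1_scaled_incr a b : 0 < a < b -> a ^ 2 * besselm1 a < b ^ 2 * besselm1 b.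
Proof.
 intros Hab. destruct (MVT_cor2 (fun v => v ^ 2 * besselm1 v) (fun v => v * besselm v / 16) a b) as [c [E Hc]]; [lra| |].
 - intros c Hc. apply is_derive_Reals. eapply is_derive_eq.
  + apply is_derive_Rmult; [|apply is_derive_besselm1; lra]. instantiate (1 := 2 * c). auto_derive; auto; ring.
  + cbv beta. note (besselm_ode c ltac:(lra)). replace (c * besselm c / 16) with (c * (besselm c / 16)) by field. rewrite <- H. ring.
 - note (besselm_pos c ltac:(lra)). assert (0 < c * besselm c / 16) by pos. nra.
Qed.

(** If the derivative were nonnegative at [v], then by [besselm1_scaled_incr] it would stay so, and
    [besselm] could not fall below its value at [v]; but it is at most [/ x], which is too small at
    [x = v + 2 / besselm v]. *)
Lemma besselm1_neg v : 0 < v -> besselm1 v < 0.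
Proof.
 intros Hv. apply Rnot_le_lt. intros Hge. assert (Hpos : forall x, v < x -> 0 <= besselm1 x).
 { intros x Hx. note (besselm1_scaled_incr v x ltac:(lra)). assert (0 < v ^ 2) by pos. assert (0 < x ^ 2) by pos.
  apply Rnot_lt_le. intros H2. nra. }
 note (besselm_pos v Hv) as Hm. set (x := v + 2 / besselm v). assert (Hx : 0 < 2 / besselm v) by pos. assert (besselm v <= besselm x).
 { apply (is_derive_nonneg_incr besselm besselm1); [unfold x; lra| |].
  - intros y Hy. apply is_derive_besselm; lra.
  - intros y Hy. apply Hpos; lra. }
 note (besselm_le x ltac:(unfold x; lra)). assert (/ x <= besselm v / 2).
 { replace (besselm v / 2) with (/ (2 / besselm v)) by fld. apply Rinv_le_contravar; unfold x; lra. }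
 lra.
Qed.

Lemma besselm2_pos v : 0 < v -> 0 < besselm2 v.
Proof.
 intros Hv. note (besselm1_neg v Hv). note (besselm_pos v Hv). apply Rdiv_lt_0_compat; lra.
Qed.

Lemma besselm3_neg v : 0 < v -> besselm3 v < 0.
Proof.
 intros Hv. note (besselm1_neg v Hv). note (besselm2_pos v Hv).
 unfold besselm3. assert (0 < (3 * besselm2 v - besselm1 v / 16) / v) by pos.
 replace ((besselm1 v / 16 - 3 * besselm2 v) / v) with (- ((3 * besselm2 v - besselm1 v / 16) / v)) by lra. lra.
Qed.

Lemma besselm_decr a b : 0 < a <= b -> besselm b <= besselm a.
Proof.
 intros Hab. apply (is_derive_nonpos_decr besselm besselm1); [lra| |].
 - intros y Hy. apply is_derive_besselm; lra.
 - intros y Hy. left; apply besselm1_neg; lra.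
Qed.

Lemma besselm1_incr a b : 0 < a <= b -> besselm1 a <= besselm1 b.
Proof.
 intros Hab. apply (is_derive_nonneg_incr besselm1 besselm2); [lra| |].
 - intros y Hy. apply is_derive_besselm1; lra.
 - intros y Hy. left; apply besselm2_pos; lra.
Qed.

Lemma besselm2_decr a b : 0 < a <= b -> besselm2 b <= besselm2 a.
Proof.
 intros Hab. apply (is_derive_nonpos_decr besselm2 besselm3); [lra| |].
 - intros y Hy. apply is_derive_besselm2; lra.
 - intros y Hy. left; apply besselm3_neg; lra.
Qed.

Lemma besselm3_abs_le a b : 0 < a <= b -> Rabs (besselm3 b) <= - besselm3 a.
Proof.
 intros Hab. note (besselm3_neg b ltac:(lra)). rewrite Rabs_left by lra. note (besselm1_incr a b Hab). note (besselm2_decr a b Hab).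
 note (besselm1_neg b ltac:(lra)). note (besselm2_pos b ltac:(lra)). unfold besselm3.
 replace (- ((besselm1 b / 16 - 3 * besselm2 b) / b)) with ((3 * besselm2 b - besselm1 b / 16) * / b) by lra.
 replace (- ((besselm1 a / 16 - 3 * besselm2 a) / a)) with ((3 * besselm2 a - besselm1 a / 16) * / a) by lra.
 apply Rmult_le_compat; try lra; [pos|]. apply Rinv_le_contravar; lra.
Qed.

(** In [r = sqrt v] and [M r = besselm (r^2)] the equation is [M'' + (3 / r) M' = M / 4], and the
    function here is the energy [M'^2 - M^2 / 4], dissipated by the first-order term. *)
Lemma is_derive_energy v : 0 < v ->
 is_derive (fun v => 4 * v * besselm1 v ^ 2 - besselm v ^ 2 / 4) v (- 12 * besselm1 v ^ 2).
Proof.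
 intros Hv. eapply is_derive_eq.
 - apply is_derive_Rminus.
  + apply is_derive_Rmult; [instantiate (1 := 4); auto_derive; auto; ring|].
   apply (is_derive_Rcomp (fun x => x ^ 2) besselm1 v (2 * besselm1 v)); [auto_derive; auto; ring|]. apply is_derive_besselm1; auto.
  + apply is_derive_Rmultc. apply (is_derive_Rcomp (fun x => x ^ 2) besselm v (2 * besselm v)); [auto_derive; auto; ring|].
   apply is_derive_besselm; auto.
 - cbv beta. unfold besselm2. field. lra.
Qed.

(** A nonincreasing energy whose negative part tends to 0 at infinity cannot be negative
    anywhere. *)
Lemma besselm_energy_ge v : 0 < v -> besselm v ^ 2 / 4 <= 4 * v * besselm1 v ^ 2.
Proof.
 (* At this [x] one has [/ x < d], while the energy at [x] is at least [- besselm x ^ 2 / 4] and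
    [besselm x ^ 2 <= / x]. *)
 intros Hv. apply Rnot_lt_le. intros Hlt. set (d := besselm v ^ 2 / 4 - 4 * v * besselm1 v ^ 2) in *. set (x := v + 1 + / d).
 assert (Hd : 0 < d) by (unfold d; lra). note (Rinv_0_lt_compat d Hd).
 assert (4 * x * besselm1 x ^ 2 - besselm x ^ 2 / 4 <= 4 * v * besselm1 v ^ 2 - besselm v ^ 2 / 4).
 { apply (is_derive_nonpos_decr (fun v => 4 * v * besselm1 v ^ 2 - besselm v ^ 2 / 4)
   (fun v => - 12 * besselm1 v ^ 2)); [unfold x; lra| |].
  - intros y Hy. apply is_derive_energy; lra.
  - intros y Hy. note (pow2_ge_0 (besselm1 y)). lra. }
 assert (Hx : 1 < x) by (unfold x; lra). note (besselm_le x ltac:(lra)). note (besselm_pos x ltac:(lra)). note (pow2_ge_0 (besselm1 x)).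
 assert (/ x < d).
 { rewrite <- (Rinv_inv d). apply Rinv_lt_contravar; [|unfold x; lra]. apply Rmult_lt_0_compat; lra. }
 assert (/ x < 1) by (rewrite <- Rinv_1; apply Rinv_lt_contravar; lra). assert (besselm x ^ 2 <= / x) by nra.
 assert (0 <= 4 * x * besselm1 x ^ 2) by pos. unfold d in *. lra.
Qed.

(** Adding [12 m m'] to the energy changes its derivative to [12 m m'' >= 0]; the corrected energy
    is therefore nondecreasing, and it is at most [4 / x] for large [x], so it is nowhere
    positive. *)
Lemma besselm_energy_le v : 0 < v ->
 4 * v * besselm1 v ^ 2 <= besselm v ^ 2 / 4 - 12 * besselm v * besselm1 v.
Proof.
 intros Hv. apply Rnot_lt_le. intros Hlt. set (H := fun v => 4 * v * besselm1 v ^ 2 - besselm v ^ 2 / 4 + 12 * (besselm v * besselm1 v)).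
 assert (Hd : 0 < H v) by (unfold H; lra). set (x := v + 1 + 4 / H v). assert (H4 : 0 < 4 / H v) by pos. assert (Hm : H v <= H x).
 { apply (is_derive_nonneg_incr H
   (fun v => - 12 * besselm1 v ^ 2 + 12 * (besselm1 v * besselm1 v + besselm v * besselm2 v))); [unfold x; lra| |].
  - intros y Hy. apply is_derive_Rplus; [apply is_derive_energy; lra|].
   apply is_derive_Rcmult, is_derive_Rmult; [apply is_derive_besselm|apply is_derive_besselm1]; lra.
  - intros y Hy. note (besselm_pos y ltac:(lra)). note (besselm2_pos y ltac:(lra)). nra. }
 assert (Hx : 1 < x) by (unfold x; lra). note (besselm_pos x ltac:(lra)). note (besselm1_neg x ltac:(lra)).
 note (besselm1_lower x ltac:(lra)). assert (Hi : 0 < / x) by pos. assert (/ x < 1) by (rewrite <- Rinv_1; apply Rinv_lt_contravar; lra).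
 assert (E : x * / x = 1) by fld. assert (HB : H x <= 4 * / x).
 { assert (besselm1 x ^ 2 <= (/ x ^ 2) ^ 2) by nra. assert (4 * x * besselm1 x ^ 2 <= 4 * x * (/ x ^ 2) ^ 2) by nra.
  assert (4 * x * (/ x ^ 2) ^ 2 = 4 * / x * (/ x * / x)) by fld. assert (/ x * / x <= 1) by nra.
  assert (4 * / x * (/ x * / x) <= 4 * / x) by nra. assert (besselm x * besselm1 x <= 0) by nra. unfold H. nra. }
 assert (4 * / x < H v).
 { apply Rmult_lt_reg_r with (x * / H v); [pos|]. replace (4 * / x * (x * / H v)) with (4 / H v) by nra.
  replace (H v * (x * / H v)) with x by fld. unfold x. lra. }
 lra.
Qed.

(** The two energy bounds are quadratic inequalities for [M' / M], where [M r = besselm (r^2)]. They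
    place it between [- (1 / 2 + 6 / r)] and [- 1 / 2]; the limit [- 1 / 2] determines all
    exponential rates below. *)
Lemma besselm_log_derivative r : 0 < r ->
 r * besselm1 (r ^ 2) <= - (1 / 4) * besselm (r ^ 2) /\
 - (1 / 4 + 3 / r) * besselm (r ^ 2) <= r * besselm1 (r ^ 2).
Proof.
 intros Hr. assert (Hv : 0 < r ^ 2) by pos. note (besselm_energy_ge _ Hv) as H1. note (besselm_energy_le _ Hv) as H2.
 note (besselm_pos _ Hv) as Hm. note (besselm1_neg _ Hv) as Hn. set (m := besselm (r ^ 2)) in *. set (n := - besselm1 (r ^ 2)).
 replace (besselm1 (r ^ 2)) with (- n) in * by (unfold n; ring).
 set (q := r * n). assert (Hq : 0 < q) by (apply Rmult_lt_0_compat; auto; lra).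
 replace (4 * r ^ 2 * (- n) ^ 2) with (4 * q ^ 2) in * by (unfold q; ring). replace (r * - n) with (- q) by (unfold q; ring).
 split; [nra|]. assert (En : n = q / r) by (unfold q; field; lra). rewrite En in H2. apply Ropp_le_cancel. assert (Hr' : 0 < 3 / r) by pos.
 replace (12 * m * - (q / r)) with (- (4 * m * q * (3 / r))) in H2 by lra. set (k := 3 / r) in *. apply Rnot_lt_le. intros Hlt. nra.
Qed.

Lemma besselm_ratio a b : 0 < a <= b ->
 besselm (b ^ 2) <= besselm (a ^ 2) * exp (- (b - a) / 2) /\
 besselm (a ^ 2) * exp (- (1 / 2 + 6 / a) * (b - a)) <= besselm (b ^ 2).
Proof.
 intros Hab. assert (D : forall k x, 0 < x -> is_derive (fun r => besselm (r ^ 2) * exp (k * r)) x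
   ((2 * (x * besselm1 (x ^ 2)) + k * besselm (x ^ 2)) * exp (k * x))).
 { intros k x Hx. eapply is_derive_eq.
  - apply is_derive_Rmult.
   + apply (is_derive_Rcomp besselm (fun r => r ^ 2) x (besselm1 (x ^ 2)) (2 * x)).
    * apply is_derive_besselm, pow_lt; auto.
    * auto_derive; auto; ring.
   + apply (is_derive_Rcomp exp (fun r => k * r) x (exp (k * x)) k).
    * apply is_derive_Reals, derivable_pt_lim_exp.
    * auto_derive; auto; ring.
  - cbv beta. ring. }
 assert (Ex : forall k, besselm (a ^ 2) * exp (k * a) * exp (- k * b) = besselm (a ^ 2) * exp (- k * (b - a))).
 { intros k. rewrite Rmult_assoc, <- exp_plus. do 2 f_equal. ring. }
 assert (Ey : forall k, besselm (b ^ 2) * exp (k * b) * exp (- k * b) = besselm (b ^ 2)).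
 { intros k. rewrite Rmult_assoc, <- exp_plus. replace (k * b + - k * b) with 0 by ring. rewrite exp_0. ring. }
 split.
 - assert (besselm (b ^ 2) * exp (1/2 * b) <= besselm (a ^ 2) * exp (1/2 * a)).
  { apply (is_derive_nonpos_decr (fun r => besselm (r ^ 2) * exp (1/2 * r)) _ a b ltac:(lra)
    (fun x Hx => D (1/2) x ltac:(lra))).
   intros x Hx. destruct (besselm_log_derivative x ltac:(lra)) as [H _]. note (exp_pos (1 / 2 * x)). nra. }
  apply Rmult_le_compat_r with (r := exp (- (1/2) * b)) in H; [|pos].
  rewrite Ex, Ey in H. replace (- (b - a) / 2) with (- (1/2) * (b - a)) by field. exact H.
 - set (k := 1 / 2 + 6 / a). assert (besselm (a ^ 2) * exp (k * a) <= besselm (b ^ 2) * exp (k * b)).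
  { apply (is_derive_nonneg_incr (fun r => besselm (r ^ 2) * exp (k * r)) _ a b ltac:(lra)
    (fun x Hx => D k x ltac:(lra))).
   intros x Hx. destruct (besselm_log_derivative x ltac:(lra)) as [_ H].
   note (exp_pos (k * x)). note (besselm_pos (x ^ 2) ltac:(apply pow_lt; lra)). assert (6 / x <= 6 / a).
   { apply Rmult_le_compat_l; [lra|]. apply Rinv_le_contravar; lra. }
   assert (2 * (3 / x) = 6 / x) by lra. assert (0 <= 2 * (x * besselm1 (x ^ 2)) + k * besselm (x ^ 2)) by (unfold k; nra). nra. }
  apply Rmult_le_compat_r with (r := exp (- k * b)) in H; [|pos]. rewrite Ex, Ey in H. exact H.
Qed.

(** * The function s / sinh s in the variable cosh s *)

Lemma continuous_inv_fun {V : UniformSpace} (f : V -> R) (q : V) :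
 continuous f q -> f q <> 0 -> continuous (fun z => / f z) q.
Proof.
 intros H H0. apply (continuous_Rcomp Rinv f); auto. apply continuous_of_ex_derive. auto_derive. auto.
Qed.

(* [arcL 0 (cosh s) = s / sinh s], see [sinh_arcL]; the integral makes sense of it, with all its
  derivatives, across [cosh s = 1]. *)
Definition arcL_integrand (n : nat) (z u : R) : R := 2 * (2 * u) ^ n * / (u ^ 2 + 2 * u * z + 1) ^ S n.
Definition arcL (n : nat) (z : R) : R := RInt (arcL_integrand n z) 0 1.

Lemma arcL_den_ge1 z u : 0 < z -> 0 <= u -> 1 <= u ^ 2 + 2 * u * z + 1.
Proof. intros. assert (0 <= u * z) by pos. nra. Qed.

Lemma arcL_integrand_cont n z u : 0 < z -> 0 <= u ->
 continuous (fun q : R * R => arcL_integrand n (fst q) (snd q)) (z, u).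
Proof.
 intros Hz Hu. unfold arcL_integrand. apply continuous_Rmult; [cont|].
 apply (continuous_inv_fun (fun q : R * R => (snd q ^ 2 + 2 * snd q * fst q + 1) ^ S n)); [cont|].
 simpl fst; simpl snd. apply pow_nonzero. note (arcL_den_ge1 z u Hz Hu). lra.
Qed.

Lemma ex_RInt_arcL n z : 0 < z -> ex_RInt (arcL_integrand n z) 0 1.
Proof.
 intros Hz. apply (ex_RInt_continuous (arcL_integrand n z)). intros u Hu. rewrite Rmin_left, Rmax_right in Hu by lra.
 apply (continuous_2d_snd (arcL_integrand n)), arcL_integrand_cont; lra.
Qed.

Lemma locally_pos (z : R) : 0 < z -> locally z (fun y => 0 < y).
Proof.
 intros Hz. exists (mkposreal _ Hz). intros y Hy. ball_simpl in Hy. apply Rabs_def2 in Hy. lra.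
Qed.

Lemma is_derive_arcL n z : 0 < z -> is_derive (arcL n) z (- INR (S n) * arcL (S n) z).
Proof.
 intros Hz. apply is_derive_eq with (RInt (fun u => - INR (S n) * arcL_integrand (S n) z u) 0 1).
 2:{ rewrite RInt_Rcmult; auto. apply ex_RInt_arcL; auto. }
 apply (is_derive_RInt_under (arcL_integrand n) (fun z u => - INR (S n) * arcL_integrand (S n) z u)); [lra| | |].
 - weaken (locally_pos z Hz). intros y Hy u Hu. note (arcL_den_ge1 y u Hy ltac:(lra)) as HD. unfold arcL_integrand. eapply is_derive_eq.
  + apply is_derive_Rcmult. apply (is_derive_Rcomp Rinv (fun x => (u ^ 2 + 2 * u * x + 1) ^ S n) y
    (- / ((u ^ 2 + 2 * u * y + 1) ^ S n) ^ 2) (INR (S n) * (u ^ 2 + 2 * u * y + 1) ^ n * (2 * u))).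
   * auto_derive; [pos|]. field. apply pow_nonzero; lra.
   * apply (is_derive_Rcomp (fun x => x ^ S n) (fun x => u ^ 2 + 2 * u * x + 1) y).
    -- apply is_derive_Reals. apply (derivable_pt_lim_pow _ (S n)).
    -- auto_derive; auto; ring.
  + rewrite <- !tech_pow_Rmult. field. repeat split; try apply pow_nonzero; lra.
 - intros u Hu. apply continuous_Rmult; [apply continuous_const|]. apply arcL_integrand_cont; lra.
 - weaken (locally_pos z Hz). intros y Hy. apply ex_RInt_arcL; auto.
Qed.

Lemma continuous_arcL n z : 0 < z -> continuous (arcL n) z.
Proof. intros Hz. eapply is_derive_continuous, is_derive_arcL; auto. Qed.

Lemma arcL_pos n z : 0 < z -> 0 < arcL n z.
Proof.
 intros Hz. apply RInt_gt_0; [lra| |].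
 - intros u Hu. unfold arcL_integrand. note (arcL_den_ge1 z u Hz ltac:(lra)). apply Rmult_lt_0_compat; [pos|].
  apply Rinv_0_lt_compat, pow_lt; lra.
 - intros u Hu. apply (continuous_2d_snd (arcL_integrand n)), arcL_integrand_cont; lra.
Qed.

Lemma arcL_S_le n z : 0 < z -> z * arcL (S n) z <= arcL n z.
Proof.
 intros Hz. unfold arcL. rewrite <- RInt_Rcmult by (apply ex_RInt_arcL; auto). apply RInt_le; [lra| | |].
 - apply ex_RInt_Rcmult, ex_RInt_arcL; auto.
 - apply ex_RInt_arcL; auto.
 - intros u Hu. unfold arcL_integrand. note (arcL_den_ge1 z u Hz ltac:(lra)) as HD. set (D := u ^ 2 + 2 * u * z + 1) in *. simpl pow.
  assert (HDn : 0 < D ^ n) by pos. replace (z * (2 * (2 * u * (2 * u) ^ n) * / (D * (D * D ^ n))))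
   with (2 * (2 * u) ^ n * / (D * D ^ n) * (2 * u * z / D)) by fld.
  rewrite <- (Rmult_1_r (2 * (2 * u) ^ n * / (D * D ^ n))) at 2. apply Rmult_le_compat_l.
  + apply Rmult_le_pos; [pos|]. left; apply Rinv_0_lt_compat; nra.
  + apply Rmult_le_reg_r with D; [lra|]. unfold Rdiv. rewrite Rmult_assoc, Rinv_l by lra.
   unfold D. assert (0 <= u ^ 2) by apply pow2_ge_0. lra.
Qed.

(** This is the first-order equation of [s / sinh s] with respect to [cosh s]; under the integral
    sign the combination is an exact derivative in [u]. *)
Lemma arcL_ode z : 0 < z -> z * arcL 0 z - (z ^ 2 - 1) * arcL 1 z = 1.
Proof.
 intros Hz. unfold arcL. rewrite <- !RInt_Rcmult by (apply ex_RInt_arcL; auto).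
 rewrite <- RInt_Rminus by (apply ex_RInt_Rcmult, ex_RInt_arcL; auto).
 transitivity (- (2 * z * 1 + 2) / (1 ^ 2 + 2 * 1 * z + 1) - - (2 * z * 0 + 2) / (0 ^ 2 + 2 * 0 * z + 1));
  [|eqR; field; lra].
 apply (RInt_fundamental (fun u => - (2 * z * u + 2) / (u ^ 2 + 2 * u * z + 1))).
 - intros u Hu. rewrite Rmin_left, Rmax_right in Hu by lra. note (arcL_den_ge1 z u Hz ltac:(lra)) as HD.
  unfold arcL_integrand. auto_derive; [lra|]. simpl in *. field. lra.
 - intros u Hu. rewrite Rmin_left, Rmax_right in Hu by lra. note (continuous_2d_snd _ _ _ (arcL_integrand_cont 0 z u Hz ltac:(lra))).
  note (continuous_2d_snd _ _ _ (arcL_integrand_cont 1 z u Hz ltac:(lra))). cont.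
Qed.

Lemma is_derive_locally_const (f : R -> R) (z l c : R) :
 locally z (fun y => f y = c) -> is_derive f z l -> l = 0.
Proof.
 intros Hc Hl. rewrite <- (is_derive_unique f z l Hl). apply is_derive_unique. apply (is_derive_ext_loc (fun _ => c)).
 - weaken Hc. auto.
 - apply is_derive_Rconst.
Qed.

Lemma arcL_ode1 z : 0 < z -> arcL 0 z - 3 * z * arcL 1 z + 2 * (z ^ 2 - 1) * arcL 2 z = 0.
Proof.
 intros Hz. assert (H : 1 * arcL 0 z + z * (- INR 1 * arcL 1 z) -
   (2 * z * arcL 1 z + (z ^ 2 - 1) * (- INR 2 * arcL 2 z)) = 0).
 { apply (is_derive_locally_const (fun z => z * arcL 0 z - (z ^ 2 - 1) * arcL 1 z) z _ 1).
  - weaken (locally_pos z Hz). apply arcL_ode.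
  - apply is_derive_Rminus.
   + apply (is_derive_Rmult (fun z => z) (arcL 0)); [apply is_derive_Rid|apply is_derive_arcL; auto].
   + apply (is_derive_Rmult (fun z => z ^ 2 - 1) (arcL 1)); [|apply is_derive_arcL; auto]. auto_derive; auto; ring. }
 simpl INR in H. lra.
Qed.

Lemma arcL_ode2 z : 0 < z -> 10 * z * arcL 2 z - 4 * arcL 1 z - 6 * (z ^ 2 - 1) * arcL 3 z = 0.
Proof.
 intros Hz. assert (H : - INR 1 * arcL 1 z - (3 * arcL 1 z + 3 * z * (- INR 2 * arcL 2 z)) +
   (4 * z * arcL 2 z + 2 * (z ^ 2 - 1) * (- INR 3 * arcL 3 z)) = 0).
 { apply (is_derive_locally_const (fun z => arcL 0 z - 3 * z * arcL 1 z + 2 * (z ^ 2 - 1) * arcL 2 z) z _ 0).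
  - weaken (locally_pos z Hz). apply arcL_ode1.
  - apply is_derive_Rplus; [apply is_derive_Rminus; [apply is_derive_arcL; auto|]|].
   + apply (is_derive_Rmult (fun z => 3 * z) (arcL 1)); [|apply is_derive_arcL; auto]. auto_derive; auto; ring.
   + apply (is_derive_Rmult (fun z => 2 * (z ^ 2 - 1)) (arcL 2)); [|apply is_derive_arcL; auto]. auto_derive; auto; ring. }
 simpl INR in H. lra.
Qed.

(** Equals [s^2] at [z = cosh s], but is differentiable across [z = 1], where [s] itself is not. *)
Definition arcsq (z : R) : R := (z ^ 2 - 1) * arcL 0 z ^ 2.

Lemma is_derive_arcsq z : 0 < z -> is_derive arcsq z (2 * arcL 0 z).
Proof.
 intros Hz. unfold arcsq. eapply is_derive_eq.
 - apply is_derive_Rmult; [instantiate (1 := 2 * z); auto_derive; auto; ring|].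
  apply (is_derive_Rcomp (fun x => x ^ 2) (arcL 0) z (2 * arcL 0 z)); [auto_derive; auto; ring|]. apply is_derive_arcL; auto.
 - cbv beta. simpl INR. note (arcL_ode z Hz). replace (2 * z * arcL 0 z ^ 2 + (z ^ 2 - 1) * (2 * arcL 0 z * (- (1) * arcL 1 z)))
   with (2 * arcL 0 z * (z * arcL 0 z - (z ^ 2 - 1) * arcL 1 z)) by ring.
  rewrite H. ring.
Qed.

Lemma arcsq_incr a b : 0 < a < b -> arcsq a < arcsq b.
Proof.
 intros Hab. destruct (MVT_cor2 arcsq (fun z => 2 * arcL 0 z) a b) as [c [E Hc]]; [lra| |].
 - intros c Hc. apply is_derive_Reals, is_derive_arcsq; lra.
 - note (arcL_pos 0 c ltac:(lra)). nra.
Qed.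

Lemma arcsq_1 : arcsq 1 = 0.
Proof. unfold arcsq. ring. Qed.

Lemma arcsq_ge0 z : 1 <= z -> 0 <= arcsq z.
Proof.
 intros [H| <-]; [|rewrite arcsq_1; lra]. note (arcsq_incr 1 z ltac:(lra)). rewrite arcsq_1 in *. lra.
Qed.

Lemma cosh_ge1 s : 1 <= cosh s.
Proof.
 unfold cosh. note (exp_pos s). note (exp_pos (- s)). assert (exp s * exp (- s) = 1) by (rewrite <- exp_plus, Rplus_opp_r; apply exp_0).
 note (pow2_ge_0 (exp s - exp (- s))). nra.
Qed.

Lemma cosh2_sinh2 s : cosh s ^ 2 - sinh s ^ 2 = 1.
Proof.
 unfold cosh, sinh. assert (E : exp s * exp (- s) = 1) by (rewrite <- exp_plus, Rplus_opp_r; apply exp_0).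
 replace (((exp s + exp (- s)) / 2) ^ 2 - ((exp s - exp (- s)) / 2) ^ 2) with (exp s * exp (- s)) by field. exact E.
Qed.

Lemma is_derive_cosh x : is_derive cosh x (sinh x).
Proof. apply is_derive_Reals, derivable_pt_lim_cosh. Qed.
Lemma is_derive_sinh x : is_derive sinh x (cosh x).
Proof. apply is_derive_Reals, derivable_pt_lim_sinh. Qed.

Lemma sinh_arcL s : 0 <= s -> sinh s * arcL 0 (cosh s) = s.
Proof.
 intros Hs. assert (D : forall x, is_derive (fun s => sinh s * arcL 0 (cosh s) - s) x 0).
 { intros x. note (cosh_ge1 x). eapply is_derive_eq.
  - apply is_derive_Rminus; [|apply is_derive_id]. apply is_derive_Rmult; [apply is_derive_sinh|].
   apply (is_derive_Rcomp (arcL 0) cosh); [apply is_derive_arcL; lra|apply is_derive_cosh].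
  - unfold one; simpl. note (arcL_ode (cosh x) ltac:(lra)) as E.
   note (cosh2_sinh2 x). replace (cosh x ^ 2 - 1) with (sinh x ^ 2) in E by lra. simpl in E. lra. }
 assert (E0 : sinh 0 * arcL 0 (cosh 0) - 0 = 0) by (rewrite sinh_0; ring).
 assert (H1 : sinh 0 * arcL 0 (cosh 0) - 0 <= sinh s * arcL 0 (cosh s) - s).
 { apply (is_derive_nonneg_incr (fun s => sinh s * arcL 0 (cosh s) - s) (fun _ => 0)); auto. intros; lra. }
 assert (H2 : sinh s * arcL 0 (cosh s) - s <= sinh 0 * arcL 0 (cosh 0) - 0).
 { apply (is_derive_nonpos_decr (fun s => sinh s * arcL 0 (cosh s) - s) (fun _ => 0)); auto. intros; lra. }
 lra.
Qed.

Lemma arcsq_cosh s : 0 <= s -> arcsq (cosh s) = s ^ 2.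
Proof.
 intros Hs. unfold arcsq. note (cosh2_sinh2 s). replace (cosh s ^ 2 - 1) with (sinh s ^ 2) by lra.
 rewrite <- Rpow_mult_distr, sinh_arcL by auto. reflexivity.
Qed.

(** The inverse of [cosh] on [1 <= z]. *)
Definition arch (z : R) : R := sqrt (arcsq z).

Lemma cosh_surj z : 1 <= z -> exists s, 0 <= s /\ cosh s = z.
Proof.
 intros Hz. exists (ln (z + sqrt (z ^ 2 - 1))). assert (H0 : 0 <= z ^ 2 - 1) by nra.
 note (sqrt_pos (z ^ 2 - 1)) as Hs. note (sqrt_sqrt _ H0) as E. set (r := sqrt (z ^ 2 - 1)) in *. split.
 - rewrite <- ln_1. apply ln_le; lra.
 - unfold cosh. rewrite exp_Ropp, exp_ln by lra.  replace (/ (z + r)) with (z - r); [field|].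
  apply Rmult_eq_reg_r with (z + r); [|lra]. rewrite Rinv_l by lra. nra.
Qed.

Lemma arch_cosh s : 0 <= s -> arch (cosh s) = s.
Proof. intros Hs. unfold arch. rewrite arcsq_cosh by auto. apply sqrt_pow2; auto. Qed.

Lemma cosh_arch z : 1 <= z -> cosh (arch z) = z.
Proof. intros Hz. destruct (cosh_surj z Hz) as [s [Hs <-]]. rewrite arch_cosh; auto. Qed.

Lemma arch_ge0 z : 0 <= arch z.
Proof. apply sqrt_pos. Qed.

Lemma ln_le_self x : 0 < x -> ln x <= x.
Proof.
 intros Hx. note (exp_ineq1_le (ln x)). rewrite exp_ln in H by auto. lra.
Qed.

(** The true order is [ln z / z]. Trading the logarithm for the power [1 / 8] is affordable: the
    most demanding product used below, [z * arcL 0 z ^ 3], then has order [z^(- 13 / 8)], which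
    still decays faster than [z^(- 3 / 2)]. *)
Lemma arcL0_le z : / 2 <= z -> arcL 0 z <= 16 * Rpower z (- (7 / 8)).
Proof.
 intros Hz. assert (H1 : z * arcL 0 z <= ln (1 + 2 * z)).
 { unfold arcL. rewrite <- RInt_Rcmult by (apply ex_RInt_arcL; lra).
  replace (ln (1 + 2 * z)) with (ln (1 + 2 * 1 * z) - ln (1 + 2 * 0 * z)).
  2:{ replace (1 + 2 * 0 * z) with 1 by ring. rewrite ln_1. rewrite Rmult_1_r. ring. }
  assert (Dl : forall u, Rmin 0 1 <= u <= Rmax 0 1 -> is_derive (fun u => ln (1 + 2 * u * z)) u (2 * z / (1 + 2 * u * z))).
  { intros u Hu. rewrite Rmin_left, Rmax_right in Hu by lra. auto_derive; [nra|]. field; nra. }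
  assert (Cl : forall u, Rmin 0 1 <= u <= Rmax 0 1 -> continuous (fun u => 2 * z / (1 + 2 * u * z)) u).
  { intros u Hu. rewrite Rmin_left, Rmax_right in Hu by lra. apply continuous_of_ex_derive. auto_derive. nra. }
  rewrite <- (RInt_fundamental (fun u => ln (1 + 2 * u * z)) (fun u => 2 * z / (1 + 2 * u * z)) 0 1 Dl Cl). apply RInt_le; [lra| | |].
  - apply ex_RInt_Rcmult, ex_RInt_arcL; lra.
  - apply (ex_RInt_continuous (fun u => 2 * z / (1 + 2 * u * z))). exact Cl.
  - intros u Hu. unfold arcL_integrand. simpl. replace (z * (2 * 1 * / ((u * (u * 1) + 2 * u * z + 1) * 1)))
    with (2 * z * / (u * u + 2 * u * z + 1)) by fld.
   unfold Rdiv. apply Rmult_le_compat_l; [lra|]. apply Rinv_le_contravar; nra. }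
 assert (H2 : ln (1 + 2 * z) <= 16 * Rpower z (1 / 8)).
 { apply Rle_trans with (ln (4 * z)); [apply ln_le; lra|]. assert (E : ln (4 * z) = 8 * ln (Rpower (4 * z) (1 / 8))).
  { unfold Rpower. rewrite ln_exp. field. }
  rewrite E. assert (Hp : Rpower (4 * z) (1 / 8) <= 2 * Rpower z (1 / 8)).
  { rewrite <- Rpower_mult_distr by lra. apply Rmult_le_compat_r; [pos|]. unfold Rpower.
   replace 2 with (exp (ln 2)) by (apply exp_ln; lra).
   replace (ln 4) with (2 * ln 2) by (replace 4 with (2 * 2) by ring; rewrite ln_mult by lra; ring).
   assert (0 < ln 2) by (rewrite <- ln_1; apply ln_increasing; lra). left. apply exp_increasing. lra. }
  note (ln_le_self (Rpower (4 * z) (1 / 8)) (exp_pos _)). lra. }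
 replace (Rpower z (- (7 / 8))) with (Rpower z (1 / 8) * / z).
 2:{ replace (- (7 / 8)) with (1 / 8 + - (1)) by field.
   rewrite Rpower_plus, Rpower_Ropp, Rpower_1 by lra. reflexivity. }
 apply Rmult_le_reg_l with z; [lra|]. replace (z * (16 * (Rpower z (1 / 8) * / z))) with (16 * Rpower z (1 / 8)) by fld. lra.
Qed.

Lemma arcL1_le z : / 2 <= z -> arcL 1 z <= 16 * Rpower z (- (15 / 8)).
Proof.
 intros Hz. note (arcL_S_le 0 z ltac:(lra)). note (arcL0_le z Hz). replace (Rpower z (- (15 / 8))) with (Rpower z (- (7 / 8)) * / z).
 2:{ replace (- (15 / 8)) with (- (7 / 8) + - (1)) by field.
   rewrite Rpower_plus, (Rpower_Ropp z 1), Rpower_1 by lra. reflexivity. }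
 apply Rmult_le_reg_l with z; [lra|]. replace (z * (16 * (Rpower z (- (7 / 8)) * / z))) with (16 * Rpower z (- (7 / 8))) by fld. lra.
Qed.

(** * Descent integrals and angular averages *)

Lemma flim_eq {T : Type} (F : (T -> Prop) -> Prop) (f : T -> R) (a b : R) :
 filterlim f F (locally a) -> a = b -> filterlim f F (locally b).
Proof. intros H <-. exact H. Qed.

Lemma flim_const {T : Type} {F : (T -> Prop) -> Prop} {FF : Filter F} (a : R) :
 filterlim (fun _ : T => a) F (locally a).
Proof. apply filterlim_const. Qed.

Lemma flim_plus {T : Type} {F : (T -> Prop) -> Prop} {FF : Filter F} (f g : T -> R) (a b : R) :
 filterlim f F (locally a) -> filterlim g F (locally b) ->
 filterlim (fun u => f u + g u) F (locally (a + b)).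
Proof. intros Hf Hg. exact (filterlim_comp_2 f g Rplus Hf Hg (filterlim_plus (V := R_NormedModule) a b)). Qed.

Lemma flim_mult {T : Type} {F : (T -> Prop) -> Prop} {FF : Filter F} (f g : T -> R) (a b : R) :
 filterlim f F (locally a) -> filterlim g F (locally b) ->
 filterlim (fun u => f u * g u) F (locally (a * b)).
Proof. intros Hf Hg. exact (filterlim_comp_2 f g Rmult Hf Hg (filterlim_mult (K := R_AbsRing) a b)). Qed.

Lemma flim_cont {T : Type} {F : (T -> Prop) -> Prop} (h : R -> R) (f : T -> R) (a : R) :
 filterlim f F (locally a) -> continuous h a -> filterlim (fun u => h (f u)) F (locally (h a)).
Proof. intros Hf Hh. exact (filterlim_comp _ _ _ _ _ _ _ _ Hf Hh). Qed.

Lemma flim_opp {T : Type} {F : (T -> Prop) -> Prop} {FF : Filter F} (f : T -> R) (a : R) :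
 filterlim f F (locally a) -> filterlim (fun u => - f u) F (locally (- a)).
Proof.
 intros Hf. apply (flim_cont Ropp); auto. apply (continuous_Ropp (fun x => x)), continuous_id.
Qed.

Lemma flim_minus {T : Type} {F : (T -> Prop) -> Prop} {FF : Filter F} (f g : T -> R) (a b : R) :
 filterlim f F (locally a) -> filterlim g F (locally b) ->
 filterlim (fun u => f u - g u) F (locally (a - b)).
Proof. intros Hf Hg. apply flim_plus; auto. apply flim_opp; auto. Qed.

Lemma flim_inv {T : Type} {F : (T -> Prop) -> Prop} {FF : Filter F} (f : T -> R) (a : R) :
 a <> 0 -> filterlim f F (locally a) -> filterlim (fun u => / f u) F (locally (/ a)).
Proof.
 intros Ha Hf. apply (flim_cont Rinv); auto. apply continuous_of_ex_derive. auto_derive. auto.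
Qed.

Lemma flim_pow {T : Type} {F : (T -> Prop) -> Prop} {FF : Filter F} (f : T -> R) (a : R) (n : nat) :
 filterlim f F (locally a) -> filterlim (fun u => f u ^ n) F (locally (a ^ n)).
Proof. intros Hf. apply (flim_cont (fun x => x ^ n)); auto. apply continuous_Rpow, continuous_id. Qed.

Lemma flim_div {T : Type} {F : (T -> Prop) -> Prop} {FF : Filter F} (f g : T -> R) (a b : R) :
 b <> 0 -> filterlim f F (locally a) -> filterlim g F (locally b) ->
 filterlim (fun u => f u / g u) F (locally (a / b)).
Proof. intros Hb Hf Hg. apply flim_mult; auto. apply flim_inv; auto. Qed.

Ltac flim := cbv beta; match goal with
 | H : filterlim ?f ?F _ |- filterlim ?f ?F _ => exact H
 | |- filterlim (fun _ => ?c) _ _ => apply flim_const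
 | |- filterlim (fun x => @?f x + @?g x) ?F _ => eapply (flim_plus f g); flim
 | |- filterlim (fun x => @?f x - @?g x) ?F _ => eapply (flim_minus f g); flim
 | |- filterlim (fun x => @?f x * @?g x) ?F _ => eapply (flim_mult f g); flim
 | |- filterlim (fun x => @?f x / @?g x) ?F _ => eapply (flim_div f g); [|flim|flim]
 | |- filterlim (fun x => / @?f x) ?F _ => eapply (flim_inv f); [|flim]
 | |- filterlim (fun x => - @?f x) ?F _ => eapply (flim_opp f); flim
 | |- filterlim (fun x => @?f x ^ ?n) ?F _ => eapply (flim_pow f); flim
 | |- _ => eauto
 end.

Lemma locally_lt (x a : R) : x < a -> locally x (fun y => y < a).
Proof.
 intros H. assert (Hd : 0 < a - x) by lra. exists (mkposreal _ Hd). intros y Hy. ball_simpl in Hy. apply Rabs_def2 in Hy. lra.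
Qed.

Lemma locally_gt (x a : R) : a < x -> locally x (fun y => a < y).
Proof.
 intros H. assert (Hd : 0 < x - a) by lra. exists (mkposreal _ Hd). intros y Hy. ball_simpl in Hy. apply Rabs_def2 in Hy. lra.
Qed.

Lemma filter_prod_locally {V W : UniformSpace} (v : V) (w : W) (Q : V * W -> Prop) :
 locally (v, w) Q <-> filter_prod (locally v) (locally w) Q.
Proof.
 split.
 - intros [d H]. exists (ball v d) (ball w d); [exists d; auto|exists d; auto|]. intros x y Hx Hy. apply H. split; auto.
 - intros [A B [d1 H1] [d2 H2] H]. assert (Hd : 0 < Rmin d1 d2) by (apply Rmin_pos; apply cond_pos).
  exists (mkposreal _ Hd). intros [x y] [Hx Hy]. apply H.
  + apply H1. eapply ball_le; [|eauto]. apply Rmin_l.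
  + apply H2. eapply ball_le; [|eauto]. apply Rmin_r.
Qed.

Lemma Rpower_neg_le (a b p : R) : 0 <= p -> 0 < a <= b -> Rpower b (- p) <= Rpower a (- p).
Proof.
 intros Hp Hab. rewrite !Rpower_Ropp. apply Rinv_le_contravar; [pos|]. apply Rle_Rpower_l; auto.
Qed.

(* The substitution [w = (1 - e) / e] turns [int_0^oo k (A + c w^2) dw] into an integral over
  [[0, 1]] whose integrand extends continuously by [0] at [e = 0]. *)
Definition descent_integrand (k : R -> R) (A c e : R) : R :=
 if Rlt_dec 0 e then k (A + c * ((1 - e) / e) ^ 2) / e ^ 2 else 0.
Definition descent (k : R -> R) (A c : R) : R := RInt (descent_integrand k A c) 0 1.

(** The power [3 / 2] makes [k (A + c w^2)] of order [w^(- 3)], hence [e^3]; after division by [e^2]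
    the integrand is of order [e] and vanishes continuously at [e = 0]. *)
Definition decays (C : R) (k : R -> R) (A : R) : Prop :=
 forall z, A <= z -> Rabs (k z) <= C * Rpower z (- (3 / 2)).

Lemma descent_arg_ge A c e : 0 < c -> A <= A + c * ((1 - e) / e) ^ 2.
Proof. intros Hc. note (pow2_ge_0 ((1 - e) / e)). nra. Qed.

Lemma descent_arg_large A c e : 0 < A -> 0 < c -> 0 < e <= 1 / 2 ->
 c / 4 * / e ^ 2 <= A + c * ((1 - e) / e) ^ 2.
Proof.
 intros HA Hc He. assert (1 / 4 * / e ^ 2 <= ((1 - e) / e) ^ 2).
 { replace (((1 - e) / e) ^ 2) with ((1 - e) ^ 2 * / e ^ 2) by fld. apply Rmult_le_compat_r; [pos|]. nra. }
 nra.
Qed.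

Lemma decays_small C k A c e : 0 < A -> 0 < c -> 0 <= C -> decays C k A -> 0 < e <= 1 / 2 ->
 Rabs (k (A + c * ((1 - e) / e) ^ 2)) <= C * Rpower (c / 4) (- (3 / 2)) * e ^ 3.
Proof.
 intros HA Hc HC Hk He. assert (He2 : 0 < / e ^ 2) by pos. note (descent_arg_large A c e HA Hc He) as HL.
 eapply Rle_trans; [apply Hk, descent_arg_ge; auto|]. rewrite Rmult_assoc. apply Rmult_le_compat_l; auto.
 eapply Rle_trans; [apply Rpower_neg_le; [lra|split; [|exact HL]]; nra|]. rewrite <- Rpower_mult_distr by lra. right. f_equal.
 rewrite Rpower_Ropp. unfold Rpower. rewrite ln_Rinv by pos. replace (ln (e ^ 2)) with (2 * ln e).
 2:{ simpl. rewrite Rmult_1_r, ln_mult by lra. ring. }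
 rewrite <- exp_Ropp. replace (- (3 / 2 * - (2 * ln e))) with (ln e + (ln e + ln e)) by field. rewrite !exp_plus, exp_ln by lra. ring.
Qed.

Lemma descent_integrand_small C k A c e : 0 < A -> 0 < c -> 0 <= C -> decays C k A -> e <= 1 / 2 ->
 Rabs (descent_integrand k A c e) <= C * Rpower (c / 4) (- (3 / 2)) * Rabs e.
Proof.
 intros HA Hc HC Hk He. unfold descent_integrand. destruct (Rlt_dec 0 e) as [H|H].
 - note (decays_small C k A c e HA Hc HC Hk ltac:(lra)). unfold Rdiv. rewrite Rabs_mult, (Rabs_right (/ e ^ 2)), (Rabs_right e) by
   (try lra; left; apply Rinv_0_lt_compat, pow_lt; lra).
  apply Rmult_le_reg_r with (e ^ 2); [pos|]. rewrite Rmult_assoc, Rinv_l by pos. simpl in *. lra.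
 - rewrite Rabs_R0. apply Rmult_le_pos; [|pos]. apply Rmult_le_pos; auto. left; apply exp_pos.
Qed.

(** At [e0 <= 0] the only issue is uniformity: the common constant [C] in [decays] bounds the
    integrands by a fixed multiple of [e], whatever the parameter. *)
Lemma descent_integrand_lim {U : Type} (F : (U -> Prop) -> Prop) (FF : Filter F)
 (k : U -> R -> R) (A c : U -> R) (k0 : R -> R) (A0 c0 C e0 : R) :
 0 < A0 -> 0 < c0 -> 0 <= C -> filterlim A F (locally A0) -> filterlim c F (locally c0) ->
 (forall z, A0 <= z -> filterlim (fun q => k (fst q) (snd q)) (filter_prod F (locally z)) (locally (k0 z))) ->
 F (fun u => decays C (k u) (A u)) ->
 filterlim (fun q => descent_integrand (k (fst q)) (A (fst q)) (c (fst q)) (snd q))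
  (filter_prod F (locally e0)) (locally (descent_integrand k0 A0 c0 e0)).
Proof.
 intros HA0 Hc0 HC HA Hc Hk Hdec. assert (Fst : forall Q : U -> Prop, F Q -> filter_prod F (locally e0) (fun q => Q (fst q)))
  by (intros Q HQ; exact (filterlim_fst (F := F) (G := locally e0) _ HQ)).
 assert (Snd : forall Q : R -> Prop, locally e0 Q -> filter_prod F (locally e0) (fun q => Q (snd q)))
  by (intros Q HQ; exact (filterlim_snd (F := F) (G := locally e0) _ HQ)).
 destruct (Rlt_le_dec 0 e0) as [He|He].
 - apply (filterlim_ext_loc (fun q => k (fst q) (A (fst q) + c (fst q) * ((1 - snd q) / snd q) ^ 2) / snd q ^ 2)).
  + weaken (Snd _ (locally_pos e0 He)). intros [u e] H; simpl in *. unfold descent_integrand. destruct (Rlt_dec 0 e); [auto|lra].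
  + unfold descent_integrand. destruct (Rlt_dec 0 e0); [|lra].
   assert (Fe : filterlim (fun q : U * R => snd q) (filter_prod F (locally e0)) (locally e0))
    by apply filterlim_snd.
   assert (FA : filterlim (fun q : U * R => A (fst q)) (filter_prod F (locally e0)) (locally A0))
    by (eapply filterlim_comp; [apply filterlim_fst|exact HA]).
   assert (Fc : filterlim (fun q : U * R => c (fst q)) (filter_prod F (locally e0)) (locally c0))
    by (eapply filterlim_comp; [apply filterlim_fst|exact Hc]).
   apply flim_div; [pos| |flim].
   * apply (filterlim_comp _ _ _ (fun q : U * R => (fst q, A (fst q) + c (fst q) * ((1 - snd q) / snd q) ^ 2))
     (fun q => k (fst q) (snd q)) _ (filter_prod F (locally (A0 + c0 * ((1 - e0) / e0) ^ 2)))).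
    -- apply filterlim_pair; [pos|]. flim. lra.
    -- apply Hk. apply descent_arg_ge; auto.
 - assert (E0 : descent_integrand k0 A0 c0 e0 = 0)
   by (unfold descent_integrand; destruct (Rlt_dec 0 e0); auto; lra).
  (* The bound for one integrand has [c u / 4] under the power; eventually [c u > c0 / 2], which
     gives [c0 / 8]. *)
  rewrite E0. apply filterlim_locally. intros eps. set (B := C * Rpower (c0 / 8) (- (3 / 2))).
  assert (HB : 0 <= B) by (apply Rmult_le_pos; auto; left; apply exp_pos). set (d := Rmin (1 / 2) (eps / (B + 1))).
  assert (Hd : 0 < d) by (apply Rmin_pos; [lra|apply Rdiv_lt_0_compat; [apply cond_pos|lra]]).
  assert (Hc2 : c0 / 2 < c0) by lra. assert (Hed : e0 < d) by lra.
  assert (G1 : F (fun u => 0 < A u)) by exact (HA _ (locally_pos A0 HA0)).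
  assert (G2 : F (fun u => c0 / 2 < c u)) by exact (Hc _ (locally_gt c0 (c0 / 2) Hc2)).
  weaken (filter_and _ _ (Fst _ (filter_and _ _ Hdec (filter_and _ _ G1 G2)))
    (Snd _ (locally_lt e0 d Hed))). intros [u e] [[H1 [H2 H3]] H4]; simpl in *.
  ball_simpl. rewrite Ropp_0, Rplus_0_r. note (Rmin_l (1 / 2) (eps / (B + 1))) as Hd1. note (Rmin_r (1 / 2) (eps / (B + 1))) as Hd2.
  fold d in Hd1, Hd2. destruct (Rlt_le_dec 0 e) as [Hep|Hen].
  + eapply Rle_lt_trans; [apply (descent_integrand_small C); auto; lra|]. rewrite (Rabs_right e) by lra.
   assert (C * Rpower (c u / 4) (- (3 / 2)) <= B).
   { apply Rmult_le_compat_l; auto. apply Rpower_neg_le; lra. }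
   assert (B * d <= B * (eps / (B + 1))) by nra. assert (B * (eps / (B + 1)) < eps).
   { apply Rmult_lt_reg_r with (B + 1); [lra|]. replace (B * (eps / (B + 1)) * (B + 1)) with (B * eps) by fld.
    note (cond_pos eps). lra. }
   assert (B * e <= B * d) by nra. nra.
  + unfold descent_integrand. destruct (Rlt_dec 0 e); [lra|]. rewrite Rabs_R0. apply cond_pos.
Qed.

Lemma continuous_descent_integrand (k : R -> R) (A c C e : R) :
 0 < A -> 0 < c -> 0 <= C -> (forall z, A <= z -> continuous k z) -> decays C k A ->
 continuous (descent_integrand k A c) e.
Proof.
 intros HA Hc HC Hk Hd. note (descent_integrand_lim (fun Q : unit -> Prop => Q tt)) as H. specialize (H ltac:(constructor; auto)).
 specialize (H (fun _ => k) (fun _ => A) (fun _ => c) k A c C e HA Hc HC).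
 assert (L : filterlim (fun q : unit * R => descent_integrand k A c (snd q))
   (filter_prod (fun Q : unit -> Prop => Q tt) (locally e)) (locally (descent_integrand k A c e))).
 { apply H; auto.
  - intros Q HQ. unfold filtermap. apply locally_singleton. auto.
  - intros Q HQ. unfold filtermap. apply locally_singleton. auto.
  - intros z Hz. apply (filterlim_comp _ _ _ snd k _ (locally z)); [|apply Hk; auto]. intros Q HQ. exists (fun _ => True) Q; auto. }
 intros Q HQ. specialize (L Q HQ). destruct L as [P1 P2 H1 H2 H3]. unfold filtermap. weaken H2. intros x Hx. apply (H3 tt x); auto.
Qed.

Lemma ex_RInt_descent (k : R -> R) (A c C : R) :
 0 < A -> 0 < c -> 0 <= C -> (forall z, A <= z -> continuous k z) -> decays C k A ->
 ex_RInt (descent_integrand k A c) 0 1.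
Proof. intros. apply ex_RInt_cont. intros e. apply (continuous_descent_integrand k A c C); auto. Qed.

Lemma descent_lim {U : Type} (F : (U -> Prop) -> Prop) (FF : Filter F)
 (k : U -> R -> R) (A c : U -> R) (k0 : R -> R) (A0 c0 C : R) :
 0 < A0 -> 0 < c0 -> 0 <= C -> filterlim A F (locally A0) -> filterlim c F (locally c0) ->
 (forall z, A0 <= z -> filterlim (fun q => k (fst q) (snd q)) (filter_prod F (locally z)) (locally (k0 z))) ->
 F (fun u => decays C (k u) (A u)) ->
 F (fun u => forall z, A u <= z -> continuous (k u) z) ->
 (forall z, A0 <= z -> continuous k0 z) -> decays C k0 A0 ->
 filterlim (fun u => descent (k u) (A u) (c u)) F (locally (descent k0 A0 c0)).
Proof.
 intros HA0 Hc0 HC HA Hc Hk Hdec Hcont Hk0 Hd0. apply (RInt_filterlim F FF (fun u => descent_integrand (k u) (A u) (c u))); [lra| | |].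
 - intros e _. apply (descent_integrand_lim F FF k A c k0 A0 c0 C e); auto.
 - assert (G1 : F (fun u => 0 < A u)) by exact (HA _ (locally_pos A0 HA0)).
  assert (G2 : F (fun u => 0 < c u)) by exact (Hc _ (locally_pos c0 Hc0)).
  weaken (filter_and _ _ Hdec (filter_and _ _ Hcont (filter_and _ _ G1 G2))). intros u [H1 [H2 [H3 H4]]]. apply (ex_RInt_descent (k u) (A u) (c u) C); auto.
 - intros e _. apply (continuous_descent_integrand k0 A0 c0 C); auto.
Qed.

(** * Differentiation of descent integrals *)

(** Openness serves differentiation; closure under increasing [z] is needed because the descent
    integral at [z] reads the kernel at all larger values. *)
Definition kernel_domain (D : R -> R -> Prop) : Prop :=
 (forall X z, D X z -> locally ((X, z) : R * R) (fun q => D (fst q) (snd q))) /\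
 (forall X z z', D X z -> z <= z' -> D X z') /\ (forall X z, D X z -> 0 < z).

Definition continuous_on_domain (D : R -> R -> Prop) (k : R -> R -> R) : Prop :=
 forall X z, D X z -> continuous (fun q : R * R => k (fst q) (snd q)) (X, z).

(** The decay constant must be locally uniform in both variables, so that limits and derivatives
    pass under the descent integral. *)
Definition admissible (D : R -> R -> Prop) (k : R -> R -> R) : Prop :=
 continuous_on_domain D k /\
 (forall X z, D X z -> exists C, 0 <= C /\ locally ((X, z) : R * R) (fun q => decays C (k (fst q)) (snd q))).

Lemma admissible_fixed D k X z : kernel_domain D -> admissible D k -> D X z ->
 (forall z', z <= z' -> continuous (k X) z') /\ exists C, 0 <= C /\ decays C (k X) z.
Proof.
 intros [_ [Hup _]] [Hc Hd] HD. split.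
 - intros z' Hz'. apply continuous_2d_snd, Hc. eapply Hup; eauto.
 - destruct (Hd X z HD) as [C [HC HL]]. exists C; split; auto. exact (locally_singleton _ _ HL).
Qed.

Lemma ex_RInt_descent_adm D k X z c : kernel_domain D -> admissible D k -> 0 < c -> D X z ->
 ex_RInt (descent_integrand (k X) z c) 0 1.
Proof.
 intros HD Hk Hc H. destruct (admissible_fixed D k X z HD Hk H) as [H1 [C [HC H2]]]. destruct HD as [_ [_ Hpos]].
 apply (ex_RInt_descent (k X) z c C); auto. eapply Hpos; eauto.
Qed.

Lemma continuous_descent D k c : kernel_domain D -> admissible D k -> 0 < c ->
 continuous_on_domain D (fun X z => descent (k X) z c).
Proof.
 intros HD Hk Hc X z H. destruct (admissible_fixed D k X z HD Hk H) as [H1 _]. destruct (proj2 Hk X z H) as [C [HC HL]].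
 apply (descent_lim (locally ((X, z) : R * R)) _ (fun q => k (fst q)) snd (fun _ => c) (k X) z c C);
  auto.
 - eapply HD; eauto.
 - apply continuous_snd.
 - apply flim_const.
 - intros z' Hz'. apply (filterlim_comp _ _ _ (fun q : R * R * R => (fst (fst q), snd q)) (fun q => k (fst q) (snd q)) _
   (locally ((X, z') : R * R))).
  + intros Q HQ. apply filter_prod_locally in HQ. destruct HQ as [Q1 Q2 HQ1 HQ2 HQ]. exists (fun q : R * R => Q1 (fst q)) Q2; auto.
   apply (continuous_fst X z). exact HQ1.
  + apply (proj1 Hk). eapply HD; eauto.
 - weaken (proj1 HD X z H). intros [a b] Hab z' Hz'; simpl in *. apply (admissible_fixed D k a b HD Hk Hab). auto.
 - exact (locally_singleton _ _ HL).
Qed.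

Lemma is_derive_descent_X D k kX c X z : kernel_domain D -> admissible D k -> admissible D kX -> 0 < c ->
 (forall X z, D X z -> is_derive (fun X => k X z) X (kX X z)) -> D X z ->
 is_derive (fun X => descent (k X) z c) X (descent (kX X) z c).
Proof.
 intros HD Hk HkX Hc Hder H. assert (Hloc : locally X (fun Y => D Y z)).
 { note (proj1 HD X z H) as HL. apply filter_prod_locally in HL. destruct HL as [Q1 Q2 HQ1 HQ2 HQ]. weaken HQ1. intros Y HY.
  apply (HQ Y z); auto. exact (locally_singleton _ _ HQ2). }
 apply (is_derive_RInt_under (fun X e => descent_integrand (k X) z c e)
  (fun X e => descent_integrand (kX X) z c e)); [lra| | |].
 - weaken Hloc. intros Y HY e _. unfold descent_integrand. destruct (Rlt_dec 0 e); [|apply is_derive_Rconst].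
  apply is_derive_Rmultc. apply Hder. eapply HD; [eauto|]. apply descent_arg_ge; auto.
 - intros e _. destruct (proj2 HkX X z H) as [C [HC HL]]. apply filter_prod_locally in HL. destruct HL as [Q1 Q2 HQ1 HQ2 HQ].
  note (locally_singleton _ _ HQ2) as Hz2. apply (filterlim_filter_le_1 (F := filter_prod (locally X) (locally e)));
   [intros Q HQQ; apply filter_prod_locally; auto|].
  apply (descent_integrand_lim (locally X) _ kX (fun _ => z) (fun _ => c) (kX X) z c C e);
   auto.
  + eapply HD; eauto.
  + apply flim_const.
  + apply flim_const.
  + intros z' Hz'. apply (filterlim_filter_le_1 (F := locally ((X, z') : R * R)));
    [intros Q HQQ; apply filter_prod_locally; auto|].
   apply (proj1 HkX). eapply HD; eauto.
  + weaken HQ1. intros Y HY. apply (HQ Y z); auto.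
 - weaken Hloc. intros Y HY. apply (ex_RInt_descent_adm D k Y z c); auto.
Qed.

Lemma is_derive_descent_z D k kz c X z : kernel_domain D -> admissible D k -> admissible D kz -> 0 < c ->
 (forall X z, D X z -> is_derive (fun z => k X z) z (kz X z)) -> D X z ->
 is_derive (fun z => descent (k X) z c) z (descent (kz X) z c).
Proof.
 intros HD Hk Hkz Hc Hder H. assert (Hloc : locally z (fun y => D X y)).
 { note (proj1 HD X z H) as HL. apply filter_prod_locally in HL. destruct HL as [Q1 Q2 HQ1 HQ2 HQ]. weaken HQ2. intros Y HY.
  apply (HQ X Y); auto. exact (locally_singleton _ _ HQ1). }
 apply (is_derive_RInt_under (fun z e => descent_integrand (k X) z c e)
  (fun z e => descent_integrand (kz X) z c e)); [lra| | |].
 - weaken Hloc. intros y Hy e _. unfold descent_integrand. destruct (Rlt_dec 0 e); [|apply is_derive_Rconst].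
  apply is_derive_Rmultc. eapply is_derive_eq.
  + apply (is_derive_Rcomp (k X) (fun y => y + c * ((1 - e) / e) ^ 2) y).
   * apply Hder. eapply HD; [eauto|]. apply descent_arg_ge; auto.
   * instantiate (1 := 1). auto_derive; auto.
  + ring.
 - intros e _. destruct (proj2 Hkz X z H) as [C [HC HL]]. apply filter_prod_locally in HL. destruct HL as [Q1 Q2 HQ1 HQ2 HQ].
  note (locally_singleton _ _ HQ1) as HX1. apply (filterlim_filter_le_1 (F := filter_prod (locally z) (locally e)));
   [intros Q HQQ; apply filter_prod_locally; auto|].
  apply (descent_integrand_lim (locally z) _ (fun _ => kz X) (fun y => y) (fun _ => c) (kz X) z c C e);
   auto.
  + eapply HD; eauto.
  + apply filterlim_id.
  + apply flim_const.
  + intros z' Hz'. apply (filterlim_comp _ _ _ snd (kz X) _ (locally z')); [apply filterlim_snd|].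
   apply continuous_2d_snd, (proj1 Hkz). eapply HD; eauto.
  + weaken HQ2. intros Y HY. apply (HQ X Y); auto.
 - weaken Hloc. intros y Hy. apply (ex_RInt_descent_adm D k X y c); auto.
Qed.

Lemma Rabs_le_all_eps (x K : R) : (forall d, 0 < d < 1 / 2 -> Rabs x <= K * d) -> x = 0.
Proof.
 intros H. destruct (Req_dec x 0) as [|Hx]; auto. exfalso. apply Rabs_pos_lt in Hx. note (H (1 / 4) ltac:(lra)) as H1.
 assert (HK : 0 < K) by lra. set (d := Rmin (1 / 4) (Rabs x / (2 * K))). assert (Hp : 0 < Rabs x / (2 * K)) by pos.
 assert (Hd : 0 < d) by (apply Rmin_pos; lra).
 note (Rmin_l (1 / 4) (Rabs x / (2 * K))) as M1. note (Rmin_r (1 / 4) (Rabs x / (2 * K))) as M2.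
 fold d in M1, M2. specialize (H d ltac:(lra)). assert (K * d <= K * (Rabs x / (2 * K))) by nra.
 replace (K * (Rabs x / (2 * K))) with (Rabs x / 2) in H0 by fld. lra.
Qed.

(* The integrand is the derivative of [- A w k_z - (c / 2) w^3 k_z - (7 / 4) w k] with respect to
  [w], written in the variable [e]. *)
Lemma descent_pde D (k kz kzz kXX : R -> R -> R) (c kap X A : R) :
 kernel_domain D -> admissible D k -> admissible D kz -> admissible D kzz -> admissible D kXX ->
 admissible D (fun X z => z * kz X z) -> 0 < c ->
 (forall X z, D X z -> is_derive (fun z => k X z) z (kz X z)) ->
 (forall X z, D X z -> is_derive (fun z => kz X z) z (kzz X z)) ->
 (forall X z, D X z -> kXX X z + (z ^ 2 - kap) * kzz X z + 5 * z * kz X z + 15 / 4 * k X z = 0) ->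
 D X A ->
 descent (kXX X) A c + (A ^ 2 - kap) * descent (kzz X) A c + 4 * A * descent (kz X) A c
  + 2 * descent (k X) A c = 0.
Proof.
 intros HD Hk Hkz Hkzz HkXX Hzkz Hc Dk Dkz Hpde H. set (h := fun z => kXX X z + (A ^ 2 - kap) * kzz X z + 4 * A * kz X z + 2 * k X z).
 assert (HA : 0 < A) by (eapply HD; eauto). note (ex_RInt_descent_adm D k X A c HD Hk Hc H) as X0.
 note (ex_RInt_descent_adm D kz X A c HD Hkz Hc H) as X1. note (ex_RInt_descent_adm D kzz X A c HD Hkzz Hc H) as X2.
 note (ex_RInt_descent_adm D kXX X A c HD HkXX Hc H) as X3.
 assert (E : forall e, descent_integrand (kXX X) A c e + (A ^ 2 - kap) * descent_integrand (kzz X) A c e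
   + 4 * A * descent_integrand (kz X) A c e + 2 * descent_integrand (k X) A c e = descent_integrand h A c e).
 { intros e. unfold descent_integrand, h. destruct (Rlt_dec 0 e); [lra|ring]. }
 unfold descent. rewrite <- !RInt_Rcmult by auto. rewrite <- !RInt_Rplus by auto using ex_RInt_Rplus, ex_RInt_Rcmult.
 rewrite (RInt_ext _ (descent_integrand h A c)) by auto.
 assert (Xh : forall a b, 0 <= a <= 1 -> 0 <= b <= 1 -> ex_RInt (descent_integrand h A c) a b).
 { intros a b Ha Hb. assert (Y : forall a b, 0 <= a <= b -> b <= 1 -> ex_RInt (descent_integrand h A c) a b).
  { intros a' b' H1 H2. apply (ex_RInt_ext (fun e => descent_integrand (kXX X) A c e + (A ^ 2 - kap) * descent_integrand (kzz X) A c e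
   + 4 * A * descent_integrand (kz X) A c e + 2 * descent_integrand (k X) A c e)); [auto|].
   apply (ex_RInt_sub _ 0 1); [lra|lra|]. auto using ex_RInt_Rplus, ex_RInt_Rcmult. }
  destruct (Rle_dec a b); [apply Y; lra|]. apply ex_RInt_swap, Y; lra. }
 destruct (admissible_fixed D k X A HD Hk H) as [C0 [B0 [P0 D0]]]. destruct (admissible_fixed D kz X A HD Hkz H) as [C1 [B1 [P1 D1]]].
 destruct (admissible_fixed D kzz X A HD Hkzz H) as [C2 [B2 [P2 D2]]].
 destruct (admissible_fixed D kXX X A HD HkXX H) as [C3 [B3 [P3 D3]]]. destruct (admissible_fixed D _ X A HD Hzkz H) as [_ [B4 [P4 D4]]].
 set (r := Rpower (c / 4) (- (3 / 2))). assert (Hr : 0 < r) by apply exp_pos.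
 set (T := fun e => - A * ((1 - e) / e) * kz X (A + c * ((1 - e) / e) ^ 2)
   - c / 2 * ((1 - e) / e) ^ 3 * kz X (A + c * ((1 - e) / e) ^ 2)
   - 7 / 4 * ((1 - e) / e) * k X (A + c * ((1 - e) / e) ^ 2)).
 assert (DT : forall e, 0 < e -> is_derive (fun e => - T e) e (descent_integrand h A c e)).
 { intros e He. assert (HDz : D X (A + c * ((1 - e) / e) ^ 2)) by (eapply HD; [exact H|apply descent_arg_ge; auto]).
  assert (Dw : is_derive (fun e => (1 - e) / e) e (- / e ^ 2)) by (auto_derive; [lra|]; field; lra).
  assert (Dzeta : is_derive (fun e => A + c * ((1 - e) / e) ^ 2) e (c * (2 * ((1 - e) / e) * - / e ^ 2))).
  { eapply is_derive_eq; [apply is_derive_Rplus; [apply is_derive_Rconst|apply is_derive_Rcmult]|].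
   - apply (is_derive_Rcomp (fun x => x ^ 2) (fun e => (1 - e) / e) e (2 * ((1 - e) / e))); [|eauto]. auto_derive; auto; ring.
   - ring. }
  note (is_derive_Rcomp _ _ _ _ _ (Dk _ _ HDz) Dzeta) as Dk'. note (is_derive_Rcomp _ _ _ _ _ (Dkz _ _ HDz) Dzeta) as Dkz'.
  assert (Dw3 : is_derive (fun e => ((1 - e) / e) ^ 3) e (3 * ((1 - e) / e) ^ 2 * - / e ^ 2)).
  { apply (is_derive_Rcomp (fun x => x ^ 3) (fun e => (1 - e) / e) e (3 * ((1 - e) / e) ^ 2)); [|pos]. auto_derive; auto; ring. }
  eapply is_derive_eq.
  - apply (is_derive_opp T). unfold T. apply is_derive_Rminus; [apply is_derive_Rminus|].
   + apply is_derive_Rmult; [apply is_derive_Rcmult; exact Dw|eauto].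
   + apply is_derive_Rmult; [apply is_derive_Rcmult; exact Dw3|eauto].
   + apply is_derive_Rmult; [apply is_derive_Rcmult; exact Dw|eauto].
  - unfold descent_integrand, h. destruct (Rlt_dec 0 e); [|lra]. note (Hpde _ _ HDz) as EP.
   set (w := (1 - e) / e) in *. set (zt := A + c * w ^ 2) in *.
   replace (kXX X zt) with (- (zt ^ 2 - kap) * kzz X zt - 5 * zt * kz X zt - 15 / 4 * k X zt) by lra.
   unfold opp; simpl. unfold zt. field. lra. }
 (* The integral is cut at [d]: the part over [[0, d]] is small by the bound on the integrand, and
    the part over [[d, 1]] equals the boundary term [T d]. Both are of order [d]. *)
 apply (Rabs_le_all_eps _ ((B3 + Rabs (A ^ 2 - kap) * B2 + 4 * A * B1 + 2 * B0) * r + (2 * B4 + 2 * B0) * r)). intros d Hd.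
 assert (Small : forall e, 0 <= e <= d -> Rabs (descent_integrand h A c e)
   <= (B3 + Rabs (A ^ 2 - kap) * B2 + 4 * A * B1 + 2 * B0) * r).
 { intros e He. rewrite <- E. note (descent_integrand_small B0 (k X) A c e HA Hc P0 D0 ltac:(lra)) as S0.
  note (descent_integrand_small B1 (kz X) A c e HA Hc P1 D1 ltac:(lra)) as S1.
  note (descent_integrand_small B2 (kzz X) A c e HA Hc P2 D2 ltac:(lra)) as S2.
  note (descent_integrand_small B3 (kXX X) A c e HA Hc P3 D3 ltac:(lra)) as S3.
  fold r in S0, S1, S2, S3. rewrite (Rabs_right e) in * by lra. assert (Q : forall B, 0 <= B -> B * r * e <= B * r).
  { intros B HB. assert (0 <= B * r) by nra. nra. }
  note (Q _ P0). note (Q _ P1). note (Q _ P2). note (Q _ P3). note (Rabs_pos (A ^ 2 - kap)) as HAk.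
  eapply Rle_trans; [apply Rabs_triang|]. eapply Rle_trans; [apply Rplus_le_compat_r, Rabs_triang|].
  eapply Rle_trans; [apply Rplus_le_compat_r, Rplus_le_compat_r, Rabs_triang|].
  rewrite !Rabs_mult. rewrite (Rabs_right 4), (Rabs_right A), (Rabs_right 2) by lra.
  assert (Rabs (A ^ 2 - kap) * Rabs (descent_integrand (kzz X) A c e) <= Rabs (A ^ 2 - kap) * (B2 * r))
   by nra.
  assert (4 * A * Rabs (descent_integrand (kz X) A c e) <= 4 * A * (B1 * r))
   by nra.
  lra. }
 assert (Split : RInt (descent_integrand h A c) 0 1 = RInt (descent_integrand h A c) 0 d + RInt (descent_integrand h A c) d 1).
 { symmetry. apply (RInt_Chasles (descent_integrand h A c)); apply Xh; lra. }
 assert (Tail : RInt (descent_integrand h A c) d 1 = T d).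
 { transitivity (- T 1 - - T d).
  - apply (RInt_fundamental (fun e => - T e)).
   + intros e He. rewrite Rmin_left, Rmax_right in He by lra. apply DT; lra.
   + intros e He. rewrite Rmin_left, Rmax_right in He by lra.
    assert (Ce : continuous (fun e => descent_integrand (kXX X) A c e + (A ^ 2 - kap) * descent_integrand (kzz X) A c e
     + 4 * A * descent_integrand (kz X) A c e + 2 * descent_integrand (k X) A c e) e).
    { note (continuous_descent_integrand _ A c B0 e HA Hc P0 C0 D0). note (continuous_descent_integrand _ A c B1 e HA Hc P1 C1 D1).
     note (continuous_descent_integrand _ A c B2 e HA Hc P2 C2 D2). note (continuous_descent_integrand _ A c B3 e HA Hc P3 C3 D3).
     cont. }
    exact (continuous_ext _ _ _ E Ce).
  - unfold T. replace ((1 - 1) / 1) with 0 by field. eqR. ring. }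
 assert (HT : Rabs (T d) <= (2 * B4 + 2 * B0) * r * d).
 { note (decays_small B0 (k X) A c d HA Hc P0 D0 ltac:(lra)) as S0.
  note (decays_small B4 (fun z => z * kz X z) A c d HA Hc P4 D4 ltac:(lra)) as S4. fold r in S0, S4. cbv beta in S4.
  note (pow2_ge_0 ((1 - d) / d)) as Hw2. assert (Hw : 0 < (1 - d) / d) by pos.
  assert (Hwd : (1 - d) / d * d <= 1) by (replace ((1 - d) / d * d) with (1 - d) by (field; lra); lra).
  unfold T. set (w := (1 - d) / d) in *. set (zt := A + c * w ^ 2) in *. assert (Hzt : A <= zt) by (unfold zt; nra).
  rewrite Rabs_mult, (Rabs_right zt) in S4 by lra. note (Rabs_pos (kz X zt)). note (Rabs_pos (k X zt)).
  assert (Z1 : A * Rabs (kz X zt) <= zt * Rabs (kz X zt)) by nra. assert (Z2 : c * w ^ 2 * Rabs (kz X zt) <= zt * Rabs (kz X zt))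
   by (apply Rmult_le_compat_r; auto; unfold zt; lra).
  assert (Hpow : forall B, 0 <= B -> w * (B * r * d ^ 3) <= B * r * d).
  { intros B HB. assert (0 <= B * r) by nra. replace (w * (B * r * d ^ 3)) with (B * r * d * (w * d * d)) by ring.
   rewrite <- (Rmult_1_r (B * r * d)) at 2. apply Rmult_le_compat_l; [|nra]. apply Rmult_le_pos; lra. }
  note (Hpow _ P0) as Q0. note (Hpow _ P4) as Q4. eapply Rle_trans; [apply Rabs_triang|]. rewrite Rabs_Ropp.
  eapply Rle_trans; [apply Rplus_le_compat_r, Rabs_triang|]. rewrite Rabs_Ropp. rewrite !Rabs_mult, Rabs_Ropp, <- RPow_abs.
  rewrite (Rabs_right A), (Rabs_right w), (Rabs_right (c / 2)), (Rabs_right (7 / 4)) by lra.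
  assert (R1 : A * w * Rabs (kz X zt) <= w * (B4 * r * d ^ 3)) by nra.
  assert (R2 : c / 2 * w ^ 3 * Rabs (kz X zt) <= w * (B4 * r * d ^ 3)).
  { replace (c / 2 * w ^ 3 * Rabs (kz X zt)) with (w / 2 * (c * w ^ 2 * Rabs (kz X zt))) by field.
   apply Rle_trans with (w / 2 * (B4 * r * d ^ 3)); [nra|]. assert (0 <= d ^ 3) by pos. assert (0 <= w * (B4 * r * d ^ 3)) by pos. lra. }
  assert (R3 : 7 / 4 * w * Rabs (k X zt) <= 7 / 4 * (w * (B0 * r * d ^ 3))).
  { rewrite Rmult_assoc. apply Rmult_le_compat_l; [lra|]. apply Rmult_le_compat_l; lra. }
  assert (0 <= B0 * r * d) by pos. lra. }
 match goal with |- Rabs ?x <= _ => change (Rabs (RInt (descent_integrand h A c) 0 1) <= ((B3 + Rabs (A ^ 2 - kap) * B2 + 4 * A * B1 + 2 * B0) * r + (2 * B4 + 2 * B0) * r) * d) end.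
 rewrite Split, Tail. eapply Rle_trans; [apply Rabs_triang|]. rewrite Rmult_plus_distr_r. apply Rplus_le_compat; [|lra].
 eapply Rle_trans; [apply (abs_RInt_le_const (descent_integrand h A c) 0 d _ ltac:(lra) (Xh 0 d ltac:(lra) ltac:(lra)) Small)|].
 right; ring.
Qed.

(** * Averages over the rotations about the origin *)

(** The Minkowski product of the vector [(c, d)] on the axis with the point at distance [y] from the
    origin in direction [t]. For [(cosh eta, sinh eta)] it is the hyperbolic cosine of the distance
    to the point at distance [eta] on the axis; for the light-like [(1, 1)] it is the exponential of
    a Busemann function. *)
Definition geo_arg (c d y t : R) : R := c * cosh y - d * sinh y * cos t.
Definition geo_arg_y (c d y t : R) : R := c * sinh y - d * cosh y * cos t.

Definition average (w f : R -> R -> R) (xi c d : R) (p : pt) : R :=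
 RInt (fun t => w (snd p) t * f (fst p - xi) (geo_arg c d (snd p) t)) 0 PI.

Definition average_domain (D : R -> R -> Prop) (xi c d : R) (p : pt) : Prop :=
 forall t, 0 <= t <= PI -> D (fst p - xi) (geo_arg c d (snd p) t).

Definition continuous2 (w : R -> R -> R) : Prop :=
 forall q : R * R, continuous (fun q : R * R => w (fst q) (snd q)) q.

Section Average.
Context (D : R -> R -> Prop) (xi c d : R).
Context (Dopen : forall X z, D X z -> locally ((X, z) : R * R) (fun q => D (fst q) (snd q))).

Lemma average_arg_continuous (q : R * R * R) :
 continuous (fun q : R * R * R => (fst (fst q) - xi, geo_arg c d (snd (fst q)) (snd q)) : R * R) q.
Proof.
 assert (C1 : continuous (fun q : R * R * R => snd q) q) by (destruct q; apply continuous_snd).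
 assert (C0 : continuous (fun q : R * R * R => fst q) q) by (destruct q; apply continuous_fst).
 assert (C2 : continuous (fun q : R * R * R => fst (fst q)) q)
  by (apply (continuous_comp fst fst); auto; destruct (fst q); apply continuous_fst).
 assert (C3 : continuous (fun q : R * R * R => snd (fst q)) q)
  by (apply (continuous_comp fst snd); auto; destruct (fst q); apply continuous_snd).
 apply continuous_pair; [cont|]. unfold geo_arg. cont.
Qed.

Lemma average_domain_open : open2 (average_domain D xi c d).
Proof.
 intros p Hp. apply locally_dist2. apply (filter_prod_compact (locally (p : R * R)) _
  (fun p t => D (fst p - xi) (geo_arg c d (snd p) t)) 0 PI); [note PI_RGT_0; lra|].
 intros t Ht. apply filter_prod_locally. apply (average_arg_continuous (p, t) (fun q => D (fst q) (snd q))). apply Dopen. apply Hp; auto.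
Qed.

Lemma average_integrand_continuous (w f : R -> R -> R) (p : pt) (t : R) :
 continuous2 w -> continuous_on_domain D f -> D (fst p - xi) (geo_arg c d (snd p) t) ->
 continuous (fun q : R * R * R => w (snd (fst q)) (snd q) * f (fst (fst q) - xi) (geo_arg c d (snd (fst q)) (snd q)))
  ((p, t) : R * R * R).
Proof.
 intros Hw Hf H. destruct p as [x y]. apply continuous_Rmult.
 - apply (continuous_comp (fun q : R * R * R => (snd (fst q), snd q) : R * R) (fun q : R * R => w (fst q) (snd q)));
   [|apply Hw].
  apply continuous_pair; [|apply continuous_snd]. apply (continuous_comp fst snd); [apply continuous_fst|apply continuous_snd].
 - apply (continuous_comp (fun q : R * R * R => (fst (fst q) - xi, geo_arg c d (snd (fst q)) (snd q)) : R * R)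
   (fun q : R * R => f (fst q) (snd q))); [apply average_arg_continuous|]. apply Hf; auto.
Qed.

Lemma average_ex_RInt (w f : R -> R -> R) (p : pt) :
 continuous2 w -> continuous_on_domain D f -> average_domain D xi c d p ->
 ex_RInt (fun t => w (snd p) t * f (fst p - xi) (geo_arg c d (snd p) t)) 0 PI.
Proof.
 intros Hw Hf H. apply (ex_RInt_continuous (fun t => w (snd p) t * f (fst p - xi) (geo_arg c d (snd p) t))).
 intros t Ht. rewrite Rmin_left, Rmax_right in Ht by (note PI_RGT_0; lra). apply (continuous_comp (fun t : R => (p, t) : R * R * R)
  (fun q : R * R * R => w (snd (fst q)) (snd q) * f (fst (fst q) - xi) (geo_arg c d (snd (fst q)) (snd q)))).
 - apply filterlim_locally. intros eps. exists eps. intros s Hs. split; [apply ball_center|pos].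
 - apply average_integrand_continuous; auto.
Qed.

Lemma average_continuous (w f : R -> R -> R) (p : pt) :
 continuous2 w -> continuous_on_domain D f -> average_domain D xi c d p ->
 continuous (average w f xi c d : R * R -> R) p.
Proof.
 intros Hw Hf H. apply (continuous_RInt_param (U := prod_UniformSpace R_UniformSpace R_UniformSpace)
  (fun p t => w (snd p) t * f (fst p - xi) (geo_arg c d (snd p) t)) p 0 PI); [note PI_RGT_0; lra| |].
 - intros t Ht. apply average_integrand_continuous; auto.
 - weaken (open2_locally _ p average_domain_open H). intros q Hq. apply average_ex_RInt; auto.
Qed.

Lemma average_derive_x (w f fX : R -> R -> R) (p : pt) :
 continuous2 w -> continuous_on_domain D f -> continuous_on_domain D fX ->
 (forall X z, D X z -> is_derive (fun X => f X z) X (fX X z)) -> average_domain D xi c d p ->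
 is_derive (fun x => average w f xi c d (x, snd p)) (fst p) (average w fX xi c d p).
Proof.
 intros Hw Hf HfX Hd H. note (open2_fst_locally _ p average_domain_open H) as HL.
 apply (is_derive_RInt_under (fun x t => w (snd p) t * f (x - xi) (geo_arg c d (snd p) t))
  (fun x t => w (snd p) t * fX (x - xi) (geo_arg c d (snd p) t))); [note PI_RGT_0; lra| | |].
 - weaken HL. intros x Hx t Ht. apply is_derive_Rcmult.
  eapply is_derive_eq; [apply (is_derive_Rcomp (fun X => f X (geo_arg c d (snd p) t)) (fun x => x - xi))|].
  + apply Hd. apply (Hx t Ht).
  + instantiate (1 := 1). auto_derive; auto; ring.
  + ring.
 - intros t Ht. apply (continuous_comp (fun q : R * R => ((fst q, snd p), snd q) : R * R * R)
   (fun q : R * R * R => w (snd (fst q)) (snd q) * fX (fst (fst q) - xi) (geo_arg c d (snd (fst q)) (snd q)))).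
  + apply filterlim_locally. intros eps. exists eps. intros [a b] [Ha Hb]. split; [split; [exact Ha|apply ball_center]|pos].
  + apply (average_integrand_continuous w fX (fst p, snd p) t Hw HfX (H t Ht)).
 - weaken HL. intros x Hx. apply (average_ex_RInt w f (x, snd p)); auto.
Qed.

Lemma average_derive_y (w wy f fz : R -> R -> R) (p : pt) :
 continuous2 w -> continuous2 wy -> continuous_on_domain D f -> continuous_on_domain D fz ->
 (forall y t, is_derive (fun y => w y t) y (wy y t)) ->
 (forall X z, D X z -> is_derive (fun z => f X z) z (fz X z)) -> average_domain D xi c d p ->
 is_derive (fun y => average w f xi c d (fst p, y)) (snd p)
  (average wy f xi c d p + average (fun y t => w y t * geo_arg_y c d y t) fz xi c d p).
Proof.
 intros Hw Hwy Hf Hfz Dw Hd H. note (open2_snd_locally _ p average_domain_open H) as HL.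
 assert (Hg : continuous2 (fun y t => w y t * geo_arg_y c d y t)).
 { intros [a b]. apply continuous_Rmult; [auto|]. unfold geo_arg_y. cont. }
 apply is_derive_eq with (RInt (fun t => wy (snd p) t * f (fst p - xi) (geo_arg c d (snd p) t)
  + w (snd p) t * geo_arg_y c d (snd p) t * fz (fst p - xi) (geo_arg c d (snd p) t)) 0 PI).
 2:{ apply (RInt_Rplus (fun t => wy (snd p) t * f (fst p - xi) (geo_arg c d (snd p) t))).
   - apply (average_ex_RInt wy f); auto.
   - apply (average_ex_RInt _ fz p Hg Hfz H). }
 apply (is_derive_RInt_under (fun y t => w y t * f (fst p - xi) (geo_arg c d y t))
  (fun y t => wy y t * f (fst p - xi) (geo_arg c d y t)
   + w y t * geo_arg_y c d y t * fz (fst p - xi) (geo_arg c d y t))); [note PI_RGT_0; lra| | |].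
 - weaken HL. intros y Hy t Ht. eapply is_derive_eq.
  + apply is_derive_Rmult; [auto|]. apply (is_derive_Rcomp (fun z => f (fst p - xi) z) (fun y => geo_arg c d y t)).
   * apply Hd. apply (Hy t Ht).
   * instantiate (1 := geo_arg_y c d y t). unfold geo_arg, geo_arg_y. apply is_derive_Rminus; [apply is_derive_Rcmult, is_derive_cosh|].
    apply is_derive_Rmultc, is_derive_Rcmult, is_derive_sinh.
  + cbv beta; ring.
 - intros t Ht. assert (CI : continuous (fun q : R * R => ((fst p, fst q), snd q) : R * R * R) ((snd p, t) : R * R)).
  { apply filterlim_locally. intros eps. exists eps. intros [a b] [Ha Hb]. split; [split; [apply ball_center|exact Ha]|pos]. }
  apply continuous_Rplus.
  + apply (continuous_comp (fun q : R * R => ((fst p, fst q), snd q) : R * R * R)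
    (fun q : R * R * R => wy (snd (fst q)) (snd q) * f (fst (fst q) - xi) (geo_arg c d (snd (fst q)) (snd q))));
    [exact CI|].
   apply (average_integrand_continuous wy f (fst p, snd p) t Hwy Hf (H t Ht)).
  + apply (continuous_comp (fun q : R * R => ((fst p, fst q), snd q) : R * R * R)
    (fun q : R * R * R => (w (snd (fst q)) (snd q) * geo_arg_y c d (snd (fst q)) (snd q))
      * fz (fst (fst q) - xi) (geo_arg c d (snd (fst q)) (snd q)))); [pos|].
   apply (average_integrand_continuous _ fz (fst p, snd p) t Hg Hfz (H t Ht)).
 - weaken HL. intros y Hy. apply (average_ex_RInt w f (fst p, y)); auto.
Qed.
End Average.

(** * The potential and the factor sinh^(3/2) *)

Lemma sinh_pos y : 0 < y -> 0 < sinh y.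
Proof. intros. rewrite <- sinh_0. apply sinh_lt; auto. Qed.

Lemma P_sinh y : 0 < y -> P y = 1 / 4 + 3 / (4 * sinh y ^ 2).
Proof.
 intros Hy. note (sinh_pos y Hy) as Hs. unfold P, sinh in *. assert (E : exp (- y) = / exp y) by apply exp_Ropp.
 assert (E2 : exp (2 * y) = exp y * exp y) by (rewrite <- exp_plus; f_equal; ring).
 assert (E4 : exp (4 * y) = exp y * exp y * (exp y * exp y)) by (rewrite <- !exp_plus; f_equal; ring).
 rewrite E in *. rewrite E2, E4. note (exp_pos y). set (x := exp y) in *. assert (x * x - 1 <> 0).
 { intros H0. assert ((x - / x) / 2 = (x * x - 1) / (2 * x)) by fld. rewrite H1, H0 in Hs.
  unfold Rdiv in Hs. rewrite Rmult_0_l in Hs. lra. }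
 field. repeat split; lra.
Qed.

Definition sinh32 (y : R) : R := sinh y * sqrt (sinh y).

Lemma sinh32_pos y : 0 < y -> 0 < sinh32 y.
Proof. intros Hy. note (sinh_pos y Hy). apply Rmult_lt_0_compat; auto. apply sqrt_lt_R0; auto. Qed.

Lemma is_derive_sqrt_sinh y : 0 < y -> is_derive (fun y => sqrt (sinh y)) y (cosh y / (2 * sqrt (sinh y))).
Proof.
 intros Hy. note (sinh_pos y Hy) as Hs. eapply is_derive_eq.
 - apply (is_derive_Rcomp sqrt sinh y (/ (2 * sqrt (sinh y))) (cosh y)); [|apply is_derive_sinh].
  apply is_derive_Reals, derivable_pt_lim_sqrt; auto.
 - field. apply Rgt_not_eq, sqrt_lt_R0; auto.
Qed.

Lemma is_derive_sinh32 y : 0 < y -> is_derive sinh32 y (3 / 2 * cosh y * sqrt (sinh y)).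
Proof.
 intros Hy. note (sinh_pos y Hy) as Hs. note (sqrt_lt_R0 _ Hs) as Hq. unfold sinh32. eapply is_derive_eq.
 - apply is_derive_Rmult; [apply is_derive_sinh|apply is_derive_sqrt_sinh; auto].
 - cbv beta. rewrite <- (sqrt_sqrt (sinh y)) at 2 by lra. field. lra.
Qed.

(** The surplus 2 over [P] is what becomes the zeroth-order term of the equation for [g] after the
    substitution [u = sinh^(3/2) y * g]. *)
Lemma is_derive_sinh32' y : 0 < y ->
 is_derive (fun y => 3 / 2 * cosh y * sqrt (sinh y)) y ((2 + P y) * sinh32 y).
Proof.
 intros Hy. note (sinh_pos y Hy) as Hs. note (sqrt_lt_R0 _ Hs) as Hq. eapply is_derive_eq.
 - apply is_derive_Rmult; [apply is_derive_Rcmult, is_derive_cosh|apply is_derive_sqrt_sinh; auto].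
 - cbv beta. rewrite P_sinh by auto. unfold sinh32. note (cosh2_sinh2 y) as E.
  assert (Es : sqrt (sinh y) * sqrt (sinh y) = sinh y) by (apply sqrt_sqrt; lra). set (q := sqrt (sinh y)) in *. rewrite <- Es.
  replace (3 / 2 * cosh y * (cosh y / (2 * q))) with (3 / 4 * cosh y ^ 2 / q) by fld.
  replace (cosh y ^ 2) with (1 + (q * q) ^ 2) by nra. field. lra.
Qed.

(** Density of the polar angle on the 3-spheres about the origin of hyperbolic 4-space. *)
Definition wsin2 (_ t : R) : R := sin t ^ 2.

Lemma continuous2_wsin2 : continuous2 wsin2.
Proof. intros [a b]. unfold wsin2. cont. Qed.

(** The last equation is that of a function of [X] and [z] on the line times hyperbolic 4-space.
    With [kap = 1] the variable [z] is the hyperbolic cosine of a distance, with [kap = 0] a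
    horospherical coordinate; [kap] is the Minkowski norm [c^2 - d^2] of the centre in [geo_arg]. *)
Definition radial_solution (D : R -> R -> Prop) (kap : R) (f : R -> R -> R) : Prop :=
 (forall X z, D X z -> locally ((X, z) : R * R) (fun q => D (fst q) (snd q))) /\
 exists fX fz fXX fXz fzz : R -> R -> R,
 (continuous_on_domain D f /\ continuous_on_domain D fX /\ continuous_on_domain D fz /\
  continuous_on_domain D fXX /\ continuous_on_domain D fXz /\ continuous_on_domain D fzz) /\
 (forall X z, D X z -> is_derive (fun X => f X z) X (fX X z) /\ is_derive (fun z => f X z) z (fz X z) /\
   is_derive (fun X => fX X z) X (fXX X z) /\ is_derive (fun z => fX X z) z (fXz X z) /\
   is_derive (fun X => fz X z) X (fXz X z) /\ is_derive (fun z => fz X z) z (fzz X z) /\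
   fXX X z + (z ^ 2 - kap) * fzz X z + 4 * z * fz X z + 2 * f X z = 0).

Definition radial_U (f : R -> R -> R) (xi c d : R) (p : pt) : R :=
 sinh32 (snd p) * average wsin2 f xi c d p.

(** Averaging over rotations commutes with the Laplacian. Concretely, the averaged equation in polar
    coordinates differs from the average of the equation by the angular part of the Laplacian, whose
    integral against [sin^2 t] vanishes. *)
Lemma radial_U_harmonic D f xi c d : radial_solution D (c ^ 2 - d ^ 2) f ->
 Lharmonic_on (fun p => Sigma p /\ average_domain D xi c d p) (radial_U f xi c d).
Proof.
 intros [Dop [fX [fz [fXX [fXz [fzz [[C0 [CX [Cz [CXX [CXz Czz]]]]] HD]]]]]]]. set (wA := fun y t => wsin2 y t * geo_arg_y c d y t).
 set (wAA := fun y t => wA y t * geo_arg_y c d y t). set (wB := fun y t => wsin2 y t * geo_arg c d y t).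
 assert (W0 : continuous2 wsin2) by apply continuous2_wsin2.
 assert (W1 : continuous2 wA) by (intros [a b]; unfold wA, wsin2, geo_arg_y; cont).
 assert (W2 : continuous2 wAA) by (intros [a b]; unfold wAA, wA, wsin2, geo_arg_y; cont).
 assert (W3 : continuous2 wB) by (intros [a b]; unfold wB, wsin2, geo_arg; cont).
 assert (W4 : continuous2 (fun _ _ => 0)) by (intros [a b]; cont).
 assert (D0 : forall y t, is_derive (fun y => wsin2 y t) y 0) by (intros y t; exact (is_derive_Rconst (sin t ^ 2) y)).
 assert (D1 : forall y t, is_derive (fun y => wA y t) y (wB y t)).
 { intros y t. unfold wA, wB, wsin2, geo_arg_y, geo_arg. apply is_derive_Rcmult.
  apply is_derive_Rminus; [apply is_derive_Rcmult, is_derive_sinh|]. apply is_derive_Rmultc, is_derive_Rcmult, is_derive_cosh. }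
 assert (Z0 : forall g p, average (fun _ _ => 0) g xi c d p = 0).
 { intros g p. unfold average. rewrite (RInt_ext _ (fun _ => 0)); [|intros; eqR; ring].
  rewrite RInt_const. unfold scal; simpl; unfold mult; simpl. ring. }
 set (V := fun w f p => average w f xi c d p). set (S1 := fun y => 3 / 2 * cosh y * sqrt (sinh y)).
 set (U := fun p => Sigma p /\ average_domain D xi c d p). assert (HU : open2 U).
 { intros p [Hs Hp]. destruct (average_domain_open D xi c d Dop p Hp) as [e [He H]].
  exists (Rmin e (snd p)). split; [pos|]. intros z Hz. split.
  - note (Rabs_snd_dist2 z p) as H1. note (Rmin_r e (snd p)). apply Rabs_le_between in H1. unfold Sigma in *. lra.
  - apply H. note (Rmin_l e (snd p)). lra. }
 assert (CS : forall y, 0 < y -> continuous sinh32 y) by (intros; eapply is_derive_continuous, is_derive_sinh32; auto).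
 assert (CS1 : forall y, 0 < y -> continuous S1 y) by (intros; eapply is_derive_continuous, is_derive_sinh32'; auto).
 assert (CS2 : forall y, 0 < y -> continuous (fun y => (2 + P y) * sinh32 y) y).
 { intros y Hy. apply continuous_Rmult; auto. apply continuous_Rplus; [apply continuous_const|].
  apply continuous_ext_loc with (fun y => 1 / 4 + 3 / (4 * sinh y ^ 2)).
  - weaken (locally_pos y Hy). intros z Hz. symmetry. apply P_sinh; auto.
  - apply continuous_Rplus; [apply continuous_const|].
   apply continuous_Rmult; [apply continuous_const|]. apply (continuous_inv_fun (fun y : R => 4 * sinh y ^ 2)); [cont|].
   note (sinh_pos y Hy). apply Rgt_not_eq. apply Rmult_lt_0_compat; [lra|pos]. }
 assert (Csnd : forall (h : R -> R) p, continuous h (snd p) -> continuous (fun p : R * R => h (snd p)) p)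
  by (intros h [a b] Hh; apply (continuous_comp snd h); [apply continuous_snd|exact Hh]).
 assert (CV : forall w f p, continuous2 w -> continuous_on_domain D f -> U p -> continuous (V w f : R * R -> R) p)
  by (intros w g p Hw Hg [_ Hp]; exact (average_continuous D xi c d Dop w g p Hw Hg Hp)).
 assert (Dx : forall w g gX p, continuous2 w -> continuous_on_domain D g -> continuous_on_domain D gX ->
   (forall X z, D X z -> is_derive (fun X => g X z) X (gX X z)) -> U p ->
   is_derive (fun t => V w g (t, snd p)) (fst p) (V w gX p))
  by (intros w g gX p Hw Hg HgX Hd [_ Hp]; exact (average_derive_x D xi c d Dop w g gX p Hw Hg HgX Hd Hp)).
 assert (Dy : forall w wy g gz p, continuous2 w -> continuous2 wy -> continuous_on_domain D g -> continuous_on_domain D gz ->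
   (forall y t, is_derive (fun y => w y t) y (wy y t)) ->
   (forall X z, D X z -> is_derive (fun z => g X z) z (gz X z)) -> U p ->
   is_derive (fun t => V w g (fst p, t)) (snd p) (V wy g p + V (fun y t => w y t * geo_arg_y c d y t) gz p))
  by (intros w wy g gz p Hw Hwy Hg Hgz Dw Hd [_ Hp]; exact (average_derive_y D xi c d Dop w wy g gz p Hw Hwy Hg Hgz Dw Hd Hp)).
 assert (Dy0 : forall g gz p, continuous_on_domain D g -> continuous_on_domain D gz ->
   (forall X z, D X z -> is_derive (fun z => g X z) z (gz X z)) -> U p ->
   is_derive (fun t => V wsin2 g (fst p, t)) (snd p) (V wA gz p)).
 { intros g gz p Hg Hgz Hd Hp. eapply is_derive_eq.
  - apply (Dy wsin2 (fun _ _ => 0) g gz p); auto.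
  - unfold V at 1. rewrite Z0. fold wA. apply Rplus_0_l. }
 exists (fun p => sinh32 (snd p) * V wsin2 fX p). exists (fun p => S1 (snd p) * V wsin2 f p + sinh32 (snd p) * V wA fz p).
 exists (fun p => sinh32 (snd p) * V wsin2 fXX p). exists (fun p => S1 (snd p) * V wsin2 fX p + sinh32 (snd p) * V wA fXz p).
 exists (fun p => S1 (snd p) * V wsin2 fX p + sinh32 (snd p) * V wA fXz p).
 exists (fun p => (2 + P (snd p)) * sinh32 (snd p) * V wsin2 f p + S1 (snd p) * V wA fz p
   + (S1 (snd p) * V wA fz p + sinh32 (snd p) * (V wB fz p + V wAA fzz p))).
 split; [|repeat match goal with |- _ /\ _ => split end].
 - intros p Hp. note (proj1 Hp) as Hy. unfold Sigma in Hy. note (is_derive_sinh32 _ Hy) as DS. note (is_derive_sinh32' _ Hy) as DS1.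
  fold S1 in DS1. repeat match goal with |- _ /\ _ => split end; apply is_derive_Reals; unfold radial_U; simpl fst; simpl snd.
  + apply is_derive_Rcmult. apply (Dx wsin2 f fX); auto. intros X z Hz; apply HD; auto.
  + apply is_derive_Rmult; [exact DS|]. apply Dy0; auto. intros X z Hz; apply HD; auto.
  + apply is_derive_Rcmult. apply (Dx wsin2 fX fXX); auto. intros X z Hz; apply HD; auto.
  + apply (is_derive_Rmult sinh32 (fun t => V wsin2 fX (fst p, t))); [exact DS|]. apply Dy0; auto. intros X z Hz; apply HD; auto.
  + apply is_derive_Rplus; apply is_derive_Rcmult.
   * apply (Dx wsin2 f fX); auto. intros X z Hz; apply HD; auto.
   * apply (Dx wA fz fXz); auto. intros X z Hz; apply HD; auto.
  + apply is_derive_Rplus.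
   * apply (is_derive_Rmult S1 (fun t => V wsin2 f (fst p, t))); [exact DS1|]. apply Dy0; auto. intros X z Hz; apply HD; auto.
   * apply (is_derive_Rmult sinh32 (fun t => V wA fz (fst p, t))); [exact DS|].
    apply (Dy wA wB fz fzz); auto. intros X z Hz; apply HD; auto.
 - apply (cont2R_on_open U); auto. intros p Hp. apply continuous_Rmult; [apply Csnd, CS, Hp|apply CV; auto].
 - apply (cont2R_on_open U); auto. intros p Hp. apply continuous_Rmult; [apply Csnd, CS, Hp|apply CV; auto].
 - apply (cont2R_on_open U); auto. intros p Hp.
  apply continuous_Rplus; (apply continuous_Rmult; [apply Csnd; (apply CS || apply CS1); apply Hp|apply CV; auto]).
 - apply (cont2R_on_open U); auto. intros p Hp. apply continuous_Rmult; [apply Csnd, CS, Hp|apply CV; auto].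
 - apply (cont2R_on_open U); auto. intros p Hp.
  apply continuous_Rplus; (apply continuous_Rmult; [apply Csnd; (apply CS || apply CS1); apply Hp|apply CV; auto]).
 - apply (cont2R_on_open U); auto. intros p Hp.
  apply continuous_Rplus; (apply continuous_Rmult; [apply Csnd; (apply CS || apply CS1); apply Hp|apply CV; auto]).
 - apply (cont2R_on_open U); auto. intros p Hp. apply continuous_Rplus; [apply continuous_Rplus|apply continuous_Rplus].
  + apply continuous_Rmult; [apply (Csnd (fun y => (2 + P y) * sinh32 y)), CS2, Hp|apply CV; auto].
  + apply continuous_Rmult; [apply Csnd, CS1, Hp|apply CV; auto].
  + apply continuous_Rmult; [apply Csnd, CS1, Hp|apply CV; auto].
  + apply continuous_Rmult; [apply Csnd, CS, Hp|]. apply continuous_Rplus; apply CV; auto.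
 - intros p [Hy Hp]. unfold Sigma in Hy. note (sinh_pos _ Hy) as Hs.
  assert (Key : V wsin2 fXX p + 2 * V wsin2 f p + 3 * (cosh (snd p) / sinh (snd p)) * V wA fz p
    + V wB fz p + V wAA fzz p = 0).
  { unfold V, average. note (average_ex_RInt D xi c d wsin2 fXX p W0 CXX Hp) as X1.
   note (average_ex_RInt D xi c d wsin2 f p W0 C0 Hp) as X2. note (average_ex_RInt D xi c d wA fz p W1 Cz Hp) as X3.
   note (average_ex_RInt D xi c d wB fz p W3 Cz Hp) as X4. note (average_ex_RInt D xi c d wAA fzz p W2 Czz Hp) as X5.
   rewrite <- !RInt_Rcmult by auto. rewrite <- !RInt_Rplus by auto using ex_RInt_Rplus, ex_RInt_Rcmult.
   set (y := snd p) in *. set (X := fst p - xi) in *.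
   (* Up to sign, [Q] is [sin^2 t / sinh^2 y] times the [t]-derivative of [fz]'s primitive at
      [geo_arg]: the flux whose derivative is the angular Laplacian. It vanishes at both poles
      [t = 0] and [t = PI]. *)
   set (Q := fun t => - / sinh y ^ 2 * (sin t ^ 3 * (d * sinh y) * fz X (geo_arg c d y t))). transitivity (Q PI - Q 0).
   2:{ unfold Q. rewrite sin_PI, sin_0. eqR. ring. }
   apply (RInt_fundamental Q).
   - intros t Ht. rewrite Rmin_left, Rmax_right in Ht by (note PI_RGT_0; lra).
    specialize (Hp t Ht). fold X y in Hp. destruct (HD _ _ Hp) as [_ [_ [_ [_ [_ [Hzz Epde]]]]]]. unfold Q. eapply is_derive_eq.
    + apply is_derive_Rcmult, is_derive_Rmult.
     * apply is_derive_Rmultc. apply (is_derive_Rcomp (fun x => x ^ 3) sin t (3 * sin t ^ 2) (cos t)); [auto_derive; auto; ring|].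
      apply is_derive_Reals, derivable_pt_lim_sin.
     * apply (is_derive_Rcomp (fun z => fz X z) (fun t => geo_arg c d y t) t (fzz X (geo_arg c d y t)) (d * sinh y * sin t)); [exact Hzz|].
      unfold geo_arg. auto_derive; auto. ring.
    + cbv beta. unfold wAA, wB, wA, wsin2. set (A := geo_arg c d y t) in *.
     replace (fXX X A) with (- (A ^ 2 - (c ^ 2 - d ^ 2)) * fzz X A - 4 * A * fz X A - 2 * f X A) by lra.
     note (cosh2_sinh2 y) as Ech. note (sin2_cos2 t) as Esc. unfold Rsqr in Esc.
     (* The squared gradient of a Minkowski-linear function [A] on the hyperboloid is [A^2] minus
        the norm of the vector; here the radial component is isolated. *)
     assert (EA : geo_arg_y c d y t ^ 2 = A ^ 2 - (c ^ 2 - d ^ 2) - (d * sin t) ^ 2).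
     { unfold A, geo_arg, geo_arg_y. replace ((d * sin t) ^ 2) with (d ^ 2 * (1 - cos t * cos t)) by (rewrite <- Esc; ring).
      replace ((c * sinh y - d * cosh y * cos t) ^ 2)
       with (c ^ 2 * (sinh y ^ 2) - 2 * c * d * sinh y * cosh y * cos t + d ^ 2 * cosh y ^ 2 * cos t ^ 2) by ring.
      replace ((c * cosh y - d * sinh y * cos t) ^ 2)
       with (c ^ 2 * cosh y ^ 2 - 2 * c * d * sinh y * cosh y * cos t + d ^ 2 * (sinh y ^ 2) * cos t ^ 2) by ring.
      replace (sinh y ^ 2) with (cosh y ^ 2 - 1) by lra. ring. }
     assert (EB : 3 * (cosh y / sinh y) * geo_arg_y c d y t = 3 * A - 3 * d * cos t / sinh y).
     { unfold A, geo_arg, geo_arg_y. replace (3 * (c * cosh y - d * sinh y * cos t) - 3 * d * cos t / sinh y)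
       with (3 * c * cosh y - 3 * d * cos t * (sinh y ^ 2 + 1) / sinh y) by (field; lra).
      replace (sinh y ^ 2 + 1) with (cosh y ^ 2) by lra. field. lra. }
     replace (sin t ^ 2 * (- (A ^ 2 - (c ^ 2 - d ^ 2)) * fzz X A - 4 * A * fz X A - 2 * f X A) +
      2 * (sin t ^ 2 * f X A) + 3 * (cosh y / sinh y) * (sin t ^ 2 * geo_arg_y c d y t * fz X A) +
      sin t ^ 2 * A * fz X A + sin t ^ 2 * geo_arg_y c d y t * geo_arg_y c d y t * fzz X A)
      with (sin t ^ 2 * (- (A ^ 2 - (c ^ 2 - d ^ 2)) + geo_arg_y c d y t ^ 2) * fzz X A
       + sin t ^ 2 * (3 * (cosh y / sinh y) * geo_arg_y c d y t - 3 * A) * fz X A) by ring.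
     rewrite EA, EB. field. lra.
   - intros t Ht. rewrite Rmin_left, Rmax_right in Ht by (note PI_RGT_0; lra).
    assert (CI : continuous (fun t : R => (p, t) : R * R * R) t).
    { apply filterlim_locally. intros eps. exists eps. intros s Hs'. split; [apply ball_center|exact Hs']. }
    assert (CC : forall w g, continuous2 w -> continuous_on_domain D g ->
      continuous (fun t => w y t * g X (geo_arg c d y t)) t).
    { intros w g Hw Hg. apply (continuous_comp (fun t : R => (p, t) : R * R * R)
      (fun q : R * R * R => w (snd (fst q)) (snd q) * g (fst (fst q) - xi) (geo_arg c d (snd (fst q)) (snd q)))); auto.
     apply (average_integrand_continuous D xi c d w g p t); auto. }
    note (CC _ _ W0 CXX). note (CC _ _ W0 C0). note (CC _ _ W1 Cz). note (CC _ _ W3 Cz). note (CC _ _ W2 Czz). cbv beta in *.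
    repeat (apply continuous_Rplus); auto; apply continuous_Rmult; auto using continuous_const. }
  set (y := snd p) in *. unfold radial_U. fold y. fold V. change (average wsin2 f xi c d p) with (V wsin2 f p).
  replace (V wAA fzz p) with (- (V wsin2 fXX p + 2 * V wsin2 f p + 3 * (cosh y / sinh y) * V wA fz p + V wB fz p)) by lra.
  unfold S1, sinh32. set (q := sqrt (sinh y)). field. lra.
Qed.

(** * Explicit solutions *)

(** The coefficients [5] and [15 / 4 = 4 - 1 / 4] belong to hyperbolic 5-space, the resulting [4]
    and [2 = 9 / 4 - 1 / 4] to hyperbolic 4-space. The admissibility of [z * kz] is what controls
    the boundary term in [descent_pde]. *)
Lemma descent_radial_solution D (k kX kz kXX kXz kzz : R -> R -> R) (c kap : R) :
 kernel_domain D -> 0 < c ->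
 admissible D k -> admissible D kX -> admissible D kz -> admissible D kXX -> admissible D kXz ->
 admissible D kzz -> admissible D (fun X z => z * kz X z) ->
 (forall X z, D X z -> is_derive (fun X => k X z) X (kX X z) /\ is_derive (fun z => k X z) z (kz X z) /\
   is_derive (fun X => kX X z) X (kXX X z) /\ is_derive (fun z => kX X z) z (kXz X z) /\
   is_derive (fun X => kz X z) X (kXz X z) /\ is_derive (fun z => kz X z) z (kzz X z) /\
   kXX X z + (z ^ 2 - kap) * kzz X z + 5 * z * kz X z + 15 / 4 * k X z = 0) ->
 radial_solution D kap (fun X z => descent (k X) z c).
Proof.
 intros HD Hc A0 AX Az AXX AXz Azz Azz' H. split; [apply HD|].
 exists (fun X z => descent (kX X) z c), (fun X z => descent (kz X) z c), (fun X z => descent (kXX X) z c),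
  (fun X z => descent (kXz X) z c), (fun X z => descent (kzz X) z c).
 split; [repeat split; apply (continuous_descent D); assumption|]. intros X z Hz. repeat match goal with |- _ /\ _ => split end.
 - apply (is_derive_descent_X D k kX); auto. intros; apply H; auto.
 - apply (is_derive_descent_z D k kz); auto. intros; apply H; auto.
 - apply (is_derive_descent_X D kX kXX); auto. intros; apply H; auto.
 - apply (is_derive_descent_z D kX kXz); auto. intros; apply H; auto.
 - apply (is_derive_descent_X D kz kXz); auto. intros; apply H; auto.
 - apply (is_derive_descent_z D kz kzz); auto. intros; apply H; auto.
 - apply (descent_pde D k kz kzz kXX); auto; intros; apply H; auto.
Qed.

(** * Building blocks of admissible kernels *)

Lemma admissible_plus D k l : admissible D k -> admissible D l -> admissible D (fun X z => k X z + l X z).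
Proof.
 intros [C1 B1] [C2 B2]. split.
 - intros X z H. apply continuous_Rplus; [apply C1|apply C2]; auto.
 - intros X z H. destruct (B1 X z H) as [c1 [P1 H1]]. destruct (B2 X z H) as [c2 [P2 H2]].
  exists (c1 + c2). split; [lra|]. weaken (filter_and _ _ H1 H2). intros q [Q1 Q2] z' Hz'. eapply Rle_trans; [apply Rabs_triang|].
  specialize (Q1 z' Hz'). specialize (Q2 z' Hz'). lra.
Qed.

Lemma admissible_scal D (e : R -> R) k : (forall X, continuous e X) -> admissible D k ->
 admissible D (fun X z => e X * k X z).
Proof.
 intros He [C1 B1]. split.
 - intros X z H. apply continuous_Rmult; [|auto]. apply (continuous_comp fst e); [apply continuous_fst|auto].
 - intros X z H. destruct (B1 X z H) as [c1 [P1 H1]]. exists ((Rabs (e X) + 1) * c1). note (Rabs_pos (e X)). split; [nra|].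
  assert (L : locally ((X, z) : R * R) (fun q => Rabs (e (fst q)) < Rabs (e X) + 1)).
  { assert (CR : continuous (fun q : R * R => Rabs (e (fst q))) (X, z)).
   { apply (continuous_Rcomp Rabs); [|apply continuous_Rabs]. apply (continuous_comp fst e); [apply continuous_fst|auto]. }
   apply (CR (fun r => r < Rabs (e X) + 1)). apply locally_lt. simpl. lra. }
  weaken (filter_and _ _ H1 L). intros q [Q1 Q2] z' Hz'. rewrite Rabs_mult. specialize (Q1 z' Hz').
  note (Rabs_pos (k (fst q) z')). note (Rabs_pos (e (fst q))). rewrite Rmult_assoc. apply Rmult_le_compat; lra.
Qed.

Lemma admissible_ext D k l : (forall X z, k X z = l X z) -> admissible D k -> admissible D l.
Proof.
 intros E [C1 B1]. split.
 - intros X z H. apply (continuous_ext (fun q : R * R => k (fst q) (snd q))); [auto|]. apply C1; auto.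
 - intros X z H. destruct (B1 X z H) as [c1 [P1 H1]]. exists c1; split; auto. weaken H1. intros q Q1 z' Hz'. rewrite <- E. auto.
Qed.

(** The geometric range is [1 <= z]; the bound [/ 2] makes it open while keeping [arcL] under
    control. For [z < 1] the value [arcsq z] is negative, hence the explicit positivity of the
    Bessel argument. *)
Definition green_domain (X z : R) : Prop := / 2 < z /\ 0 < X ^ 2 + arcsq z.

Lemma continuous_arcsq z : 0 < z -> continuous arcsq z.
Proof. intros. eapply is_derive_continuous, is_derive_arcsq; auto. Qed.

Lemma continuous_green_arg X z : 0 < z -> continuous (fun q : R * R => fst q ^ 2 + arcsq (snd q)) (X, z).
Proof.
 intros Hz. apply continuous_Rplus; [apply continuous_Rpow, continuous_fst|].
 apply (continuous_comp snd arcsq); [apply continuous_snd|apply continuous_arcsq; auto].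
Qed.

Lemma green_domain_kernel : kernel_domain green_domain.
Proof.
 repeat split.
 - intros X z [H1 H2]. apply filter_and.
  + apply (continuous_snd X z (fun y => / 2 < y)). apply locally_gt; auto.
  + apply (continuous_green_arg X z ltac:(lra) (fun v => 0 < v)). apply locally_gt; auto.
 - destruct H. lra.
 - destruct H, H0; [|subst; auto]. note (arcsq_incr z z' ltac:(lra)). lra.
 - intros X z [H1 H2]. lra.
Qed.

Definition mid_domain (_ z : R) : Prop := / 2 < z.

Lemma mid_domain_kernel : kernel_domain mid_domain.
Proof.
 repeat split.
 - intros X z H. apply (continuous_snd X z (fun y => / 2 < y)). apply locally_gt; auto.
 - unfold mid_domain. intros; lra.
 - unfold mid_domain. intros; lra.
Qed.

Definition Ldecay (l : R -> R) : Prop :=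
 (forall z, / 2 < z -> continuous l z) /\
 exists C, 0 <= C /\ forall z, / 2 < z -> Rabs (l z) <= C * Rpower z (- (3 / 2)).

Definition mono_bounded (mu : R -> R) : Prop :=
 (forall v, 0 < v -> continuous mu v) /\
 forall a, 0 < a -> exists C, 0 <= C /\ forall v, a <= v -> Rabs (mu v) <= C.

Lemma admissible_atom l mu : Ldecay l -> mono_bounded mu ->
 admissible green_domain (fun X z => l z * mu (X ^ 2 + arcsq z)).
Proof.
 intros [Cl [C [HC Bl]]] [Cm Bm]. split.
 - intros X z [H1 H2]. apply continuous_Rmult.
  + apply (continuous_comp snd l); [apply continuous_snd|auto].
  + apply (continuous_comp (fun q : R * R => fst q ^ 2 + arcsq (snd q)) mu); [apply continuous_green_arg; lra|]. apply Cm; auto.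
 - intros X z [H1 H2]. set (v := X ^ 2 + arcsq z) in *. destruct (Bm (v / 2) ltac:(lra)) as [M [HM Bm']]. exists (C * M). split; [nra|].
  assert (L1 : locally ((X, z) : R * R) (fun q => / 2 < snd q))
   by (apply (continuous_snd X z (fun y => / 2 < y)); apply locally_gt; auto).
  assert (L2 : locally ((X, z) : R * R) (fun q => v / 2 < fst q ^ 2 + arcsq (snd q)))
   by (apply (continuous_green_arg X z ltac:(lra) (fun y => v / 2 < y)); apply locally_gt; simpl fst; simpl snd; fold v; lra).
  weaken (filter_and _ _ L1 L2). intros [X' z1] [Q1 Q2] z' Hz'; simpl in *. rewrite Rabs_mult.
  assert (Hv : v / 2 <= X' * (X' * 1) + arcsq z').
  { destruct Hz' as [Hz'| <-]; [|lra]. note (arcsq_incr z1 z' ltac:(lra)). lra. }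
  specialize (Bl z' ltac:(lra)). specialize (Bm' _ Hv). note (Rabs_pos (l z')). note (Rabs_pos (mu (X' * (X' * 1) + arcsq z'))).
  assert (0 < Rpower z' (- (3 / 2))) by apply exp_pos.
  replace (C * M * Rpower z' (- (3 / 2))) with (C * Rpower z' (- (3 / 2)) * M) by ring. apply Rmult_le_compat; lra.
Qed.

Lemma admissible_mid (e l : R -> R) : (forall X, continuous e X) -> Ldecay l ->
 admissible mid_domain (fun X z => e X * l z).
Proof.
 intros He [Cl [C [HC Bl]]]. apply (admissible_scal mid_domain e (fun _ z => l z)); auto. split.
 - intros X z H. apply (continuous_comp snd l); [apply continuous_snd|auto].
 - intros X z H. exists C. split; auto. assert (L1 : locally ((X, z) : R * R) (fun q => / 2 < snd q))
   by (apply (continuous_snd X z (fun y => / 2 < y)); apply locally_gt; auto).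
  weaken L1. intros [X' z1] Q1 z' Hz'; simpl in *. apply Bl. lra.
Qed.

Lemma mono_bounded_m : mono_bounded besselm.
Proof.
 split; [intros; eapply is_derive_continuous, is_derive_besselm; auto|].
 intros a Ha. exists (besselm a). split; [left; apply besselm_pos; auto|].
 intros v Hv. note (besselm_pos v ltac:(lra)). rewrite Rabs_right by lra. apply besselm_decr; lra.
Qed.

Lemma mono_bounded_m1 : mono_bounded besselm1.
Proof.
 split; [intros; eapply is_derive_continuous, is_derive_besselm1; auto|].
 intros a Ha. exists (- besselm1 a). split; [note (besselm1_neg a Ha); lra|].
 intros v Hv. note (besselm1_neg v ltac:(lra)). rewrite Rabs_left by lra. note (besselm1_incr a v ltac:(lra)). lra.
Qed.

Lemma mono_bounded_m2 : mono_bounded besselm2.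
Proof.
 split; [intros; eapply is_derive_continuous, is_derive_besselm2; auto|].
 intros a Ha. exists (besselm2 a). split; [left; apply besselm2_pos; auto|].
 intros v Hv. note (besselm2_pos v ltac:(lra)). rewrite Rabs_right by lra. apply besselm2_decr; lra.
Qed.

Lemma mono_bounded_m3 : mono_bounded besselm3.
Proof.
 split.
 - intros v Hv. unfold besselm3. apply continuous_Rmult.
  + apply continuous_Rminus; apply continuous_Rmult; try apply continuous_const;
    [apply mono_bounded_m1|apply mono_bounded_m2]; auto.
  + apply (continuous_inv_fun (fun v : R => v)); [apply continuous_id|lra].
 - intros a Ha. exists (- besselm3 a). split; [note (besselm3_neg a Ha); lra|]. intros v Hv. apply besselm3_abs_le; lra.
Qed.

Lemma Ldecay_mult_bounded (l b : R -> R) (K : R) : Ldecay l -> (forall z, / 2 < z -> continuous b z) ->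
 (forall z, / 2 < z -> Rabs (b z) <= K) -> Ldecay (fun z => l z * b z).
Proof.
 intros [Cl [C [HC Bl]]] Cb Bb. split.
 - intros z Hz. apply continuous_Rmult; auto.
 - assert (0 <= K) by (eapply Rle_trans; [apply Rabs_pos|apply (Bb 1); lra]).
  exists (C * K). split; [nra|]. intros z Hz. rewrite Rabs_mult.
  specialize (Bl z Hz). specialize (Bb z Hz). note (Rabs_pos (l z)). note (Rabs_pos (b z)).
  replace (C * K * Rpower z (- (3 / 2))) with (C * Rpower z (- (3 / 2)) * K) by ring. apply Rmult_le_compat; lra.
Qed.

Lemma Rpower_split_le (z p : R) : / 2 < z -> 0 <= p -> Rpower z (- (3 / 2 + p)) <= Rpower 2 p * Rpower z (- (3 / 2)).
Proof.
 intros Hz Hp. replace (- (3 / 2 + p)) with (- p + - (3 / 2)) by ring. rewrite Rpower_plus. apply Rmult_le_compat_r; [pos|].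
 eapply Rle_trans; [apply (Rpower_neg_le (/ 2) z p); lra|]. right. unfold Rpower. rewrite ln_Rinv by lra. f_equal. ring.
Qed.

Lemma arcL0_bounded z : / 2 < z -> Rabs (arcL 0 z) <= 32.
Proof.
 intros Hz. note (arcL_pos 0 z ltac:(lra)). rewrite Rabs_right by lra. eapply Rle_trans; [apply arcL0_le; lra|].
 assert (Rpower z (- (7 / 8)) <= 2); [|lra]. eapply Rle_trans; [apply (Rpower_neg_le (/ 2) z (7 / 8)); lra|].
 unfold Rpower. rewrite ln_Rinv by lra. replace 2 with (exp (ln 2)) at 2 by (apply exp_ln; lra).
 assert (0 < ln 2) by (rewrite <- ln_1; apply ln_increasing; lra). left. apply exp_increasing. lra.
Qed.

Lemma Ldecay_L0sq : Ldecay (fun z => arcL 0 z ^ 2).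
Proof.
 split.
 - intros z Hz. apply continuous_Rpow, continuous_arcL; lra.
 - exists (256 * Rpower 2 (1 / 4)). note (exp_pos (1 / 4 * ln 2)). unfold Rpower at 1. split; [lra|].
  intros z Hz. note (arcL_pos 0 z ltac:(lra)). note (arcL0_le z ltac:(lra)). rewrite Rabs_right by pos.
  apply Rle_trans with (256 * Rpower z (- (3 / 2 + 1 / 4))).
  + replace (- (3 / 2 + 1 / 4)) with (- (7 / 8) + - (7 / 8)) by field. rewrite Rpower_plus.
   note (exp_pos (- (7 / 8) * ln z)). unfold Rpower in *. nra.
  + note (Rpower_split_le z (1 / 4) Hz ltac:(lra)). lra.
Qed.

Lemma Ldecay_L1 : Ldecay (arcL 1).
Proof.
 split.
 - intros z Hz. apply continuous_arcL; lra.
 - exists (16 * Rpower 2 (3 / 8)). note (exp_pos (3 / 8 * ln 2)). unfold Rpower at 1. split; [lra|].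
  intros z Hz. note (arcL_pos 1 z ltac:(lra)). note (arcL1_le z ltac:(lra)). rewrite Rabs_right by lra.
  note (Rpower_split_le z (3 / 8) Hz ltac:(lra)). replace (- (3 / 2 + 3 / 8)) with (- (15 / 8)) in H2 by field. lra.
Qed.

Lemma Ldecay_le (l l' : R -> R) (K : R) : Ldecay l -> (forall z, / 2 < z -> continuous l' z) ->
 (forall z, / 2 < z -> Rabs (l' z) <= K * Rabs (l z)) -> 0 <= K -> Ldecay l'.
Proof.
 intros [Cl [C [HC Bl]]] Cl' B HK. split; auto. exists (K * C). split; [nra|]. intros z Hz. specialize (B z Hz). specialize (Bl z Hz).
 assert (K * Rabs (l z) <= K * (C * Rpower z (- (3 / 2)))) by nra. lra.
Qed.

Lemma Ldecay_ext (l l' : R -> R) : (forall z, l z = l' z) -> Ldecay l -> Ldecay l'.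
Proof.
 intros E [Cl [C [HC Bl]]]. split.
 - intros z Hz. apply (continuous_ext l); auto.
 - exists C; split; auto. intros z Hz. rewrite <- E. auto.
Qed.

Lemma Ldecay_zL0cube : Ldecay (fun z => z * arcL 0 z ^ 3).
Proof.
 split.
 - intros z Hz. apply continuous_Rmult; [apply continuous_id|]. apply continuous_Rpow, continuous_arcL; lra.
 - exists (4096 * Rpower 2 (1 / 8)). note (exp_pos (1 / 8 * ln 2)). unfold Rpower at 1. split; [lra|].
  intros z Hz. note (arcL_pos 0 z ltac:(lra)). note (arcL0_le z ltac:(lra)). rewrite Rabs_right by pos.
  apply Rle_trans with (4096 * Rpower z (- (3 / 2 + 1 / 8))).
  + replace (- (3 / 2 + 1 / 8)) with (1 + (- (7 / 8) + (- (7 / 8) + - (7 / 8)))) by field. rewrite !Rpower_plus, Rpower_1 by lra.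
   replace (4096 * (z * (Rpower z (- (7 / 8)) * (Rpower z (- (7 / 8)) * Rpower z (- (7 / 8))))))
    with (z * (16 * Rpower z (- (7 / 8))) ^ 3) by ring.
   apply Rmult_le_compat_l; [lra|]. apply pow_incr; lra.
  + note (Rpower_split_le z (1 / 8) Hz ltac:(lra)). lra.
Qed.

Lemma arcL_S_le2 n z : / 2 < z -> arcL (S n) z <= 2 * arcL n z.
Proof.
 intros Hz. note (arcL_S_le n z ltac:(lra)). note (arcL_pos (S n) z ltac:(lra)). nra.
Qed.

Lemma Ldecay_L2 : Ldecay (arcL 2).
Proof.
 apply (Ldecay_le (arcL 1) _ 2 Ldecay_L1); [intros; apply continuous_arcL; lra| |lra]. intros z Hz. note (arcL_S_le2 1 z Hz).
 note (arcL_pos 1 z ltac:(lra)). note (arcL_pos 2 z ltac:(lra)). rewrite !Rabs_right by lra. auto.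
Qed.

Lemma Ldecay_L3 : Ldecay (arcL 3).
Proof.
 apply (Ldecay_le (arcL 2) _ 2 Ldecay_L2); [intros; apply continuous_arcL; lra| |lra]. intros z Hz. note (arcL_S_le2 2 z Hz).
 note (arcL_pos 2 z ltac:(lra)). note (arcL_pos 3 z ltac:(lra)). rewrite !Rabs_right by lra. auto.
Qed.

Lemma Ldecay_zL2 : Ldecay (fun z => z * arcL 2 z).
Proof.
 apply (Ldecay_le (arcL 1) _ 1 Ldecay_L1); [intros; apply continuous_Rmult; [apply continuous_id|apply continuous_arcL; lra]| |lra].
 intros z Hz. note (arcL_S_le 1 z ltac:(lra)). note (arcL_pos 1 z ltac:(lra)). note (arcL_pos 2 z ltac:(lra)). rewrite !Rabs_right; nra.
Qed.

Lemma Ldecay_zL0L1 : Ldecay (fun z => z * (arcL 0 z * arcL 1 z)).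
Proof.
 apply (Ldecay_le (fun z => arcL 0 z ^ 2) _ 1 Ldecay_L0sq);
  [intros; apply continuous_Rmult; [apply continuous_id|apply continuous_Rmult; apply continuous_arcL; lra]| |lra].
 intros z Hz. note (arcL_S_le 0 z ltac:(lra)). note (arcL_pos 0 z ltac:(lra)). note (arcL_pos 1 z ltac:(lra)).
 rewrite !Rabs_right; [nra|pos|]. apply Rle_ge. apply Rmult_le_pos; [lra|]. apply Rmult_le_pos; lra.
Qed.

Lemma Ldecay_mult_L0 (l : R -> R) : Ldecay l -> Ldecay (fun z => l z * arcL 0 z).
Proof.
 intros H. apply (Ldecay_mult_bounded l (arcL 0) 32 H); [intros; apply continuous_arcL; lra|]. apply arcL0_bounded.
Qed.

Lemma Ldecay_mult_L1 (l : R -> R) : Ldecay l -> Ldecay (fun z => l z * arcL 1 z).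
Proof.
 intros H. apply (Ldecay_mult_bounded l (arcL 1) 64 H); [intros; apply continuous_arcL; lra|].
 intros z Hz. note (arcL0_bounded z Hz). note (arcL_S_le2 0 z Hz).
 note (arcL_pos 0 z ltac:(lra)). note (arcL_pos 1 z ltac:(lra)). rewrite Rabs_right in * by lra. lra.
Qed.

(** * The kernel with a pole *)

(** This is [- 2 d/dz] of [arcL 0 z * besselm (X^2 + arcsq z)]. That product is the radial solution
    on the line times hyperbolic 3-space: multiplied by [sinh s] it is [s * besselm (X^2 + s^2)],
    and [besselm (r^2)] is the decaying radial solution of [Laplacian = 1 / 4] in Euclidean 4-space.
    The derivative in [z] passes from dimension 3 to dimension 5. *)
Definition green_kernel (X z : R) : R :=
 - 4 * (arcL 0 z ^ 2 * besselm1 (X ^ 2 + arcsq z)) + 2 * (arcL 1 z * besselm (X ^ 2 + arcsq z)).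

Lemma is_derive_green_arg_X (mu mu' : R -> R) X z : 0 < X ^ 2 + arcsq z ->
 (forall v, 0 < v -> is_derive mu v (mu' v)) ->
 is_derive (fun X => mu (X ^ 2 + arcsq z)) X (mu' (X ^ 2 + arcsq z) * (2 * X)).
Proof.
 intros Hv Hm. apply (is_derive_Rcomp mu (fun X => X ^ 2 + arcsq z)); auto. auto_derive; auto; ring.
Qed.

Lemma is_derive_green_arg_z (mu mu' : R -> R) X z : 0 < z -> 0 < X ^ 2 + arcsq z ->
 (forall v, 0 < v -> is_derive mu v (mu' v)) ->
 is_derive (fun z => mu (X ^ 2 + arcsq z)) z (mu' (X ^ 2 + arcsq z) * (2 * arcL 0 z)).
Proof.
 intros Hz Hv Hm. apply (is_derive_Rcomp mu (fun z => X ^ 2 + arcsq z)); auto.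
 eapply is_derive_eq; [apply is_derive_Rplus; [apply is_derive_Rconst|apply is_derive_arcsq; auto]|ring].
Qed.

Lemma is_derive_arcL0 z : 0 < z -> is_derive (arcL 0) z (- arcL 1 z).
Proof. intros. eapply is_derive_eq; [apply is_derive_arcL; auto|simpl; ring]. Qed.
Lemma is_derive_arcL1 z : 0 < z -> is_derive (arcL 1) z (- 2 * arcL 2 z).
Proof. intros. eapply is_derive_eq; [apply is_derive_arcL; auto|auto]. Qed.
Lemma is_derive_arcL2 z : 0 < z -> is_derive (arcL 2) z (- 3 * arcL 3 z).
Proof. intros. eapply is_derive_eq; [apply is_derive_arcL; auto|simpl; ring]. Qed.

Lemma is_derive_Rpow (f : R -> R) (x a : R) (n : nat) :
 is_derive f x a -> is_derive (fun t => f t ^ S n) x (INR (S n) * f x ^ n * a).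
Proof.
 intros H. apply (is_derive_Rcomp (fun t => t ^ S n) f); auto. apply is_derive_Reals. apply (derivable_pt_lim_pow (f x) (S n)).
Qed.

Lemma green_radial_solution c : 0 < c ->
 radial_solution green_domain 1 (fun X z => descent (green_kernel X) z c).
Proof.
 intros Hc. note mono_bounded_m as M0. note mono_bounded_m1 as M1. note mono_bounded_m2 as M2. note mono_bounded_m3 as M3.
 note Ldecay_L0sq as N0. note Ldecay_L1 as N1. note Ldecay_L2 as N2. note (Ldecay_mult_L0 _ N1) as N10. note (Ldecay_mult_L0 _ N0) as N000.
 note (Ldecay_mult_L1 _ N1) as N11. note (Ldecay_mult_L0 _ N2) as N20.
 note (Ldecay_mult_L1 _ N0) as N001. note (Ldecay_mult_L0 _ N000) as N0000. note Ldecay_L3 as N3. set (v := fun X z => X ^ 2 + arcsq z).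
 assert (Cid : forall X : R, continuous (fun X => X) X) by (intros; apply continuous_id).
 assert (Cc : forall (r : R) X, continuous (fun _ : R => r) X) by (intros; apply continuous_const).
 assert (C2X : forall r X : R, continuous (fun X => r * X) X) by (intros; apply continuous_Rmult; auto).
 assert (C2XX : forall r X : R, continuous (fun X => r * X ^ 2) X)
  by (intros; apply continuous_Rmult; auto; apply continuous_Rpow; auto).
 assert (AT : forall (r : R) l mu, Ldecay l -> mono_bounded mu ->
   admissible green_domain (fun X z => r * (l z * mu (v X z))))
  by (intros r l mu Hl Hm; apply (admissible_scal _ (fun _ => r) (fun X z => l z * mu (v X z))); auto;
    apply admissible_atom; auto).
 apply (descent_radial_solution green_domain green_kernel
  (fun X z => 2 * X * (- 4 * (arcL 0 z ^ 2 * besselm2 (v X z)) + 2 * (arcL 1 z * besselm1 (v X z))))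
  (fun X z => 12 * (arcL 1 z * arcL 0 z * besselm1 (v X z)) + - 8 * (arcL 0 z ^ 2 * arcL 0 z * besselm2 (v X z))
        + - 4 * (arcL 2 z * besselm (v X z)))
  (fun X z => 2 * (- 4 * (arcL 0 z ^ 2 * besselm2 (v X z)) + 2 * (arcL 1 z * besselm1 (v X z)))
       + 4 * X ^ 2 * (- 4 * (arcL 0 z ^ 2 * besselm3 (v X z)) + 2 * (arcL 1 z * besselm2 (v X z))))
  (fun X z => 2 * X * (12 * (arcL 1 z * arcL 0 z * besselm2 (v X z)) + - 8 * (arcL 0 z ^ 2 * arcL 0 z * besselm3 (v X z))
        + - 4 * (arcL 2 z * besselm1 (v X z))))
  (fun X z => - 12 * (arcL 1 z * arcL 1 z * besselm1 (v X z)) + - 32 * (arcL 2 z * arcL 0 z * besselm1 (v X z))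
    + 48 * (arcL 0 z ^ 2 * arcL 1 z * besselm2 (v X z)) + - 16 * (arcL 0 z ^ 2 * arcL 0 z * arcL 0 z * besselm3 (v X z))
    + 12 * (arcL 3 z * besselm (v X z)))).
 - apply green_domain_kernel.
 - exact Hc.
 - apply admissible_plus; [apply (AT _ (fun z => arcL 0 z ^ 2))|apply AT]; auto.
 - apply (admissible_scal _ (fun X => 2 * X)); auto. apply admissible_plus; [apply (AT _ (fun z => arcL 0 z ^ 2))|apply AT]; auto.
 - apply admissible_plus; [apply admissible_plus|];
   [apply (AT _ (fun z => arcL 1 z * arcL 0 z))|apply (AT _ (fun z => arcL 0 z ^ 2 * arcL 0 z))|apply AT]; auto.
 - apply admissible_plus.
  + apply (admissible_scal _ (fun X => 2)); auto. apply admissible_plus; [apply (AT _ (fun z => arcL 0 z ^ 2))|apply AT]; auto.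
  + apply (admissible_scal _ (fun X => 4 * X ^ 2)); auto. apply admissible_plus; [apply (AT _ (fun z => arcL 0 z ^ 2))|apply AT]; auto.
 - apply (admissible_scal _ (fun X => 2 * X)); auto. apply admissible_plus; [apply admissible_plus|];
   [apply (AT _ (fun z => arcL 1 z * arcL 0 z))|apply (AT _ (fun z => arcL 0 z ^ 2 * arcL 0 z))|apply AT]; auto.
 - apply admissible_plus; [apply admissible_plus; [apply admissible_plus; [apply admissible_plus|]|]|];
   [apply (AT _ (fun z => arcL 1 z * arcL 1 z))|apply (AT _ (fun z => arcL 2 z * arcL 0 z))
   |apply (AT _ (fun z => arcL 0 z ^ 2 * arcL 1 z))|apply (AT _ (fun z => arcL 0 z ^ 2 * arcL 0 z * arcL 0 z))|apply AT]; auto.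
 - apply (admissible_ext _ (fun X z => 12 * (z * (arcL 0 z * arcL 1 z) * besselm1 (v X z))
    + - 8 * (z * arcL 0 z ^ 3 * besselm2 (v X z)) + - 4 * (z * arcL 2 z * besselm (v X z)))); [intros; ring|].
  apply admissible_plus; [apply admissible_plus|];
   [apply (AT _ (fun z => z * (arcL 0 z * arcL 1 z)))|apply (AT _ (fun z => z * arcL 0 z ^ 3))|apply (AT _ (fun z => z * arcL 2 z))];
   auto using Ldecay_zL0cube, Ldecay_zL2, Ldecay_zL0L1.
 - intros X z [Hz Hv]. assert (Hz0 : 0 < z) by lra. note (is_derive_green_arg_X besselm besselm1 X z Hv is_derive_besselm) as E0.
  note (is_derive_green_arg_X besselm1 besselm2 X z Hv is_derive_besselm1) as E1.
  note (is_derive_green_arg_X besselm2 besselm3 X z Hv is_derive_besselm2) as E2.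
  note (is_derive_green_arg_z besselm besselm1 X z Hz0 Hv is_derive_besselm) as F0.
  note (is_derive_green_arg_z besselm1 besselm2 X z Hz0 Hv is_derive_besselm1) as F1.
  note (is_derive_green_arg_z besselm2 besselm3 X z Hz0 Hv is_derive_besselm2) as F2.
  note (is_derive_arcL0 z Hz0) as G0. note (is_derive_arcL1 z Hz0) as G1. note (is_derive_arcL2 z Hz0) as G2.
  note (is_derive_Rpow (arcL 0) z _ 1 G0) as G00. assert (Q2X : is_derive (fun X => 2 * X) X 2) by (auto_derive; auto; ring).
  unfold green_kernel, v. repeat match goal with |- _ /\ _ => split end.
  + eapply is_derive_eq.
   * apply is_derive_Rplus; apply is_derive_Rcmult, is_derive_Rcmult; eassumption.
   * ring.
  + eapply is_derive_eq.
   * apply is_derive_Rplus; apply is_derive_Rcmult, is_derive_Rmult; eassumption.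
   * cbv beta. simpl INR. ring.
  + eapply is_derive_eq.
   * apply is_derive_Rmult; [eauto|]. apply is_derive_Rplus; apply is_derive_Rcmult, is_derive_Rcmult; eassumption.
   * cbv beta. ring.
  + eapply is_derive_eq.
   * apply is_derive_Rcmult. apply is_derive_Rplus; apply is_derive_Rcmult, is_derive_Rmult; eassumption.
   * cbv beta. simpl INR. ring.
  + eapply is_derive_eq.
   * apply is_derive_Rplus; [apply is_derive_Rplus|]; apply is_derive_Rcmult, is_derive_Rcmult; eassumption.
   * cbv beta. ring.
  + eapply is_derive_eq.
   * apply is_derive_Rplus; [apply is_derive_Rplus|]; apply is_derive_Rcmult, is_derive_Rmult; try eassumption;
     apply is_derive_Rmult; eassumption.
   * cbv beta. simpl INR. ring.
  + note (besselm_ode _ Hv) as O0. note (besselm_ode1 _ Hv) as O1.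
   note (arcL_ode z Hz0) as A0. note (arcL_ode1 z Hz0) as A1. note (arcL_ode2 z Hz0) as A2.
   assert (EX : X ^ 2 = (X ^ 2 + arcsq z) - (z ^ 2 - 1) * arcL 0 z ^ 2) by (unfold arcsq; ring).
   set (w := X ^ 2 + arcsq z) in *. rewrite EX.
   set (l0 := arcL 0 z) in *. set (l1 := arcL 1 z) in *. set (l2 := arcL 2 z) in *. set (l3 := arcL 3 z) in *.
   set (m0 := besselm w) in *. set (m1 := besselm1 w) in *. set (m2 := besselm2 w) in *. set (m3 := besselm3 w) in *.
   clearbody l0 l1 l2 l3 m0 m1 m2 m3 w. clear - O0 O1 A0 A1 A2. assert (B3 : 6 * (z ^ 2 - 1) * l3 = 10 * z * l2 - 4 * l1) by lra.
   assert (B2 : 2 * (z ^ 2 - 1) * l2 = 3 * z * l1 - l0) by lra. assert (B1 : (z ^ 2 - 1) * l1 = z * l0 - 1) by lra.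
   assert (P3 : w * m3 = m1 / 16 - 3 * m2) by lra. assert (P2 : w * m2 = m0 / 16 - 2 * m1) by lra. set (s := z ^ 2 - 1) in *.
   (* After elimination of [X^2] the terms are grouped so that the higher functions occur only as
      [w * m3], [w * m2], [s * l3], [s * l2], [s * l1], which the Bessel equations and those of
      [arcL] lower. *)
   match goal with |- ?lhs = 0 => replace lhs with (
    2 * (- 4 * (l0 ^ 2 * m2) + 2 * (l1 * m1)) + 4 * (- 4 * l0 ^ 2 * (w * m3) + 2 * l1 * (w * m2))
    - 4 * l0 ^ 2 * 2 * m2 * (s * l1)
    - 12 * l1 * m1 * (s * l1) - 16 * l0 * m1 * (2 * s * l2) + 48 * l0 ^ 2 * m2 * (s * l1) + 2 * m0 * (6 * s * l3)
    + 5 * z * (12 * (l1 * l0 * m1) + - 8 * (l0 ^ 2 * l0 * m2) + - 4 * (l2 * m0))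
    + 15 / 4 * (- 4 * (l0 ^ 2 * m1) + 2 * (l1 * m0))) by ring end.
   rewrite P3, P2, B3, B2, B1. field.
Qed.

(** * Product solutions exp (a x) f (z) *)

Lemma is_derive_exp_lin (a X : R) : is_derive (fun X => exp (a * X)) X (a * exp (a * X)).
Proof. auto_derive; auto. ring. Qed.

Lemma continuous_exp_lin (a X : R) : continuous (fun X => exp (a * X)) X.
Proof. eapply is_derive_continuous, is_derive_exp_lin. Qed.

(** The arbitrary constant [r] in the admissibility condition covers the factors [a] and [a^2]
    produced by derivatives in [X]. *)
Lemma product_radial_solution D (l l1 l2 : R -> R) (a c kap : R) : kernel_domain D -> 0 < c ->
 (forall r (g : R -> R), (g = l \/ g = l1 \/ g = l2 \/ g = (fun z => z * l1 z)) ->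
   admissible D (fun X z => r * exp (a * X) * g z)) ->
 (forall X z, D X z -> is_derive l z (l1 z) /\ is_derive l1 z (l2 z) /\
   a ^ 2 * l z + (z ^ 2 - kap) * l2 z + 5 * z * l1 z + 15 / 4 * l z = 0) ->
 radial_solution D kap (fun X z => descent (fun z => exp (a * X) * l z) z c).
Proof.
 intros HD Hc Hadm H. assert (Hadm' : forall g, (g = l \/ g = l1 \/ g = l2 \/ g = (fun z => z * l1 z)) ->
  admissible D (fun X z => exp (a * X) * g z)).
 { intros g Hg. apply (admissible_ext D (fun X z => 1 * exp (a * X) * g z)); [intros; ring|auto]. }
 apply (descent_radial_solution D (fun X z => exp (a * X) * l z) (fun X z => a * exp (a * X) * l z)
  (fun X z => exp (a * X) * l1 z) (fun X z => a * a * exp (a * X) * l z) (fun X z => a * exp (a * X) * l1 z)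
  (fun X z => exp (a * X) * l2 z)); auto.
 - apply (admissible_ext D (fun X z => exp (a * X) * (z * l1 z))); [intros; ring|]. apply (Hadm' (fun z => z * l1 z)); auto.
 - intros X z Hz. destruct (H X z Hz) as [H1 [H2 H3]]. repeat match goal with |- _ /\ _ => split end.
  + apply is_derive_Rmultc, is_derive_exp_lin.
  + apply is_derive_Rcmult; auto.
  + apply is_derive_Rmultc. eapply is_derive_eq; [apply is_derive_Rcmult, is_derive_exp_lin|ring].
  + apply is_derive_Rcmult; auto.
  + apply is_derive_Rmultc, is_derive_exp_lin.
  + apply is_derive_Rcmult; auto.
  + transitivity (exp (a * X) * (a ^ 2 * l z + (z ^ 2 - kap) * l2 z + 5 * z * l1 z + 15 / 4 * l z)); [ring|]. rewrite H3. ring.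
Qed.

(** With [a^2 = 1 / 4] the exponential absorbs the whole eigenvalue, and what remains is the radial
    equation of hyperbolic 5-space at the bottom of its spectrum. It is solved by [- d/dz] of
    [s / sinh s], the corresponding function in dimension 3. *)
Lemma corner_radial_solution (a c : R) : 0 < c -> a ^ 2 = 1 / 4 ->
 radial_solution mid_domain 1 (fun X z => descent (fun z => exp (a * X) * arcL 1 z) z c).
Proof.
 intros Hc Ha. apply (product_radial_solution mid_domain (arcL 1) (fun z => - 2 * arcL 2 z) (fun z => 6 * arcL 3 z)); auto.
 - apply mid_domain_kernel.
 - intros r g Hg. apply (admissible_mid (fun X => r * exp (a * X))).
  + intros X. apply continuous_Rmult; [apply continuous_const|apply continuous_exp_lin].
  + assert (Hs : forall q l, Ldecay l -> Ldecay (fun z => q * l z)).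
   { intros q l0 Hl. apply (Ldecay_ext (fun z => l0 z * q)); [intros; ring|].
    apply (Ldecay_mult_bounded l0 (fun _ => q) (Rabs q) Hl); [intros; apply continuous_const|intros; lra]. }
   destruct Hg as [-> | [-> | [-> | ->]]].
   * apply Ldecay_L1.
   * apply Hs, Ldecay_L2.
   * apply Hs, Ldecay_L3.
   * apply (Ldecay_ext (fun z => -2 * (z * arcL 2 z))); [intros; ring|]. apply Hs, Ldecay_zL2.
 - intros X z Hz. unfold mid_domain in Hz. split; [|split].
  + apply is_derive_arcL1; lra.
  + apply is_derive_eq with (-2 * (-3 * arcL 3 z)); [|ring]. apply (is_derive_Rcmult (-2) (arcL 2)). apply is_derive_arcL2; lra.
  + note (arcL_ode2 z ltac:(lra)). rewrite Ha. lra.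
Qed.

Definition pos_domain (_ z : R) : Prop := 0 < z.

Lemma pos_domain_kernel : kernel_domain pos_domain.
Proof.
 repeat split.
 - intros X z H. apply (continuous_snd X z (fun y => 0 < y)). apply locally_gt; auto.
 - unfold pos_domain. intros; lra.
 - unfold pos_domain. intros; lra.
Qed.

Lemma is_derive_Rpower (z p : R) : 0 < z -> is_derive (fun z => Rpower z p) z (p * Rpower z (p - 1)).
Proof. intros. apply is_derive_Reals, derivable_pt_lim_power; auto. Qed.

Lemma continuous_Rpower (z p : R) : 0 < z -> continuous (fun z => Rpower z p) z.
Proof. intros. eapply is_derive_continuous, is_derive_Rpower; auto. Qed.

Lemma admissible_power (e : R -> R) (q p : R) : (forall X, continuous e X) -> 0 <= p ->
 admissible pos_domain (fun X z => e X * (q * Rpower z (- (3 / 2 + p)))).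
Proof.
 intros He Hp. apply (admissible_scal pos_domain e (fun _ z => q * Rpower z (- (3 / 2 + p)))); auto. split.
 - intros X z H. apply (continuous_comp snd (fun z => q * Rpower z (- (3 / 2 + p)))); [apply continuous_snd|].
  apply continuous_Rmult; [apply continuous_const|apply continuous_Rpower; auto].
 - intros X z H. unfold pos_domain in H. exists (Rabs q * Rpower (z / 2) (- p)).
  note (Rabs_pos q). note (exp_pos (- p * ln (z / 2))). split; [pos|]. assert (L1 : locally ((X, z) : R * R) (fun q => z / 2 < snd q))
   by (apply (continuous_snd X z (fun y => z / 2 < y)); apply locally_gt; simpl; lra).
  weaken L1. intros [X' z1] Q1 z' Hz'; simpl in *. rewrite Rabs_mult, (Rabs_right (Rpower _ _)) by pos. rewrite Rmult_assoc.
  apply Rmult_le_compat_l; auto. replace (- (3 / 2 + p)) with (- p + - (3 / 2)) by ring. rewrite Rpower_plus.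
  apply Rmult_le_compat_r; [pos|]. apply Rpower_neg_le; lra.
Qed.

(** For a power [z^(- sigma)] the horospherical equation reduces to
    [(sigma - 2)^2 = 1 / 4 - a^2 = b^2]; the root [2 + b] decays fast enough for the descent. *)
Lemma theta_radial_solution (a b c : R) : 0 < c -> 0 <= b -> a ^ 2 + b ^ 2 = 1 / 4 ->
 radial_solution pos_domain 0 (fun X z => descent (fun z => exp (a * X) * Rpower z (- (2 + b))) z c).
Proof.
 intros Hc Hb Hab. apply (product_radial_solution pos_domain (fun z => Rpower z (- (2 + b)))
  (fun z => - (2 + b) * Rpower z (- (2 + b) - 1)) (fun z => - (2 + b) * ((- (2 + b) - 1) * Rpower z (- (2 + b) - 1 - 1)))); auto.
 - apply pos_domain_kernel.
 - assert (A : forall r q s, 0 <= s -> admissible pos_domain (fun X z => r * exp (a * X) * (q * Rpower z (- (3 / 2 + s))))).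
  { intros r q s Hs. apply (admissible_power (fun X => r * exp (a * X)) q s); auto.
   intros X. apply continuous_Rmult; [apply continuous_const|apply continuous_exp_lin]. }
  intros r g Hg. destruct Hg as [-> | [-> | [-> | ->]]].
  + apply (admissible_ext _ (fun X z => r * exp (a * X) * (1 * Rpower z (- (3 / 2 + (1 / 2 + b)))))); [|apply A; lra].
   intros X z. rewrite Rmult_1_l. do 2 f_equal. field.
  + apply (admissible_ext _ (fun X z => r * exp (a * X) * (- (2 + b) * Rpower z (- (3 / 2 + (3 / 2 + b)))))); [|apply A; lra].
   intros X z. do 3 f_equal. field.
  + apply (admissible_ext _ (fun X z => r * exp (a * X) * (- (2 + b) * (- (2 + b) - 1) * Rpower z (- (3 / 2 + (5 / 2 + b)))))); [|apply A; lra].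
   intros X z. rewrite (Rmult_assoc (- (2 + b))). do 4 f_equal. field.
  + assert (A' : admissible pos_domain (fun X z => r * exp (a * X) * (- (2 + b) * Rpower z (- (3 / 2 + (1 / 2 + b)))))) by (apply A; lra).
   destruct A' as [C1 B1]. split.
   * intros X z Hz. apply (continuous_ext_loc _ (fun q : R * R => r * exp (a * fst q) * (- (2 + b) * Rpower (snd q) (- (3 / 2 + (1 / 2 + b)))))); [|auto].
    weaken (proj1 pos_domain_kernel X z Hz). intros [X' z'] Hz'; unfold pos_domain in Hz'; simpl in *.
    replace (- (3 / 2 + (1 / 2 + b))) with ((- (2 + b) - 1) + 1) by field. rewrite Rpower_plus, Rpower_1 by auto. ring.
   * intros X z Hz. destruct (B1 X z Hz) as [C [HC HL]]. exists C; split; auto.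
    weaken (filter_and _ _ HL (proj1 pos_domain_kernel X z Hz)).
    intros [X' z'] [H1 H2] z'' Hz''; unfold pos_domain in H2; simpl in *. specialize (H1 z'' Hz'').
    replace (- (3 / 2 + (1 / 2 + b))) with ((- (2 + b) - 1) + 1) in H1 by field. rewrite Rpower_plus, Rpower_1 in H1 by lra.
    replace (r * exp (a * X') * (z'' * (- (2 + b) * Rpower z'' (- (2 + b) - 1))))
     with (r * exp (a * X') * (- (2 + b) * (Rpower z'' (- (2 + b) - 1) * z''))) by ring. exact H1.
 - intros X z Hz. unfold pos_domain in Hz. split; [|split].
  + apply is_derive_Rpower; auto.
  + apply is_derive_Rcmult, is_derive_Rpower; auto.
  + set (E := Rpower z (- (2 + b) - 1 - 1)). replace (Rpower z (- (2 + b))) with (E * z * z).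
   2:{ unfold E. replace (- (2 + b)) with ((- (2 + b) - 1 - 1) + (1 + 1)) at 2 by ring.
     rewrite !Rpower_plus, Rpower_1 by auto. ring. }
   replace (Rpower z (- (2 + b) - 1)) with (E * z).
   2:{ unfold E. replace (- (2 + b) - 1) with ((- (2 + b) - 1 - 1) + 1) at 2 by ring.
     rewrite !Rpower_plus, Rpower_1 by auto. ring. }
   replace (a ^ 2) with (1 / 4 - b ^ 2) by lra. field.
Qed.

Lemma Lharmonic_on_subset (U U' : pt -> Prop) (u : pt -> R) :
 (forall p, U' p -> U p) -> Lharmonic_on U u -> Lharmonic_on U' u.
Proof.
 intros HS [ux [uy [uxx [uxy [uyx [uyy [HD [C0 [C1 [C2 [C3 [C4 [C5 [C6 Hp]]]]]]]]]]]]]].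
 assert (HC : forall f, cont2R_on U f -> cont2R_on U' f).
 { intros f Hf a Ha eps Heps. destruct (Hf a (HS a Ha) eps Heps) as [d [Hd H]]. exists d; split; auto. }
 exists ux, uy, uxx, uxy, uyx, uyy. repeat (split; [auto|]). auto.
Qed.

(** * The averaged kernel: positivity and decay *)

(** Changing [c] only multiplies the descent integral by a constant (the integral scales as
    [c^(- 1 / 2)]). The choice [cosh (snd q)] in [green_avg] makes the rescaling by the height of
    the pole in [green_avg_scaled] exact. *)
Definition green_radial (c : R) (X z : R) : R := descent (green_kernel X) z c.
Definition green_avg (q p : pt) : R :=
 average wsin2 (green_radial (cosh (snd q))) (fst q) (cosh (snd q)) (sinh (snd q)) p.
Definition green_U (q p : pt) : R := sinh32 (snd p) * green_avg q p.

Lemma geo_arg_ge (q p : pt) t : 0 <= snd q -> 0 <= snd p ->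
 cosh (snd p - snd q) + sinh (snd q) * sinh (snd p) * (1 - cos t) = geo_arg (cosh (snd q)) (sinh (snd q)) (snd p) t /\
 0 <= sinh (snd q) * sinh (snd p).
Proof.
 intros Hq Hp. split.
 - unfold geo_arg, cosh, sinh. unfold Rminus. rewrite !Ropp_plus_distr, Ropp_involutive, !exp_plus. field.
 - assert (H0 : forall y, 0 <= y -> 0 <= sinh y).
  { intros y [Hy| <-]; [left; apply sinh_pos; auto|rewrite sinh_0; lra]. }
  apply Rmult_le_pos; auto.
Qed.

Lemma cosh_abs y : cosh (Rabs y) = cosh y.
Proof.
 unfold Rabs. destruct (Rcase_abs y); auto. unfold cosh. rewrite Ropp_involutive. field.
Qed.

Lemma arcsq_cosh_all y : arcsq (cosh y) = y ^ 2.
Proof. rewrite <- cosh_abs, arcsq_cosh by apply Rabs_pos. rewrite pow2_abs. reflexivity. Qed.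

Lemma arcsq_le a b : 0 < a <= b -> arcsq a <= arcsq b.
Proof. intros [H1 [H2| <-]]; [left; apply arcsq_incr; lra|lra]. Qed.

(** Among the rotated images of [p], the one at [t = 0], on the ray through the pole, is the
    closest. Hence the Bessel argument is at least the squared Euclidean distance in the half
    plane. *)
Lemma geo_arg_green (q p : pt) t : 0 <= snd q -> 0 <= snd p ->
 cosh (snd p - snd q) <= geo_arg (cosh (snd q)) (sinh (snd q)) (snd p) t /\
 dist2 p q ^ 2 <= (fst p - fst q) ^ 2 + arcsq (geo_arg (cosh (snd q)) (sinh (snd q)) (snd p) t).
Proof.
 intros Hq Hp. destruct (geo_arg_ge q p t Hq Hp) as [E H].
 assert (HA : cosh (snd p - snd q) <= geo_arg (cosh (snd q)) (sinh (snd q)) (snd p) t).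
 { rewrite <- E. note (COS_bound t). assert (0 <= sinh (snd q) * sinh (snd p) * (1 - cos t)) by pos. lra. }
 split; auto. rewrite dist2_sqr. apply Rplus_le_compat_l. rewrite <- arcsq_cosh_all. apply arcsq_le. note (cosh_ge1 (snd p - snd q)). lra.
Qed.

Lemma green_average_domain (q p : pt) : 0 <= snd q -> 0 <= snd p -> p <> q ->
 average_domain green_domain (fst q) (cosh (snd q)) (sinh (snd q)) p.
Proof.
 intros Hq Hp Hne t _. destruct (geo_arg_green q p t Hq Hp) as [H1 H2]. note (cosh_ge1 (snd p - snd q)). split; [lra|].
 assert (0 < dist2 p q ^ 2) by (apply pow_lt, dist2_gt0; auto). lra.
Qed.

Lemma green_U_harmonic (q : pt) : 0 <= snd q -> Lharmonic_on (fun p => Sigma p /\ p <> q) (green_U q).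
Proof.
 intros Hq. apply (Lharmonic_on_subset (fun p => Sigma p /\ average_domain green_domain (fst q) (cosh (snd q)) (sinh (snd q)) p)).
 - intros p [Hs Hne]. split; auto. apply green_average_domain; auto. unfold Sigma in Hs; lra.
 - apply (radial_U_harmonic green_domain (green_radial (cosh (snd q)))).
  rewrite cosh2_sinh2. apply green_radial_solution. note (cosh_ge1 (snd q)); lra.
Qed.

Lemma green_kernel_pos X z : green_domain X z -> 0 < green_kernel X z.
Proof.
 intros [Hz Hv]. unfold green_kernel. note (arcL_pos 0 z ltac:(lra)). note (arcL_pos 1 z ltac:(lra)).
 note (besselm_pos _ Hv). note (besselm1_neg _ Hv). assert (0 < arcL 0 z ^ 2) by pos. nra.
Qed.

Lemma admissible_green : admissible green_domain green_kernel.
Proof.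
 apply admissible_plus.
 - apply (admissible_scal _ (fun _ => -4) (fun X z => arcL 0 z ^ 2 * besselm1 (X ^ 2 + arcsq z)));
   [intros; apply continuous_const|].
  apply (admissible_atom (fun z => arcL 0 z ^ 2)); [apply Ldecay_L0sq|apply mono_bounded_m1].
 - apply (admissible_scal _ (fun _ => 2) (fun X z => arcL 1 z * besselm (X ^ 2 + arcsq z)));
   [intros; apply continuous_const|].
  apply admissible_atom; [apply Ldecay_L1|apply mono_bounded_m].
Qed.

Lemma descent_gt0 D k c X z : kernel_domain D -> admissible D k -> 0 < c -> D X z ->
 (forall z', z <= z' -> 0 < k X z') -> 0 < descent (k X) z c.
Proof.
 intros HD Hk Hc H Hpos. destruct (admissible_fixed D k X z HD Hk H) as [C1 [C [HC HB]]]. apply RInt_gt_0; [lra| |].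
 - intros e He. unfold descent_integrand. destruct (Rlt_dec 0 e); [|lra]. apply Rdiv_lt_0_compat; [|pos]. apply Hpos, descent_arg_ge; auto.
 - intros e _. apply (continuous_descent_integrand (k X) z c C); auto. eapply HD; eauto.
Qed.

Lemma average_gt0 D f xi c d (p : pt) : continuous_on_domain D f -> average_domain D xi c d p ->
 (forall X z, D X z -> 0 < f X z) -> 0 < average wsin2 f xi c d p.
Proof.
 intros Hf HD Hpos. apply RInt_gt_0; [apply PI_RGT_0| |].
 - intros t Ht. apply Rmult_lt_0_compat; [|apply Hpos, HD; lra]. apply pow_lt. apply sin_gt_0; lra.
 - intros t Ht. apply (continuous_comp (fun t : R => (p, t) : R * R * R)
   (fun q : R * R * R => wsin2 (snd (fst q)) (snd q) * f (fst (fst q) - xi) (geo_arg c d (snd (fst q)) (snd q)))).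
  + apply filterlim_locally. intros eps. exists eps. intros s Hs. split; [apply ball_center|pos].
  + apply (average_integrand_continuous D); auto. apply continuous2_wsin2.
Qed.

Lemma green_radial_continuous c : 0 < c -> continuous_on_domain green_domain (green_radial c).
Proof. intros Hc. apply (continuous_descent green_domain green_kernel c green_domain_kernel admissible_green Hc). Qed.

Lemma green_radial_pos c X z : 0 < c -> green_domain X z -> 0 < green_radial c X z.
Proof.
 intros Hc H. apply (descent_gt0 green_domain green_kernel); auto using green_domain_kernel, admissible_green.
 intros z' Hz'. apply green_kernel_pos. eapply green_domain_kernel; eauto.
Qed.

Lemma green_avg_pos (q p : pt) : 0 <= snd q -> 0 <= snd p -> p <> q -> 0 < green_avg q p.
Proof.
 intros Hq Hp Hne. note (cosh_ge1 (snd q)). unfold green_avg.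
 apply (average_gt0 green_domain); [apply green_radial_continuous; lra|apply green_average_domain; auto|].
 intros X z Hz. apply green_radial_pos; auto; lra.
Qed.

Lemma green_U_pos (q p : pt) : 0 <= snd q -> Sigma p -> p <> q -> 0 < green_U q p.
Proof.
 intros Hq Hp Hne. unfold Sigma in Hp. apply Rmult_lt_0_compat; [apply sinh32_pos; auto|]. apply green_avg_pos; auto; lra.
Qed.

Lemma besselm1_le_besselm r0 : 0 < r0 -> exists C, 0 < C /\ forall v, r0 ^ 2 <= v -> - besselm1 v <= C * besselm v.
Proof.
 intros Hr. exists ((1 / 4 + 3 / r0) / r0). assert (0 < 3 / r0) by pos. split; [pos|]. intros v Hv. assert (H0 : 0 < r0 ^ 2) by pos.
 assert (Hs : r0 <= sqrt v).
 { rewrite <- (sqrt_pow2 r0) by lra. apply sqrt_le_1_alt; auto. }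
 set (r := sqrt v) in *. replace v with (r ^ 2) by (unfold r; apply pow2_sqrt; lra).
 destruct (besselm_log_derivative r ltac:(lra)) as [_ H1]. note (besselm_pos (r ^ 2) ltac:(apply pow_lt; lra)) as Hm.
 note (besselm1_neg (r ^ 2) ltac:(apply pow_lt; lra)) as Hn.
 assert (H3 : 3 / r <= 3 / r0) by (apply Rmult_le_compat_l; [lra|apply Rinv_le_contravar; lra]). apply Rmult_le_reg_l with r0; auto.
 replace (r0 * ((1 / 4 + 3 / r0) / r0 * besselm (r ^ 2))) with ((1 / 4 + 3 / r0) * besselm (r ^ 2)) by fld.
 apply Rle_trans with (- (r * besselm1 (r ^ 2))); [nra|].
 apply Rle_trans with ((1 / 4 + 3 / r) * besselm (r ^ 2)); [lra|]. apply Rmult_le_compat_r; lra.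
Qed.

Lemma green_kernel_le r0 : 0 < r0 -> exists C, 0 < C /\ forall X z, 1 <= z -> r0 ^ 2 <= X ^ 2 + arcsq z ->
 green_kernel X z <= C * besselm (X ^ 2 + arcsq z) * Rpower z (- (7 / 4)).
Proof.
 intros Hr. destruct (besselm1_le_besselm r0 Hr) as [C [HC H]]. exists (1024 * C + 32). split; [lra|]. intros X z Hz Hv.
 assert (H0 : 0 < r0 ^ 2) by pos. specialize (H _ Hv). set (v := X ^ 2 + arcsq z) in *.
 note (besselm_pos v ltac:(lra)) as Hm. note (besselm1_neg v ltac:(lra)) as Hn.
 note (arcL_pos 0 z ltac:(lra)). note (arcL0_le z ltac:(lra)). note (arcL_pos 1 z ltac:(lra)). note (arcL1_le z ltac:(lra)).
 assert (E0 : arcL 0 z ^ 2 <= 256 * Rpower z (- (7 / 4))).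
 { replace (- (7 / 4)) with (- (7 / 8) + - (7 / 8)) by field. rewrite Rpower_plus. nra. }
 assert (E1 : arcL 1 z <= 16 * Rpower z (- (7 / 4))).
 { assert (Rpower z (- (15 / 8)) <= Rpower z (- (7 / 4))) by (apply Rle_Rpower; lra). lra. }
 assert (HR : 0 < Rpower z (- (7 / 4))) by apply exp_pos. set (R74 := Rpower z (- (7 / 4))) in *. unfold green_kernel. fold v.
 assert (P1 : arcL 0 z ^ 2 * - besselm1 v <= 256 * R74 * (C * besselm v)).
 { apply Rmult_le_compat; try lra. apply pow2_ge_0. }
 assert (P2 : arcL 1 z * besselm v <= 16 * R74 * besselm v) by nra. nra.
Qed.

Lemma RInt_jacobian (a b : R) : 0 < a -> 0 < b ->
 ex_RInt (fun e => / (a * e + b * (1 - e)) ^ 2) 0 1 /\ RInt (fun e => / (a * e + b * (1 - e)) ^ 2) 0 1 = / (a * b).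
Proof.
 intros Ha Hb. assert (Hp : forall e, 0 <= e <= 1 -> 0 < a * e + b * (1 - e)) by (intros; nra).
 assert (C : forall e, Rmin 0 1 <= e <= Rmax 0 1 -> continuous (fun e => / (a * e + b * (1 - e)) ^ 2) e).
 { intros e He. rewrite Rmin_left, Rmax_right in He by lra. specialize (Hp e He).
  apply continuous_of_ex_derive. auto_derive. apply Rgt_not_eq. nra. }
 split; [apply (ex_RInt_continuous (fun e => / (a * e + b * (1 - e)) ^ 2)); auto|].
 transitivity (1 / (b * (a * 1 + b * (1 - 1))) - 0 / (b * (a * 0 + b * (1 - 0)))); [|eqR; field; lra].
 apply (RInt_fundamental (fun e => e / (b * (a * e + b * (1 - e))))); auto.
 intros e He. rewrite Rmin_left, Rmax_right in He by lra. specialize (Hp e He). auto_derive; [pos|]. field. split; lra.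
Qed.

(** A descent costs half a power: [7 / 4] becomes [5 / 4]. Of [z^(- 7 / 4)] only [/ z] is kept under
    the integral, the rest is bounded by its value at [A]. Since [z e^2 = A e^2 + c (1 - e)^2] is at
    least half the square of [sqrt A * e + sqrt c * (1 - e)], the remaining integral is the explicit
    one of [RInt_jacobian]. *)
Lemma descent_le_power D k c C X A : kernel_domain D -> admissible D k -> D X A -> 1 <= A -> 1 <= c -> 0 <= C ->
 (forall z, A <= z -> 0 <= k X z <= C * Rpower z (- (7 / 4))) ->
 descent (k X) A c <= 2 * C * Rpower A (- (5 / 4)).
Proof.
 intros HD Hk H HA Hc HC Hb. assert (HsA : 0 < sqrt A) by pos. assert (Hsc : 1 <= sqrt c) by (rewrite <- sqrt_1; apply sqrt_le_1_alt; lra).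
 destruct (RInt_jacobian (sqrt A) (sqrt c) HsA ltac:(lra)) as [X1 E1].
 apply Rle_trans with (RInt (fun e => 2 * C * Rpower A (- (3 / 4)) * / (sqrt A * e + sqrt c * (1 - e)) ^ 2) 0 1).
 - apply RInt_le; [lra| | |].
  + apply (ex_RInt_descent_adm D); auto; lra.
  + apply ex_RInt_Rcmult; auto.
  + intros e He. unfold descent_integrand. destruct (Rlt_dec 0 e); [|lra]. note (descent_arg_ge A c e ltac:(lra)) as Hz.
   destruct (Hb _ Hz) as [_ H2]. assert (He2 : 0 < e ^ 2) by pos. set (z := A + c * ((1 - e) / e) ^ 2) in *.
   assert (Ez : Rpower z (- (7 / 4)) <= Rpower A (- (3 / 4)) * / z).
   { replace (- (7 / 4)) with (- (3 / 4) + - (1)) by field. rewrite Rpower_plus, (Rpower_Ropp z 1), Rpower_1 by lra.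
    apply Rmult_le_compat_r; [pos|]. apply Rpower_neg_le; lra. }
   assert (Hq : 0 < sqrt A * e + sqrt c * (1 - e)) by nra. assert (Hze : (sqrt A * e + sqrt c * (1 - e)) ^ 2 <= 2 * (z * e ^ 2)).
   { unfold z. replace ((A + c * ((1 - e) / e) ^ 2) * e ^ 2) with (A * e ^ 2 + c * (1 - e) ^ 2) by fld.
    rewrite <- (sqrt_sqrt A) at 2 by lra. rewrite <- (sqrt_sqrt c) at 2 by lra. note (pow2_ge_0 (sqrt A * e - sqrt c * (1 - e))). lra. }
   assert (Hi : / (z * e ^ 2) <= 2 * / (sqrt A * e + sqrt c * (1 - e)) ^ 2).
   { replace (2 * / (sqrt A * e + sqrt c * (1 - e)) ^ 2) with (/ ((sqrt A * e + sqrt c * (1 - e)) ^ 2 / 2)) by fld.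
    apply Rinv_le_contravar; [|lra]. apply Rdiv_lt_0_compat; [pos|lra]. }
   assert (HP : 0 < Rpower A (- (3 / 4))) by apply exp_pos.
   unfold Rdiv at 1. apply Rle_trans with (C * (Rpower A (- (3 / 4)) * / z) * / e ^ 2).
   * apply Rmult_le_compat_r; [pos|]. eapply Rle_trans; [eauto|]. apply Rmult_le_compat_l; auto.
   * replace (C * (Rpower A (- (3 / 4)) * / z) * / e ^ 2) with (C * Rpower A (- (3 / 4)) * / (z * e ^ 2)) by fld.
    replace (2 * C * Rpower A (- (3 / 4)) * / (sqrt A * e + sqrt c * (1 - e)) ^ 2)
     with (C * Rpower A (- (3 / 4)) * (2 * / (sqrt A * e + sqrt c * (1 - e)) ^ 2)) by ring.
    apply Rmult_le_compat_l; [|auto]. apply Rmult_le_pos; lra.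
 - rewrite RInt_Rcmult by auto. rewrite E1. replace (- (5 / 4)) with (- (3 / 4) + - (1 / 2)) by field.
  rewrite Rpower_plus, (Rpower_Ropp A (1 / 2)).
  replace (Rpower A (1 / 2)) with (sqrt A) by (rewrite <- Rpower_sqrt by lra; f_equal; field).
  assert (/ (sqrt A * sqrt c) <= / sqrt A) by (apply Rinv_le_contravar; nra). assert (0 <= 2 * C * Rpower A (- (3 / 4))) by pos.
  rewrite <- Rmult_assoc. apply Rmult_le_compat_l; auto.
Qed.

Lemma besselm_exp_le r0 : 0 < r0 -> exists C, 0 < C /\ forall r, r0 <= r -> besselm (r ^ 2) <= C * exp (- (r / 2)).
Proof.
 intros Hr. exists (besselm (r0 ^ 2) * exp (r0 / 2)). note (besselm_pos (r0 ^ 2) ltac:(apply pow_lt; auto)). note (exp_pos (r0 / 2)).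
 split; [pos|]. intros r Hrr. destruct (besselm_ratio r0 r ltac:(lra)) as [H1 _].
 rewrite Rmult_assoc, <- exp_plus. replace (r0 / 2 + - (r / 2)) with (- (r - r0) / 2) by field. exact H1.
Qed.

Lemma cosh_ge_exp y : exp y / 2 <= cosh y.
Proof. unfold cosh. note (exp_pos (- y)). lra. Qed.

Lemma exp_le a b : a <= b -> exp a <= exp b.
Proof. intros [H| ->]; [left; apply exp_increasing; auto|lra]. Qed.

Lemma average_le_const D f xi c d (p : pt) K : continuous_on_domain D f -> average_domain D xi c d p ->
 (forall t, 0 <= t <= PI -> 0 <= f (fst p - xi) (geo_arg c d (snd p) t) <= K) -> average wsin2 f xi c d p <= 4 * K.
Proof.
 intros Hf HD HK. note PI_RGT_0. note PI_4. assert (0 <= K) by (destruct (HK 0); lra). eapply Rle_trans; [apply Rle_abs|].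
 eapply Rle_trans.
 - apply (abs_RInt_le_const _ 0 PI K); [lra|apply (average_ex_RInt D); auto using continuous2_wsin2|].
  intros t Ht. destruct (HK t Ht) as [H2 H3]. unfold wsin2.  note (SIN_bound t).
  rewrite Rabs_mult, (Rabs_right (sin t ^ 2)), (Rabs_right (f _ _)) by pos. assert (sin t ^ 2 <= 1) by nra. note (pow2_ge_0 (sin t)). nra.
 - nra.
Qed.

(** The rate in [y] must exceed [3 / 2], the growth of [sinh32]. The descent yields [5 / 4] and the
    Bessel factor [exp (- rho / 2)] a further [2 / 5], in total [33 / 20], while [3 / 10] is left
    for the decay in [x]. *)
Lemma green_avg_decay (q : pt) dl : 0 <= snd q -> 0 < dl -> exists C, 0 < C /\ forall p : pt, 0 <= snd p -> dl <= dist2 p q ->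
 green_avg q p <= C * exp (- (33 / 20) * snd p - 3 / 10 * Rabs (fst p - fst q)).
Proof.
 intros Hq Hdl. destruct (green_kernel_le dl Hdl) as [C1 [HC1 HG]]. destruct (besselm_exp_le dl Hdl) as [C2 [HC2 HM]].
 set (K := exp (33 / 20 * snd q) * Rpower 2 (5 / 4)). assert (HK : 0 < K) by (apply Rmult_lt_0_compat; apply exp_pos).
 exists (8 * C1 * C2 * K). split; [pos|]. intros p Hp Hd. assert (Hne : p <> q) by (intros ->; rewrite dist2_refl in Hd; lra).
 note (green_average_domain q p Hq Hp Hne) as Hdom. note (cosh_ge1 (snd q)) as Hc. set (rho := dist2 p q) in *.
 replace (8 * C1 * C2 * K * exp (- (33 / 20) * snd p - 3 / 10 * Rabs (fst p - fst q)))
  with (4 * (2 * C1 * C2 * K * exp (- (33 / 20) * snd p - 3 / 10 * Rabs (fst p - fst q)))) by ring.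
 unfold green_avg. apply (average_le_const green_domain); auto; [apply green_radial_continuous; lra|].
 intros t Ht. note (Hdom t Ht) as HDt. split; [left; apply green_radial_pos; auto; lra|].
 destruct (geo_arg_green q p t Hq Hp) as [HA1 HA2]. note (cosh_ge1 (snd p - snd q)). fold rho in HA2.
 set (A := geo_arg (cosh (snd q)) (sinh (snd q)) (snd p) t) in *. set (X := fst p - fst q) in *.
 apply Rle_trans with (2 * (C1 * (C2 * exp (- (rho / 2)))) * Rpower A (- (5 / 4))).
 - apply (descent_le_power green_domain green_kernel); auto using green_domain_kernel, admissible_green; try lra.
  + note (exp_pos (- (rho / 2))). apply Rmult_le_pos; [lra|]. apply Rmult_le_pos; lra.
  + intros z Hz. assert (HDz : green_domain X z) by (eapply green_domain_kernel; eauto). split; [left; apply green_kernel_pos; auto|].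
   assert (Hv : rho ^ 2 <= X ^ 2 + arcsq z).
   { note (arcsq_le A z ltac:(lra)). lra. }
   eapply Rle_trans; [apply HG; [lra|]|].
   { eapply Rle_trans; [|eauto]. apply pow_incr; lra. }
   apply Rmult_le_compat_r; [pos|]. apply Rmult_le_compat_l; [lra|]. eapply Rle_trans; [|auto]. apply besselm_decr. split; [pos|auto].
 - assert (HAp : Rpower A (- (5 / 4)) <= Rpower 2 (5 / 4) * exp (- (5 / 4) * (snd p - snd q))).
  { note (cosh_ge_exp (snd p - snd q)). note (exp_pos (snd p - snd q)).
   eapply Rle_trans; [apply (Rpower_neg_le (exp (snd p - snd q) / 2) A (5 / 4)); lra|].
   right. unfold Rpower, Rdiv at 2. rewrite ln_mult, ln_exp, ln_Rinv by lra. rewrite <- exp_plus. f_equal. field. }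
  (* Cauchy-Schwarz against the unit vector [(3 / 5, 4 / 5)] splits the distance into a horizontal
     and a vertical part. *)
  assert (HX : 4 / 5 * (snd p - snd q) + 3 / 5 * Rabs X <= rho).
  { apply Rsqr_incr_0_var; [|lra]. unfold Rsqr. replace (rho * rho) with (rho ^ 2) by ring. unfold rho. rewrite dist2_sqr. fold X.
   rewrite <- (pow2_abs X). set (a := Rabs X). set (b := snd p - snd q). note (pow2_ge_0 (3 / 5 * b - 4 / 5 * a)). lra. }
  note (exp_pos (- (rho / 2))).
  apply Rle_trans with (2 * (C1 * (C2 * exp (- (rho / 2)))) * (Rpower 2 (5 / 4) * exp (- (5 / 4) * (snd p - snd q)))).
  { apply Rmult_le_compat_l; auto. apply Rmult_le_pos; [lra|]. apply Rmult_le_pos; [lra|]. apply Rmult_le_pos; lra. }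
  replace (2 * (C1 * (C2 * exp (- (rho / 2)))) * (Rpower 2 (5 / 4) * exp (- (5 / 4) * (snd p - snd q))))
   with (2 * C1 * C2 * Rpower 2 (5 / 4) * (exp (- (rho / 2)) * exp (- (5 / 4) * (snd p - snd q)))) by ring.
  replace (2 * C1 * C2 * K * exp (- (33 / 20) * snd p - 3 / 10 * Rabs X))
   with (2 * C1 * C2 * Rpower 2 (5 / 4) * (exp (33 / 20 * snd q) * exp (- (33 / 20) * snd p - 3 / 10 * Rabs X)))
   by (unfold K; ring).
  apply Rmult_le_compat_l; [pos|]. rewrite <- !exp_plus. apply exp_le. lra.
Qed.

Lemma sinh_ge_id y : 0 <= y -> y <= sinh y.
Proof.
 intros Hy. assert (sinh 0 - 0 <= sinh y - y); [|rewrite sinh_0 in *; lra].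
 apply (is_derive_nonneg_incr (fun y => sinh y - y) (fun y => cosh y - 1)); auto.
 - intros x _. apply is_derive_Rminus; [apply is_derive_sinh|apply is_derive_Rid].
 - intros x _. note (cosh_ge1 x). lra.
Qed.

Lemma cosh_ge_sqr y : 1 + y ^ 2 / 2 <= cosh y.
Proof.
 rewrite <- cosh_abs, <- pow2_abs. note (Rabs_pos y). set (x := Rabs y) in *. clearbody x.
 assert (cosh 0 - 0 ^ 2 / 2 <= cosh x - x ^ 2 / 2); [|rewrite cosh_0 in *; lra].
 apply (is_derive_nonneg_incr (fun y => cosh y - y ^ 2 / 2) (fun y => sinh y - y)); auto.
 - intros z _. apply is_derive_Rminus; [apply is_derive_cosh|]. auto_derive; auto; field.
 - intros z Hz. note (sinh_ge_id z). lra.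
Qed.

(** * Comparison and Harnack inequalities *)

Lemma cont2R_on_lin (U : pt -> Prop) (f g : pt -> R) (a b : R) :
 cont2R_on U f -> cont2R_on U g -> cont2R_on U (fun p => a * f p + b * g p).
Proof.
 intros Hf Hg p Hp. apply lim2R_filterlim.
 specialize (Hf p Hp). specialize (Hg p Hp). apply lim2R_filterlim in Hf. apply lim2R_filterlim in Hg. flim.
Qed.

Lemma derivable_pt_lim_lin (f g : R -> R) (x l m a b : R) :
 derivable_pt_lim f x l -> derivable_pt_lim g x m ->
 derivable_pt_lim (fun t => a * f t + b * g t) x (a * l + b * m).
Proof.
 intros Hf Hg. apply is_derive_Reals. apply is_derive_Reals in Hf. apply is_derive_Reals in Hg.
 apply is_derive_Rplus; apply is_derive_Rcmult; auto.
Qed.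

Lemma Lharmonic_lin (U : pt -> Prop) (u v : pt -> R) (a b : R) :
 Lharmonic_on U u -> Lharmonic_on U v -> Lharmonic_on U (fun p => a * u p + b * v p).
Proof.
 intros [ux [uy [uxx [uxy [uyx [uyy [HD [C0 [C1 [C2 [C3 [C4 [C5 [C6 Hp]]]]]]]]]]]]]]
     [vx [vy [vxx [vxy [vyx [vyy [HD' [C0' [C1' [C2' [C3' [C4' [C5' [C6' Hp']]]]]]]]]]]]]].
 exists (fun p => a * ux p + b * vx p), (fun p => a * uy p + b * vy p), (fun p => a * uxx p + b * vxx p),
  (fun p => a * uxy p + b * vxy p), (fun p => a * uyx p + b * vyx p), (fun p => a * uyy p + b * vyy p).
 split; [|repeat (split; [apply cont2R_on_lin; assumption|])].
 - intros p HU. destruct (HD p HU) as [? [? [? [? [? ?]]]]]. destruct (HD' p HU) as [? [? [? [? [? ?]]]]].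
  repeat split; apply derivable_pt_lim_lin; auto.
 - intros p HU. rewrite Rmult_plus_distr_l. replace (P (snd p) * (a * u p)) with (a * (P (snd p) * u p)) by ring.
  replace (P (snd p) * (b * v p)) with (b * (P (snd p) * v p)) by ring. rewrite <- Hp, <- Hp' by auto. ring.
Qed.

(** Subsolutions suffice for comparison, and the barriers used below are subsolutions only. *)
Definition Lsub (U : pt -> Prop) (w : pt -> R) : Prop :=
 exists wxx wyy, C2data U w wxx wyy /\ forall p, U p -> P (snd p) * w p <= wxx p + wyy p.

Lemma Lsub_lin (U : pt -> Prop) (u v : pt -> R) (a b : R) : 0 <= a -> 0 <= b ->
 Lsub U u -> Lsub U v -> Lsub U (fun p => a * u p + b * v p).
Proof.
 intros Ha Hb [uxx [uyy [[Cu [ux [uy Du]]] Hu]]] [vxx [vyy [[Cv [vx [vy Dv]]] Hv]]].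
 exists (fun p => a * uxx p + b * vxx p), (fun p => a * uyy p + b * vyy p). split; [split|].
 - apply cont2R_on_lin; auto.
 - exists (fun p => a * ux p + b * vx p), (fun p => a * uy p + b * vy p). intros p Hp.
  destruct (Du p Hp) as [? [? [? ?]]]. destruct (Dv p Hp) as [? [? [? ?]]]. repeat split; apply derivable_pt_lim_lin; auto.
 - intros p Hp. specialize (Hu p Hp). specialize (Hv p Hp).
  apply (Rmult_le_compat_l a) in Hu; auto. apply (Rmult_le_compat_l b) in Hv; auto. lra.
Qed.

Lemma Lharmonic_Lsub (U : pt -> Prop) (u : pt -> R) : Lharmonic_on U u -> Lsub U u.
Proof.
 intros [ux [uy [uxx [uxy [uyx [uyy [HD [C0 [C1 [C2 [C3 [C4 [C5 [C6 Hp]]]]]]]]]]]]]]. exists uxx, uyy. split; [split; auto|].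
 - exists ux, uy. intros p HU. destruct (HD p HU) as [? [? [? [? [? ?]]]]]. auto.
 - intros p HU. rewrite Hp by auto. lra.
Qed.

Lemma P_ge_quarter y : 0 < y -> 1 / 4 <= P y.
Proof.
 intros Hy. rewrite P_sinh by auto. note (sinh_pos y Hy). assert (0 < 3 / (4 * sinh y ^ 2)) by pos. lra.
Qed.

Lemma cont2R_on_const (U : pt -> Prop) (c : R) : cont2R_on U (fun _ => c).
Proof.
 intros p Hp eps He. exists 1. split; [lra|]. intros. rewrite Rminus_diag, Rabs_R0. auto.
Qed.

Lemma Lsub_const (U : pt -> Prop) (c : R) : (forall p, U p -> Sigma p) -> 0 <= c -> Lsub U (fun _ => - c).
Proof.
 intros HU Hc. exists (fun _ => 0), (fun _ => 0). split; [split|].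
 - apply cont2R_on_const.
 - exists (fun _ => 0), (fun _ => 0). intros p Hp. repeat split; apply derivable_pt_lim_const.
 - intros p Hp. note (P_ge_quarter (snd p) (HU p Hp)). nra.
Qed.

Lemma comparison (U : pt -> Prop) (w : pt -> R) :
 open2 U -> (forall p, U p -> Sigma p) -> Lsub U w ->
 (forall eta, 0 < eta -> exists M, forall p, U p -> M < Rabs (fst p) + Rabs (snd p) -> w p < eta) ->
 (forall eta, 0 < eta -> forall p, ~ U p -> exists d, 0 < d /\ forall z, U z -> dist2 z p < d -> w z < eta) ->
 forall p, U p -> w p <= 0.
Proof.
 intros HU HS [wxx [wyy [HC Hw]]]. apply (max_principle U w wxx wyy); auto.
 intros p Hp Hpos. specialize (Hw p Hp). note (P_ge_quarter (snd p) (HS p Hp)). nra.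
Qed.

Lemma open2_Sigma : open2 Sigma.
Proof.
 intros p Hp. exists (snd p). split; auto. intros z Hz. unfold Sigma in *. note (Rabs_snd_dist2 z p) as H. apply Rabs_le_between in H. lra.
Qed.

Lemma open2_and (U V : pt -> Prop) : open2 U -> open2 V -> open2 (fun p => U p /\ V p).
Proof.
 intros HU HV p [H1 H2]. destruct (HU p H1) as [a [Ha A]]. destruct (HV p H2) as [b [Hb B]]. exists (Rmin a b). split; [pos|]. intros z Hz.
 note (Rmin_l a b). note (Rmin_r a b). split; [apply A|apply B]; lra.
Qed.

Lemma open2_ne (q : pt) : open2 (fun p => p <> q).
Proof.
 intros p Hp. exists (dist2 p q). split; [apply dist2_gt0; auto|]. intros z Hz ->. rewrite dist2_sym in Hz. lra.
Qed.

Lemma open2_annulus (q : pt) (r1 r2 : R) : open2 (fun p => r1 < dist2 p q < r2).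
Proof.
 intros p Hp. exists (Rmin (dist2 p q - r1) (r2 - dist2 p q)). split; [pos|].
 intros z Hz. note (Rmin_l (dist2 p q - r1) (r2 - dist2 p q)). note (Rmin_r (dist2 p q - r1) (r2 - dist2 p q)).
 note (dist2_triang z p q). note (dist2_triang p z q). rewrite (dist2_sym p z) in *. lra.
Qed.

Lemma polar_angle (q p : pt) (r : R) : dist2 p q = r -> 0 < r ->
 exists t, - PI <= t <= PI /\ p = (fst q + r * cos t, snd q + r * sin t).
Proof.
 intros Hr Hr0. set (a := (fst p - fst q) / r). set (b := (snd p - snd q) / r). assert (E : a ^ 2 + b ^ 2 = 1).
 { unfold a, b. note (dist2_sqr p q) as H. rewrite Hr in H. replace (((fst p - fst q) / r) ^ 2 + ((snd p - snd q) / r) ^ 2)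
   with (((fst p - fst q) ^ 2 + (snd p - snd q) ^ 2) / r ^ 2) by fld.
  rewrite <- H. field. lra. }
 assert (Ha : -1 <= a <= 1) by nra. note (acos_bound a) as Hac. assert (Es : sin (acos a) = Rabs b).
 { rewrite sin_acos by auto. replace (1 - Rsqr a) with (Rsqr b) by (unfold Rsqr; lra). apply sqrt_Rsqr_abs. }
 assert (Hp : p = (fst q + r * a, snd q + r * b)).
 { destruct p; unfold a, b; simpl. f_equal; field; lra. }
 destruct (Rle_lt_dec 0 b) as [Hb|Hb].
 - exists (acos a). split; [lra|]. rewrite cos_acos, Es, Rabs_right by lra. exact Hp.
 - exists (- acos a). split; [lra|]. rewrite cos_neg, sin_neg, cos_acos, Es, Rabs_left by lra. rewrite Ropp_involutive. exact Hp.
Qed.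

(** * Harnack inequality on circles around a pole *)

(** A logarithmic derivative of at most 32 per unit of angle, over an arc of at most [2 PI]. *)
Definition harnack_const : R := exp (64 * PI).

Lemma log_lipschitz (f df : R -> R) (k a b : R) :
 (forall s, Rmin a b <= s <= Rmax a b -> is_derive f s (df s) /\ Rabs (df s) <= k * f s) -> f b <= exp (k * Rabs (b - a)) * f a.
Proof.
 intros H.
 assert (De : forall l s, Rmin a b <= s <= Rmax a b -> is_derive (fun s => f s * exp (l * s)) s (df s * exp (l * s) + f s * (l * exp (l * s)))).
 { intros l s Hs. apply (is_derive_Rmult f (fun s => exp (l * s))); [apply H; auto|apply is_derive_exp_lin]. }
 assert (Fin : forall l, f b * exp (l * b) <= f a * exp (l * a) -> f b <= exp (l * (a - b)) * f a).
 { intros l Hl. apply (Rmult_le_compat_r (exp (- l * b))) in Hl; [|pos]. rewrite !Rmult_assoc, <- !exp_plus in Hl.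
  replace (l * b + - l * b) with 0 in Hl by ring. replace (l * a + - l * b) with (l * (a - b)) in Hl by ring. rewrite exp_0 in Hl. lra. }
 assert (Hd : forall s, Rmin a b <= s <= Rmax a b -> 0 <= (k * f s - df s) * exp (- k * s) /\ 0 <= (k * f s + df s) * exp (k * s)).
 { intros s Hs. destruct (H s Hs) as [_ G]. apply Rabs_le_between in G. note (exp_pos (- k * s)). note (exp_pos (k * s)). split; apply Rmult_le_pos; lra. }
 destruct (Rle_lt_dec a b) as [Hab|Hab].
 - rewrite Rmin_left, Rmax_right in * by lra. rewrite Rabs_right by lra. replace (k * (b - a)) with (- k * (a - b)) by ring. apply Fin.
  apply (is_derive_nonpos_decr _ _ a b Hab (De (- k))). intros s Hs. specialize (Hd s ltac:(lra)). lra.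
 - rewrite Rmin_right, Rmax_left in * by lra. rewrite Rabs_left by lra. replace (- (b - a)) with (a - b) by ring. apply Fin.
  apply (is_derive_nonneg_incr _ _ b a ltac:(lra) (De k)). intros s Hs. specialize (Hd s ltac:(lra)). lra.
Qed.

(** The gradient estimate is used on discs of radius [r / 4] centred on the circle; their doubles
    avoid [q], so the constant does not depend on [r] and the inequality survives as the circles
    shrink to the pole. [M * r ^ 2 <= 16] is the smallness condition for radius [r / 4]. *)
Lemma circle_harnack (U : pt -> Prop) (w : pt -> R) (q : pt) (r M : R) :
 open2 U -> Lharmonic_on U w -> (forall z, U z -> 0 <= w z) -> 0 < r ->
 (forall z, 0 < dist2 z q < 2 * r -> U z /\ 0 <= P (snd z) <= M) -> M * r ^ 2 <= 16 ->
 forall p1 p2, dist2 p1 q = r -> dist2 p2 q = r -> w p2 <= harnack_const * w p1.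
Proof.
 intros HU [wx [wy [wxx [wxy [wyx [wyy HD]]]]]] Hw Hr Hin HM p1 p2 H1 H2. change (harmonic_data U w wx wy wxx wxy wyx wyy) in HD.
 destruct (polar_angle q p1 r H1 Hr) as [t1 [Ht1 ->]]. destruct (polar_angle q p2 r H2 Hr) as [t2 [Ht2 ->]].
 set (c := fun t => (fst q + r * cos t, snd q + r * sin t)). assert (Hc : forall t, dist2 (c t) q = r).
 { intros t. unfold dist2, c. simpl. replace ((fst q + r * cos t - fst q) * ((fst q + r * cos t - fst q) * 1) +
   (snd q + r * sin t - snd q) * ((snd q + r * sin t - snd q) * 1)) with (r ^ 2).
  - apply sqrt_pow2; lra.
  - note (sin2_cos2 t) as E. unfold Rsqr in E. replace (r ^ 2) with (r ^ 2 * (sin t * sin t + cos t * cos t)) by nra. ring. }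
 assert (Hgrad : forall t, Rabs (wx (c t)) <= 16 / r * w (c t) /\ Rabs (wy (c t)) <= 16 / r * w (c t)).
 { intros t. assert (Hdisc : forall z, dist2 z (c t) < 2 * (r / 4) -> 0 < dist2 z q < 2 * r).
  { intros z Hz. note (dist2_triang z (c t) q). note (dist2_triang (c t) z q). rewrite (dist2_sym (c t) z) in *. rewrite Hc in *. lra. }
  replace (16 / r) with (4 / (r / 4)) by fld. apply (gradient_bound U w wx wy wxx wxy wyx wyy (c t) (r / 4) HU HD ltac:(lra)) with M.
  - intros z Hz. apply Hin; auto.
  - auto.
  - intros z Hz. apply Hin; auto.
  - replace (M * (r / 4) ^ 2) with (M * r ^ 2 / 16) by field. lra. }
 destruct HD as [HD [C0 [C1 [C2 _]]]].
 assert (Dw : forall t, is_derive (fun t => w (c t)) t (wx (c t) * (- r * sin t) + wy (c t) * (r * cos t))).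
 { intros t. apply (C1_chain U w wx wy (fun t => fst q + r * cos t) (fun t => snd q + r * sin t)); auto.
  - apply (Hin (c t)). rewrite Hc. lra.
  - intros z Hz. destruct (HD z Hz) as [? [? _]]. auto.
  - auto_derive; auto; ring.
  - auto_derive; auto; ring. }
 assert (Hbd : forall t, Rabs (wx (c t) * (- r * sin t) + wy (c t) * (r * cos t)) <= 32 * w (c t)).
 { intros t. destruct (Hgrad t) as [G1 G2]. eapply Rle_trans; [apply Rabs_triang|]. rewrite !Rabs_mult, Rabs_Ropp, (Rabs_right r) by lra.
  assert (S1 : Rabs (sin t) <= 1) by (apply Rabs_le; note (SIN_bound t); lra).
  assert (S2 : Rabs (cos t) <= 1) by (apply Rabs_le; note (COS_bound t); lra).
  assert (Q : forall x s, 0 <= x <= 16 / r * w (c t) -> 0 <= s <= 1 -> x * (r * s) <= 16 * w (c t)).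
  { intros x s Hx Hs. apply Rle_trans with (16 / r * w (c t) * (r * 1)).
   - apply Rmult_le_compat; nra.
   - right. field. lra. }
  note (Q _ _ (conj (Rabs_pos _) G1) (conj (Rabs_pos _) S1)). note (Q _ _ (conj (Rabs_pos _) G2) (conj (Rabs_pos _) S2)). lra. }
 change (w (c t2) <= harnack_const * w (c t1)). assert (Hw1 : 0 <= w (c t1)) by (apply Hw, (Hin (c t1)); rewrite Hc; lra).
 note PI_RGT_0 as Hpi. unfold harnack_const.
 eapply Rle_trans; [apply (log_lipschitz (fun t => w (c t)) _ 32 t1 t2 (fun t _ => conj (Dw t) (Hbd t)))|].
 apply Rmult_le_compat_r; auto. apply exp_le. assert (Rabs (t2 - t1) <= 2 * PI) by (apply Rabs_le; lra). lra.
Qed.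

(** * Identification of the Green function *)

Lemma sinh_le x y : x <= y -> sinh x <= sinh y.
Proof.
 intros [H| ->]; [|lra]. unfold sinh. note (exp_le x y ltac:(lra)). note (exp_le (- y) (- x) ltac:(lra)). lra.
Qed.

Lemma sinh32_le_exp y : 0 < y -> sinh32 y <= exp (3 / 2 * y).
Proof.
 intros Hy. unfold sinh32. note (sinh_pos y Hy) as Hs.
 assert (H1 : sinh y <= exp y) by (unfold sinh; note (exp_pos y); note (exp_pos (- y)); lra).
 replace (exp (3 / 2 * y)) with (exp y * exp (y / 2)) by (rewrite <- exp_plus; f_equal; field).
 apply Rmult_le_compat; auto; [lra|apply sqrt_pos|]. rewrite <- (sqrt_pow2 (exp (y / 2))) by (left; apply exp_pos). apply sqrt_le_1_alt.
 simpl. rewrite Rmult_1_r, <- exp_plus. replace (y / 2 + y / 2) with y by field. auto.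
Qed.

Lemma sinh32_small eps : 0 < eps -> exists d, 0 < d /\ forall y, 0 < y < d -> sinh32 y < eps.
Proof.
 intros He. assert (C : continuous (fun y => sinh y * sqrt (sinh y)) 0).
 { apply continuous_Rmult; [apply continuous_sinh; apply continuous_id|]. apply (continuous_comp sinh sqrt); [apply continuous_sinh; apply continuous_id|].
  apply continuity_pt_filterlim, continuity_pt_sqrt. rewrite sinh_0. lra. }
 specialize (C (ball 0 (mkposreal eps He))). destruct C as [d Hd].
 { exists (mkposreal eps He). rewrite sinh_0, Rmult_0_l. auto. }
 exists d. split; [apply cond_pos|]. intros y Hy. specialize (Hd y).
 assert (B : ball 0 d y) by (change (Rabs (y - 0) < d); rewrite Rabs_right; lra).
 specialize (Hd B). change (Rabs (sinh y * sqrt (sinh y) - 0) < eps) in Hd. unfold sinh32. apply Rabs_def2 in Hd. lra.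
Qed.

Lemma green_U_decay (q : pt) dl : 0 <= snd q -> 0 < dl -> exists C, 0 < C /\ forall p : pt, Sigma p -> dl <= dist2 p q ->
 green_U q p <= C * exp (- (3 / 20) * snd p - 3 / 10 * Rabs (fst p - fst q)) /\ green_U q p <= C * sinh32 (snd p).
Proof.
 intros Hq Hdl. destruct (green_avg_decay q dl Hq Hdl) as [C [HC H]]. exists C. split; auto. intros p Hp Hd.
 unfold Sigma in Hp. specialize (H p ltac:(lra) Hd). unfold green_U.
 note (sinh32_pos _ Hp) as S. note (sinh32_le_exp _ Hp) as SE. note (Rabs_pos (fst p - fst q)). split.
 - replace (C * exp (- (3 / 20) * snd p - 3 / 10 * Rabs (fst p - fst q))) with
   (exp (3 / 2 * snd p) * (C * exp (- (33 / 20) * snd p - 3 / 10 * Rabs (fst p - fst q)))).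
  + apply Rle_trans with (sinh32 (snd p) * (C * exp (- (33 / 20) * snd p - 3 / 10 * Rabs (fst p - fst q)))).
   * apply Rmult_le_compat_l; lra.
   * apply Rmult_le_compat_r; [|lra]. left. apply Rmult_lt_0_compat; [auto|apply exp_pos].
  + rewrite Rmult_comm, Rmult_assoc, <- exp_plus. do 2 f_equal. field.
 - rewrite Rmult_comm. apply Rmult_le_compat_r; [lra|]. eapply Rle_trans; [exact H|].
  rewrite <- (Rmult_1_r C) at 2. apply Rmult_le_compat_l; [lra|]. rewrite <- exp_0. apply exp_le. lra.
Qed.

Lemma exp_neg_small eps : 0 < eps -> exists M, forall s, M < s -> exp (- s) < eps.
Proof.
 intros He. exists (- ln eps). intros s Hs. rewrite <- (exp_ln eps He). apply exp_increasing. lra.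
Qed.

Lemma green_U_at_infinity (q : pt) eps : 0 <= snd q -> 0 < eps -> exists M, forall p : pt, Sigma p ->
 M < Rabs (fst p) + Rabs (snd p) -> green_U q p < eps.
Proof.
 intros Hq He. destruct (green_U_decay q 1 Hq ltac:(lra)) as [C [HC H]].
 destruct (exp_neg_small (eps / C)) as [M HM]; [apply Rdiv_lt_0_compat; lra|].
 exists (Rmax (Rabs (fst q) + snd q + 2) (20 / 3 * M + 2 * Rabs (fst q))). intros p Hp Hl. unfold Sigma in Hp.
 rewrite (Rabs_right (snd p)) in Hl by lra. note (Rmax_l (Rabs (fst q) + snd q + 2) (20 / 3 * M + 2 * Rabs (fst q))).
 note (Rmax_r (Rabs (fst q) + snd q + 2) (20 / 3 * M + 2 * Rabs (fst q))).
 note (Rabs_triang (fst p - fst q) (fst q)) as T. replace (fst p - fst q + fst q) with (fst p) in T by ring. note (Rabs_pos (fst q)).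
 assert (Hd : 1 <= dist2 p q).
 { apply Rnot_lt_le. intros Hd. note (Rabs_fst_dist2 p q). note (Rabs_snd_dist2 p q) as T2. apply Rabs_le_between in T2. lra. }
 destruct (H p Hp Hd) as [Hdec _]. eapply Rle_lt_trans; [exact Hdec|].
 replace eps with (C * (eps / C)) by (field; lra). apply Rmult_lt_compat_l; auto.
 eapply Rle_lt_trans; [|apply (HM (3 / 20 * (snd p + Rabs (fst p - fst q)))); lra]. apply exp_le. note (Rabs_pos (fst p - fst q)). lra.
Qed.

Lemma green_U_at_edge (q : pt) dl eps : 0 <= snd q -> 0 < dl -> 0 < eps -> exists h, 0 < h /\ forall p : pt, Sigma p ->
 snd p < h -> dl <= dist2 p q -> green_U q p < eps.
Proof.
 intros Hq Hdl He. destruct (green_U_decay q dl Hq Hdl) as [C [HC H]].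
 destruct (sinh32_small (eps / C)) as [h [Hh S]]; [apply Rdiv_lt_0_compat; lra|].
 exists h. split; auto. intros p Hp Hs Hd. eapply Rle_lt_trans; [apply H; auto|].
 replace eps with (C * (eps / C)) by (field; lra). apply Rmult_lt_compat_l; auto.
Qed.

(** [green_U q] tends to 0 at the boundary line away from [q] and at infinity, so an inequality on
    the circle propagates outwards. The pole may lie on the boundary line, in which case the circle
    is a half circle in [Sigma]. *)
Lemma green_outside (q : pt) (v : pt -> R) (k r : R) : 0 <= snd q -> 0 <= k -> 0 < r ->
 Lharmonic_on (fun p => Sigma p /\ p <> q) v -> (forall p, Sigma p -> p <> q -> 0 <= v p) ->
 (forall p, Sigma p -> dist2 p q = r -> k * green_U q p <= v p) ->
 forall p, Sigma p -> r <= dist2 p q -> k * green_U q p <= v p.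
Proof.
 intros Hq Hk Hr Hv Hpos Hc p Hp Hpr. destruct (Req_dec (dist2 p q) r) as [E|E]; auto.
 assert (Hne : forall z, r <= dist2 z q -> z <> q) by (intros z Hz ->; rewrite dist2_refl in Hz; lra).
 set (g := fun p => k * green_U q p + - (1) * v p).
 assert (HL : Lharmonic_on (fun p => Sigma p /\ p <> q) g) by (apply Lharmonic_lin; auto; apply green_U_harmonic; auto).
 assert (Hsmall : forall eta, 0 < eta -> 0 < eta / (k + 1)) by (intros; pos).
 assert (Hg : forall z eta, Sigma z -> r <= dist2 z q -> green_U q z < eta / (k + 1) -> g z < eta).
 { intros z eta Hz Hzr Hu. note (green_U_pos q z Hq Hz (Hne z Hzr)). note (Hpos z Hz (Hne z Hzr)). unfold g.
  apply (Rmult_lt_compat_l (k + 1)) in Hu; [|lra]. replace ((k + 1) * (eta / (k + 1))) with eta in Hu by fld. nra. }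
 cut (g p <= 0); [unfold g; lra|]. apply (comparison (fun z => Sigma z /\ r < dist2 z q) g).
 - apply open2_and; [apply open2_Sigma|]. intros z Hz. exists (dist2 z q - r). split; [lra|]. intros z' Hz'.
  note (dist2_triang z z' q). rewrite (dist2_sym z z') in *. lra.
 - tauto.
 - apply Lharmonic_Lsub. eapply Lharmonic_on_subset; [|exact HL]. intros z [Hz Hz']. split; auto. apply Hne; lra.
 - intros eta He. destruct (green_U_at_infinity q (eta / (k + 1)) Hq (Hsmall eta He)) as [M HM].
  exists M. intros z [Hz Hz'] Hl. apply Hg; auto. lra.
 - intros eta He z Hz. destruct (Rle_lt_dec (snd z) 0) as [Hz0|Hz0].
  + destruct (green_U_at_edge q r (eta / (k + 1)) Hq Hr (Hsmall eta He)) as [h [Hh HE]]. exists h. split; auto. intros z' [Hz1 Hz2] Hd.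
   note (Rabs_snd_dist2 z' z) as T. apply Rabs_le_between in T. apply Hg; auto; [lra|]. apply HE; auto; lra.
  + destruct (Rlt_le_dec (dist2 z q) r) as [A|A].
   { exists (r - dist2 z q). split; [lra|]. intros z' Hz' Hd. note (dist2_triang z' z q). lra. }
   assert (Ez : dist2 z q = r) by (apply Rle_antisym; auto; apply Rnot_lt_le; intros C; apply Hz; split; auto).
   assert (Uz : Sigma z /\ z <> q) by (split; [exact Hz0|apply Hne; auto]). specialize (Hc z Hz0 Ez).
   destruct HL as [ux [uy [uxx [uxy [uyx [uyy [_ [C0 _]]]]]]]]. destruct (C0 z Uz eta He) as [d [Hd HC]].
   exists d. split; auto. intros z' [Hz1 Hz2] Hd'. specialize (HC z' (conj Hz1 (Hne z' ltac:(lra))) Hd'). apply Rabs_def2 in HC. unfold g in *. lra.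
 - split; auto. lra.
Qed.

Lemma P_le y0 y : 0 < y0 <= y -> P y <= P y0.
Proof.
 intros H. rewrite !P_sinh by lra. note (sinh_pos y0 ltac:(lra)). note (sinh_le y0 y ltac:(lra)).
 apply Rplus_le_compat_l. unfold Rdiv. apply Rmult_le_compat_l; [lra|]. apply Rinv_le_contravar; [|].
 - apply Rmult_lt_0_compat; [lra|apply pow_lt; auto].
 - apply Rmult_le_compat_l; [lra|]. apply pow_incr. lra.
Qed.

Lemma le_epsilon_mult (a b k : R) : 0 <= k -> (forall eps, 0 < eps -> a <= b + eps * k) -> a <= b.
Proof.
 intros Hk H. apply Rnot_lt_le. intros Hab. specialize (H ((a - b) / (2 * (k + 1))) ltac:(apply Rdiv_lt_0_compat; lra)).
 assert ((a - b) / (2 * (k + 1)) * k <= (a - b) / 2); [|lra].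
 replace ((a - b) / 2) with ((a - b) / (2 * (k + 1)) * (k + 1)) by (field; lra).
 apply Rmult_le_compat_l; [|lra]. left. apply Rdiv_lt_0_compat; lra.
Qed.

(* The remainder [w] is small compared with the pole along a sequence of points tending to [q]; Harnack spreads this
  over the circles through these points and the comparison principle over the annuli between them. *)
Lemma bounded_near_pole (q : pt) (w : pt -> R) (r0 : R) : Sigma q -> 0 < r0 < 1 -> r0 < snd q / 4 -> P (snd q / 2) * r0 <= 1 ->
 Lharmonic_on (fun p => Sigma p /\ p <> q) w -> (forall p, Sigma p -> p <> q -> 0 <= w p) ->
 (forall eps r, 0 < eps -> 0 < r -> exists p, Sigma p /\ p <> q /\ dist2 p q < r /\ w p <= eps * green_U q p) ->
 exists M1, 0 <= M1 /\ forall p, p <> q -> dist2 p q < r0 -> w p <= M1.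
Proof.
 intros Hq Hr0 Hrq HP Hw Wpos Hseq. unfold Sigma in Hq. set (g := green_U q) in *. set (U := fun p => Sigma p /\ p <> q) in *.
 assert (Hg : Lharmonic_on U g) by (apply green_U_harmonic; lra).
 assert (Gpos : forall z, U z -> 0 <= g z) by (intros z [Z1 Z2]; left; apply green_U_pos; auto; lra).
 assert (Uopen : open2 U) by (apply open2_and; [apply open2_Sigma|apply open2_ne]).
 assert (HS : forall z, dist2 z q < 2 * r0 -> snd q / 2 < snd z).
 { intros z Hz. note (Rabs_snd_dist2 z q) as T. apply Rabs_le_between in T. lra. }
 assert (HU : forall z, 0 < dist2 z q < 2 * r0 -> U z).
 { intros z Hz. split; [unfold Sigma; specialize (HS z); lra|]. intros ->. rewrite dist2_refl in Hz. lra. }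
 assert (Harn : forall f r p1 p2, Lharmonic_on U f -> (forall z, U z -> 0 <= f z) -> 0 < r <= r0 -> dist2 p1 q = r -> dist2 p2 q = r ->
  f p2 <= harnack_const * f p1).
 { intros f r p1 p2 Hf Hf0 Hr H1 H2. apply (circle_harnack U f q r (P (snd q / 2)) Uopen Hf); auto; [lra| |].
  - intros z Hz. split; [apply HU; lra|]. specialize (HS z ltac:(lra)). note (P_ge_quarter (snd z) ltac:(lra)). split; [lra|]. apply P_le; lra.
  - note (P_ge_quarter (snd q / 2) ltac:(lra)). nra. }
 assert (H0 : 0 < harnack_const) by apply exp_pos. assert (Wpos' : forall z, U z -> 0 <= w z) by (intros z [Z1 Z2]; auto).
 set (q0 := (fst q + r0, snd q)). assert (Hq0 : dist2 q0 q = r0).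
 { unfold dist2, q0. cbn [fst snd]. replace ((fst q + r0 - fst q) ^ 2 + (snd q - snd q) ^ 2) with (r0 ^ 2) by ring. apply sqrt_pow2; lra. }
 set (M1 := harnack_const * w q0). assert (HM1 : 0 <= M1) by (apply Rmult_le_pos; [lra|apply Wpos', HU; lra]).
 exists M1. split; auto. intros p Hpq Hpr. note (dist2_gt0 _ _ Hpq) as Hp0. note (HU p ltac:(lra)) as Up.
 apply (le_epsilon_mult _ _ (harnack_const * harnack_const * g p)).
 { apply Rmult_le_pos; [nra|auto]. }
 intros eps He. destruct (Hseq eps (dist2 p q) He Hp0) as [p1 [H1 [H1q [H1r H1w]]]].
 set (r := dist2 p1 q) in *. note (dist2_gt0 _ _ H1q) as Hr. fold r in Hr.
 (* One Harnack factor moves the smallness of [w] from [p1] around the circle, the other moves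
    [green_U q] back. *)
 set (K := eps * (harnack_const * harnack_const)). assert (HK : 0 <= K) by (apply Rmult_le_pos; nra).
 assert (Hcirc : forall z, dist2 z q = r -> w z <= K * g z).
 { intros z Hz. apply Rle_trans with (harnack_const * w p1); [apply (Harn w r); auto; lra|].
  assert (Hgz : g p1 <= harnack_const * g z) by (apply (Harn g r); auto; lra).
  apply Rle_trans with (harnack_const * (eps * (harnack_const * g z))); [|right; unfold K; ring].
  apply Rmult_le_compat_l; [lra|]. eapply Rle_trans; [exact H1w|]. apply Rmult_le_compat_l; lra. }
 replace (M1 + eps * (harnack_const * harnack_const * g p)) with (M1 + K * g p) by (unfold K; ring).
 cut (1 * (1 * w p + - K * g p) + 1 * - M1 <= 0); [lra|].
 assert (HL : Lharmonic_on U (fun p => 1 * w p + - K * g p)) by (apply Lharmonic_lin; auto).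
 apply (comparison (fun z => r < dist2 z q < r0) (fun p => 1 * (1 * w p + - K * g p) + 1 * - M1)).
 - apply open2_annulus.
 - intros z Hz. apply HU. lra.
 - apply Lsub_lin; try lra.
  + apply Lharmonic_Lsub. eapply Lharmonic_on_subset; [|exact HL]. intros z Hz. apply HU. lra.
  + apply Lsub_const; auto. intros z Hz; apply HU; lra.
 - intros eta _. exists (Rabs (fst q) + Rabs (snd q) + 2 * r0). intros z Hz Hl. exfalso.
  note (Rabs_fst_dist2 z q). note (Rabs_snd_dist2 z q).
  note (Rabs_triang_inv (fst z) (fst q)). note (Rabs_triang_inv (snd z) (snd q)). lra.
 - intros eta He' z Hz. destruct (Rlt_le_dec (dist2 z q) r) as [A|A].
  { exists (r - dist2 z q). split; [lra|]. intros z' Hz' Hd. note (dist2_triang z' z q). lra. }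
  destruct (Rlt_le_dec r0 (dist2 z q)) as [B|B].
  { exists (dist2 z q - r0). split; [lra|]. intros z' Hz' Hd. note (dist2_triang z z' q). rewrite (dist2_sym z z') in *. lra. }
  note (HU z ltac:(lra)) as Uz. assert (Hval : 1 * w z + - K * g z <= M1).
  { destruct (Req_dec (dist2 z q) r) as [E|E].
   - specialize (Hcirc z E). lra.
   - assert (E2 : dist2 z q = r0) by (apply NNPP; intros E2; apply Hz; lra).
    note (Harn w r0 q0 z Hw Wpos' ltac:(lra) Hq0 E2). specialize (Gpos z Uz). note (Rmult_le_pos K (g z) HK Gpos). unfold M1. lra. }
  destruct HL as [ux [uy [uxx [uxy [uyx [uyy [_ [C0 _]]]]]]]]. destruct (C0 z Uz eta He') as [d [Hd HC]].
  exists d. split; auto. intros z' Hz' Hd'. specialize (HC z' (HU z' ltac:(lra)) Hd'). apply Rabs_def2 in HC. lra.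
 - split; auto.
Qed.

(** Only the singularity of [G] enters. That [green_U q] has the same kind of singularity is not
    proved beforehand; it is a consequence. *)
Theorem green_identification (G : pt -> pt -> R) (q : pt) : is_min_Green G -> Sigma q ->
 exists lam, 0 < lam /\ forall p, Sigma p -> p <> q -> G p q = lam * green_U q p.
Proof.
 intros HG Hq. destruct (HG q Hq) as [[Gpos [Gh [M0 [del [Hdel Hlog]]]]] Gmin].
 set (g := fun p => G p q) in *. change (forall p, Sigma p -> p <> q -> 0 < g p) in Gpos. unfold Sigma in Hq.
 assert (Upos : forall p, Sigma p -> p <> q -> 0 < green_U q p) by (intros; apply green_U_pos; auto; lra).
 set (E := fun k => 0 <= k /\ forall p, Sigma p -> p <> q -> k * green_U q p <= g p).
 set (q1 := (fst q, snd q + 1)). assert (Hq1 : q1 <> q) by (intros C; apply (f_equal snd) in C; unfold q1 in C; simpl in C; lra).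
 assert (Sq1 : Sigma q1) by (unfold Sigma, q1; simpl; lra). destruct (completeness E) as [l [Hl1 Hl2]].
 { exists (g q1 / green_U q q1). intros k [Hk Hk']. apply (proj1 (Rle_div_r k (g q1) _ (Upos q1 Sq1 Hq1))). auto. }
 { exists 0. split; [lra|]. intros p Hp Hpq. note (Gpos p Hp Hpq). lra. }
 assert (Hl0 : 0 <= l) by (apply Hl1; split; [lra|]; intros p Hp Hpq; note (Gpos p Hp Hpq); lra).
 assert (Hdom : forall p, Sigma p -> p <> q -> l * green_U q p <= g p).
 { intros p Hp Hpq. apply (proj2 (Rle_div_r l (g p) _ (Upos p Hp Hpq))). apply Hl2. intros k [Hk Hk'].
  apply (proj1 (Rle_div_r k (g p) _ (Upos p Hp Hpq))). auto. }
 set (w := fun p => 1 * g p + - l * green_U q p).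
 assert (HU : Lharmonic_on (fun p => Sigma p /\ p <> q) (green_U q)) by (apply green_U_harmonic; lra).
 assert (Hw : Lharmonic_on (fun p => Sigma p /\ p <> q) w) by (apply Lharmonic_lin; auto).
 assert (Hw0 : forall p, Sigma p -> p <> q -> 0 <= w p) by (intros p Hp Hpq; specialize (Hdom p Hp Hpq); unfold w; lra).
 set (k := P (snd q / 2)). assert (Hk : / 4 <= k) by (note (P_ge_quarter (snd q / 2) ltac:(lra)); unfold k; lra).
 set (r0 := Rmin (del / 2) (Rmin (snd q / 5) (Rmin (1 / 2) (/ k)))).
 assert (Hr0 : 0 < r0 /\ r0 < del /\ r0 < snd q / 4 /\ r0 < 1 /\ r0 <= / k).
 { assert (0 < / k) by pos.
  unfold r0. note (Rmin_l (del / 2) (Rmin (snd q / 5) (Rmin (1 / 2) (/ k)))). note (Rmin_r (del / 2) (Rmin (snd q / 5) (Rmin (1 / 2) (/ k)))).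
  note (Rmin_l (snd q / 5) (Rmin (1 / 2) (/ k))). note (Rmin_r (snd q / 5) (Rmin (1 / 2) (/ k))).
  note (Rmin_l (1 / 2) (/ k)). note (Rmin_r (1 / 2) (/ k)). split; [repeat apply Rmin_pos; lra|lra]. }
 destruct Hr0 as [R1 [R2 [R3 [R4 R5]]]]. destruct (bounded_near_pole q w r0) as [M1 [HM1 Hb]]; auto.
 - fold k. apply Rle_trans with (k * / k); [apply Rmult_le_compat_l; lra|right; field; lra].
 (* If [w] exceeded [eps * green_U q] throughout a punctured neighbourhood of [q], then [l + eps]
    would be admissible there and, by [green_outside], everywhere, against the choice of [l]. *)
 - intros eps r He Hr. apply NNPP. intros HN.
  assert (Hnear : forall p, Sigma p -> p <> q -> dist2 p q < r -> (l + eps) * green_U q p <= g p).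
  { intros p Hp Hpq Hd. apply Rnot_lt_le. intros C. apply HN. exists p. repeat split; auto. unfold w. lra. }
  assert (HE : E (l + eps)); [|specialize (Hl1 _ HE); lra]. split; [lra|]. intros p Hp Hpq.
  destruct (Rlt_le_dec (dist2 p q) r) as [Hd|Hd]; auto.
  apply (green_outside q g (l + eps) (r / 2)); auto; try lra; [intros z Z1 Z2; left; auto|].
  intros z Hz Hzd. apply Hnear; auto; [|lra]. intros ->. rewrite dist2_refl in Hzd. lra.
 (* The competitor is [g - w / 2]. As [w] is bounded near [q] it keeps the logarithmic singularity
    of [g], and minimality of [g] gives [w <= 0]. *)
 - assert (Hv : pos_fund_sol (fun p => / 2 * g p + l / 2 * green_U q p) q).
  { split; [|split].
   - intros p Hp Hpq. note (Gpos p Hp Hpq). assert (0 <= l / 2 * green_U q p) by (apply Rmult_le_pos; [lra|left; auto]). lra.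
   - apply Lharmonic_lin; auto.
   - exists (M0 + / 2 * M1), r0. split; auto. intros p Hp Hpq Hd.
    replace (/ 2 * g p + l / 2 * green_U q p + / (2 * PI) * ln (dist2 p q)) with
     ((g p + / (2 * PI) * ln (dist2 p q)) + - (/ 2 * w p)) by (unfold w; field; apply PI_neq0).
    eapply Rle_trans; [apply Rabs_triang|]. rewrite Rabs_Ropp. apply Rplus_le_compat; [apply Hlog; auto; lra|].
    specialize (Hw0 p Hp Hpq). rewrite Rabs_right by lra. apply Rmult_le_compat_l; [lra|]. apply Hb; auto. }
  assert (Heq : forall p, Sigma p -> p <> q -> g p = l * green_U q p).
  { intros p Hp Hpq. specialize (Gmin _ Hv p Hp Hpq). specialize (Hdom p Hp Hpq). change (g p <= / 2 * g p + l / 2 * green_U q p) in Gmin. lra. }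
  exists l. split; auto. destruct Hl0 as [|E0]; auto. exfalso. note (Gpos q1 Sq1 Hq1). rewrite Heq, <- E0 in H by auto. lra.
Qed.

(** * Continuity in the pole *)

Lemma flim_fst {U V : Type} {F : (U -> Prop) -> Prop} {G : (V -> Prop) -> Prop} {FG : Filter G} {FF : Filter F} (f : U -> R) (l : R) :
 filterlim f F (locally l) -> filterlim (fun q : U * V => f (fst q)) (filter_prod F G) (locally l).
Proof. intros H. exact (filterlim_comp _ _ _ fst f _ _ _ filterlim_fst H). Qed.

Lemma flim_snd {U V : Type} {F : (U -> Prop) -> Prop} {G : (V -> Prop) -> Prop} {FG : Filter G} {FF : Filter F} (f : V -> R) (l : R) :
 filterlim f G (locally l) -> filterlim (fun q : U * V => f (snd q)) (filter_prod F G) (locally l).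
Proof. intros H. exact (filterlim_comp _ _ _ snd f _ _ _ filterlim_snd H). Qed.

Lemma flim_pair {T : Type} {F : (T -> Prop) -> Prop} {FF : Filter F} (f g : T -> R) (a b : R) :
 filterlim f F (locally a) -> filterlim g F (locally b) -> filterlim (fun u => (f u, g u)) F (locally ((a, b) : R * R)).
Proof.
 intros Hf Hg Q HQ. apply filter_prod_locally in HQ. exact (filterlim_pair f g Hf Hg Q HQ).
Qed.

Lemma flim_within {T : UniformSpace} {W : Type} (S : T -> Prop) (a : T) (f : T -> W) (G : (W -> Prop) -> Prop) :
 filterlim f (locally a) G -> filterlim f (within S (locally a)) G.
Proof. intros H. exact (filterlim_filter_le_1 f (filter_le_within (F := locally a) S) H). Qed.

(** Two limits are interchanged at once, the descent integral inside and the angular integral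
    outside. A decay constant is required only near each angle; compactness of [[0, PI]] does the
    rest. *)
Lemma average_lim {U : Type} (F : (U -> Prop) -> Prop) (FF : Filter F) (k : U -> R -> R) (A : U -> R -> R) (c : U -> R)
 (k0 A0 : R -> R) (c0 : R) : 0 < c0 -> filterlim c F (locally c0) ->
 (forall t, 0 <= t <= PI -> 0 < A0 t /\ filterlim (fun q => A (fst q) (snd q)) (filter_prod F (locally t)) (locally (A0 t))) ->
 (forall t z, 0 <= t <= PI -> A0 t <= z -> continuous k0 z /\
   filterlim (fun q => k (fst q) (snd q)) (filter_prod F (locally z)) (locally (k0 z))) ->
 (forall t, 0 <= t <= PI -> exists C, 0 <= C /\ decays C k0 (A0 t) /\
   filter_prod F (locally t) (fun q => decays C (k (fst q)) (A (fst q) (snd q)) /\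
    forall z, A (fst q) (snd q) <= z -> continuous (k (fst q)) z)) ->
 F (fun u => ex_RInt (fun t => sin t ^ 2 * descent (k u) (A u t) (c u)) 0 PI) ->
 (forall t, 0 <= t <= PI -> continuous (fun t => sin t ^ 2 * descent k0 (A0 t) c0) t) ->
 filterlim (fun u => RInt (fun t => sin t ^ 2 * descent (k u) (A u t) (c u)) 0 PI) F
  (locally (RInt (fun t => sin t ^ 2 * descent k0 (A0 t) c0) 0 PI)).
Proof.
 intros Hc0 Hc HA Hk Hdec Hex Hcont.
 apply (RInt_filterlim F FF (fun u t => sin t ^ 2 * descent (k u) (A u t) (c u))); auto; [note PI_RGT_0; lra|].
 intros t Ht. destruct (HA t Ht) as [HA0 HAl]. destruct (Hdec t Ht) as [C [HC [Hd0 Hd]]].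
 apply (flim_mult (fun q : U * R => sin (snd q) ^ 2)).
 - apply flim_pow. apply (flim_snd sin). apply continuous_sin.
 - apply (descent_lim (filter_prod F (locally t)) _ (fun q => k (fst q)) (fun q => A (fst q) (snd q)) (fun q => c (fst q)) k0 (A0 t) c0 C); auto.
  + apply flim_fst; auto.
  + intros z Hz. destruct (Hk t z Ht Hz) as [_ H].
   apply (filterlim_comp _ _ _ (fun q : U * R * R => (fst (fst q), snd q)) (fun q => k (fst q) (snd q)) _ (filter_prod F (locally z))); auto.
   intros Q [Q1 Q2 HQ1 HQ2 HQ]. exists (fun q : U * R => Q1 (fst q)) Q2; auto. exact (filterlim_fst (F := F) (G := locally t) _ HQ1).
  + weaken Hd. tauto.
  + weaken Hd. tauto.
  + intros z Hz. apply (Hk t z Ht Hz).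
Qed.

Lemma continuous_average_slice D f xi c d (p : pt) t : continuous_on_domain D f -> average_domain D xi c d p -> 0 <= t <= PI ->
 continuous (fun t => sin t ^ 2 * f (fst p - xi) (geo_arg c d (snd p) t)) t.
Proof.
 intros Hf Hd Ht. apply continuous_Rmult; [cont|]. apply (continuous_comp (fun t => geo_arg c d (snd p) t) (fun z => f (fst p - xi) z)).
 - unfold geo_arg. cont.
 - apply continuous_2d_snd, Hf, Hd; auto.
Qed.

Lemma ex_RInt_average_slice D f xi c d (p : pt) : continuous_on_domain D f -> average_domain D xi c d p ->
 ex_RInt (fun t => sin t ^ 2 * f (fst p - xi) (geo_arg c d (snd p) t)) 0 PI.
Proof.
 intros Hf Hd. apply (ex_RInt_continuous (V := R_CompleteNormedModule)). intros t Ht. rewrite Rmin_left, Rmax_right in Ht by (note PI_RGT_0; lra).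
 apply (continuous_average_slice D); auto.
Qed.

Lemma green_avg_continuous (q p : pt) : 0 <= snd q -> 0 <= snd p -> p <> q ->
 filterlim (fun u => green_avg u p) (within (fun u => 0 <= snd u) (locally (q : R * R))) (locally (green_avg q p)).
Proof.
 intros Hq Hp Hne. set (F := within (fun u : R * R => 0 <= snd u) (locally (q : R * R))).
 assert (FF : Filter F) by apply within_filter, locally_filter.
 assert (F1 : filterlim (fun u : R * R => fst u) F (locally (fst q))) by (apply flim_within; destruct q; apply continuous_fst).
 assert (F2 : filterlim (fun u : R * R => snd u) F (locally (snd q))) by (apply flim_within; destruct q; apply continuous_snd).
 assert (Cc : forall y, continuous cosh y) by (intros; apply continuous_cosh).
 assert (Cs : forall y, continuous sinh y) by (intros; apply continuous_sinh).
 assert (Fc : filterlim (fun u : R * R => cosh (snd u)) F (locally (cosh (snd q)))) by (apply (flim_cont cosh); auto).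
 assert (Fs : filterlim (fun u : R * R => sinh (snd u)) F (locally (sinh (snd q)))) by (apply (flim_cont sinh); auto).
 note (cosh_ge1 (snd q)) as Hc. note admissible_green as Adm. note green_domain_kernel as Dom.
 note (green_average_domain q p Hq Hp Hne) as Hdom. set (X0 := fst p - fst q) in *.
 assert (FX : forall t, filterlim (fun r : R * R * R => fst p - fst (fst r)) (filter_prod F (locally t)) (locally X0)).
 { intros t. apply (flim_fst (fun u : R * R => fst p - fst u)). unfold X0. flim. }
 assert (FA : forall t, filterlim (fun r : R * R * R => geo_arg (cosh (snd (fst r))) (sinh (snd (fst r))) (snd p) (snd r))
   (filter_prod F (locally t)) (locally (geo_arg (cosh (snd q)) (sinh (snd q)) (snd p) t))).
 { intros t. unfold geo_arg.
  assert (G1 : filterlim (fun r : R * R * R => cosh (snd (fst r))) (filter_prod F (locally t)) (locally (cosh (snd q)))) by (apply (flim_fst (fun u : R * R => cosh (snd u))); auto).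
  assert (G2 : filterlim (fun r : R * R * R => sinh (snd (fst r))) (filter_prod F (locally t)) (locally (sinh (snd q)))) by (apply (flim_fst (fun u : R * R => sinh (snd u))); auto).
  assert (G3 : filterlim (fun r : R * R * R => cos (snd r)) (filter_prod F (locally t)) (locally (cos t))) by (apply (flim_snd cos); apply continuous_cos).
  flim. }
 unfold green_avg, average, wsin2, green_radial. fold F X0.
 apply (average_lim F FF (fun u => green_kernel (fst p - fst u)) (fun u t => geo_arg (cosh (snd u)) (sinh (snd u)) (snd p) t)
  (fun u => cosh (snd u)) (green_kernel X0) (fun t => geo_arg (cosh (snd q)) (sinh (snd q)) (snd p) t)).
 - lra.
 - exact Fc.
 - intros t Ht. split; auto. eapply Dom. apply Hdom; auto.
 - intros t z Ht Hz. assert (Hg : green_domain X0 z) by (eapply Dom; [apply Hdom; eauto|auto]).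
  split; [apply continuous_2d_snd, Adm; auto|].
  apply (filterlim_comp _ _ _ (fun r : R * R * R => (fst p - fst (fst r), snd r)) (fun r => green_kernel (fst r) (snd r)) _ (locally ((X0, z) : R * R))).
  + apply flim_pair; auto. apply (flim_snd (fun z => z)). apply continuous_id.
  + apply Adm; auto.
 - intros t Ht. note (Hdom t Ht) as Hg. destruct (proj2 Adm _ _ Hg) as [C [HC HL]]. exists C. split; [auto|split].
  + exact (locally_singleton _ _ HL).
  + note (flim_pair _ _ _ _ (FX t) (FA t)) as HP.
   generalize (filter_and _ _ (HP _ HL) (HP _ (proj1 Dom _ _ Hg))). unfold filtermap. apply filter_imp. intros r [H1 H2]. split; auto.
   intros z Hz. apply (admissible_fixed _ _ _ _ Dom Adm H2). auto.
 - assert (E : F (fun u => 0 <= snd u /\ u <> p)).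
  { unfold F, within. weaken (open2_locally _ (q : pt) (open2_ne p) (not_eq_sym Hne)). tauto. }
  weaken E. intros u [Hu Hu']. apply (ex_RInt_average_slice green_domain (green_radial (cosh (snd u))) (fst u)).
  + apply green_radial_continuous. note (cosh_ge1 (snd u)); lra.
  + apply green_average_domain; auto.
 - intros t Ht. apply (continuous_average_slice green_domain (green_radial (cosh (snd q))) (fst q)); auto.
  apply green_radial_continuous; lra.
Qed.

(** * The solutions attached to the semicircle *)

(** For [om] on the unit circle the halves [a = fst om / 2], [b = snd om / 2] satisfy
    [a^2 + b^2 = 1 / 4], the condition of [theta_radial_solution]. The centre [(1, 1)] in [theta_U]
    averages over horospheres instead of spheres. *)
Definition theta_radial (a b X z : R) : R := descent (fun z => exp (a * X) * Rpower z (- (2 + b))) z 1.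
Definition theta_U (om p : pt) : R := radial_U (theta_radial (fst om / 2) (snd om / 2)) 0 1 1 p.

Lemma geo_arg_horo y t : 0 <= y -> exp (- y) <= geo_arg 1 1 y t.
Proof.
 intros Hy. unfold geo_arg. note (COS_bound t). note (sinh_ge_id y Hy).
 replace (exp (- y)) with (cosh y - sinh y) by (unfold cosh, sinh; field). nra.
Qed.

Lemma theta_average_domain (p : pt) : 0 <= snd p -> average_domain pos_domain 0 1 1 p.
Proof. intros Hp t _. note (geo_arg_horo (snd p) t Hp). note (exp_pos (- snd p)). unfold pos_domain. lra. Qed.

Lemma theta_admissible (a b : R) : 0 <= b -> admissible pos_domain (fun X z => exp (a * X) * Rpower z (- (2 + b))).
Proof.
 intros Hb. apply (admissible_ext _ (fun X z => exp (a * X) * (1 * Rpower z (- (3 / 2 + (1 / 2 + b)))))).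
 - intros X z. rewrite Rmult_1_l. do 2 f_equal. field.
 - apply admissible_power; [intros; apply continuous_exp_lin|lra].
Qed.

Lemma theta_radial_continuous (a b : R) : 0 <= b -> continuous_on_domain pos_domain (theta_radial a b).
Proof. intros Hb. apply (continuous_descent pos_domain _ 1 pos_domain_kernel (theta_admissible a b Hb)). lra. Qed.

Lemma theta_U_harmonic (om : pt) : 0 <= snd om -> fst om ^ 2 + snd om ^ 2 = 1 -> Lharmonic_on Sigma (theta_U om).
Proof.
 intros H1 H2. apply (Lharmonic_on_subset (fun p => Sigma p /\ average_domain pos_domain 0 1 1 p)).
 - intros p Hp. split; auto. apply theta_average_domain. unfold Sigma in Hp; lra.
 - apply (radial_U_harmonic pos_domain (theta_radial (fst om / 2) (snd om / 2))). replace (1 ^ 2 - 1 ^ 2) with 0 by ring.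
  apply (theta_radial_solution (fst om / 2) (snd om / 2) 1); lra.
Qed.

Lemma theta_avg_pos (a b : R) (p : pt) : 0 <= b -> 0 <= snd p -> 0 < average wsin2 (theta_radial a b) 0 1 1 p.
Proof.
 intros Hb Hp. apply (average_gt0 pos_domain); [apply theta_radial_continuous; auto|apply theta_average_domain; auto|].
 intros X z Hz. apply (descent_gt0 pos_domain (fun X z => exp (a * X) * Rpower z (- (2 + b))) 1 X z pos_domain_kernel (theta_admissible a b Hb)); auto; [lra|].
 intros z' _. apply Rmult_lt_0_compat; apply exp_pos.
Qed.

Lemma theta_U_pos (om p : pt) : 0 <= snd om -> Sigma p -> 0 < theta_U om p.
Proof.
 intros H Hp. apply Rmult_lt_0_compat; [apply sinh32_pos; auto|]. apply theta_avg_pos; [lra|]. unfold Sigma in Hp; lra.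
Qed.

(** * Asymptotics of the Green function *)

Lemma flim_squeeze {T : Type} {F : (T -> Prop) -> Prop} {FF : Filter F} (f g : T -> R) (l : R) :
 F (fun u => Rabs (f u - l) <= g u) -> filterlim g F (locally 0) -> filterlim f F (locally l).
Proof.
 intros H Hg. apply filterlim_locally. intros eps. assert (E : F (fun u => g u < eps)) by exact (Hg _ (locally_lt 0 eps (cond_pos eps))).
 weaken (filter_and _ _ H E). intros u [H1 H2]. change (Rabs (f u - l) < eps). lra.
Qed.

Lemma flim_inv_infty {T : Type} {F : (T -> Prop) -> Prop} {FF : Filter F} (f : T -> R) :
 (forall M, F (fun u => M < f u)) -> filterlim (fun u => / f u) F (locally 0).
Proof.
 intros H. apply filterlim_locally. intros eps. note (Rinv_0_lt_compat _ (cond_pos eps)).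
 weaken (H (/ eps)). intros u Hu. change (Rabs (/ f u - 0) < eps). assert (0 < / f u) by pos. rewrite Rminus_0_r, Rabs_right by lra.
 rewrite <- (Rinv_inv eps). apply Rinv_lt_contravar; auto. apply Rmult_lt_0_compat; lra.
Qed.

Lemma flim_exp_infty {T : Type} {F : (T -> Prop) -> Prop} {FF : Filter F} (f : T -> R) :
 (forall M, F (fun u => M < f u)) -> filterlim (fun u => exp (- f u)) F (locally 0).
Proof.
 intros H. apply filterlim_locally. intros eps. destruct (exp_neg_small eps (cond_pos eps)) as [M HM].
 weaken (H M). intros u Hu. change (Rabs (exp (- f u) - 0) < eps). note (exp_pos (- f u)). rewrite Rminus_0_r, Rabs_right by lra. auto.
Qed.

Lemma flim_infty_le {T : Type} {F : (T -> Prop) -> Prop} {FF : Filter F} (f g : T -> R) (B : R) :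
 (forall M, F (fun u => M < f u)) -> F (fun u => f u <= g u + B) -> forall M, F (fun u => M < g u).
Proof.
 intros H Hle M. weaken (filter_and _ _ (H (M + B)) Hle). intros u [H1 H2]. lra.
Qed.

Lemma besselm_ratio_log (a b c : R) : 0 < c -> c <= a -> c <= b ->
 Rabs (ln (besselm (b ^ 2)) - ln (besselm (a ^ 2)) + (b - a) / 2) <= 6 / c * Rabs (b - a).
Proof.
 intros Hc Ha Hb.
 assert (Q : forall a b, c <= a -> a <= b -> Rabs (ln (besselm (b ^ 2)) - ln (besselm (a ^ 2)) + (b - a) / 2) <= 6 / c * (b - a)).
 { clear a b Ha Hb. intros a b Ha Hab. destruct (besselm_ratio a b ltac:(lra)) as [H1 H2].
  note (besselm_pos (a ^ 2) ltac:(apply pow_lt; lra)) as Pa. note (besselm_pos (b ^ 2) ltac:(apply pow_lt; lra)) as Pb.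
  apply ln_le in H1; auto. rewrite ln_mult, ln_exp in H1 by pos. apply ln_le in H2; [|pos]. rewrite ln_mult, ln_exp in H2 by pos.
  assert (6 / a * (b - a) <= 6 / c * (b - a)).
  { apply Rmult_le_compat_r; [lra|]. apply Rmult_le_compat_l; [lra|]. apply Rinv_le_contravar; lra. }
  assert (0 <= 6 / c * (b - a)) by lra. apply Rabs_le. lra. }
 destruct (Rle_lt_dec a b) as [H|H].
 - rewrite (Rabs_right (b - a)) by lra. apply Q; auto.
 - rewrite (Rabs_left (b - a)) by lra. rewrite <- Rabs_Ropp. specialize (Q b a Hb ltac:(lra)).
  replace (- (ln (besselm (b ^ 2)) - ln (besselm (a ^ 2)) + (b - a) / 2)) with
   (ln (besselm (a ^ 2)) - ln (besselm (b ^ 2)) + (a - b) / 2) by field. lra.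
Qed.

(** The logarithmic derivative of [besselm (r^2)] in [r] tends to [- 1 / 2], so a bounded
    displacement of a large radius only contributes an exponential. *)
Lemma besselm_ratio_lim {T : Type} {F : (T -> Prop) -> Prop} {FF : Filter F} (r R0 : T -> R) (l : R) :
 (forall M, F (fun u => M < R0 u)) -> filterlim (fun u => r u - R0 u) F (locally l) ->
 filterlim (fun u => besselm (r u ^ 2) / besselm (R0 u ^ 2)) F (locally (exp (- l / 2))).
Proof.
 intros HR Hr. assert (Hlog : filterlim (fun u => ln (besselm (r u ^ 2)) - ln (besselm (R0 u ^ 2)) + (r u - R0 u) / 2) F (locally 0)).
 { apply (flim_squeeze _ (fun u => 12 * (/ R0 u) * Rabs (r u - R0 u))).
  - assert (E : F (fun u => Rabs l + 1 > Rabs (r u - R0 u))).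
   { assert (H : filterlim (fun u => Rabs (r u - R0 u)) F (locally (Rabs l))) by (apply (flim_cont Rabs); auto; apply continuous_Rabs).
    exact (H _ (locally_lt _ _ (Rlt_plus_1 _))). }
   weaken (filter_and _ _ E (HR (2 * (Rabs l + 1)))). intros u [H1 H2]. rewrite Rminus_0_r. note (Rabs_pos l). apply Rabs_def2 in H1.
   replace (12 * / R0 u) with (6 / (R0 u / 2)) by fld. apply besselm_ratio_log; lra.
  - apply flim_eq with (12 * 0 * Rabs l); [|ring]. note (flim_inv_infty R0 HR).
   assert (filterlim (fun u => Rabs (r u - R0 u)) F (locally (Rabs l))) by (apply (flim_cont Rabs); auto; apply continuous_Rabs). flim. }
 apply (filterlim_ext_loc (fun u => exp (ln (besselm (r u ^ 2)) - ln (besselm (R0 u ^ 2)) + (r u - R0 u) / 2 - (r u - R0 u) / 2))).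
 - assert (E : F (fun u => l - 1 < r u - R0 u)) by exact (Hr _ (locally_gt l (l - 1) ltac:(lra))).
  weaken (filter_and _ _ E (filter_and _ _ (HR 0) (HR (1 - l)))). intros u [H1 [H2 H3]].
  match goal with |- exp ?a = _ => replace a with (ln (besselm (r u ^ 2)) - ln (besselm (R0 u ^ 2))) by field end.
  unfold Rminus. rewrite exp_plus, exp_Ropp, !exp_ln by (apply besselm_pos, pow_lt; lra). reflexivity.
 - apply (flim_cont exp); [|apply continuous_exp]. apply flim_eq with (0 - l / 2); [|field]. flim. lra.
Qed.

(** Minus half the logarithmic derivative of [besselm (r^2)] with respect to [r]; it tends to
    [1 / 4]. *)
Definition besselk (r : R) : R := - (r * besselm1 (r ^ 2)) / besselm (r ^ 2).

Lemma besselk_bounds r : 0 < r -> 1 / 4 <= besselk r <= 1 / 4 + 3 / r.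
Proof.
 intros Hr. destruct (besselm_log_derivative r Hr) as [H1 H2]. note (besselm_pos (r ^ 2) ltac:(apply pow_lt; auto)) as Hm. unfold besselk.
 set (m := besselm (r ^ 2)) in *. set (m1 := r * besselm1 (r ^ 2)) in *. split.
 - apply (proj1 (Rle_div_r (1 / 4) (- m1) m Hm)). lra.
 - apply (proj2 (Rle_div_l (- m1) (1 / 4 + 3 / r) m Hm)). lra.
Qed.

Lemma green_kernel_arch (X s r : R) : 0 < s -> 0 < r -> r ^ 2 = X ^ 2 + s ^ 2 ->
 green_kernel X (cosh s) = besselm (r ^ 2) * (s / sinh s ^ 2) * (4 * (s / r) * besselk r + 2 * (cosh s / sinh s - / s)).
Proof.
 intros Hs Hr E. note (cosh_ge1 s) as Hc. note (sinh_pos s Hs) as Hsh. unfold green_kernel. rewrite arcsq_cosh, <- E by lra.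
 assert (L0 : arcL 0 (cosh s) = s / sinh s).
 { note (sinh_arcL s ltac:(lra)) as H. rewrite <- H at 2. field. lra. }
 assert (L1 : arcL 1 (cosh s) = (cosh s * (s / sinh s) - 1) / sinh s ^ 2).
 { note (arcL_ode (cosh s) ltac:(lra)) as H. rewrite L0 in H. note (cosh2_sinh2 s) as H2.
  replace (cosh s ^ 2 - 1) with (sinh s ^ 2) in H by lra.
  replace (cosh s * (s / sinh s) - 1) with (sinh s ^ 2 * arcL 1 (cosh s)) by lra. field. lra. }
 rewrite L0, L1. unfold besselk. note (besselm_pos (r ^ 2) ltac:(apply pow_lt; auto)). field. lra.
Qed.

Definition norm2 (q : pt) : R := sqrt (fst q ^ 2 + snd q ^ 2).

Lemma norm2_sqr (q : pt) : norm2 q ^ 2 = fst q ^ 2 + snd q ^ 2.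
Proof. apply pow2_sqrt, sum_sqr_ge0. Qed.

Lemma norm2_ge_snd (q : pt) : snd q <= norm2 q.
Proof. apply Rsqr_incr_0_var; [|apply sqrt_pos]. unfold Rsqr. note (norm2_sqr q). note (pow2_ge_0 (fst q)). lra. Qed.

Lemma norm2_ge_fst (q : pt) : Rabs (fst q) <= norm2 q.
Proof.
 rewrite <- (Rabs_right (norm2 q)) by (apply Rle_ge, sqrt_pos). apply Rsqr_le_abs_0. unfold Rsqr. note (norm2_sqr q). note (pow2_ge_0 (snd q)). lra.
Qed.

(** The difference of the two norms is the difference of their squares, which is linear in the large
    quantities, divided by their sum. The limit is the displacement projected on the direction
    [(C, S)]. *)
Lemma far_radius_lim {T : Type} {F : (T -> Prop) -> Prop} {FF : Filter F} (xi s : T -> R) (q : T -> pt) (x C S l : R) :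
 C ^ 2 + S ^ 2 = 1 -> (forall u, fst (q u) = xi u) -> (forall M, F (fun u => M < norm2 (q u))) ->
 filterlim (fun u => xi u / norm2 (q u)) F (locally C) -> filterlim (fun u => snd (q u) / norm2 (q u)) F (locally S) ->
 filterlim (fun u => s u - snd (q u)) F (locally l) ->
 filterlim (fun u => norm2 (x - xi u, s u) - norm2 (q u)) F (locally (- (x * C) + l * S)) /\
 filterlim (fun u => norm2 (x - xi u, s u) / norm2 (q u)) F (locally 1) /\
 filterlim (fun u => s u / norm2 (q u)) F (locally S).
Proof.
 intros HCS Hxi HR HC HS Hs. note (flim_inv_infty _ HR) as Hi. assert (E0 : F (fun u => 0 < norm2 (q u))) by apply HR.
 assert (L1 : filterlim (fun u => s u / norm2 (q u)) F (locally S)).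
 { apply (filterlim_ext (fun u => (s u - snd (q u)) * / norm2 (q u) + snd (q u) / norm2 (q u))); [intros; unfold Rdiv; ring|].
  apply flim_eq with (l * 0 + S); [|ring]. flim. }
 assert (L2 : filterlim (fun u => norm2 (x - xi u, s u) / norm2 (q u)) F (locally 1)).
 { apply (filterlim_ext_loc (fun u => sqrt ((x * / norm2 (q u) - xi u / norm2 (q u)) ^ 2 + (s u / norm2 (q u)) ^ 2))).
  - weaken E0. intros u Hu.
   replace ((x * / norm2 (q u) - xi u / norm2 (q u)) ^ 2 + (s u / norm2 (q u)) ^ 2) with (((x - xi u) ^ 2 + s u ^ 2) / norm2 (q u) ^ 2) by fld.
   rewrite sqrt_div_alt by pos. rewrite sqrt_pow2 by lra. reflexivity.
  - rewrite <- sqrt_1. apply (flim_cont sqrt).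
   + apply flim_eq with ((x * 0 - C) ^ 2 + S ^ 2); [|lra]. flim.
   + apply continuity_pt_filterlim, continuity_pt_sqrt. lra. }
 split; [|split]; auto. apply (filterlim_ext_loc (fun u => (x ^ 2 * / norm2 (q u) - 2 * x * (xi u / norm2 (q u)) +
  (s u - snd (q u)) * (s u / norm2 (q u) + snd (q u) / norm2 (q u))) / (norm2 (x - xi u, s u) / norm2 (q u) + 1))).
 - weaken E0. intros u Hu. set (r := norm2 (x - xi u, s u)).
  assert (Hr : 0 <= r) by apply sqrt_pos. assert (Er : r ^ 2 = (x - xi u) ^ 2 + s u ^ 2) by apply norm2_sqr.
  note (norm2_sqr (q u)) as Eq. rewrite Hxi in Eq. set (N := norm2 (q u)) in *.
  replace ((x ^ 2 * / N - 2 * x * (xi u / N) + (s u - snd (q u)) * (s u / N + snd (q u) / N)) / (r / N + 1)) with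
   ((x ^ 2 - 2 * x * xi u + (s u ^ 2 - snd (q u) ^ 2)) / (r + N)) by fld.
  replace (x ^ 2 - 2 * x * xi u + (s u ^ 2 - snd (q u) ^ 2)) with (r ^ 2 - N ^ 2) by lra. field. lra.
 - apply flim_eq with ((x ^ 2 * 0 - 2 * x * C + l * (S + S)) / (1 + 1)); [|field]. flim. lra.
Qed.

Lemma continuous_ln x : 0 < x -> continuous ln x.
Proof. intros. apply continuous_of_ex_derive. auto_derive. auto. Qed.

(** For large arguments [cosh s] behaves like [exp s / 2], so a factor [b] shifts [s] by [ln b]. *)
Lemma arch_shift_lim {T : Type} {F : (T -> Prop) -> Prop} {FF : Filter F} (eta b : T -> R) (b0 : R) :
 0 < b0 -> (forall M, F (fun u => M < eta u)) -> filterlim b F (locally b0) -> F (fun u => 1 <= cosh (eta u) * b u) ->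
 filterlim (fun u => arch (cosh (eta u) * b u) - eta u) F (locally (ln b0)).
Proof.
 intros Hb0 He Hb H1. note (flim_exp_infty eta He) as Hx.
 apply (filterlim_ext_loc (fun u => ln (exp (arch (cosh (eta u) * b u) - eta u)))).
 { apply filter_forall. intros u. apply ln_exp. }
 apply (flim_cont ln); [|apply continuous_ln; auto].
 apply (flim_squeeze _ (fun u => Rabs (b u * (1 + exp (- eta u) * exp (- eta u)) - b0) + exp (- eta u))).
 - weaken H1. intros u Hu. set (s := arch (cosh (eta u) * b u)).
  assert (Es : cosh s = cosh (eta u) * b u) by (apply cosh_arch; auto). assert (Hs : 0 <= s) by apply arch_ge0.
  assert (E : exp (s - eta u) = b u * (1 + exp (- eta u) * exp (- eta u)) - exp (- s) * exp (- eta u)).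
  { unfold cosh in Es. assert (E1 : exp s = (exp (eta u) + exp (- eta u)) * b u - exp (- s)) by lra.
   unfold Rminus at 1. rewrite exp_plus, E1.
   assert (E2 : exp (eta u) * exp (- eta u) = 1) by (rewrite <- exp_plus, Rplus_opp_r; apply exp_0).
   replace (((exp (eta u) + exp (- eta u)) * b u - exp (- s)) * exp (- eta u)) with
    (b u * (exp (eta u) * exp (- eta u) + exp (- eta u) * exp (- eta u)) - exp (- s) * exp (- eta u)) by ring.
   rewrite E2. ring. }
  rewrite E. set (y := b u * (1 + exp (- eta u) * exp (- eta u))).
  replace (y - exp (- s) * exp (- eta u) - b0) with ((y - b0) + - (exp (- s) * exp (- eta u))) by ring.
  eapply Rle_trans; [apply Rabs_triang|]. apply Rplus_le_compat_l. rewrite Rabs_Ropp. note (exp_pos (- s)). note (exp_pos (- eta u)).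
  assert (exp (- s) <= 1) by (rewrite <- exp_0; apply exp_le; lra). rewrite Rabs_right by nra. nra.
 - apply flim_eq with (Rabs (b0 * (1 + 0 * 0) - b0) + 0); [|replace (b0 * (1 + 0 * 0) - b0) with 0 by ring; rewrite Rabs_R0; ring].
  apply (flim_plus (fun u => Rabs (b u * (1 + exp (- eta u) * exp (- eta u)) - b0))); auto.
  apply (flim_cont Rabs); [flim|apply continuous_Rabs].
Qed.

(** The size of the kernel at a distant pole, normalised so that the limit in [far_kernel_lim] is 1
    at [x = 0], [b0 = 1]. The factor [2 + S] is the limit of the bracket in [green_kernel_arch],
    with [4 S / 4] from the Bessel term and 2 from the hyperbolic cotangent. *)
Definition far_norm (S : R) (q : pt) : R := (2 + S) * (besselm (norm2 q ^ 2) * snd q / cosh (snd q) ^ 2).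

Lemma far_norm_pos (S : R) (q : pt) : 0 <= S -> 0 < snd q -> 0 < far_norm S q.
Proof.
 intros HS Hq. note (norm2_ge_snd q). note (cosh_ge1 (snd q)). apply Rmult_lt_0_compat; [lra|]. apply Rdiv_lt_0_compat; [|pos].
 apply Rmult_lt_0_compat; auto. apply besselm_pos, pow_lt. lra.
Qed.

(** In the limit the radius changes by [- x C + S ln b0], so the Bessel ratio gives [exp (C x / 2)]
    and [b0^(- S / 2)]; the factor [s / sinh^2 s] contributes [b0^(- 2)]. This is exactly the
    integrand of [theta_radial]. *)
Lemma far_kernel_lim {T : Type} {F : (T -> Prop) -> Prop} {FF : Filter F} (q : T -> pt) (b : T -> R) (x C S b0 : R) :
 0 < b0 -> 0 <= S -> C ^ 2 + S ^ 2 = 1 -> (forall M, F (fun u => M < snd (q u))) ->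
 filterlim (fun u => fst (q u) / norm2 (q u)) F (locally C) -> filterlim (fun u => snd (q u) / norm2 (q u)) F (locally S) ->
 filterlim b F (locally b0) ->
 filterlim (fun u => green_kernel (x - fst (q u)) (cosh (snd (q u)) * b u) / far_norm S (q u)) F
  (locally (exp (C / 2 * x) * Rpower b0 (- (2 + S / 2)))).
Proof.
 intros Hb0 HS HCS He HC HSl Hb. assert (HR : forall M, F (fun u => M < norm2 (q u))).
 { apply (flim_infty_le (fun u => snd (q u)) _ 0 He). apply filter_forall. intros u. note (norm2_ge_snd (q u)). lra. }
 note (flim_exp_infty _ He) as Hx. note (flim_inv_infty _ He) as Hi.
 assert (Eb : F (fun u => b0 / 2 < b u)) by exact (Hb _ (locally_gt b0 (b0 / 2) ltac:(lra))).
 assert (Ez : F (fun u => 1 <= cosh (snd (q u)) * b u)).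
 { weaken (filter_and _ _ Eb (He (2 + 4 / b0))). intros u [H1 H2]. assert (0 < 4 / b0) by pos.
  note (cosh_ge_sqr (snd (q u))). apply Rle_trans with (4 / b0 * (b0 / 2)); [replace (4 / b0 * (b0 / 2)) with 2 by (field; lra); lra|apply Rmult_le_compat; nra]. }
 set (s := fun u => arch (cosh (snd (q u)) * b u)).
 assert (Hs : filterlim (fun u => s u - snd (q u)) F (locally (ln b0))) by (apply arch_shift_lim; auto).
 assert (HsI : forall M, F (fun u => M < s u)).
 { apply (flim_infty_le (fun u => snd (q u)) _ (1 - ln b0) He).
  generalize (Hs _ (locally_gt (ln b0) (ln b0 - 1) ltac:(lra))). unfold filtermap. apply filter_imp. intros; lra. }
 destruct (far_radius_lim (fun u => fst (q u)) s q x C S (ln b0) HCS (fun _ => eq_refl) HR HC HSl Hs) as [Lr [Lq Lsr]].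
 set (r := fun u => norm2 (x - fst (q u), s u)) in *. note (besselm_ratio_lim (F := F) r (fun u => norm2 (q u)) _ HR Lr) as Lm.
 assert (HrI : forall M, F (fun u => M < r u)).
 { apply (flim_infty_le s _ 0 HsI). apply filter_forall. intros u. note (norm2_ge_snd (x - fst (q u), s u)). simpl in *. unfold r. lra. }
 note (flim_inv_infty _ HrI) as Hir. note (flim_inv_infty _ HsI) as His. note (flim_exp_infty _ HsI) as Hes.
 assert (Lk : filterlim (fun u => besselk (r u)) F (locally (1 / 4))).
 { apply (flim_squeeze _ (fun u => 3 * / r u)); [|apply flim_eq with (3 * 0); [flim|ring]].
  weaken (HrI 0). intros u Hu. note (besselk_bounds _ Hu). unfold Rdiv in *. apply Rabs_le. lra. }
 set (A := fun u => besselm (r u ^ 2) / besselm (norm2 (q u) ^ 2)). set (B := fun u => (s u - snd (q u)) * / snd (q u) + 1).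
 set (D := fun u => / (b u ^ 2 - (2 * exp (- snd (q u)) / (1 + exp (- snd (q u)) ^ 2)) ^ 2)).
 set (E := fun u => 4 * (s u / norm2 (q u) / (r u / norm2 (q u))) * besselk (r u) + 2 * ((1 + exp (- s u) ^ 2) / (1 - exp (- s u) ^ 2) - / s u)).
 apply (filterlim_ext_loc (fun u => A u * B u * D u * E u / (2 + S))).
 - weaken (filter_and _ _ (filter_and _ _ (HsI 0) (HrI 0)) (filter_and _ _ (He 0) Ez)). intros u [[H1 H2] [H3 H4]].
  assert (Ec : cosh (s u) = cosh (snd (q u)) * b u) by (apply cosh_arch; auto).
  assert (Hrn : r u ^ 2 = (x - fst (q u)) ^ 2 + s u ^ 2) by apply norm2_sqr. rewrite <- Ec, (green_kernel_arch _ (s u) (r u)) by auto.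
  note (sinh_pos _ H1) as Hsh. note (cosh2_sinh2 (s u)) as Hcs. assert (Hn : 0 < norm2 (q u)) by (note (norm2_ge_snd (q u)); lra).
  assert (E1 : 2 * exp (- snd (q u)) / (1 + exp (- snd (q u)) ^ 2) = / cosh (snd (q u))).
  { unfold cosh. rewrite exp_Ropp. note (exp_pos (snd (q u))). field. nra. }
  assert (E2 : (1 + exp (- s u) ^ 2) / (1 - exp (- s u) ^ 2) = cosh (s u) / sinh (s u)).
  { unfold cosh, sinh in *. rewrite exp_Ropp in *. note (exp_pos (s u)).
   assert (1 < exp (s u)) by nra. field. repeat match goal with |- _ /\ _ => split end; nra. }
  note (cosh_ge1 (snd (q u))) as Hch. set (ch := cosh (snd (q u))) in *. assert (E3 : b u ^ 2 - (/ ch) ^ 2 = sinh (s u) ^ 2 / ch ^ 2).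
  { replace (b u) with (cosh (s u) / ch) by (rewrite Ec; field; lra).
   replace (sinh (s u) ^ 2) with (cosh (s u) ^ 2 - 1) by lra. field. lra. }
  unfold A, B, D, E. rewrite E1, E2, E3. unfold far_norm. fold ch. note (besselm_pos (norm2 (q u) ^ 2) ltac:(apply pow_lt; auto)). field.
  repeat match goal with |- _ /\ _ => split end; lra.
 - apply flim_eq with (exp (- (- (x * C) + ln b0 * S) / 2) * (ln b0 * 0 + 1) * / (b0 ^ 2 - (2 * 0 / (1 + 0 ^ 2)) ^ 2) *
   (4 * (S / 1) * (1 / 4) + 2 * ((1 + 0 ^ 2) / (1 - 0 ^ 2) - 0)) / (2 + S)).
  + assert (LA : filterlim A F (locally (exp (- (- (x * C) + ln b0 * S) / 2)))) by exact Lm.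
   assert (LB : filterlim B F (locally (ln b0 * 0 + 1))) by (unfold B; flim).
   assert (LD : filterlim D F (locally (/ (b0 ^ 2 - (2 * 0 / (1 + 0 ^ 2)) ^ 2)))).
   { unfold D. flim; [|lra]. replace (b0 ^ 2 - (2 * 0 / (1 + 0 ^ 2)) ^ 2) with (b0 ^ 2) by field. apply pow_nonzero; lra. }
   assert (LE : filterlim E F (locally (4 * (S / 1) * (1 / 4) + 2 * ((1 + 0 ^ 2) / (1 - 0 ^ 2) - 0)))) by (unfold E; flim; lra).
   flim. lra.
  + replace (- (2 + S / 2)) with (- (2) + - (S / 2)) by ring. rewrite Rpower_plus. rewrite (Rpower_Ropp b0 2).
   replace (Rpower b0 2) with (b0 ^ 2) by (rewrite <- Rpower_pow by lra; f_equal; simpl; lra).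
   replace (- (- (x * C) + ln b0 * S) / 2) with (C / 2 * x + - (S / 2) * ln b0) by field. rewrite exp_plus.
   unfold Rpower. field. repeat match goal with |- _ /\ _ => split end; try lra. 
Qed.

Lemma besselm_le_shift (a b K : R) : 1 <= a -> 1 <= b -> 0 <= K -> b <= a + K -> besselm (a ^ 2) <= exp (7 * K) * besselm (b ^ 2).
Proof.
 intros Ha Hb HK H. note (besselm_pos (b ^ 2) ltac:(apply pow_lt; lra)) as Pb. note (besselm_pos (a ^ 2) ltac:(apply pow_lt; lra)) as Pa.
 destruct (Rle_lt_dec b a) as [Hab|Hab].
 - destruct (besselm_ratio b a ltac:(lra)) as [H1 _]. eapply Rle_trans; [eauto|]. rewrite Rmult_comm.
  apply Rmult_le_compat_r; [lra|]. apply exp_le. lra.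
 (* For radii at least 1 the logarithmic slope is at most [1 / 2 + 6], rounded up to 7. *)
 - assert (Hk : (1 / 2 + 6 / a) * (b - a) <= 7 * K).
  { assert (6 / a <= 6) by (apply Rle_div_l; lra). assert (0 < 6 / a) by pos. apply Rmult_le_compat; lra. }
  destruct (besselm_ratio a b ltac:(lra)) as [_ H1]. rewrite Rmult_comm.
  apply Rle_trans with (besselm (a ^ 2) * exp (- (1 / 2 + 6 / a) * (b - a)) * exp (7 * K)).
  + rewrite Rmult_assoc, <- exp_plus. rewrite <- (Rmult_1_r (besselm (a ^ 2))) at 1. apply Rmult_le_compat_l; [lra|].
   apply Rle_trans with (exp 0); [rewrite exp_0; lra|]. apply exp_le. lra.
  + apply Rmult_le_compat_r; auto. left; apply exp_pos.
Qed.

Lemma norm2_triang_shift (a b u v : R) : 0 <= u -> 0 <= v -> norm2 (Rabs a + u, Rabs b + v) <= norm2 (a, b) + u + v.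
Proof.
 intros Hu Hv. note (norm2_ge_fst (a, b)) as H1. note (norm2_ge_fst (b, a)) as H2.
 replace (norm2 (b, a)) with (norm2 (a, b)) in H2 by (unfold norm2; simpl; f_equal; ring). simpl in *.
 note (norm2_sqr (a, b)) as E1. note (norm2_sqr (Rabs a + u, Rabs b + v)) as E2. simpl in E1, E2.
 note (pow2_abs a). note (pow2_abs b). note (Rabs_pos a). note (Rabs_pos b).
 apply Rsqr_incr_0_var; [|lra]. unfold Rsqr. set (n := norm2 (a, b)) in *.
 assert (Rabs a * u <= n * u) by nra. assert (Rabs b * v <= n * v) by nra. assert (0 <= u * v) by pos. simpl in *. nra.
Qed.

Lemma norm2_le (a b c d : R) : Rabs a <= c -> Rabs b <= d -> norm2 (a, b) <= norm2 (c, d).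
Proof.
 intros H1 H2. apply sqrt_le_1_alt. cbn [fst snd]. rewrite <- (pow2_abs a), <- (pow2_abs b).
 apply Rplus_le_compat; apply pow_incr; split; auto; apply Rabs_pos.
Qed.

Lemma ln_double_le b : 0 < b -> ln (2 * b) <= 3 * sqrt b.
Proof.
 intros Hb. note (sqrt_lt_R0 b Hb) as Hs. assert (H2 : 0 < sqrt 2) by pos. assert (H3 : sqrt 2 <= 3 / 2).
 { rewrite <- (sqrt_pow2 (3 / 2)) by lra. apply sqrt_le_1_alt. lra. }
 replace (2 * b) with ((sqrt 2 * sqrt b) * (sqrt 2 * sqrt b)).
 2:{ replace (sqrt 2 * sqrt b * (sqrt 2 * sqrt b)) with ((sqrt 2 * sqrt 2) * (sqrt b * sqrt b)) by ring. rewrite !sqrt_sqrt by lra. ring. }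
 assert (H4 : 0 < sqrt 2 * sqrt b) by pos. rewrite ln_mult by auto. note (ln_le_self _ H4). nra.
Qed.

(** The domination that allows the far limit to pass under the integrals: the constant depends on
    [(x, y)] but neither on the pole nor on [S]. The lower bound on [b] is the least value of the
    rescaled [geo_arg], attained at [t = 0]. *)
Lemma far_kernel_decay (x y : R) : 0 < y -> exists C, 0 <= C /\ forall S (q : pt) b, 0 <= S -> y + Rabs x + 2 <= snd q ->
 cosh y - sinh (snd q) / cosh (snd q) * sinh y <= b -> 1 <= cosh (snd q) * b /\ 4 <= arcsq (cosh (snd q) * b) /\
 Rabs (green_kernel (x - fst q) (cosh (snd q) * b) / far_norm S q) <= C * Rpower b (- (3 / 2)).
Proof.
 intros Hy. exists (exp (7 * (Rabs x + y)) * 40 * (exp (y / 2) + 3)).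
 note (exp_pos (7 * (Rabs x + y))) as HE7. note (exp_pos (y / 2)) as HEy. split; [pos|]. intros S q b HS Hq Hb.
 note (Rabs_pos x) as Hx. set (eta := snd q) in *. note (cosh_ge1 eta) as Hch. set (ch := cosh eta) in *.
 assert (Hz : cosh (eta - y) <= ch * b).
 { replace (cosh (eta - y)) with (ch * (cosh y - sinh eta / ch * sinh y)); [nra|].
  replace (ch * (cosh y - sinh eta / ch * sinh y)) with (ch * cosh y - sinh eta * sinh y) by fld.
  unfold ch, cosh, sinh, Rminus. rewrite Ropp_plus_distr, !exp_plus, Ropp_involutive. field. }
 note (cosh_ge1 (eta - y)) as Hc1. split; [lra|]. assert (Hb0 : exp (- y) <= b).
 { eapply Rle_trans; [|eauto]. assert (Ht : sinh eta / ch <= 1) by (apply Rle_div_l; [lra|]; unfold ch, cosh, sinh; note (exp_pos (- eta)); lra).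
  note (sinh_pos y Hy). replace (exp (- y)) with (cosh y - 1 * sinh y) by (unfold cosh, sinh; field).
  apply Rplus_le_compat_l, Ropp_le_contravar, Rmult_le_compat_r; lra. }
 assert (Hbp : 0 < b) by nra. set (s := arch (ch * b)). assert (Es : cosh s = ch * b) by (apply cosh_arch; lra).
 assert (Hs : eta - y <= s).
 { assert (H : (eta - y) ^ 2 <= s ^ 2) by (rewrite <- !arcsq_cosh_all; apply arcsq_le; rewrite Es; lra).
  note (arch_ge0 (ch * b)) as H0. fold s in H0. apply Rsqr_incr_0_var; auto. unfold Rsqr; lra. }
 assert (Hs2 : 2 <= s) by lra. split; [rewrite <- Es, arcsq_cosh_all; nra|].
 set (r := norm2 (x - fst q, s)). assert (Er : r ^ 2 = (x - fst q) ^ 2 + s ^ 2) by apply norm2_sqr.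
 assert (Hrs : s <= r) by apply (norm2_ge_snd (x - fst q, s)). assert (HR : norm2 q <= r + Rabs x + y).
 { eapply Rle_trans; [|apply norm2_triang_shift; lra]. destruct q as [q1 q2]. apply norm2_le; simpl in *.
  - replace q1 with (- (x - q1) + x) at 1 by ring. eapply Rle_trans; [apply Rabs_triang|]. rewrite Rabs_Ropp. lra.
  - unfold eta in *. rewrite !Rabs_right by lra. lra. }
 note (norm2_ge_snd q) as HRe. fold eta in HRe.
 note (besselm_le_shift r (norm2 q) (Rabs x + y) ltac:(lra) ltac:(lra) ltac:(lra) ltac:(lra)) as Hm.
 note (besselm_pos (norm2 q ^ 2) ltac:(apply pow_lt; lra)) as Pm. note (besselm_pos (r ^ 2) ltac:(apply pow_lt; lra)) as Pr.
 rewrite <- Es, (green_kernel_arch _ s r) by lra. unfold far_norm. fold eta ch.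
 note (sinh_pos s ltac:(lra)) as Hsh. note (besselk_bounds r ltac:(lra)) as Hk. assert (Hcs : 1 <= cosh s / sinh s <= 2).
 { assert (H : exp 2 <= exp s) by (apply exp_le; lra). note (exp_ineq1 2 ltac:(lra)).
  assert (exp (- s) <= 1) by (rewrite <- exp_0; apply exp_le; lra). note (exp_pos (- s)).
  split; [apply (proj1 (Rle_div_r 1 _ _ Hsh))|apply (proj2 (Rle_div_l _ 2 _ Hsh))]; unfold cosh, sinh; lra. }
 set (E := 4 * (s / r) * besselk r + 2 * (cosh s / sinh s - / s)). assert (HE : 0 <= E <= 20).
 { assert (A1 : 0 < s / r <= 1) by (split; [apply Rdiv_lt_0_compat; lra|apply Rle_div_l; lra]). assert (A2 : 3 / r <= 3 / 2) by nra.
  assert (A3 : 0 < / s <= / 2) by (split; [apply Rinv_0_lt_compat|apply Rinv_le_contravar]; lra). unfold E. split; nra. }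
 assert (Hsi : 0 < s / sinh s ^ 2) by pos. assert (Hch2 : 0 < ch ^ 2) by pos.
 assert (Hd : 0 < besselm (norm2 q ^ 2) * eta / ch ^ 2) by pos. rewrite Rabs_right.
 2:{ apply Rle_ge. apply Rmult_le_pos; [|pos]. apply Rmult_le_pos; [|lra].
   apply Rmult_le_pos; lra. }
 apply (proj2 (Rle_div_l _ _ _ (Rmult_lt_0_compat _ _ (ltac:(lra) : 0 < 2 + S) Hd))).
 apply Rle_trans with (exp (7 * (Rabs x + y)) * besselm (norm2 q ^ 2) * (s / sinh s ^ 2) * 20).
 { apply Rmult_le_compat; try lra; [pos|]. apply Rmult_le_compat_r; lra. }
 (* From [cosh s = ch * b] one gets [s <= eta + ln (2 b)], and the logarithm is absorbed by [sqrt b]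
    because [eta >= 1]. With [sinh^2 s >= ch^2 b^2 / 4] this produces [sqrt b / b^2], the required
    power [- 3 / 2]. *)
 set (em := exp (7 * (Rabs x + y))) in *. set (m := besselm (norm2 q ^ 2)) in *. assert (Hsb : s <= eta * (1 + 3 * sqrt b)).
 { note (sqrt_pos b). assert (Hln : s <= eta + ln (2 * b)).
  { rewrite <- (ln_exp s). rewrite <- (ln_exp eta) at 1. rewrite <- ln_mult by pos. apply ln_le; [pos|].
   note (cosh_ge_exp s) as H1. rewrite Es in H1. assert (ch <= exp eta).
   { unfold ch, cosh. assert (exp (- eta) <= exp eta) by (apply exp_le; lra). lra. } nra. }
  note (ln_double_le b Hbp). nra. }
 assert (Hsq : sinh s ^ 2 >= ch ^ 2 * b ^ 2 / 4).
 { replace (ch ^ 2 * b ^ 2 / 4) with ((cosh s / 2) ^ 2) by nra. apply Rle_ge, pow_incr.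
  assert (cosh s <= 2 * sinh s) by (apply (proj1 (Rle_div_l _ 2 _ Hsh)); lra). note (cosh_ge1 s). lra. }
 assert (Hs1 : 1 <= exp (y / 2) * sqrt b).
 { replace 1 with (exp (y / 2) * exp (- y / 2)) by (rewrite <- exp_plus; replace (y / 2 + - y / 2) with 0 by field; apply exp_0).
  apply Rmult_le_compat_l; [lra|]. rewrite <- (sqrt_pow2 (exp (- y / 2))) by pos.
  apply sqrt_le_1_alt. simpl. rewrite Rmult_1_r, <- exp_plus. replace (- y / 2 + - y / 2) with (- y) by field. auto. }
 assert (EP : Rpower b (- (3 / 2)) = sqrt b / b ^ 2).
 { replace (- (3 / 2)) with (/ 2 + - (2)) by field. rewrite Rpower_plus, Rpower_sqrt, (Rpower_Ropp b 2) by auto.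
  replace (Rpower b 2) with (b ^ 2) by (rewrite <- Rpower_pow by lra; f_equal; simpl; lra). reflexivity. }
 rewrite EP. assert (Hb2 : 0 < b ^ 2) by pos. apply Rle_trans with (em * m * (eta * (1 + 3 * sqrt b) / (ch ^ 2 * b ^ 2 / 4)) * 20).
 { apply Rmult_le_compat_r; [lra|]. apply Rmult_le_compat_l; [lra|]. apply Rmult_le_compat; [lra|pos|auto|].
  apply Rinv_le_contravar; [|lra]. apply Rdiv_lt_0_compat; [pos|lra]. }
 apply Rle_trans with (em * 40 * ((exp (y / 2) + 3) * sqrt b / b ^ 2) * (2 * (m * eta / ch ^ 2))).
 - replace (em * m * (eta * (1 + 3 * sqrt b) / (ch ^ 2 * b ^ 2 / 4)) * 20) with (em * m * eta * 80 / (ch ^ 2 * b ^ 2) * (1 + 3 * sqrt b)) by fld.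
  replace (em * 40 * ((exp (y / 2) + 3) * sqrt b / b ^ 2) * (2 * (m * eta / ch ^ 2))) with
   (em * m * eta * 80 / (ch ^ 2 * b ^ 2) * ((exp (y / 2) + 3) * sqrt b)) by fld.
  apply Rmult_le_compat_l; [|lra]. apply Rlt_le, Rdiv_lt_0_compat; [|pos].
  apply Rmult_lt_0_compat; [|lra]. apply Rmult_lt_0_compat; [|lra]. apply Rmult_lt_0_compat; lra.
 - unfold Rdiv. rewrite <- !Rmult_assoc. replace (em * 40 * (exp (y * / 2) + 3) * sqrt b * / b ^ 2 * 2 * m * eta * / ch ^ 2) with
   (em * 40 * (exp (y * / 2) + 3) * sqrt b * / b ^ 2 * (m * eta * / ch ^ 2) * 2) by ring.
  replace (em * 40 * (exp (y * / 2) + 3) * sqrt b * / b ^ 2 * (2 + S) * m * eta * / ch ^ 2) with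
   (em * 40 * (exp (y * / 2) + 3) * sqrt b * / b ^ 2 * (m * eta * / ch ^ 2) * (2 + S)) by ring.
  apply Rmult_le_compat_l; [|lra]. note (sqrt_pos b). note (Rinv_0_lt_compat _ Hb2).
  repeat (apply Rmult_le_pos; [|lra]); try lra; unfold Rdiv in *; try lra.
Qed.

(** The substitution [z = lam * b] acts on the starting point and on the scale of the descent alike,
    so no Jacobian appears. *)
Lemma green_avg_scaled (q p : pt) (N lam c : R) (A : R -> R) : 0 < N -> 0 <= snd q -> 0 <= snd p -> p <> q ->
 lam * c = cosh (snd q) -> (forall t, lam * A t = geo_arg (cosh (snd q)) (sinh (snd q)) (snd p) t) ->
 ex_RInt (fun t => sin t ^ 2 * descent (fun b => green_kernel (fst p - fst q) (lam * b) / N) (A t) c) 0 PI /\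
 RInt (fun t => sin t ^ 2 * descent (fun b => green_kernel (fst p - fst q) (lam * b) / N) (A t) c) 0 PI = green_avg q p / N.
Proof.
 intros HN Hq Hp Hne Hc HA. note (green_average_domain q p Hq Hp Hne) as Hdom. note (cosh_ge1 (snd q)) as Hch. set (X := fst p - fst q).
 assert (HD : forall t, 0 <= t <= PI -> descent (fun b => green_kernel X (lam * b) / N) (A t) c =
   / N * green_radial (cosh (snd q)) X (geo_arg (cosh (snd q)) (sinh (snd q)) (snd p) t)).
 { intros t Ht. unfold green_radial, descent. rewrite <- RInt_Rcmult.
  - apply RInt_ext. intros e _. unfold descent_integrand. destruct (Rlt_dec 0 e) as [He|He]; [|lra].
   rewrite Rmult_plus_distr_l, <- Rmult_assoc, Hc, HA. eqR. unfold Rdiv. ring.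
  - apply (ex_RInt_descent_adm green_domain); auto using green_domain_kernel, admissible_green; lra. }
 note (ex_RInt_average_slice green_domain (green_radial (cosh (snd q))) (fst q) _ _ p
  (green_radial_continuous (cosh (snd q)) ltac:(lra)) Hdom) as Hex.
 note PI_RGT_0 as HPI.
 assert (HE : forall t, Rmin 0 PI < t < Rmax 0 PI -> / N * (sin t ^ 2 * green_radial (cosh (snd q)) X (geo_arg (cosh (snd q)) (sinh (snd q)) (snd p) t)) =
   sin t ^ 2 * descent (fun b => green_kernel X (lam * b) / N) (A t) c).
 { intros t Ht. rewrite Rmin_left, Rmax_right in Ht by lra. rewrite HD by lra. ring. }
 split.
 - eapply ex_RInt_ext; [exact HE|]. apply ex_RInt_Rcmult. exact Hex.
 - rewrite <- (RInt_ext _ _ _ _ HE). rewrite RInt_Rcmult by exact Hex. exact (Rmult_comm _ _).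
Qed.

(** After division by [cosh (snd q)] the centre of the spheres is [(1, tanh (snd q))], which tends
    to the light-like vector [(1, 1)]: spheres about the escaping pole become horospheres. *)
Lemma green_avg_far (F : (pt -> Prop) -> Prop) (FF : Filter F) (om p : pt) : Sigma p ->
 0 <= snd om -> fst om ^ 2 + snd om ^ 2 = 1 -> (forall M, F (fun q => M < snd q)) ->
 filterlim (fun q => fst q / norm2 q) F (locally (fst om)) -> filterlim (fun q => snd q / norm2 q) F (locally (snd om)) ->
 filterlim (fun q => green_avg q p / far_norm (snd om) q) F (locally (average wsin2 (theta_radial (fst om / 2) (snd om / 2)) 0 1 1 p)).
Proof.
 intros Hp Hom HCS He HC HS. unfold Sigma in Hp. set (x := fst p). set (y := snd p) in *. set (S := snd om) in *. set (C := fst om) in *.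
 destruct (far_kernel_decay x y Hp) as [K [HK Hdec]].
 assert (Hgood : forall q : pt, y + Rabs x + 2 <= snd q -> 0 <= snd q /\ p <> q /\ 0 < far_norm S q /\ 1 <= cosh (snd q)).
 { intros q Hq. note (Rabs_pos x). split; [lra|split; [intros ->; unfold y in *; lra|split; [apply far_norm_pos; lra|apply cosh_ge1]]]. }
 note (He (y + Rabs x + 2)) as HeE.
 apply (filterlim_ext_loc (fun q => RInt (fun t => sin t ^ 2 * descent (fun b => green_kernel (x - fst q) (cosh (snd q) * b) / far_norm S q)
   (geo_arg 1 (sinh (snd q) / cosh (snd q)) y t) 1) 0 PI)).
 { weaken HeE. intros q Hq. destruct (Hgood q ltac:(lra)) as [G1 [G2 [G3 G4]]].
  apply (green_avg_scaled q p (far_norm S q) (cosh (snd q)) 1 (fun t => geo_arg 1 (sinh (snd q) / cosh (snd q)) y t)); auto; try (unfold y in *; lra).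
  intros t. unfold geo_arg. fold y. field. lra. }
 unfold average, wsin2, theta_radial. fold y. replace (fst p - 0) with x by (unfold x; ring).
 assert (Hdom : average_domain pos_domain 0 1 1 p) by (apply theta_average_domain; unfold y in *; lra).
 assert (Hth : filterlim (fun q : pt => sinh (snd q) / cosh (snd q)) F (locally 1)).
 { note (flim_exp_infty _ He) as Hx. apply (filterlim_ext (fun q : pt => (1 - exp (- snd q) ^ 2) / (1 + exp (- snd q) ^ 2))).
  - intros q. unfold sinh, cosh. rewrite exp_Ropp. note (exp_pos (snd q)). field. repeat match goal with |- _ /\ _ => split end; nra.
  - apply flim_eq with ((1 - 0 ^ 2) / (1 + 0 ^ 2)); [|field]. flim. lra. }
 apply (average_lim F FF (fun q b => green_kernel (x - fst q) (cosh (snd q) * b) / far_norm S q)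
  (fun q t => geo_arg 1 (sinh (snd q) / cosh (snd q)) y t) (fun _ => 1)
  (fun z => exp (C / 2 * x) * Rpower z (- (2 + S / 2))) (fun t => geo_arg 1 1 y t)).
 - lra.
 - apply flim_const.
 - intros t Ht. split; [apply (Hdom t Ht)|]. unfold geo_arg.
  assert (G1 : filterlim (fun r : pt * R => sinh (snd (fst r)) / cosh (snd (fst r))) (filter_prod F (locally t)) (locally 1)) by (apply (flim_fst (fun q : pt => sinh (snd q) / cosh (snd q))); auto).
  assert (G2 : filterlim (fun r : pt * R => cos (snd r)) (filter_prod F (locally t)) (locally (cos t))) by (apply (flim_snd cos); apply continuous_cos).
  flim.
 - intros t z Ht Hz. assert (Hz0 : 0 < z) by (note (Hdom t Ht) as H; unfold pos_domain in H; fold y in H; lra). split.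
  + apply continuous_Rmult; [apply continuous_const|apply continuous_Rpower; auto].
  + apply (far_kernel_lim (F := filter_prod F (locally z)) fst snd x C S z); auto.
   * intros M. exact (filterlim_fst (F := F) (G := locally z) _ (He M)).
   * apply (flim_fst (fun q => fst q / norm2 q)); auto.
   * apply (flim_fst (fun q => snd q / norm2 q)); auto.
   * apply (flim_snd (fun z => z)). apply continuous_id.
 - intros t Ht. set (K2 := exp (C / 2 * x) * exp ((1 / 2 + S / 2) * y)).
  exists (Rmax K K2). note (Rmax_l K K2) as M1. note (Rmax_r K K2) as M2. split; [lra|split].
  + intros z Hz. note (geo_arg_horo y t ltac:(lra)) as Hge. note (exp_pos (- y)) as Hey. rewrite Rabs_right by pos.
   apply Rle_trans with (K2 * Rpower z (- (3 / 2))); [|apply Rmult_le_compat_r; auto; left; apply exp_pos].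
   unfold K2. rewrite Rmult_assoc. apply Rmult_le_compat_l; [pos|]. unfold Rpower. rewrite <- exp_plus. apply exp_le.
   assert (- y <= ln z) by (rewrite <- (ln_exp (- y)); apply ln_le; lra).
   assert ((1 / 2 + S / 2) * (- ln z) <= (1 / 2 + S / 2) * y) by nra. lra.
  + generalize (filterlim_fst (F := F) (G := locally t) _ HeE). unfold filtermap. apply filter_imp. intros [q t'] Hq. cbn [fst snd] in *.
   destruct (Hgood q ltac:(lra)) as [G1 [G2 [G3 G4]]].
   assert (Hmin : cosh y - sinh (snd q) / cosh (snd q) * sinh y <= geo_arg 1 (sinh (snd q) / cosh (snd q)) y t').
   { unfold geo_arg. rewrite Rmult_1_l. apply Rplus_le_compat_l, Ropp_le_contravar. note (COS_bound t') as Hcb.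
    assert (H0 : 0 <= sinh (snd q) / cosh (snd q) * sinh y).
    { apply Rmult_le_pos; [|left; apply sinh_pos; auto]. note (sinh_ge_id (snd q) G1). apply Rmult_le_pos; [lra|pos]. }
    rewrite <- (Rmult_1_r (sinh (snd q) / cosh (snd q) * sinh y)) at 2. apply Rmult_le_compat_l; lra. }
   split; intros z Hz; destruct (Hdec S q z Hom ltac:(lra) ltac:(lra)) as [D1 [D3 D2]].
   * eapply Rle_trans; [eauto|]. apply Rmult_le_compat_r; auto. left; apply exp_pos.
   * apply continuous_Rmult; [|apply continuous_const]. apply (continuous_comp (fun z => cosh (snd q) * z) (green_kernel (x - fst q))).
    -- apply continuous_Rmult; [apply continuous_const|apply continuous_id].
    -- apply continuous_2d_snd, admissible_green. split; [lra|]. note (pow2_ge_0 (x - fst q)). lra.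
 - weaken HeE. intros q Hq. destruct (Hgood q ltac:(lra)) as [G1 [G2 [G3 G4]]].
  apply (green_avg_scaled q p (far_norm S q) (cosh (snd q)) 1 (fun t => geo_arg 1 (sinh (snd q) / cosh (snd q)) y t)); auto; try (unfold y in *; lra).
  intros t. unfold geo_arg. fold y. field. lra.
 - intros t Ht. note (continuous_average_slice pos_domain (theta_radial (C / 2) (S / 2)) 0 1 1 p t
   (theta_radial_continuous (C / 2) (S / 2) ltac:(lra)) Hdom Ht) as H.
  unfold theta_radial in H. fold y in H. replace (fst p - 0) with x in H by (unfold x; ring). exact H.
Qed.

(** * Poles escaping sideways at bounded height *)

(** When only the abscissa of the pole is large, the term with [besselm1] is smaller by a factor of
    order [/ r], and the term [2 * arcL 1 * besselm] survives. *)
Lemma corner_kernel_lim {T : Type} {F : (T -> Prop) -> Prop} {FF : Filter F} (xi z : T -> R) (x sg z0 : R) :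
 sg ^ 2 = 1 -> 0 < z0 -> (forall M, F (fun u => M < sg * xi u)) -> filterlim z F (locally z0) ->
 filterlim (fun u => green_kernel (x - xi u) (1 * z u) / (2 * besselm (xi u ^ 2))) F (locally (exp (sg / 2 * x) * arcL 1 z0)).
Proof.
 intros Hsg Hz0 HR Hz. set (R0 := fun u => sg * xi u). change (forall M, F (fun u => M < R0 u)) in HR. note (flim_inv_infty _ HR) as Hi.
 assert (Ha : filterlim (fun u => arcsq (z u)) F (locally (arcsq z0))) by (apply (flim_cont arcsq); auto; apply continuous_arcsq; auto).
 assert (HL : forall n, filterlim (fun u => arcL n (z u)) F (locally (arcL n z0))) by (intros n; apply (flim_cont (arcL n)); auto; apply continuous_arcL; auto).
 note (HL 0%nat) as HL0. note (HL 1%nat) as HL1. set (v := fun u => (x - xi u) ^ 2 + arcsq (z u)).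
 set (w := fun u => (x * / R0 u - sg) ^ 2 + arcsq (z u) * / R0 u * / R0 u). assert (Hw : filterlim w F (locally 1)).
 { apply flim_eq with ((x * 0 - sg) ^ 2 + arcsq z0 * 0 * 0); [unfold w; flim|]. rewrite <- Hsg. ring. }
 assert (Hxi : forall u, xi u = sg * R0 u) by (intros u; unfold R0; rewrite <- Rmult_assoc; replace (sg * sg) with (sg ^ 2) by ring; rewrite Hsg; ring).
 assert (Hvw : forall u, 0 < R0 u -> v u = w u * R0 u ^ 2).
 { intros u Hu. unfold v, w. rewrite (Hxi u).
  replace (((x * / R0 u - sg) ^ 2 + arcsq (z u) * / R0 u * / R0 u) * R0 u ^ 2) with ((x - sg * R0 u) ^ 2 + arcsq (z u)) by fld. reflexivity. }
 assert (Ew : F (fun u => 0 < w u)) by exact (Hw _ (locally_gt 1 0 ltac:(lra))). set (r := fun u => sqrt (v u)).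
 assert (Hrq : filterlim (fun u => r u / R0 u) F (locally 1)).
 { apply (filterlim_ext_loc (fun u => sqrt (w u))).
  - weaken (filter_and _ _ (HR 0) Ew). intros u [H1 H2]. unfold r. rewrite Hvw by auto.
   rewrite sqrt_mult by pos. rewrite sqrt_pow2 by lra. field. lra.
  - rewrite <- sqrt_1. apply (flim_cont sqrt); auto. apply continuity_pt_filterlim, continuity_pt_sqrt. lra. }
 assert (Hrd : filterlim (fun u => r u - R0 u) F (locally (- (sg * x)))).
 { apply (filterlim_ext_loc (fun u => ((x ^ 2 + arcsq (z u)) * / R0 u - 2 * x * sg) / (r u / R0 u + 1))).
  - weaken (filter_and _ _ (HR 0) Ew). intros u [H1 H2].
   assert (Hv : 0 < v u) by (rewrite Hvw by auto; apply Rmult_lt_0_compat; [|apply pow_lt]; auto).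
   note (sqrt_lt_R0 _ Hv) as Hr. fold (r u) in Hr. assert (Er : r u ^ 2 = v u) by (apply pow2_sqrt; lra).
   replace (((x ^ 2 + arcsq (z u)) * / R0 u - 2 * x * sg) / (r u / R0 u + 1)) with ((x ^ 2 + arcsq (z u) - 2 * x * sg * R0 u) / (r u + R0 u)) by fld.
   replace (x ^ 2 + arcsq (z u) - 2 * x * sg * R0 u) with (r u ^ 2 - R0 u ^ 2); [fld|].
   rewrite Er. unfold v. rewrite (Hxi u). replace ((x - sg * R0 u) ^ 2) with (x ^ 2 - 2 * x * sg * R0 u + sg ^ 2 * R0 u ^ 2) by ring. rewrite Hsg. ring.
  - apply flim_eq with (((x ^ 2 + arcsq z0) * 0 - 2 * x * sg) / (1 + 1)); [|field]. flim. lra. }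
 assert (HrI : forall M, F (fun u => M < r u)).
 { apply (flim_infty_le R0 _ (sg * x + 1) HR).
  assert (E : F (fun u => - (sg * x) - 1 < r u - R0 u)) by exact (Hrd _ (locally_gt (- (sg * x)) (- (sg * x) - 1) ltac:(lra))).
  weaken E. intros; lra. }
 note (flim_inv_infty _ HrI) as Hir. assert (Lk : filterlim (fun u => besselk (r u)) F (locally (1 / 4))).
 { apply (flim_squeeze _ (fun u => 3 * / r u)); [|apply flim_eq with (3 * 0); [flim|ring]].
  weaken (HrI 0). intros u Hu. note (besselk_bounds _ Hu). unfold Rdiv in *. apply Rabs_le. lra. }
 note (besselm_ratio_lim (F := F) r R0 _ HR Hrd) as Lm.
 apply (filterlim_ext_loc (fun u => besselm (r u ^ 2) / besselm (R0 u ^ 2) * (2 * arcL 0 (z u) ^ 2 * (besselk (r u) * / r u) + arcL 1 (z u)))).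
 - weaken (filter_and _ _ (HR 0) (HrI 0)). intros u [H1 H2]. assert (Er : r u ^ 2 = v u).
  { apply pow2_sqrt. apply Rnot_lt_le. intros C. unfold r in H2. rewrite sqrt_neg_0 in H2 by lra. lra. }
  assert (E0 : xi u ^ 2 = R0 u ^ 2) by (rewrite (Hxi u), Rpow_mult_distr, Hsg; ring).
  rewrite E0, Rmult_1_l. unfold green_kernel, besselk. fold (v u). rewrite <- Er.
  note (besselm_pos (R0 u ^ 2) ltac:(apply pow_lt; auto)). note (besselm_pos (r u ^ 2) ltac:(apply pow_lt; auto)). field. lra.
 - apply flim_eq with (exp (- - (sg * x) / 2) * (2 * arcL 0 z0 ^ 2 * (1 / 4 * 0) + arcL 1 z0)).
  + apply (flim_mult (fun u => besselm (r u ^ 2) / besselm (R0 u ^ 2))); [pos|]. flim.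
  + replace (- - (sg * x) / 2) with (sg / 2 * x) by field. ring.
Qed.

Lemma corner_kernel_decay (x : R) : exists C, 0 <= C /\ forall xi z, Rabs x + 2 <= Rabs xi -> 1 <= z ->
 Rabs (green_kernel (x - xi) (1 * z) / (2 * besselm (xi ^ 2))) <= C * Rpower z (- (3 / 2)).
Proof.
 destruct (green_kernel_le 1 ltac:(lra)) as [C [HC H]]. exists (C * exp (7 * Rabs x)). note (exp_pos (7 * Rabs x)).
 split; [pos|]. intros xi z Hxi Hz. rewrite Rmult_1_l. note (Rabs_pos x) as Hx.
 note (Rabs_triang (xi - x) x) as T. replace (xi - x + x) with xi in T by ring. rewrite Rabs_minus_sym in T.
 set (X := x - xi) in *. set (a := Rabs X) in *. note (arcsq_ge0 z Hz) as Ha. assert (Ea : a ^ 2 = X ^ 2) by apply pow2_abs.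
 assert (Hv : 1 ^ 2 <= X ^ 2 + arcsq z) by nra. specialize (H X z Hz Hv).
 assert (Hm : besselm (X ^ 2 + arcsq z) <= exp (7 * Rabs x) * besselm (xi ^ 2)).
 { rewrite <- (pow2_abs xi). eapply Rle_trans; [apply (besselm_decr (a ^ 2)); rewrite Ea in *; split; [rewrite <- Ea; apply pow_lt|]; lra|].
  apply besselm_le_shift; lra. }
 assert (Pm : 0 < besselm (xi ^ 2)) by (apply besselm_pos; rewrite <- pow2_abs; apply pow_lt; lra).
 assert (Pg : 0 < green_kernel X z) by (apply green_kernel_pos; split; lra).
 assert (Pz : Rpower z (- (7 / 4)) <= Rpower z (- (3 / 2))) by (apply Rle_Rpower; lra).
 assert (P3 : 0 < Rpower z (- (3 / 2))) by apply exp_pos. assert (P7 : 0 < Rpower z (- (7 / 4))) by apply exp_pos.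
 rewrite Rabs_right by pos. apply (proj2 (Rle_div_l _ _ _ (ltac:(lra) : 0 < 2 * besselm (xi ^ 2)))). eapply Rle_trans; [eauto|].
 assert (Pv : 0 < besselm (X ^ 2 + arcsq z)) by (apply besselm_pos; lra).
 apply Rle_trans with (C * (exp (7 * Rabs x) * besselm (xi ^ 2)) * Rpower z (- (3 / 2))).
 - apply Rmult_le_compat; [pos|lra| |auto]. apply Rmult_le_compat_l; lra.
 - replace (C * exp (7 * Rabs x) * Rpower z (- (3 / 2)) * (2 * besselm (xi ^ 2))) with
   (2 * (C * (exp (7 * Rabs x) * besselm (xi ^ 2)) * Rpower z (- (3 / 2)))) by ring.
  assert (0 <= C * (exp (7 * Rabs x) * besselm (xi ^ 2)) * Rpower z (- (3 / 2))); [|lra]. repeat (apply Rmult_le_pos; try lra).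
Qed.

Definition corner_radial (a c X z : R) : R := descent (fun z => exp (a * X) * arcL 1 z) z c.

Lemma geo_arg_ge1 (eta y t : R) : 0 <= eta -> 0 <= y -> 1 <= geo_arg (cosh eta) (sinh eta) y t.
Proof.
 intros He Hy. destruct (geo_arg_ge (0, eta) (0, y) t He Hy) as [H1 H2]. simpl in *. rewrite <- H1.
 note (cosh_ge1 (y - eta)). note (COS_bound t). nra.
Qed.

Lemma corner_average_domain (eta : R) (p : pt) : 0 <= eta -> 0 <= snd p -> average_domain mid_domain 0 (cosh eta) (sinh eta) p.
Proof. intros He Hp t _. note (geo_arg_ge1 eta (snd p) t He Hp). unfold mid_domain. lra. Qed.

Lemma corner_admissible (a : R) : admissible mid_domain (fun X z => exp (a * X) * arcL 1 z).
Proof. apply (admissible_mid (fun X => exp (a * X))); [intros; apply continuous_exp_lin|apply Ldecay_L1]. Qed.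

Lemma corner_radial_continuous (a c : R) : 0 < c -> continuous_on_domain mid_domain (corner_radial a c).
Proof. intros Hc. exact (continuous_descent mid_domain _ c mid_domain_kernel (corner_admissible a) Hc). Qed.

Lemma green_avg_corner (F : (pt -> Prop) -> Prop) (FF : Filter F) (sg eta : R) (p : pt) : Sigma p -> sg ^ 2 = 1 -> 0 <= eta ->
 (forall M, F (fun q => M < sg * fst q)) -> filterlim (fun q => snd q) F (locally eta) -> F (fun q => 0 <= snd q) ->
 filterlim (fun q => green_avg q p / (2 * besselm (fst q ^ 2))) F
  (locally (average wsin2 (corner_radial (sg / 2) (cosh eta)) 0 (cosh eta) (sinh eta) p)).
Proof.
 intros Hp Hsg Heta HR Hs H0. unfold Sigma in Hp. set (x := fst p). set (y := snd p) in *.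
 destruct (corner_kernel_decay x) as [K [HK Hdec]]. assert (HE : F (fun q => 0 <= snd q /\ Rabs x + 2 <= Rabs (fst q))).
 { apply filter_and; auto. weaken (HR (Rabs x + 2)). intros q Hq. rewrite <- (Rmult_1_l (Rabs (fst q))). replace 1 with (Rabs sg).
  - rewrite <- Rabs_mult. note (Rle_abs (sg * fst q)). lra.
  - assert (sg = 1 \/ sg = -1) as [-> | ->] by nra. apply Rabs_R1. rewrite Rabs_left; lra. }
 assert (Hgood : forall q : pt, 0 <= snd q /\ Rabs x + 2 <= Rabs (fst q) -> p <> q /\ 0 < 2 * besselm (fst q ^ 2)).
 { intros q [H1 H2]. split; [intros ->; unfold x in *; lra|]. note (Rabs_pos x). apply Rmult_lt_0_compat; [lra|]. apply besselm_pos. rewrite <- pow2_abs. apply pow_lt; lra. }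
 assert (Cc : forall y, continuous cosh y) by (intros; apply continuous_cosh). assert (Cs : forall y, continuous sinh y) by (intros; apply continuous_sinh).
 assert (Fc : filterlim (fun q : pt => cosh (snd q)) F (locally (cosh eta))) by (apply (flim_cont cosh); auto).
 assert (Fs : filterlim (fun q : pt => sinh (snd q)) F (locally (sinh eta))) by (apply (flim_cont sinh); auto). note (cosh_ge1 eta) as Hch.
 apply (filterlim_ext_loc (fun q => RInt (fun t => sin t ^ 2 * descent (fun b => green_kernel (x - fst q) (1 * b) / (2 * besselm (fst q ^ 2)))
   (geo_arg (cosh (snd q)) (sinh (snd q)) y t) (cosh (snd q))) 0 PI)).
 { weaken HE. intros q Hq. destruct (Hgood q Hq) as [G1 G2].
  apply (green_avg_scaled q p (2 * besselm (fst q ^ 2)) 1 (cosh (snd q)) (fun t => geo_arg (cosh (snd q)) (sinh (snd q)) y t)); auto; try (unfold y in *; lra); try (intros; apply Rmult_1_l). }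
 unfold average, wsin2, corner_radial. fold y. replace (fst p - 0) with x by (unfold x; ring).
 assert (Hdom : average_domain mid_domain 0 (cosh eta) (sinh eta) p) by (apply corner_average_domain; unfold y in *; lra).
 apply (average_lim F FF (fun q b => green_kernel (x - fst q) (1 * b) / (2 * besselm (fst q ^ 2)))
  (fun q t => geo_arg (cosh (snd q)) (sinh (snd q)) y t) (fun q => cosh (snd q))
  (fun z => exp (sg / 2 * x) * arcL 1 z) (fun t => geo_arg (cosh eta) (sinh eta) y t)).
 - lra.
 - exact Fc.
 - intros t Ht. split; [note (geo_arg_ge1 eta y t Heta ltac:(lra)); lra|]. unfold geo_arg.
  assert (G1 : filterlim (fun r : pt * R => cosh (snd (fst r))) (filter_prod F (locally t)) (locally (cosh eta))) by (apply (flim_fst (fun q : pt => cosh (snd q))); auto).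
  assert (G2 : filterlim (fun r : pt * R => sinh (snd (fst r))) (filter_prod F (locally t)) (locally (sinh eta))) by (apply (flim_fst (fun q : pt => sinh (snd q))); auto).
  assert (G3 : filterlim (fun r : pt * R => cos (snd r)) (filter_prod F (locally t)) (locally (cos t))) by (apply (flim_snd cos); apply continuous_cos).
  flim.
 - intros t z Ht Hz. assert (Hz0 : 0 < z) by (note (geo_arg_ge1 eta y t Heta ltac:(lra)); lra). split.
  + apply continuous_Rmult; [apply continuous_const|apply continuous_arcL; auto].
  + apply (corner_kernel_lim (F := filter_prod F (locally z)) (fun r : pt * R => fst (fst r)) snd x sg z); auto.
   * intros M. exact (filterlim_fst (F := F) (G := locally z) _ (HR M)).
   * apply (flim_snd (fun z => z)). apply continuous_id.
 - intros t Ht. set (K2 := exp (sg / 2 * x) * 16).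
  exists (Rmax K K2). note (Rmax_l K K2) as M1. note (Rmax_r K K2) as M2. split; [lra|split].
  + intros z Hz. note (geo_arg_ge1 eta y t Heta ltac:(lra)) as Hge. note (exp_pos (sg / 2 * x)) as Hex.
   note (arcL_pos 1 z ltac:(lra)). rewrite Rabs_right by pos.
   apply Rle_trans with (K2 * Rpower z (- (3 / 2))); [|apply Rmult_le_compat_r; auto; left; apply exp_pos].
   unfold K2. rewrite Rmult_assoc. apply Rmult_le_compat_l; [lra|]. eapply Rle_trans; [apply arcL1_le; lra|].
   apply Rmult_le_compat_l; [lra|]. apply Rle_Rpower; lra.
  + generalize (filterlim_fst (F := F) (G := locally t) _ HE). unfold filtermap. apply filter_imp. intros [q t'] Hq. cbn [fst snd] in *.
   destruct (Hgood q Hq) as [G1 G2]. destruct Hq as [Hq1 Hq2]. note (geo_arg_ge1 (snd q) y t' Hq1 ltac:(lra)) as Hge. split; intros z Hz.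
   * eapply Rle_trans; [apply Hdec; lra|]. apply Rmult_le_compat_r; auto. left; apply exp_pos.
   * apply continuous_Rmult; [|apply continuous_const].
    apply (continuous_comp (fun z => 1 * z) (green_kernel (x - fst q))); [apply continuous_Rmult; [apply continuous_const|apply continuous_id]|].
    apply continuous_2d_snd, admissible_green. rewrite Rmult_1_l. split; [lra|]. note (arcsq_ge0 z ltac:(lra)).
    assert (0 < (x - fst q) ^ 2); [|lra]. rewrite <- pow2_abs. apply pow_lt.
    note (Rabs_triang (fst q - x) x) as T. replace (fst q - x + x) with (fst q) in T by ring. rewrite Rabs_minus_sym in T. lra.
 - weaken HE. intros q Hq. destruct (Hgood q Hq) as [G1 G2].
  apply (green_avg_scaled q p (2 * besselm (fst q ^ 2)) 1 (cosh (snd q)) (fun t => geo_arg (cosh (snd q)) (sinh (snd q)) y t)); auto; try (unfold y in *; lra); try (intros; apply Rmult_1_l).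
 - intros t Ht. note (continuous_average_slice mid_domain (corner_radial (sg / 2) (cosh eta)) 0 (cosh eta) (sinh eta) p t
   (corner_radial_continuous (sg / 2) (cosh eta) ltac:(lra)) Hdom Ht) as H.
  unfold corner_radial in H. fold y in H. replace (fst p - 0) with x in H by (unfold x; ring). exact H.
Qed.

(** * Uniqueness of product solutions *)

Lemma radial_U_exp D (l : R -> R) (a c c' d : R) (p : pt) : kernel_domain D -> (forall X X' z, D X z -> D X' z) -> 0 < c' ->
 admissible D (fun X z => exp (a * X) * l z) -> average_domain D 0 c d p ->
 radial_U (fun X z => descent (fun z => exp (a * X) * l z) z c') 0 c d p =
 exp (a * fst p) * radial_U (fun X z => descent (fun z => exp (a * X) * l z) z c') 0 c d (0, snd p).
Proof.
 intros HD Hind Hc Hadm Hdom. unfold radial_U, average, wsin2. cbn [fst snd]. rewrite !Rminus_0_r.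
 assert (E : forall X z, D X z -> descent (fun z => exp (a * X) * l z) z c' = exp (a * X) * descent (fun z => exp (a * 0) * l z) z c').
 { intros X z Hz. unfold descent. rewrite <- RInt_Rcmult.
  - apply RInt_ext. intros e _. unfold descent_integrand. rewrite Rmult_0_r, exp_0. destruct (Rlt_dec 0 e); eqR; unfold Rdiv; ring.
  - apply (ex_RInt_descent_adm D (fun X z => exp (a * X) * l z) 0 z c'); eauto. }
 assert (Hdom0 : average_domain D 0 c d (0, snd p)) by (intros t Ht; eapply Hind, Hdom; auto).
 transitivity (sinh32 (snd p) * (exp (a * fst p) * RInt (fun t => sin t ^ 2 * descent (fun z => exp (a * 0) * l z) (geo_arg c d (snd p) t) c') 0 PI)); [|ring].
 f_equal. rewrite <- RInt_Rcmult.
 - apply RInt_ext. intros t Ht. note PI_RGT_0. rewrite Rmin_left, Rmax_right in Ht by lra.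
  rewrite E by (eapply Hind, (Hdom t); lra). eqR. ring.
 - note (ex_RInt_average_slice D (fun X z => descent (fun z => exp (a * X) * l z) z c') 0 c d (0, snd p)
   (continuous_descent D (fun X z => exp (a * X) * l z) c' HD Hadm Hc) Hdom0) as H. cbn [fst snd] in H. rewrite Rminus_0_r in H. exact H.
Qed.

Lemma theta_U_exp (om p : pt) : 0 <= snd om -> Sigma p -> theta_U om p = exp (fst om / 2 * fst p) * theta_U om (0, snd p).
Proof.
 intros Hom Hp. unfold Sigma in Hp.
 exact (radial_U_exp pos_domain (fun z => Rpower z (- (2 + snd om / 2))) (fst om / 2) 1 1 1 p pos_domain_kernel (fun _ _ _ H => H)
  Rlt_0_1 (theta_admissible (fst om / 2) (snd om / 2) ltac:(lra)) (theta_average_domain p ltac:(lra))).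
Qed.

(** The derivatives hidden in [Lharmonic_on] are evaluated on the axis [x = 0], where the
    exponential is 1; this turns the partial differential equation into an ordinary one for the
    profile. *)
Lemma exp_product_ode (f : R -> R) (a : R) (u : pt -> R) : Lharmonic_on Sigma u ->
 (forall p, Sigma p -> u p = exp (a * fst p) * f (snd p)) ->
 exists f1, forall y, 0 < y -> is_derive f y (f1 y) /\ is_derive f1 y ((P y - a ^ 2) * f y).
Proof.
 intros [ux [uy [uxx [uxy [uyx [uyy [HD [_ [_ [_ [_ [_ [_ [_ Hpde]]]]]]]]]]]]]] Hu.
 exists (fun y => uy (0, y)). intros y Hy. destruct (HD (0, y) Hy) as [_ [D2 [D3 [_ [_ D6]]]]]. cbn [fst snd] in *. split.
 - apply is_derive_Reals in D2. eapply is_derive_ext_loc; [|eauto]. weaken (locally_pos y Hy).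
  intros t Ht. rewrite Hu by exact Ht. cbn [fst snd]. rewrite Rmult_0_r, exp_0. apply Rmult_1_l.
 - assert (E : forall t, ux (t, y) = a * exp (a * t) * f y).
  { intros t. destruct (HD (t, y) Hy) as [D1 _]. cbn [fst snd] in D1. apply is_derive_Reals in D1.
   apply is_derive_unique in D1. rewrite <- D1. apply is_derive_unique.
   apply (is_derive_ext (fun t => exp (a * t) * f y)); [intros s; rewrite Hu by exact Hy; reflexivity|].
   apply is_derive_Rmultc, is_derive_exp_lin. }
  assert (E2 : uxx (0, y) = a ^ 2 * f y).
  { apply is_derive_Reals in D3. apply is_derive_unique in D3. rewrite <- D3. apply is_derive_unique.
   apply (is_derive_ext (fun t => a * exp (a * t) * f y)); [auto|].
   eapply is_derive_eq; [apply is_derive_Rmultc, is_derive_Rcmult, is_derive_exp_lin|]. rewrite Rmult_0_r, exp_0. ring. }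
  specialize (Hpde (0, y) Hy). cbn [fst snd] in Hpde. rewrite (Hu (0, y) Hy) in Hpde. cbn [fst snd] in Hpde. rewrite Rmult_0_r, exp_0 in Hpde.
  apply is_derive_Reals in D6. eapply is_derive_eq; [eauto|]. lra.
Qed.

Lemma is_derive_zero_const (f : R -> R) : (forall y, 0 < y -> is_derive f y 0) -> forall y, 0 < y -> f y = f 1.
Proof.
 intros H. assert (Q : forall a b, 0 < a -> a <= b -> f a = f b).
 { intros a b Ha Hab. apply Rle_antisym.
  - apply (is_derive_nonneg_incr f (fun _ => 0)); auto; [intros; apply H; lra|intros; lra].
  - apply (is_derive_nonpos_decr f (fun _ => 0)); auto; [intros; apply H; lra|intros; lra]. }
 intros y Hy. destruct (Rle_lt_dec y 1); [auto|symmetry; apply Q; lra].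
Qed.

(* The Wronskian is constant, and a nonzero Wronskian would force [f / g] to diverge at least logarithmically at [0]. *)
Lemma ode_ratio (V f f1 g g1 : R -> R) (C : R) :
 (forall y, 0 < y -> is_derive f y (f1 y) /\ is_derive f1 y (V y * f y)) ->
 (forall y, 0 < y -> is_derive g y (g1 y) /\ is_derive g1 y (V y * g y)) ->
 (forall y, 0 < y -> 0 < g y) -> (forall y, 0 < y <= 1 -> Rabs (f y) <= C * g y) -> (forall y, 0 < y <= 1 -> g y ^ 2 <= C * y) ->
 exists c, forall y, 0 < y -> f y = c * g y.
Proof.
 intros Hf Hg Gp Hb Hg2. assert (HC : 0 < C) by (note (Hg2 1 ltac:(lra)); note (pow_lt (g 1) 2 (Gp 1 ltac:(lra))); lra).
 set (w := f1 1 * g 1 - f 1 * g1 1). assert (HW : forall y, 0 < y -> f1 y * g y - f y * g1 y = w).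
 { apply (is_derive_zero_const (fun y => f1 y * g y - f y * g1 y)). intros y Hy. destruct (Hf y Hy) as [F1 F2]. destruct (Hg y Hy) as [G1 G2].
  eapply is_derive_eq; [apply is_derive_Rminus; apply is_derive_Rmult; eauto|]. ring. }
 assert (Hh : forall y, 0 < y -> is_derive (fun y => f y / g y) y (w / g y ^ 2)).
 { intros y Hy. destruct (Hf y Hy) as [F1 F2]. destruct (Hg y Hy) as [G1 G2]. note (Gp y Hy).
  eapply is_derive_eq; [apply (is_derive_div f g y _ _ F1 G1); lra|]. rewrite <- (HW y Hy). reflexivity. }
 assert (Q : forall s, s ^ 2 = 1 -> s * w <= 0).
 { intros s Hs. apply Rnot_lt_le. intros Hw. set (k := s * w / C). assert (Hk : 0 < k) by (apply Rdiv_lt_0_compat; auto).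
  (* With this [e] the logarithmic term [- k * ln e] exceeds [2 * C], the largest oscillation
     allowed by the bound on [f / g]. *)
  set (e := exp (- (2 * C / k + 1))). assert (He : 0 < e) by apply exp_pos. assert (0 < 2 * C / k) by pos.
  assert (He1 : e <= 1) by (unfold e; apply Rle_trans with (exp 0); [apply exp_le; lra|rewrite exp_0; lra]).
  assert (Hinc : s * (f e / g e) - k * ln e <= s * (f 1 / g 1) - k * ln 1).
  { apply (is_derive_nonneg_incr (fun y => s * (f y / g y) - k * ln y) (fun y => s * (w / g y ^ 2) - k * / y)); auto.
   - intros y Hy. apply is_derive_Rminus; [apply is_derive_Rcmult, Hh; lra|]. apply (is_derive_Rcmult k ln). apply is_derive_Reals, derivable_pt_lim_ln. lra.
   - intros y Hy. note (Gp y ltac:(lra)) as Hgy. note (pow_lt (g y) 2 Hgy). specialize (Hg2 y ltac:(lra)).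
    assert (k * / y <= s * (w / g y ^ 2)); [|lra]. replace (k * / y) with (s * w * / (C * y)) by (unfold k; field; lra).
    replace (s * (w / g y ^ 2)) with (s * w * / g y ^ 2) by lra. apply Rmult_le_compat_l; [lra|]. apply Rinv_le_contravar; auto. }
  assert (B : forall y, 0 < y <= 1 -> Rabs (s * (f y / g y)) <= C).
  { intros y Hy. specialize (Hb y Hy). note (Gp y ltac:(lra)). rewrite Rabs_mult.
   replace (Rabs s) with 1 by (assert (Rabs s ^ 2 = 1) by (rewrite pow2_abs; auto); note (Rabs_pos s); nra).
   rewrite Rmult_1_l. unfold Rdiv. rewrite Rabs_mult, Rabs_inv, (Rabs_right (g y)) by lra.
   apply (proj2 (Rle_div_l (Rabs (f y)) C (g y) H0)). auto. }
  note (B e ltac:(lra)) as B1. note (B 1 ltac:(lra)) as B2. apply Rabs_le_between in B1. apply Rabs_le_between in B2.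
  rewrite ln_1 in Hinc. unfold e in Hinc at 3. rewrite ln_exp in Hinc.
  replace (k * - (2 * C / k + 1)) with (- (2 * C) - k) in Hinc by fld. lra. }
 assert (W0 : w = 0) by (note (Q 1 ltac:(ring)); note (Q (-1) ltac:(ring)); lra). exists (f 1 / g 1). intros y Hy. note (Gp y Hy).
 assert (E : f y / g y = f 1 / g 1).
 { apply (is_derive_zero_const (fun y => f y / g y)); auto. intros z Hz. eapply is_derive_eq; [auto|]. rewrite W0. unfold Rdiv. ring. }
 rewrite <- E. field. lra.
Qed.

Lemma continuous_pos_bounds (f : R -> R) (a b : R) : a <= b -> (forall y, a <= y <= b -> continuous f y /\ 0 < f y) ->
 exists m M, 0 < m /\ 0 < M /\ forall y, a <= y <= b -> m <= f y <= M.
Proof.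
 intros Hab H. destruct (continuity_ab_min f a b Hab) as [x1 [H1 H1']]; [intros; apply continuity_pt_filterlim, H; auto|].
 destruct (continuity_ab_maj f a b Hab) as [x2 [H2 H2']]; [intros; apply continuity_pt_filterlim, H; auto|].
 exists (f x1), (f x2). split; [apply H; auto|split; [apply H; auto|]]. intros; split; auto.
Qed.

Lemma average_bounds D f xi c d x : kernel_domain D -> continuous_on_domain D f -> (forall X z, D X z -> 0 < f X z) ->
 (forall y, 0 <= y <= 1 -> average_domain D xi c d (x, y)) ->
 exists m M, 0 < m /\ 0 < M /\ forall y, 0 <= y <= 1 -> m <= average wsin2 f xi c d (x, y) <= M.
Proof.
 intros HD Hf Hpos Hdom. apply continuous_pos_bounds; [lra|]. intros y Hy. split.
 - apply (continuous_comp (fun y : R => (x, y) : R * R) (average wsin2 f xi c d)).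
  + apply filterlim_locally. intros eps. exists eps. intros s Hs. split; [apply ball_center|pos].
  + apply (average_continuous D xi c d (proj1 HD) wsin2 f (x, y)); auto. apply continuous2_wsin2.
 - apply (average_gt0 D); auto.
Qed.

Lemma sinh_le_lin y : 0 <= y <= 1 -> sinh y <= cosh 1 * y.
Proof.
 intros Hy. assert (H : cosh 1 * 0 - sinh 0 <= cosh 1 * y - sinh y); [|rewrite sinh_0 in H; lra].
 apply (is_derive_nonneg_incr (fun y => cosh 1 * y - sinh y) (fun y => cosh 1 * 1 - cosh y)); [lra| |].
 - intros z _. apply is_derive_Rminus; [apply is_derive_Rcmult, is_derive_Rid|apply is_derive_sinh].
 - intros z Hz. assert (cosh z <= cosh 1); [|lra]. unfold cosh.
  assert (E : exp 1 + exp (- (1)) - exp z - exp (- z) = (exp 1 - exp z) * (1 - exp (- (1 + z)))).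
  { replace (- (1 + z)) with (- (1) + - z) by ring. rewrite exp_plus, !exp_Ropp. note (exp_pos 1). note (exp_pos z). field. lra. }
  note (exp_le z 1 ltac:(lra)). assert (exp (- (1 + z)) <= exp 0) by (apply exp_le; lra). rewrite exp_0 in *. nra.
Qed.

Lemma sinh32_sqr_le y : 0 < y <= 1 -> sinh32 y ^ 2 <= cosh 1 ^ 3 * y ^ 3.
Proof.
 intros Hy. note (sinh_pos y ltac:(lra)). note (sinh_le_lin y ltac:(lra)). unfold sinh32.
 replace ((sinh y * sqrt (sinh y)) ^ 2) with (sinh y ^ 2 * (sqrt (sinh y) * sqrt (sinh y))) by ring. rewrite sqrt_sqrt by lra.
 replace (sinh y ^ 2 * sinh y) with (sinh y ^ 3) by ring. rewrite <- Rpow_mult_distr. apply pow_incr. lra.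
Qed.

Lemma radial_U_sqr_le f xi c d x M : (forall y, 0 <= y <= 1 -> 0 <= average wsin2 f xi c d (x, y) <= M) ->
 forall y, 0 < y <= 1 -> radial_U f xi c d (x, y) ^ 2 <= M ^ 2 * cosh 1 ^ 3 * y ^ 3.
Proof.
 intros H y Hy. unfold radial_U. cbn [snd]. rewrite Rpow_mult_distr. specialize (H y ltac:(lra)).
 note (sinh32_sqr_le y Hy). replace (M ^ 2 * cosh 1 ^ 3 * y ^ 3) with (cosh 1 ^ 3 * y ^ 3 * M ^ 2) by ring.
 apply Rmult_le_compat; try apply pow2_ge_0; auto. apply pow_incr; auto.
Qed.

(** The average extends continuously and positively to [y = 0]; all vanishing of [theta_U] at the
    boundary line therefore comes from [sinh32]. *)
Lemma theta_bounds (om : pt) x : 0 <= snd om -> exists m M, 0 < m /\ 0 < M /\ forall y, 0 <= y <= 1 ->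
 m <= average wsin2 (theta_radial (fst om / 2) (snd om / 2)) 0 1 1 (x, y) <= M.
Proof.
 intros Hom. apply (average_bounds pos_domain); [apply pos_domain_kernel|apply theta_radial_continuous; lra| |].
 - intros X z Hz. unfold theta_radial. apply (descent_gt0 pos_domain (fun X z => exp (fst om / 2 * X) * Rpower z (- (2 + snd om / 2))) 1 X z
   pos_domain_kernel (theta_admissible (fst om / 2) (snd om / 2) ltac:(lra))); auto; [lra|]. intros. apply Rmult_lt_0_compat; apply exp_pos.
 - intros y Hy. apply theta_average_domain. simpl. lra.
Qed.

Lemma theta_profile_sqr (om : pt) : 0 <= snd om -> exists C, 1 <= C /\ forall y, 0 < y <= 1 -> theta_U om (0, y) ^ 2 <= C * y ^ 3.
Proof.
 intros Hom. destruct (theta_bounds om 0 Hom) as [m [M [Hm [HM H]]]].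
 exists (Rmax 1 (M ^ 2 * cosh 1 ^ 3)). split; [apply Rmax_l|]. intros y Hy. eapply Rle_trans; [apply (radial_U_sqr_le _ _ _ _ _ M); auto|].
 - intros z Hz. specialize (H z Hz). lra.
 - apply Rmult_le_compat_r; [pos|apply Rmax_r].
Qed.

Lemma corner_pos a c X z : 0 < c -> mid_domain X z -> 0 < corner_radial a c X z.
Proof.
 intros Hc Hz. apply (descent_gt0 mid_domain (fun X z => exp (a * X) * arcL 1 z) c X z mid_domain_kernel (corner_admissible a)); auto.
 intros z' Hz'. apply Rmult_lt_0_compat; [pos|apply arcL_pos]. unfold mid_domain in Hz. lra.
Qed.

(** The limit of the Green functions at height [eta] depends visibly on [eta]. But it is
    [exp (sg x / 2)] times a profile that solves the same ordinary equation as that of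
    [theta_U (sg, 0)] and is bounded by a multiple of it near 0, so [ode_ratio] applies. *)
Lemma corner_proportional (sg eta : R) : sg ^ 2 = 1 -> 0 <= eta -> exists c, 0 < c /\ forall p, Sigma p ->
 radial_U (corner_radial (sg / 2) (cosh eta)) 0 (cosh eta) (sinh eta) p = c * theta_U (sg, 0) p.
Proof.
 intros Hsg Heta. set (U := radial_U (corner_radial (sg / 2) (cosh eta)) 0 (cosh eta) (sinh eta)). note (cosh_ge1 eta) as Hch.
 assert (Hdom : forall p : pt, 0 <= snd p -> average_domain mid_domain 0 (cosh eta) (sinh eta) p) by (intros; apply corner_average_domain; auto).
 assert (UL : Lharmonic_on Sigma U).
 { apply (Lharmonic_on_subset (fun p => Sigma p /\ average_domain mid_domain 0 (cosh eta) (sinh eta) p)).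
  - intros p Hp. split; auto. apply Hdom. unfold Sigma in Hp; lra.
  - apply (radial_U_harmonic mid_domain (corner_radial (sg / 2) (cosh eta))). rewrite cosh2_sinh2.
   apply (corner_radial_solution (sg / 2) (cosh eta)); [lra|]. replace ((sg / 2) ^ 2) with (sg ^ 2 / 4) by field. lra. }
 assert (UE : forall p, Sigma p -> U p = exp (sg / 2 * fst p) * U (0, snd p)).
 { intros p Hp. exact (radial_U_exp mid_domain (arcL 1) (sg / 2) (cosh eta) (cosh eta) (sinh eta) p mid_domain_kernel (fun _ _ _ H => H)
   ltac:(lra) (corner_admissible (sg / 2)) (Hdom p (Rlt_le _ _ Hp))). }
 assert (TE : forall p, Sigma p -> theta_U (sg, 0) p = exp (sg / 2 * fst p) * theta_U (sg, 0) (0, snd p)).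
 { intros p Hp. apply theta_U_exp; auto. simpl. lra. }
 destruct (exp_product_ode (fun y => U (0, y)) (sg / 2) U UL UE) as [f1 Hf].
 destruct (exp_product_ode (fun y => theta_U (sg, 0) (0, y)) (sg / 2) (theta_U (sg, 0))) as [g1 Hg]; auto.
 { apply theta_U_harmonic; simpl; lra. }
 destruct (theta_bounds (sg, 0) 0 ltac:(simpl; lra)) as [m [M [Hm [HM HB]]]].
 destruct (average_bounds mid_domain (corner_radial (sg / 2) (cosh eta)) 0 (cosh eta) (sinh eta) 0 mid_domain_kernel) as [m' [M' [Hm' [HM' HB']]]].
 { apply corner_radial_continuous; lra. }
 { intros; apply corner_pos; auto; lra. }
 { intros y Hy. apply Hdom. simpl; lra. }
 destruct (theta_profile_sqr (sg, 0) ltac:(simpl; lra)) as [C [HC HCs]]. assert (U0 : forall y, 0 < y -> 0 < U (0, y)).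
 { intros y Hy. apply Rmult_lt_0_compat; [apply sinh32_pos; auto|]. apply (average_gt0 mid_domain); [apply corner_radial_continuous; lra|apply Hdom; simpl; lra|].
  intros; apply corner_pos; auto; lra. }
 destruct (ode_ratio (fun y => P y - (sg / 2) ^ 2) (fun y => U (0, y)) f1 (fun y => theta_U (sg, 0) (0, y)) g1 (Rmax C (M' / m))) as [c Hc]; auto.
 - intros y Hy. apply theta_U_pos; auto. simpl; lra.
 - intros y Hy. specialize (HB y ltac:(lra)). specialize (HB' y ltac:(lra)). rewrite Rabs_right by (apply Rle_ge, Rlt_le, U0; lra).
  apply Rle_trans with (M' / m * theta_U (sg, 0) (0, y)); [|apply Rmult_le_compat_r; [left; apply theta_U_pos; unfold Sigma; simpl; lra|apply Rmax_r]].
  unfold U, theta_U, radial_U. cbn [snd]. note (sinh32_pos y ltac:(lra)).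
  replace (M' / m * (sinh32 y * average wsin2 (theta_radial (fst (sg, 0) / 2) (0 / 2)) 0 1 1 (0, y))) with
   (sinh32 y * (M' * (average wsin2 (theta_radial (fst (sg, 0) / 2) (0 / 2)) 0 1 1 (0, y) / m))) by lra.
  apply Rmult_le_compat_l; [lra|]. eapply Rle_trans; [apply HB'|]. rewrite <- (Rmult_1_r M') at 1. apply Rmult_le_compat_l; [lra|].
  apply (proj1 (Rle_div_r 1 _ m Hm)). rewrite Rmult_1_l. apply HB.
 - intros y Hy. eapply Rle_trans; [auto|]. apply Rle_trans with (C * y); [|apply Rmult_le_compat_r; [lra|apply Rmax_l]].
  apply Rmult_le_compat_l; [lra|]. simpl. assert (y * y <= 1) by nra. nra.
 - exists c. split.
  + specialize (Hc 1 ltac:(lra)). cbv beta in Hc. note (U0 1 ltac:(lra)). note (theta_U_pos (sg, 0) (0, 1) ltac:(simpl; lra) ltac:(unfold Sigma; simpl; lra)).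
   apply Rnot_le_lt. intros Hn. nra.
  + intros p Hp. rewrite UE, TE, Hc by auto. ring.
Qed.

(** * Limits of the kernel quotients *)

(** The normalisation [N] depends on the pole only and cancels; this is why [far_norm] and the
    factor [2 * besselm (fst q ^ 2)] may be used without comparing them. *)
Lemma green_ratio_lim (F : (pt -> Prop) -> Prop) (FF : Filter F) (N : pt -> R) (p p0 : pt) (a a0 : R) : Sigma p0 -> 0 < a0 ->
 F (fun q => 0 < N q) -> filterlim (fun q => green_avg q p / N q) F (locally a) -> filterlim (fun q => green_avg q p0 / N q) F (locally a0) ->
 filterlim (fun q => green_U q p / green_U q p0) F (locally ((sinh32 (snd p) * a) / (sinh32 (snd p0) * a0))).
Proof.
 intros Hp0 Ha0 HN Hl Hl0. note (sinh32_pos _ Hp0) as Hs.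
 assert (E : F (fun q => 0 < green_avg q p0 / N q)) by exact (Hl0 _ (locally_gt a0 0 Ha0)).
 apply (filterlim_ext_loc (fun q => (sinh32 (snd p) * (green_avg q p / N q)) / (sinh32 (snd p0) * (green_avg q p0 / N q)))).
 - weaken (filter_and _ _ HN E). intros q [H1 H2]. unfold green_U.
  assert (0 < green_avg q p0) by (replace (green_avg q p0) with (green_avg q p0 / N q * N q) by (field; lra); apply Rmult_lt_0_compat; auto).
  field. lra.
 - apply (flim_div (fun q => sinh32 (snd p) * (green_avg q p / N q)) (fun q => sinh32 (snd p0) * (green_avg q p0 / N q))).
  + apply Rgt_not_eq, Rmult_lt_0_compat; auto.
  + exact (flim_mult (fun _ => sinh32 (snd p)) _ _ _ (flim_const _) Hl).
  + exact (flim_mult (fun _ => sinh32 (snd p0)) _ _ _ (flim_const _) Hl0).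
Qed.

Lemma theta_ratio_eq (om p p0 : pt) :
 theta_U om p / theta_U om p0 = (sinh32 (snd p) * average wsin2 (theta_radial (fst om / 2) (snd om / 2)) 0 1 1 p) /
  (sinh32 (snd p0) * average wsin2 (theta_radial (fst om / 2) (snd om / 2)) 0 1 1 p0).
Proof. reflexivity. Qed.

(** The pole tends to infinity in the direction [om]. Heights 0 are allowed, so that approach along
    the boundary line is included. *)
Definition towards (om : pt) (M dl : R) (q : pt) : Prop :=
 0 <= snd q /\ M < norm2 q /\ Rabs (fst q / norm2 q - fst om) < dl /\ Rabs (snd q / norm2 q - snd om) < dl.

Lemma towards_mono om M M' dl dl' q : M <= M' -> dl' <= dl -> towards om M' dl' q -> towards om M dl q.
Proof. unfold towards. intros. repeat split; lra. Qed.

Definition towards_filter (om : pt) (h : R -> R -> Prop) (Q : pt -> Prop) : Prop :=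
 exists H M dl, 0 < dl /\ forall q, h H (snd q) -> towards om M dl q -> Q q.

Lemma towards_filter_filter om : Filter (towards_filter om (fun H y => H < y)).
Proof.
 constructor.
 - exists 0, 0, 1. split; [lra|auto].
 - intros A B [H [M [dl [Hd HA]]]] [H' [M' [dl' [Hd' HB]]]]. exists (Rmax H H'), (Rmax M M'), (Rmin dl dl').
  split; [pos|]. intros q Hq Ht. note (Rmax_l H H'). note (Rmax_r H H'). split.
  + apply HA; [lra|]. eapply towards_mono; [apply Rmax_l|apply Rmin_l|eauto].
  + apply HB; [lra|]. eapply towards_mono; [apply Rmax_r|apply Rmin_r|eauto].
 - intros A B Himp [H [M [dl [Hd HA]]]]. exists H, M, dl. split; auto.
Qed.

Lemma green_ratio_far (om p p0 : pt) : 0 <= snd om -> fst om ^ 2 + snd om ^ 2 = 1 -> Sigma p -> Sigma p0 -> forall eps, 0 < eps ->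
 exists H M dl, 0 < dl /\ forall q, H < snd q -> towards om M dl q -> Rabs (green_U q p / green_U q p0 - theta_U om p / theta_U om p0) < eps.
Proof.
 intros Hom Hn Hp Hp0 eps He. set (F := towards_filter om (fun H y => H < y)). assert (FF : Filter F) by apply towards_filter_filter.
 assert (HI : forall M, F (fun q => M < snd q)) by (intros M; exists M, 0, 1; split; [lra|auto]).
 assert (L1 : filterlim (fun q : pt => fst q / norm2 q) F (locally (fst om))).
 { apply filterlim_locally. intros e. exists 0, 0, e. split; [apply cond_pos|]. intros q _ [_ [_ [H _]]]. exact H. }
 assert (L2 : filterlim (fun q : pt => snd q / norm2 q) F (locally (snd om))).
 { apply filterlim_locally. intros e. exists 0, 0, e. split; [apply cond_pos|]. intros q _ [_ [_ [_ H]]]. exact H. }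
 assert (L : filterlim (fun q => green_U q p / green_U q p0) F (locally (theta_U om p / theta_U om p0))).
 { rewrite theta_ratio_eq. apply (green_ratio_lim F FF (far_norm (snd om))); auto.
  - apply theta_avg_pos; [lra|pos].
  - weaken (HI 0). intros q Hq. apply far_norm_pos; auto.
  - apply green_avg_far; auto.
  - apply green_avg_far; auto. }
 exact (proj1 (filterlim_locally _ _) L (mkposreal eps He)).
Qed.

Definition side_filter (sg : R) (Q : R -> Prop) : Prop := exists M, forall x, M < sg * x -> Q x.

Lemma side_filter_filter sg : Filter (side_filter sg).
Proof.
 constructor.
 - exists 0. auto.
 - intros A B [M HA] [M' HB]. exists (Rmax M M'). intros x Hx. note (Rmax_l M M'). note (Rmax_r M M'). split; [apply HA|apply HB]; lra.
 - intros A B Himp [M HA]. exists M. auto.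
Qed.

(** By [corner_proportional] the limiting quotient is the same at every height, so compactness of
    [[0, H]] makes the convergence uniform over bounded heights. *)
Lemma green_ratio_corner (sg H : R) (p p0 : pt) : sg ^ 2 = 1 -> 0 <= H -> Sigma p -> Sigma p0 -> forall eps, 0 < eps ->
 exists M, forall q, M < sg * fst q -> 0 <= snd q <= H ->
  Rabs (green_U q p / green_U q p0 - theta_U (sg, 0) p / theta_U (sg, 0) p0) < eps.
Proof.
 intros Hsg HH Hp Hp0 eps He. destruct (filter_prod_compact (side_filter sg) (side_filter_filter sg) (fun x t => 0 <= t ->
  Rabs (green_U (x, t) p / green_U (x, t) p0 - theta_U (sg, 0) p / theta_U (sg, 0) p0) < eps) 0 H HH) as [M HM].
 - intros eta Heta. set (F := within (fun q : R * R => 0 <= snd q) (filter_prod (side_filter sg) (locally eta))).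
  assert (FF0 : Filter (side_filter sg)) by apply side_filter_filter.
  assert (FF : Filter F) by (apply within_filter, filter_prod_filter; auto; apply locally_filter).
  destruct (corner_proportional sg eta Hsg ltac:(lra)) as [c [Hc HU]]. assert (HI : forall M, F (fun q => M < sg * fst q)).
  { intros M. unfold F, within. assert (S : side_filter sg (fun x => M < sg * x)) by (exists M; auto).
   generalize (filterlim_fst (F := side_filter sg) (G := locally eta) _ S). unfold filtermap. apply filter_imp. auto. }
  assert (HS : filterlim (fun q : pt => snd q) F (locally eta)).
  { intros Q HQ. unfold F, within, filtermap. generalize (filterlim_snd (F := side_filter sg) (G := locally eta) _ HQ). unfold filtermap. apply filter_imp. auto. }
  assert (H0 : F (fun q => 0 <= snd q)) by (unfold F, within; apply filter_forall; auto).
  set (A := average wsin2 (corner_radial (sg / 2) (cosh eta)) 0 (cosh eta) (sinh eta)). note (cosh_ge1 eta) as Hch.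
  assert (Apos : forall p, Sigma p -> 0 < A p).
  { intros p' Hp'. apply (average_gt0 mid_domain); [apply corner_radial_continuous; lra|apply corner_average_domain; unfold Sigma in Hp'; lra|].
   intros; apply corner_pos; auto; lra. }
  assert (L : filterlim (fun q => green_U q p / green_U q p0) F (locally (theta_U (sg, 0) p / theta_U (sg, 0) p0))).
  { replace (theta_U (sg, 0) p / theta_U (sg, 0) p0) with (sinh32 (snd p) * A p / (sinh32 (snd p0) * A p0)).
   - apply (green_ratio_lim F FF (fun q => 2 * besselm (fst q ^ 2))); auto.
    + weaken (HI 0). intros q Hq. apply Rmult_lt_0_compat; [lra|]. apply besselm_pos. apply pow2_gt_0. intros C. rewrite C in Hq. lra.
    + apply green_avg_corner; auto; lra.
    + apply green_avg_corner; auto; lra.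
   - change (radial_U (corner_radial (sg / 2) (cosh eta)) 0 (cosh eta) (sinh eta) p / radial_U (corner_radial (sg / 2) (cosh eta)) 0 (cosh eta) (sinh eta) p0 = theta_U (sg, 0) p / theta_U (sg, 0) p0).
    rewrite !HU by auto. note (theta_U_pos (sg, 0) p0 ltac:(simpl; lra) Hp0). field. lra. }
  generalize (proj1 (filterlim_locally _ _) L (mkposreal eps He)). unfold F, within. apply filter_imp. intros [x t] Q Ht. exact (Q Ht).
 - exists M. intros [x t] Hx Ht. apply (HM x Hx t Ht). apply Ht.
Qed.

(** If [snd om > 0] the heights go to infinity automatically. If [snd om = 0] they need not: poles
    above the height [H] are covered by the far limit, those below by the corner limit, and the two
    limits coincide. *)
Lemma green_ratio_direction (om p p0 : pt) : 0 <= snd om -> fst om ^ 2 + snd om ^ 2 = 1 -> Sigma p -> Sigma p0 -> forall eps, 0 < eps ->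
 exists M dl, 0 < dl /\ forall q, towards om M dl q -> Rabs (green_U q p / green_U q p0 - theta_U om p / theta_U om p0) < eps.
Proof.
 intros Hom Hn Hp Hp0 eps He. destruct (green_ratio_far om p p0 Hom Hn Hp Hp0 eps He) as [H [M [dl [Hd HF]]]]. destruct Hom as [Hom|Hom].
 - exists (Rmax M (Rmax 0 (2 * H / snd om))), (Rmin dl (snd om / 2)). split; [pos|]. intros q Ht.
  note (Rmax_l M (Rmax 0 (2 * H / snd om))). note (Rmax_r M (Rmax 0 (2 * H / snd om))). note (Rmax_l 0 (2 * H / snd om)). note (Rmax_r 0 (2 * H / snd om)).
  apply HF; [|eapply towards_mono; [| |exact Ht]; [auto|apply Rmin_l]].
  destruct Ht as [T1 [T2 [_ T4]]]. note (Rmin_r dl (snd om / 2)). apply Rabs_def2 in T4. assert (Q : snd om / 2 < snd q / norm2 q) by lra.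
  apply (Rmult_lt_compat_r (norm2 q)) in Q; [|lra]. replace (snd q / norm2 q * norm2 q) with (snd q) in Q by fld.
  assert (2 * H / snd om < norm2 q) by lra. apply (Rmult_lt_compat_r (snd om / 2)) in H5; [|lra].
  replace (2 * H / snd om * (snd om / 2)) with H in H5 by fld. lra.
 - assert (Hsg : fst om ^ 2 = 1) by nra.
  assert (Eom : om = (fst om, 0)) by (destruct om; simpl in *; subst; auto). rewrite Eom in *. cbn [fst snd] in *. set (sg := fst om) in *.
  destruct (green_ratio_corner sg (Rmax 0 H) p p0 Hsg (Rmax_l _ _) Hp Hp0 eps He) as [M2 HC].
  exists (Rmax M (Rmax 0 (2 * M2))), (Rmin dl (1 / 2)). split; [pos|]. intros q Ht.
  note (Rmax_l M (Rmax 0 (2 * M2))). note (Rmax_r M (Rmax 0 (2 * M2))). note (Rmax_l 0 (2 * M2)). note (Rmax_r 0 (2 * M2)).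
  destruct (Rlt_le_dec H (snd q)) as [Hq|Hq].
  + apply HF; auto. eapply towards_mono; [| |eauto]; [auto|apply Rmin_l].
  + destruct Ht as [T1 [T2 [T3 _]]]. note (Rmin_r dl (1 / 2)). cbn [fst snd] in *. apply HC; [|split; auto; eapply Rle_trans; [exact Hq|apply Rmax_r]].
   apply Rabs_def2 in T3. set (u := fst q / norm2 q) in *. assert (Eu : fst q = u * norm2 q) by (unfold u; field; lra).
   rewrite Eu, <- Rmult_assoc. assert (1 / 2 < sg * u); [|nra]. assert (sg = 1 \/ sg = -1) as [-> | ->] by nra; lra.
Qed.

(** * Minimality of the boundary kernels *)

(** Near the boundary line [P y] is of order [y^(- 2)], so discs of radius proportional to the
    height satisfy the smallness condition of [gradient_bound]. *)
Lemma harnack_gradient (u ux uy uxx uxy uyx uyy : pt -> R) (p : pt) : harmonic_data Sigma u ux uy uxx uxy uyx uyy ->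
 (forall z, Sigma z -> 0 <= u z) -> Sigma p ->
 Rabs (ux p) <= 32 / Rmin 1 (snd p) * u p /\ Rabs (uy p) <= 32 / Rmin 1 (snd p) * u p.
Proof.
 intros HD Hu Hp. unfold Sigma in Hp. set (m := Rmin 1 (snd p)).
 assert (Hm : 0 < m /\ m <= 1 /\ m <= snd p) by (unfold m; note (Rmin_l 1 (snd p)); note (Rmin_r 1 (snd p)); split; [apply Rmin_pos; lra|lra]).
 assert (Hin : forall z, dist2 z p < 2 * (m / 8) -> 3 / 4 * snd p <= snd z).
 { intros z Hz. note (Rabs_snd_dist2 z p) as T. apply Rabs_le_between in T. lra. }
 (* The disc of radius [2 * (m / 8)] stays above height [3 / 4 * snd p], where [P] times the square
    of [m / 8] is at most [m^2 / 256 + 1 / 48]. *)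
 replace (32 / m) with (4 / (m / 8)) by fld.
 refine (gradient_bound Sigma u ux uy uxx uxy uyx uyy p (m / 8) open2_Sigma HD ltac:(lra) _ (P (3 / 4 * snd p)) Hu _ _).
 - intros z Hz. specialize (Hin z Hz). unfold Sigma. lra.
 - intros z Hz. specialize (Hin z Hz). note (P_ge_quarter (snd z) ltac:(lra)). split; [lra|apply P_le; lra].
 - rewrite P_sinh by lra. note (sinh_ge_id (3 / 4 * snd p) ltac:(lra)) as Hs.
  assert (H1 : 3 / (4 * sinh (3 / 4 * snd p) ^ 2) <= 3 / (4 * (3 / 4 * m) ^ 2)).
  { apply Rmult_le_compat_l; [lra|]. apply Rinv_le_contravar; [pos|]. apply Rmult_le_compat_l; [lra|]. apply pow_incr. lra. }
  apply Rle_trans with ((1 / 4 + 3 / (4 * (3 / 4 * m) ^ 2)) * (m / 8) ^ 2); [nra|].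
  replace ((1 / 4 + 3 / (4 * (3 / 4 * m) ^ 2)) * (m / 8) ^ 2) with (m ^ 2 / 256 + 1 / 48) by fld. nra.
Qed.

Lemma harnack_high (u : pt -> R) (h x y x' y' : R) : Lharmonic_on Sigma u -> (forall z, Sigma z -> 0 <= u z) -> 0 < h <= 1 -> h <= y -> h <= y' ->
 u (x', y') <= exp (32 / h * Rabs (x' - x)) * (exp (32 / h * Rabs (y' - y)) * u (x, y)).
Proof.
 intros [ux [uy [uxx [uxy [uyx [uyy HD]]]]]] Hu Hh Hy Hy'. change (harmonic_data Sigma u ux uy uxx uxy uyx uyy) in HD.
 assert (G : forall s t : R, h <= t -> Rabs (ux (s, t)) <= 32 / h * u (s, t) /\ Rabs (uy (s, t)) <= 32 / h * u (s, t)).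
 { intros s t Ht. assert (St : Sigma (s, t)) by (unfold Sigma; simpl; lra). assert (32 / Rmin 1 t <= 32 / h).
  { apply Rmult_le_compat_l; [lra|]. apply Rinv_le_contravar; [lra|]. apply Rmin_glb; lra. }
  destruct (harnack_gradient _ _ _ _ _ _ _ (s, t) HD Hu St) as [H1 H2]. cbn [snd] in *. specialize (Hu _ St).
  split; (eapply Rle_trans; [eassumption|apply Rmult_le_compat_r; auto]). }
 eapply Rle_trans; [apply (log_lipschitz (fun s : R => u (s, y')) (fun s : R => ux (s, y')) (32 / h) x x')|].
 - intros s _. split; [|apply G; auto]. apply is_derive_Reals. apply (proj1 HD (s, y')). unfold Sigma; simpl; lra.
 - apply Rmult_le_compat_l; [pos|]. apply (log_lipschitz (fun s : R => u (x, s)) (fun s : R => uy (x, s)) (32 / h) y y').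
  intros s Hs. assert (h <= s) by (eapply Rle_trans; [apply (Rmin_glb y y' h); auto|apply Hs]).
  split; [|apply G; auto]. apply is_derive_Reals. apply (proj1 HD (x, s)). unfold Sigma; simpl; lra.
Qed.

Lemma cont2R_on_translate (f : pt -> R) (s : R) : cont2R_on Sigma f -> cont2R_on Sigma (fun p => f (fst p + s, snd p)).
Proof.
 intros H a Ha eps He. destruct (H (fst a + s, snd a) Ha eps He) as [d [Hd Hc]]. exists d. split; auto. intros z Hz Hzd.
 apply Hc; auto. unfold dist2 in *. cbn [fst snd]. replace (fst z + s - (fst a + s)) with (fst z - fst a) by ring. auto.
Qed.

Lemma Lharmonic_translate (u : pt -> R) (s : R) : Lharmonic_on Sigma u -> Lharmonic_on Sigma (fun p => u (fst p + s, snd p)).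
Proof.
 intros [ux [uy [uxx [uxy [uyx [uyy [HD [C0 [C1 [C2 [C3 [C4 [C5 [C6 Hp]]]]]]]]]]]]]].
 assert (T : forall (f : R -> R) x l, derivable_pt_lim f (x + s) l -> derivable_pt_lim (fun t => f (t + s)) x l).
 { intros f x l H. apply is_derive_Reals. apply is_derive_Reals in H.
  eapply is_derive_eq; [apply (is_derive_Rcomp f (fun t => t + s)); [exact H|instantiate (1 := 1); auto_derive; auto; ring]|ring]. }
 exists (fun p => ux (fst p + s, snd p)), (fun p => uy (fst p + s, snd p)), (fun p => uxx (fst p + s, snd p)),
  (fun p => uxy (fst p + s, snd p)), (fun p => uyx (fst p + s, snd p)), (fun p => uyy (fst p + s, snd p)).
 split; [|repeat (split; [apply cont2R_on_translate; assumption|])].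
 - intros p HU. destruct (HD (fst p + s, snd p) HU) as [D1 [D2 [D3 [D4 [D5 D6]]]]]. cbn [fst snd] in *. repeat split; auto.
  + apply (T (fun t => u (t, snd p))); auto.
  + apply (T (fun t => ux (t, snd p))); auto.
  + apply (T (fun t => uy (t, snd p))); auto.
 - intros p HU. apply (Hp (fst p + s, snd p) HU).
Qed.

(** For [y < 1] the concavity of the square root contributes at least [sqrt y / 4], which together
    with [P >= 1 / 4] outweighs [k^2 <= 1 / 2]. *)
Lemma Lsub_power (U : pt -> Prop) (k : R) : (forall p, U p -> 0 < snd p < 1) -> k ^ 2 <= 1 / 2 -> Lsub U (fun p => - (exp (k * fst p) * sqrt (snd p))).
Proof.
 intros HU Hk.
 assert (D1 : forall y, 0 < y -> is_derive sqrt y (/ (2 * sqrt y))) by (intros; apply is_derive_Reals, derivable_pt_lim_sqrt; auto).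
 assert (D2 : forall y, 0 < y -> is_derive (fun y => / (2 * sqrt y)) y (- / (4 * y * sqrt y))).
 { intros y Hy. note (sqrt_lt_R0 y Hy). assert (E : sqrt y * sqrt y = y) by (apply sqrt_sqrt; lra). auto_derive; [lra|].
  set (q := sqrt y) in *. rewrite <- E. field. lra. }
 exists (fun p => - (k * (k * exp (k * fst p)) * sqrt (snd p))), (fun p => - (exp (k * fst p) * - / (4 * snd p * sqrt (snd p)))). split; [split|].
 - intros p Hp. apply lim2R_filterlim, flim_within. apply flim_opp. destruct p as [x y]. destruct (HU _ Hp) as [Hy _]. simpl in Hy.
  apply (flim_mult (fun q : R * R => exp (k * fst q)) (fun q : R * R => sqrt (snd q))).
  + apply (flim_cont (fun x => exp (k * x)) (fun q : R * R => fst q)); [apply continuous_fst|apply continuous_exp_lin].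
  + apply (flim_cont sqrt (fun q : R * R => snd q)); [apply continuous_snd|eapply is_derive_continuous, D1; auto].
 - exists (fun p => - (k * exp (k * fst p) * sqrt (snd p))), (fun p => - (exp (k * fst p) * / (2 * sqrt (snd p)))).
  intros p Hp. destruct (HU p Hp) as [Hy _]. repeat split; apply is_derive_Reals; apply (is_derive_opp (V := R_NormedModule)); cbn [fst snd].
  + apply is_derive_Rmultc, is_derive_exp_lin.
  + apply is_derive_Rcmult, D1; auto.
  + apply is_derive_Rmultc, is_derive_Rcmult, is_derive_exp_lin.
  + apply is_derive_Rcmult, D2; auto.
 - intros p Hp. destruct (HU p Hp) as [Hy Hy1]. note (sqrt_lt_R0 _ Hy) as Hs. note (exp_pos (k * fst p)) as He. note (P_ge_quarter _ Hy) as HP.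
  set (y := snd p) in *. assert (H4 : sqrt y / 4 <= / (4 * y * sqrt y)).
  { apply Rmult_le_reg_r with (4 * y * sqrt y); [pos|]. rewrite Rinv_l by pos.
   replace (sqrt y / 4 * (4 * y * sqrt y)) with (y * (sqrt y * sqrt y)) by field. rewrite sqrt_sqrt by lra. nra. }
  assert (exp (k * fst p) * (sqrt y * (k ^ 2 - P y)) <= exp (k * fst p) * / (4 * y * sqrt y)); [|lra].
  apply Rmult_le_compat_l; [lra|]. eapply Rle_trans; [|eauto]. unfold Rdiv. apply Rmult_le_compat_l; lra.
Qed.

(** * Minimality on the semicircle *)

Section ThetaMinimal.
Context (om : pt) (Hom : 0 <= snd om) (Hn : fst om ^ 2 + snd om ^ 2 = 1) (v : pt -> R) (Hv : Lharmonic_on Sigma v).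
Context (Hle : forall p, Sigma p -> 0 <= v p <= theta_U om p).

Let c := fst om / 2.
(** Under a shift by [s] the kernel [theta_U om] is multiplied by [exp (c s)]. Vanishing of all
    these differences says that [v] has the same behaviour, that is, separates as [exp (c x)] times
    a function of [y]. *)
Let shift_diff (s : R) (p : pt) := exp (- c * s) * v (fst p + s, snd p) + - (1) * v p.

Lemma theta_U_shift (s : R) (p : pt) : Sigma p -> theta_U om (fst p + s, snd p) = exp (c * s) * theta_U om p.
Proof.
 intros Hp. rewrite (theta_U_exp om (fst p + s, snd p)), (theta_U_exp om p) by auto. cbn [fst snd]. fold c.
 rewrite Rmult_plus_distr_l, exp_plus. ring.
Qed.

Lemma shift_diff_le (s : R) (p : pt) : Sigma p -> shift_diff s p <= theta_U om p.
Proof.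
 intros Hp. unfold shift_diff. note (Hle (fst p + s, snd p) Hp) as H1. note (Hle p Hp) as H2. rewrite theta_U_shift in H1 by auto.
 assert (exp (- c * s) * v (fst p + s, snd p) <= exp (- c * s) * (exp (c * s) * theta_U om p)) by (apply Rmult_le_compat_l; [left; apply exp_pos|lra]).
 rewrite <- Rmult_assoc, <- exp_plus in H. replace (- c * s + c * s) with 0 in H by ring. rewrite exp_0 in H. lra.
Qed.

Lemma shift_diff_harmonic (s : R) : Lharmonic_on Sigma (shift_diff s).
Proof. apply (Lharmonic_lin Sigma (fun p => v (fst p + s, snd p)) v); auto. apply Lharmonic_translate; auto. Qed.

(** A Phragmen-Lindelof argument in the strip [0 < y < 1], where Harnack is not uniform: [f] may
    grow like [exp (c x)] there, and a small multiple of a barrier growing faster in both directions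
    controls it before being sent to 0. *)
Lemma strip_domination (f : pt -> R) (m : R) : Lharmonic_on Sigma f -> (forall p, Sigma p -> f p <= theta_U om p) -> 0 <= m ->
 (forall p, 1 <= snd p -> f p <= m * theta_U om p) -> forall p, Sigma p -> f p <= m * theta_U om p.
Proof.
 intros Hf HfK Hm H1 p Hp. destruct (Rle_lt_dec 1 (snd p)) as [Hy|Hy]; auto.
 (* Exponents on either side of [c] make the barrier outgrow [exp (c x)] at both ends; since
    [|c| <= 1 / 2], their squares stay below the [1 / 2] of [Lsub_power]. *)
 assert (HT := theta_U_harmonic om Hom Hn). set (k1 := c + 1 / 8). set (k2 := c - 1 / 8).
 assert (Hc2 : Rabs c <= 1 / 2) by (unfold c; apply Rabs_le; note (pow2_ge_0 (snd om)); nra). apply Rabs_le_between in Hc2.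
 set (b := fun q : pt => exp (k1 * fst q) * sqrt (snd q) + exp (k2 * fst q) * sqrt (snd q)).
 set (g := fun q => 1 * f q + - m * theta_U om q). assert (HL : Lharmonic_on Sigma g) by (apply Lharmonic_lin; auto).
 cut (g p <= 0); [unfold g; lra|]. apply (le_epsilon_mult (g p) 0 (b p)).
 { note (exp_pos (k1 * fst p)). note (exp_pos (k2 * fst p)). note (sqrt_pos (snd p)). unfold b. nra. }
 intros d Hd. rewrite Rplus_0_l. destruct (theta_profile_sqr om Hom) as [C [HC HCs]].
 assert (Hphi : forall y, 0 < y <= 1 -> theta_U om (0, y) <= C * sqrt y).
 { intros y Hy'. note (theta_U_pos om (0, y) Hom ltac:(unfold Sigma; simpl; lra)). note (sqrt_lt_R0 y ltac:(lra)). specialize (HCs y Hy').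
  apply Rsqr_incr_0_var; [|nra]. unfold Rsqr. replace (C * sqrt y * (C * sqrt y)) with (C * C * (sqrt y * sqrt y)) by ring. rewrite sqrt_sqrt by lra.
  assert (y ^ 3 <= y) by nra. assert (C * y ^ 3 <= C * y) by nra. assert (C * y <= C * C * y) by nra. lra. }
 assert (Hbig : forall q : pt, 0 < snd q < 1 -> g q <= exp (c * fst q) * (C * sqrt (snd q))).
 { intros q Hq. unfold g. note (theta_U_pos om q Hom ltac:(unfold Sigma; lra)). specialize (HfK q ltac:(unfold Sigma; lra)).
  assert (theta_U om q <= exp (c * fst q) * (C * sqrt (snd q))).
  { rewrite theta_U_exp by (unfold Sigma; lra). fold c. apply Rmult_le_compat_l; [pos|]. apply Hphi; lra. }
  assert (0 <= m * theta_U om q) by pos. lra. }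
 cut (1 * g p + d * (1 * - (exp (k1 * fst p) * sqrt (snd p)) + 1 * - (exp (k2 * fst p) * sqrt (snd p))) <= 0); [unfold b; lra|].
 apply (comparison (fun q => 0 < snd q < 1) (fun p => 1 * g p + d * (1 * - (exp (k1 * fst p) * sqrt (snd p)) + 1 * - (exp (k2 * fst p) * sqrt (snd p))))).
 - intros z Hz. exists (Rmin (snd z) (1 - snd z)). split; [pos|]. intros z' Hz'.
  note (Rmin_l (snd z) (1 - snd z)). note (Rmin_r (snd z) (1 - snd z)). note (Rabs_snd_dist2 z' z) as T. apply Rabs_le_between in T. lra.
 - unfold Sigma. tauto.
 - apply Lsub_lin; try lra; [apply Lharmonic_Lsub; eapply Lharmonic_on_subset; [|exact HL]; unfold Sigma; tauto|].
  apply Lsub_lin; try lra; apply Lsub_power; auto; unfold k1, k2; nra.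
 - intros eta He. exists (8 * (C / d) + 1). intros q Hq Hl. rewrite (Rabs_right (snd q)) in Hl by lra.
  specialize (Hbig q Hq). note (sqrt_lt_R0 (snd q) ltac:(lra)) as Hs. note (exp_pos (c * fst q)) as Hex. assert (HCd : 0 < C / d) by pos.
  assert (E : C / d <= exp (1 / 8 * fst q) + exp (- (1 / 8) * fst q)).
  { note (exp_ineq1_le (1 / 8 * Rabs (fst q))) as Ei. note (exp_pos (1 / 8 * fst q)). note (exp_pos (- (1 / 8) * fst q)).
   unfold Rabs in Ei, Hl. destruct (Rcase_abs (fst q)); [replace (1 / 8 * - fst q) with (- (1 / 8) * fst q) in Ei by ring|]; lra. }
  assert (exp (c * fst q) * (C * sqrt (snd q)) <= d * (exp (k1 * fst q) * sqrt (snd q) + exp (k2 * fst q) * sqrt (snd q))); [|lra].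
  unfold k1, k2. replace ((c + 1 / 8) * fst q) with (c * fst q + 1 / 8 * fst q) by ring. replace ((c - 1 / 8) * fst q) with (c * fst q + - (1 / 8) * fst q) by ring.
  rewrite !exp_plus. replace (exp (c * fst q) * (C * sqrt (snd q))) with (exp (c * fst q) * sqrt (snd q) * d * (C / d)) by fld.
  replace (d * (exp (c * fst q) * exp (1 / 8 * fst q) * sqrt (snd q) + exp (c * fst q) * exp (- (1 / 8) * fst q) * sqrt (snd q))) with
   (exp (c * fst q) * sqrt (snd q) * d * (exp (1 / 8 * fst q) + exp (- (1 / 8) * fst q))) by ring.
  apply Rmult_le_compat_l; auto. apply Rmult_le_pos; [|lra]. apply Rmult_le_pos; lra.
 - intros eta He z Hz. destruct (Rle_lt_dec (snd z) 0) as [Hz0|Hz0].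
  + set (K := exp (Rabs (fst z) + 1) * C). assert (HK : 0 < K) by (apply Rmult_lt_0_compat; [apply exp_pos|lra]).
   exists (Rmin 1 ((eta / K) ^ 2)). split; [pos|]. intros q Hq Hqd. note (Rmin_l 1 ((eta / K) ^ 2)). note (Rmin_r 1 ((eta / K) ^ 2)).
   note (Rabs_fst_dist2 q z) as T1. note (Rabs_snd_dist2 q z) as T2. apply Rabs_le_between in T2.
   specialize (Hbig q Hq). note (exp_pos (k1 * fst q)). note (exp_pos (k2 * fst q)). note (sqrt_lt_R0 (snd q) ltac:(lra)) as Hs.
   assert (0 < exp (k1 * fst q) * sqrt (snd q)) by pos. assert (0 < exp (k2 * fst q) * sqrt (snd q)) by pos.
   assert (Hsq : sqrt (snd q) < eta / K).
   { rewrite <- (sqrt_pow2 (eta / K)) by pos. apply sqrt_lt_1_alt. lra. }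
   assert (Hex : exp (c * fst q) * (C * sqrt (snd q)) <= K * sqrt (snd q)).
   { unfold K. rewrite Rmult_assoc. apply Rmult_le_compat_r; [pos|]. apply exp_le.
    note (Rabs_triang (fst q - fst z) (fst z)) as T. replace (fst q - fst z + fst z) with (fst q) in T by ring.
    note (Rle_abs (c * fst q)) as T3. rewrite Rabs_mult in T3. assert (Rabs c <= 1) by (apply Rabs_le; lra). note (Rabs_pos (fst q)). note (Rabs_pos c). nra. }
   assert (K * sqrt (snd q) < eta) by (replace eta with (K * (eta / K)) by (field; lra); apply Rmult_lt_compat_l; auto).
   assert (0 < d * (exp (k1 * fst q) * sqrt (snd q) + exp (k2 * fst q) * sqrt (snd q))) by pos. lra.
  + assert (Hz1 : 1 <= snd z) by lra. specialize (H1 z Hz1). assert (Hgz : g z <= 0) by (unfold g; lra).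
   destruct HL as [ux [uy [uxx [uxy [uyx [uyy [_ [C0 _]]]]]]]]. destruct (C0 z Hz0 eta He) as [d' [Hd' HC']].
   exists d'. split; auto. intros q Hq Hqd. specialize (HC' q (proj1 Hq) Hqd). apply Rabs_def2 in HC'.
   note (exp_pos (k1 * fst q)). note (exp_pos (k2 * fst q)). note (sqrt_lt_R0 (snd q) ltac:(lra)) as Hs.
   assert (0 < exp (k1 * fst q) * sqrt (snd q)) by pos. assert (0 < exp (k2 * fst q) * sqrt (snd q)) by pos.
   assert (0 < d * (exp (k1 * fst q) * sqrt (snd q) + exp (k2 * fst q) * sqrt (snd q))) by pos. lra.
 - auto.
Qed.

(* If [shift_diff s] came within [eps] of a multiple [m > 0] of the kernel at some point, then by Harnack it would do so along
  a long chain of translates of that point, and the telescoping sum would exceed the kernel. *)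
Lemma shift_diff_nonpos (s : R) (p : pt) : Sigma p -> shift_diff s p <= 0.
Proof.
 intros Hp. set (K := theta_U om) in *. set (f := shift_diff s).
 assert (Kpos : forall q, Sigma q -> 0 < K q) by (intros; apply theta_U_pos; auto).
 set (E := fun r => exists q : pt, 1 <= snd q /\ r = f q / K q).
 assert (S1 : forall q : pt, 1 <= snd q -> Sigma q) by (intros; unfold Sigma; lra). destruct (completeness E) as [m [Hm1 Hm2]].
 { exists 1. intros r [q [Hq ->]]. apply (proj2 (Rle_div_l _ 1 _ (Kpos q (S1 q Hq)))). rewrite Rmult_1_l. apply shift_diff_le; auto. }
 { exists (f (0, 1) / K (0, 1)), (0, 1). simpl; split; auto; lra. }
 assert (Hm : forall q : pt, 1 <= snd q -> f q <= m * K q).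
 { intros q Hq. apply (proj1 (Rle_div_l _ m _ (Kpos q (S1 q Hq)))). apply Hm1. exists q; auto. }
 assert (Hf := shift_diff_harmonic s). fold f in Hf. destruct (Rle_lt_dec m 0) as [Hm0|Hm0].
 - replace 0 with (0 * K p) by ring. apply (strip_domination f 0); auto; [intros; apply shift_diff_le; auto|lra|].
  intros q Hq. eapply Rle_trans; [auto|]. apply Rmult_le_compat_r; auto. left; apply Kpos; auto.
 - exfalso. assert (Hall : forall q, Sigma q -> f q <= m * K q) by (apply strip_domination; auto; [intros; apply shift_diff_le; auto|lra]).
  (* Each link of the chain contributes at least [m / 2] times the kernel, so [n] links with
     [n * m > 3] exceed the bound 1. *)
  destruct (INR_unbounded (3 / m)) as [n Hnn]. assert (Hnm : 3 < INR n * m) by (apply (Rmult_lt_compat_r m) in Hnn; auto; replace (3 / m * m) with 3 in Hnn by (field; lra); lra).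
  (* The rate 33 pays for Harnack, with constant 32 per unit length at heights at least 1, and for
     the factor [exp (- c t)] with [|c| <= 1], over the total length [n |s|]. *)
  set (eps := m / 2 * exp (- (33 * (INR n * Rabs s)))). assert (He : 0 < eps) by (apply Rmult_lt_0_compat; [lra|apply exp_pos]).
  assert (Hq : exists q : pt, 1 <= snd q /\ (m - eps) * K q <= f q).
  { apply NNPP. intros HN. assert (m <= m - eps); [|lra]. apply Hm2. intros r [q [Hq ->]].
   apply (proj2 (Rle_div_l _ (m - eps) _ (Kpos q (S1 q Hq)))). apply Rnot_lt_le. intros C. apply HN. exists q. split; auto. lra. }
  destruct Hq as [[x y] [Hy Hq]]. simpl in Hy. assert (Sg : forall x, Sigma (x, y)) by auto. set (u := fun q => m * K q + - (1) * f q).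
  assert (Hu : Lharmonic_on Sigma u) by (apply Lharmonic_lin; auto; apply theta_U_harmonic; auto).
  assert (Hu0 : forall q, Sigma q -> 0 <= u q) by (intros q Hq'; specialize (Hall q Hq'); unfold u; lra).
  assert (Hc2 : Rabs c <= 1) by (unfold c; apply Rabs_le; note (pow2_ge_0 (snd om)); nra).
  assert (Hind : forall j, (j <= n)%nat -> v (x, y) + INR j * (m / 2) * K (x, y) <= exp (- c * (INR j * s)) * v (x + INR j * s, y)).
  { induction j as [|j IH]; intros Hj.
   - simpl. replace (- c * (0 * s)) with 0 by ring. rewrite exp_0. replace (x + 0 * s) with x by ring. lra.
   - specialize (IH ltac:(lia)). rewrite S_INR. set (t := INR j * s) in *. assert (Ht : Rabs t <= INR n * Rabs s).
    { unfold t. rewrite Rabs_mult, (Rabs_right (INR j)) by (apply Rle_ge, pos_INR). apply Rmult_le_compat_r; [pos|apply le_INR; lia]. }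
    assert (Hux : u (x + t, y) <= exp (32 * Rabs t) * (eps * K (x, y))).
    { note (harnack_high u 1 x y (x + t) y Hu Hu0 ltac:(lra) Hy Hy) as HH. replace (x + t - x) with t in HH by ring.
     rewrite Rminus_diag, Rabs_R0, Rmult_0_r, exp_0, Rmult_1_l in HH. replace (32 / 1) with 32 in HH by field.
     eapply Rle_trans; [exact HH|]. apply Rmult_le_compat_l; [pos|]. unfold u. lra. }
    assert (HKt : K (x + t, y) = exp (c * t) * K (x, y)) by (exact (theta_U_shift t (x, y) (Sg x))).
    assert (Hft : m / 2 * K (x, y) <= exp (- c * t) * f (x + t, y)).
    { replace (f (x + t, y)) with (m * K (x + t, y) - u (x + t, y)) by (unfold u; ring). rewrite HKt.
     replace (exp (- c * t) * (m * (exp (c * t) * K (x, y)) - u (x + t, y))) with (m * K (x, y) * (exp (- c * t) * exp (c * t)) - exp (- c * t) * u (x + t, y)) by ring.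
     rewrite <- exp_plus. replace (- c * t + c * t) with 0 by ring. rewrite exp_0.
     assert (exp (- c * t) * u (x + t, y) <= m / 2 * K (x, y)); [|lra].
     eapply Rle_trans; [apply Rmult_le_compat_l; [left; apply exp_pos|exact Hux]|].
     unfold eps. replace (exp (- c * t) * (exp (32 * Rabs t) * (m / 2 * exp (- (33 * (INR n * Rabs s))) * K (x, y)))) with
      (m / 2 * K (x, y) * (exp (- c * t) * exp (32 * Rabs t) * exp (- (33 * (INR n * Rabs s))))) by ring.
     rewrite <- !exp_plus. rewrite <- (Rmult_1_r (m / 2 * K (x, y))) at 2. apply Rmult_le_compat_l; [apply Rmult_le_pos; [lra|left; apply Kpos; auto]|].
     apply Rle_trans with (exp 0); [|rewrite exp_0; lra]. apply exp_le.
     note (Rle_abs (- c * t)) as T. rewrite Rabs_mult, Rabs_Ropp in T. note (Rabs_pos t). note (Rabs_pos c). nra. }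
    unfold f, shift_diff in Hft. cbn [fst snd] in Hft.
    replace (x + (INR j + 1) * s) with (x + t + s) by (unfold t; ring). replace (- c * ((INR j + 1) * s)) with (- c * t + - c * s) by (unfold t; ring). rewrite exp_plus. lra. }
  specialize (Hind n (le_n n)). note (Hle (x, y) (Sg x)) as H0. note (Hle (x + INR n * s, y) (Sg _)) as H1. fold K in H0, H1.
  assert (HKt : K (x + INR n * s, y) = exp (c * (INR n * s)) * K (x, y)) by (exact (theta_U_shift (INR n * s) (x, y) (Sg x))). rewrite HKt in H1.
  assert (exp (- c * (INR n * s)) * v (x + INR n * s, y) <= K (x, y)).
  { eapply Rle_trans; [apply Rmult_le_compat_l; [left; apply exp_pos|apply H1]|]. rewrite <- Rmult_assoc, <- exp_plus.
   replace (- c * (INR n * s) + c * (INR n * s)) with 0 by ring. rewrite exp_0. lra. }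
  note (Kpos (x, y) (Sg x)). nra.
Qed.

(** Shifts by [x] and by [- x] give the two inequalities of separation; the profile of [v] then
    solves the ordinary equation of [theta_U om] and lies below its profile, so [ode_ratio]
    identifies it. *)
Lemma theta_minimal_aux : exists a, forall p, Sigma p -> v p = a * theta_U om p.
Proof.
 assert (Hsep : forall p, Sigma p -> v p = exp (c * fst p) * v (0, snd p)).
 { intros [x y] Hp. cbn [fst snd]. note (shift_diff_nonpos x (0, y) Hp) as H1. note (shift_diff_nonpos (- x) (x, y) Hp) as H2.
  unfold shift_diff in *. cbn [fst snd] in *. rewrite Rplus_0_l in H1. rewrite Rplus_opp_r in H2.
  replace (- c * - x) with (c * x) in H2 by ring. apply Rle_antisym; [|lra].
  apply Rmult_le_reg_l with (exp (- c * x)); [pos|]. rewrite <- Rmult_assoc, <- exp_plus.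
  replace (- c * x + c * x) with 0 by ring. rewrite exp_0. lra. }
 destruct (exp_product_ode (fun y => v (0, y)) c v Hv Hsep) as [f1 Hf].
 destruct (exp_product_ode (fun y => theta_U om (0, y)) c (theta_U om) (theta_U_harmonic om Hom Hn)) as [g1 Hg].
 { intros p Hp. apply theta_U_exp; auto. }
 destruct (theta_profile_sqr om Hom) as [C [HC HCs]].
 destruct (ode_ratio (fun y => P y - c ^ 2) (fun y => v (0, y)) f1 (fun y => theta_U om (0, y)) g1 C) as [a Ha]; auto.
 - intros y Hy. apply theta_U_pos; auto.
 - intros y Hy. assert (Hs : Sigma (0, y)) by (unfold Sigma; simpl; lra). specialize (Hle _ Hs). rewrite Rabs_right by lra.
  note (theta_U_pos om (0, y) Hom Hs). nra.
 - intros y Hy. eapply Rle_trans; [auto|]. apply Rmult_le_compat_l; [lra|]. simpl. assert (y * y <= 1) by nra. nra.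
 - exists a. intros p Hp. rewrite Hsep, (theta_U_exp om p), Ha by auto. fold c. ring.
Qed.
End ThetaMinimal.

(** * Minimality on the open segment *)

Lemma cosh_1_le : cosh 1 <= 2.
Proof. unfold cosh. note exp_le_3. note (exp_le (- (1)) 0 ltac:(lra)). rewrite exp_0 in *. lra. Qed.

Lemma sinh32_le y r : 0 < y <= r -> sinh32 y <= sinh32 r.
Proof.
 intros H. note (sinh_pos y ltac:(lra)). note (sinh_le y r ltac:(lra)). unfold sinh32.
 apply Rmult_le_compat; [lra|apply sqrt_pos|auto|apply sqrt_le_1_alt; auto].
Qed.

(** Doubling [z] at most doubles the denominator, which occurs to a power at most 2. In
    [green_kernel_top] the square of [arcL 0] turns this 4 into 16. *)
Lemma arcL_ge_quarter n z z' : (n <= 1)%nat -> 1 <= z -> z' <= 2 * z -> 1 <= z' -> arcL n z <= 4 * arcL n z'.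
Proof.
 intros Hn Hz Hz' H1. unfold arcL. rewrite <- RInt_Rcmult by (apply ex_RInt_arcL; lra).
 apply RInt_le; [lra|apply ex_RInt_arcL; lra|apply ex_RInt_Rcmult, ex_RInt_arcL; lra|]. intros u Hu. unfold arcL_integrand.
 note (arcL_den_ge1 z u ltac:(lra) ltac:(lra)). note (arcL_den_ge1 z' u ltac:(lra) ltac:(lra)).
 assert (B : u ^ 2 + 2 * u * z' + 1 <= 2 * (u ^ 2 + 2 * u * z + 1)) by nra.
 set (A := u ^ 2 + 2 * u * z + 1) in *. set (A' := u ^ 2 + 2 * u * z' + 1) in *.
 replace (4 * (2 * (2 * u) ^ n * / A' ^ S n)) with (2 * (2 * u) ^ n * / (A' ^ S n / 4)) by fld.
 apply Rmult_le_compat_l; [pos|]. apply Rinv_le_contravar; [pos|]. destruct n as [|[|n]]; [| |lia]; simpl; nra.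
Qed.

Lemma arcsq_concave z z' t : 1 <= z <= z' -> 0 <= t -> arcsq (z' + t) - arcsq z' <= arcsq (z + t) - arcsq z.
Proof.
 intros Hz Ht. assert (D : forall s, 0 <= s -> is_derive (fun s => arcsq (z + s) - arcsq (z' + s)) s (2 * arcL 0 (z + s) - 2 * arcL 0 (z' + s))).
 { assert (Q : forall w s, 1 <= w -> 0 <= s -> is_derive (fun s => arcsq (w + s)) s (2 * arcL 0 (w + s))).
  { intros w s Hw Hs. eapply is_derive_eq; [apply (is_derive_Rcomp arcsq (fun s => w + s)); [apply is_derive_arcsq; lra|instantiate (1 := 1); auto_derive; auto; ring]|ring]. }
  intros s Hs. apply is_derive_Rminus; apply Q; lra. }
 cut (arcsq (z + 0) - arcsq (z' + 0) <= arcsq (z + t) - arcsq (z' + t)); [rewrite !Rplus_0_r; lra|].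
 apply (is_derive_nonneg_incr (fun s => arcsq (z + s) - arcsq (z' + s)) (fun s => 2 * arcL 0 (z + s) - 2 * arcL 0 (z' + s))); auto.
 - intros s Hs. apply D; lra.
 - intros s Hs. cut (arcL 0 (z' + s) <= arcL 0 (z + s)); [lra|].
  apply (is_derive_nonpos_decr (arcL 0) (fun w => - arcL 1 w)); [lra|intros; apply is_derive_arcL0; lra|].
  intros w Hw. note (arcL_pos 1 w ltac:(lra)). lra.
Qed.

(* Concavity of [arcsq] makes the Bessel arguments at the top of the circle the smallest ones. *)
Lemma green_kernel_top X y r t : 0 <= y -> 0 < r <= 1 -> X ^ 2 + y ^ 2 = r ^ 2 -> 0 <= t ->
 green_kernel X (cosh y + t) <= 16 * green_kernel 0 (cosh r + t).
Proof.
 intros Hy Hr E Ht. note (cosh_ge1 y). note (cosh_ge1 r). assert (Hyr : y <= r) by (note (pow2_ge_0 X); nra).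
 assert (Hc : cosh y <= cosh r).
 { apply (is_derive_nonneg_incr cosh sinh); auto; [intros; apply is_derive_cosh|]. intros s Hs. left. apply sinh_pos. lra. }
 assert (Hc1 : cosh r <= 2).
 { apply Rle_trans with (cosh 1).
  - apply (is_derive_nonneg_incr cosh sinh); [lra|intros; apply is_derive_cosh|]. intros s Hs. left. apply sinh_pos. lra.
  - apply cosh_1_le. }
 set (z := cosh y + t). set (z' := cosh r + t). assert (Hz : 1 <= z /\ 1 <= z' /\ z' <= 2 * z) by (unfold z, z'; lra).
 assert (Hv : 0 < 0 ^ 2 + arcsq z' <= X ^ 2 + arcsq z).
 { note (arcsq_concave (cosh y) (cosh r) t ltac:(lra) Ht) as C. rewrite !arcsq_cosh_all in C.
  note (arcsq_le (cosh r) z' ltac:(unfold z'; lra)) as C2. rewrite arcsq_cosh_all in C2. fold z z' in C. assert (0 < r ^ 2) by pos. lra. }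
 set (v := X ^ 2 + arcsq z) in *. set (v' := 0 ^ 2 + arcsq z') in *.
 note (besselm_decr v' v Hv). note (besselm1_incr v' v Hv). note (besselm_pos v ltac:(lra)). note (besselm1_neg v ltac:(lra)).
 note (arcL_ge_quarter 0 z z' ltac:(lia) ltac:(lra) ltac:(lra) ltac:(lra)) as A0. note (arcL_ge_quarter 1 z z' ltac:(lia) ltac:(lra) ltac:(lra) ltac:(lra)) as A1.
 note (arcL_pos 0 z ltac:(lra)). note (arcL_pos 1 z ltac:(lra)).
 assert (A2 : arcL 0 z ^ 2 <= (4 * arcL 0 z') ^ 2) by (apply pow_incr; lra).
 assert (B1 : arcL 0 z ^ 2 * - besselm1 v <= (4 * arcL 0 z') ^ 2 * - besselm1 v') by (apply Rmult_le_compat; [pos|lra|lra|lra]).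
 assert (B2 : arcL 1 z * besselm v <= 4 * arcL 1 z' * besselm v') by (apply Rmult_le_compat; lra).
 assert (0 <= arcL 1 z' * besselm v') by (apply Rmult_le_pos; lra). unfold green_kernel. fold v v'. lra.
Qed.

Lemma green_radial_top X y r : 0 <= y -> 0 < r <= 1 -> X ^ 2 + y ^ 2 = r ^ 2 -> green_radial 1 X (cosh y) <= 16 * green_radial 1 0 (cosh r).
Proof.
 intros Hy Hr E. note (cosh_ge1 y). note (cosh_ge1 r). assert (HD : green_domain X (cosh y) /\ green_domain 0 (cosh r)).
 { assert (0 < r ^ 2) by pos. split; split; try lra; rewrite arcsq_cosh_all; lra. }
 assert (Ex : forall X z, green_domain X z -> ex_RInt (descent_integrand (green_kernel X) z 1) 0 1).
 { intros X' z' H'. apply (ex_RInt_descent_adm green_domain); auto using green_domain_kernel, admissible_green; lra. }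
 unfold green_radial, descent. rewrite <- RInt_Rcmult by (apply Ex; tauto).
 apply RInt_le; [lra|apply Ex; tauto|apply ex_RInt_Rcmult, Ex; tauto|]. intros e He. unfold descent_integrand. destruct (Rlt_dec 0 e); [|lra].
 rewrite !Rmult_1_l. unfold Rdiv. rewrite <- Rmult_assoc. apply Rmult_le_compat_r; [pos|]. apply green_kernel_top; auto. pos.
Qed.

Lemma green_avg_top (xi r : R) (p : pt) : 0 < r <= 1 -> Sigma p -> dist2 p (xi, 0) = r -> green_avg (xi, 0) p <= 16 * green_avg (xi, 0) (xi, r).
Proof.
 intros Hr Hp Hd. unfold Sigma in Hp. assert (Ne : forall z : pt, 0 < snd z -> z <> (xi, 0)) by (intros z Hz ->; simpl in Hz; lra).
 assert (Ex : forall z : pt, 0 < snd z -> ex_RInt (fun t => wsin2 (snd z) t * green_radial (cosh 0) (fst z - xi) (geo_arg (cosh 0) (sinh 0) (snd z) t)) 0 PI).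
 { intros z Hz. apply (average_ex_RInt green_domain); [apply continuous2_wsin2|apply green_radial_continuous; note (cosh_ge1 0); lra|].
  apply (green_average_domain (xi, 0) z); simpl; auto; lra. }
 unfold green_avg, average. cbn [fst snd]. rewrite <- RInt_Rcmult by exact (Ex (xi, r) ltac:(simpl; lra)).
 note PI_RGT_0. apply RInt_le; [lra|exact (Ex p Hp)|apply ex_RInt_Rcmult; exact (Ex (xi, r) ltac:(simpl; lra))|].
 intros t _. unfold wsin2, geo_arg. rewrite sinh_0, cosh_0, !Rmult_0_l, !Rminus_0_r, !Rmult_1_l, Rminus_diag.
 rewrite <- Rmult_assoc, (Rmult_comm 16), Rmult_assoc. apply Rmult_le_compat_l; [pos|]. apply green_radial_top; auto; [lra|].
 rewrite <- Hd. unfold dist2. cbn [fst snd]. rewrite pow2_sqrt by apply sum_sqr_ge0. ring.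
Qed.

Lemma cont2R_on_subset (U V : pt -> Prop) (f : pt -> R) : (forall p, V p -> U p) -> cont2R_on U f -> cont2R_on V f.
Proof. intros H C p Hp eps He. destruct (C p (H p Hp) eps He) as [d [Hd HC]]. exists d. split; auto. Qed.

Lemma box_continuous (x a : R) : cont2R_on Sigma (fun p => sinh32 (snd p) * (a ^ 2 - 2 * (fst p - x) ^ 2 + sinh (snd p) ^ 2)).
Proof.
 intros [x0 y0] Hy. unfold Sigma in Hy. simpl in Hy. apply lim2R_filterlim, flim_within.
 apply (flim_mult (fun q : R * R => sinh32 (snd q)) (fun q : R * R => a ^ 2 - 2 * (fst q - x) ^ 2 + sinh (snd q) ^ 2)).
 - apply (flim_cont sinh32 (fun q : R * R => snd q)); [apply continuous_snd|eapply is_derive_continuous, is_derive_sinh32; auto].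
 - assert (filterlim (fun q : R * R => fst q) (locally (x0, y0)) (locally x0)) by apply continuous_fst.
  assert (filterlim (fun q : R * R => sinh (snd q)) (locally (x0, y0)) (locally (sinh y0))) by (apply (flim_cont sinh (fun q : R * R => snd q)); [apply continuous_snd|apply continuous_sinh]).
  flim.
Qed.

(** A Hopf barrier that vanishes at the boundary line at the exact rate [sinh32]. The term [sinh^2]
    produces enough convexity to pay for the concave [- 2 (x' - x)^2], which makes the function
    nonpositive on the lateral sides of a box. *)
Lemma Lsub_box (U : pt -> Prop) (x a : R) : (forall p, U p -> Sigma p /\ (fst p - x) ^ 2 <= a ^ 2) -> a ^ 2 <= 1 ->
 Lsub U (fun p => sinh32 (snd p) * (a ^ 2 - 2 * (fst p - x) ^ 2 + sinh (snd p) ^ 2)).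
Proof.
 intros HU Ha. set (S1 := fun y => 3 / 2 * cosh y * sqrt (sinh y)). exists (fun p => sinh32 (snd p) * - 4),
  (fun p => (2 + P (snd p)) * sinh32 (snd p) * (a ^ 2 - 2 * (fst p - x) ^ 2 + sinh (snd p) ^ 2) + S1 (snd p) * (2 * sinh (snd p) * cosh (snd p)) +
   (S1 (snd p) * (2 * sinh (snd p) * cosh (snd p)) + sinh32 (snd p) * (2 * (cosh (snd p) ^ 2 + sinh (snd p) ^ 2)))). split; [split|].
 - apply (cont2R_on_subset Sigma); [intros p Hp; apply HU; auto|apply box_continuous].
 - exists (fun p => sinh32 (snd p) * (- 4 * (fst p - x))), (fun p => S1 (snd p) * (a ^ 2 - 2 * (fst p - x) ^ 2 + sinh (snd p) ^ 2) + sinh32 (snd p) * (2 * sinh (snd p) * cosh (snd p))).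
  intros p Hp. destruct (HU p Hp) as [Hy _]. unfold Sigma in Hy.
  assert (Dq : is_derive (fun t => a ^ 2 - 2 * (fst p - x) ^ 2 + sinh t ^ 2) (snd p) (2 * sinh (snd p) * cosh (snd p))).
  { eapply is_derive_eq; [apply is_derive_Rplus; [apply is_derive_Rconst|apply (is_derive_Rpow sinh (snd p) (cosh (snd p)) 1), is_derive_sinh]|simpl; ring]. }
  assert (Dr : is_derive (fun t => 2 * sinh t * cosh t) (snd p) (2 * (cosh (snd p) ^ 2 + sinh (snd p) ^ 2))).
  { eapply is_derive_eq; [apply is_derive_Rmult; [apply is_derive_Rcmult, is_derive_sinh|apply is_derive_cosh]|simpl; ring]. }
  repeat split; apply is_derive_Reals; cbn [fst snd].
  + apply is_derive_Rcmult. auto_derive; auto. ring.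
  + apply (is_derive_Rmult sinh32 (fun t => a ^ 2 - 2 * (fst p - x) ^ 2 + sinh t ^ 2)); [apply is_derive_sinh32; auto|exact Dq].
  + apply is_derive_Rcmult. auto_derive; auto. ring.
  + apply is_derive_Rplus; [apply (is_derive_Rmult S1 (fun t => a ^ 2 - 2 * (fst p - x) ^ 2 + sinh t ^ 2)); [apply is_derive_sinh32'; auto|exact Dq]|apply (is_derive_Rmult sinh32 (fun t => 2 * sinh t * cosh t)); [apply is_derive_sinh32; auto|exact Dr]].
 - intros p Hp. destruct (HU p Hp) as [Hy Hx]. unfold Sigma in Hy. note (sinh32_pos _ Hy) as Hs. note (cosh2_sinh2 (snd p)). note (pow2_ge_0 (sinh (snd p))).
  assert (ES : S1 (snd p) * (2 * sinh (snd p) * cosh (snd p)) = sinh32 (snd p) * (3 * cosh (snd p) ^ 2)) by (unfold S1, sinh32; field).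
  rewrite ES. set (s := sinh32 (snd p)) in *. set (q := a ^ 2 - 2 * (fst p - x) ^ 2 + sinh (snd p) ^ 2) in *. set (c := cosh (snd p) ^ 2) in *.
  assert (0 <= s * (2 * q + 8 * c + 2 * sinh (snd p) ^ 2 - 4)); [|lra]. apply Rmult_le_pos; [lra|]. unfold q. lra.
Qed.

(** Comparison in the box of half-width [sinh h] and height [h]: the barrier is nonpositive on the
    sides, tends to 0 at the bottom and is at most [2 a^2 sinh32 h] on top, while on the axis of the
    box it is at least [a^2 sinh32 y]. *)
Lemma boundary_lower (u : pt -> R) (x h m : R) : Lharmonic_on Sigma u -> (forall p, Sigma p -> 0 <= u p) -> 0 < h <= 1 / 2 -> 0 <= m ->
 (forall t, Rabs (t - x) <= sinh h -> m <= u (t, h)) -> forall y, 0 < y < h -> m * sinh32 y <= 2 * sinh32 h * u (x, y).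
Proof.
 intros Hu Hu0 Hh Hm Htop y Hy. set (a := sinh h). note (sinh_pos h ltac:(lra)) as Ha. fold a in Ha, Htop. assert (Ha1 : a <= 1).
 { note (sinh_le h (1 / 2) ltac:(lra)). note (sinh_le_lin (1 / 2) ltac:(lra)). note cosh_1_le. unfold a. lra. }
 note (sinh32_pos h ltac:(lra)) as Hsh. set (U := fun p : pt => Sigma p /\ Rabs (fst p - x) < a /\ snd p < h).
 set (w := fun p : pt => sinh32 (snd p) * (a ^ 2 - 2 * (fst p - x) ^ 2 + sinh (snd p) ^ 2)).
 assert (Hsq : forall s : R, Rabs s <= a -> s ^ 2 <= a ^ 2) by (intros s Hs; rewrite <- (pow2_abs s); apply pow_incr; split; [apply Rabs_pos|auto]).
 assert (HUS : forall p, U p -> Sigma p) by (intros p [Hp _]; exact Hp).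
 set (g := fun p => m * w p + (2 * sinh32 h * a ^ 2) * (- (1) * u p + 0 * u p)). assert (Hk : 0 <= 2 * sinh32 h * a ^ 2) by pos.
 assert (HL : Lsub Sigma (fun p => - (1) * u p + 0 * u p)) by (apply Lharmonic_Lsub, Lharmonic_lin; auto).
 assert (Hwle : forall p : pt, Sigma p -> snd p <= h -> w p <= 2 * a ^ 2 * sinh32 (snd p)).
 { intros p Hp Hph. unfold Sigma in Hp. note (sinh32_pos _ Hp). note (pow2_ge_0 (fst p - x)).
  note (sinh_pos _ Hp). note (sinh_le (snd p) h Hph).
  assert (sinh (snd p) ^ 2 <= a ^ 2) by (apply pow_incr; unfold a; lra). unfold w. nra. }
 assert (Hg : g (x, y) <= 0).
 { apply (comparison U g); auto.
  - apply open2_and; [apply open2_Sigma|]. apply open2_and; intros z Hz.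
   + exists (a - Rabs (fst z - x)). split; [lra|]. intros z' Hz'. note (Rabs_fst_dist2 z' z). note (Rabs_triang (fst z' - fst z) (fst z - x)) as T.
    replace (fst z' - fst z + (fst z - x)) with (fst z' - x) in T by ring. lra.
   + exists (h - snd z). split; [lra|]. intros z' Hz'. note (Rabs_snd_dist2 z' z) as T. apply Rabs_le_between in T. lra.
  - apply Lsub_lin; auto.
   + apply Lsub_box; [|nra]. intros p [Hp [Hx _]]. split; auto. apply Hsq; lra.
   + destruct HL as [wxx [wyy [[C [wx [wy D]]] Q]]]. exists wxx, wyy. split; [split|]; auto.
    * apply (cont2R_on_subset Sigma); auto.
    * exists wx, wy. auto.
  - intros eta _. exists (Rabs x + a + h). intros p [Hp [Hx Hy']] Hl. exfalso. unfold Sigma in Hp. rewrite (Rabs_right (snd p)) in Hl by lra.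
   note (Rabs_triang (fst p - x) x) as T. replace (fst p - x + x) with (fst p) in T by ring. lra.
  - intros eta He z Hz. destruct (Rle_lt_dec (snd z) 0) as [Hz0|Hz0].
   + destruct (sinh32_small (eta / (m * (2 * a ^ 2) + 1))) as [d [Hd HS]]; [assert (0 <= m * (2 * a ^ 2)) by pos; pos|].
    exists d. split; auto. intros z' [Z1 [Z2 Z3]] Hd'. note (Rabs_snd_dist2 z' z) as T. apply Rabs_le_between in T. unfold Sigma in Z1.
    specialize (HS (snd z') ltac:(lra)). specialize (Hwle z' Z1 ltac:(lra)). specialize (Hu0 z' Z1). note (sinh32_pos _ Z1).
    assert (K0 : 0 <= m * (2 * a ^ 2)) by pos. apply (Rmult_lt_compat_l (m * (2 * a ^ 2) + 1)) in HS; [|lra].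
    replace ((m * (2 * a ^ 2) + 1) * (eta / (m * (2 * a ^ 2) + 1))) with eta in HS by (field; lra).
    assert (m * w z' <= m * (2 * a ^ 2 * sinh32 (snd z'))) by (apply Rmult_le_compat_l; auto).
    assert (0 <= 2 * sinh32 h * a ^ 2 * u z') by (apply Rmult_le_pos; auto). unfold g. lra.
   + destruct (Rlt_le_dec h (snd z)) as [B|B].
    { exists (snd z - h). split; [lra|]. intros z' [Z1 [Z2 Z3]] Hd. note (Rabs_snd_dist2 z' z) as T. apply Rabs_le_between in T. lra. }
    destruct (Rlt_le_dec a (Rabs (fst z - x))) as [B'|B'].
    { exists (Rabs (fst z - x) - a). split; [lra|]. intros z' [Z1 [Z2 Z3]] Hd. note (Rabs_fst_dist2 z' z) as T. rewrite Rabs_minus_sym in T.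
     note (Rabs_triang (fst z - fst z') (fst z' - x)) as T2. replace (fst z - fst z' + (fst z' - x)) with (fst z - x) in T2 by ring. lra. }
    assert (Hgz : g z <= 0).
    { specialize (Hu0 z Hz0). specialize (Hwle z Hz0 B). assert (E : 0 <= 2 * sinh32 h * a ^ 2 * u z) by (apply Rmult_le_pos; auto).
     destruct (Req_dec (snd z) h) as [Eh|Eh].
     - assert (Hmu : m <= u z) by (rewrite (surjective_pairing z), Eh; apply Htop; auto). rewrite Eh in Hwle.
      apply (Rmult_le_compat_l m) in Hwle; auto. assert (m * (2 * sinh32 h * a ^ 2) <= u z * (2 * sinh32 h * a ^ 2)) by (apply Rmult_le_compat_r; auto). unfold g. lra.
     - assert (Ex : Rabs (fst z - x) = a) by (apply Rle_antisym; auto; apply Rnot_lt_le; intros C; apply Hz; repeat split; auto; lra).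
      assert (w z <= 0).
      { unfold w. rewrite <- (pow2_abs (fst z - x)), Ex. note (sinh32_pos _ Hz0). note (sinh_pos _ Hz0). note (sinh_le (snd z) h B).
       assert (sinh (snd z) ^ 2 <= a ^ 2) by (apply pow_incr; unfold a; lra). nra. }
      unfold g. nra. }
    assert (HC : cont2R_on Sigma g).
    { apply cont2R_on_lin; [apply box_continuous|]. destruct HL as [? [? [[C _] _]]]; exact C. }
    destruct (HC z Hz0 eta He) as [d [Hd HCd]]. exists d. split; auto. intros z' [Z1 _] Hd'. specialize (HCd z' Z1 Hd'). apply Rabs_def2 in HCd. lra.
  - split; [apply Hy|]. cbn [fst snd]. rewrite Rminus_diag, Rabs_R0. lra. }
 unfold g, w in Hg. cbn [fst snd] in Hg. note (sinh32_pos y ltac:(lra)). note (pow2_ge_0 (sinh y)). assert (0 < a ^ 2) by pos.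
 apply (Rmult_le_reg_l (a ^ 2)); auto. assert (0 <= m * sinh32 y * sinh y ^ 2) by (apply Rmult_le_pos; [apply Rmult_le_pos; lra|auto]). replace (x - x) with 0 in Hg by ring. lra.
Qed.

Lemma segment_U_harmonic (xi : R) : Lharmonic_on Sigma (green_U (xi, 0)).
Proof.
 eapply Lharmonic_on_subset; [|apply green_U_harmonic; simpl; lra]. intros p Hp. split; auto. intros ->. unfold Sigma in Hp. simpl in Hp. lra.
Qed.

Lemma segment_U_pos (xi : R) (p : pt) : Sigma p -> 0 < green_U (xi, 0) p.
Proof. intros Hp. apply green_U_pos; auto; [simpl; lra|]. intros ->. unfold Sigma in Hp. simpl in Hp. lra. Qed.

(** The constant does not depend on the radius, which is what lets a lower bound at the top point of
    arbitrarily small half circles spread. Points above height [r / 4] are reached by Harnack, lower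
    ones by [boundary_lower]; [green_avg_top] bounds the Green function on the half circle by its
    value at the top. *)
Lemma segment_circle_lower (xi : R) : exists dl, 0 < dl /\ forall r u, 0 < r <= 1 -> Lharmonic_on Sigma u -> (forall p, Sigma p -> 0 <= u p) ->
 green_U (xi, 0) (xi, r) <= 2 * u (xi, r) -> forall p, Sigma p -> dist2 p (xi, 0) = r -> dl * green_U (xi, 0) p <= u p.
Proof.
 (* At heights at least [r / 4] the Harnack rate is [128 / r]; the path covers at most [2 r]
    horizontally and [r] vertically. In [64 * K] the factor is 16 from [green_avg_top], 2 from the
    hypothesis and 2 from [boundary_lower]. *)
 set (K := exp 256 * exp 128). assert (HK : 0 < K) by (apply Rmult_lt_0_compat; apply exp_pos).
 exists (/ (64 * K)). split; [apply Rinv_0_lt_compat; lra|]. intros r u Hr Hu Hu0 Htop p Hp Hd.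
 note (green_avg_top xi r p Hr Hp Hd) as HA. set (A := green_avg (xi, 0) (xi, r)) in *.
 note (Rabs_fst_dist2 p (xi, 0)) as Hx. note (Rabs_snd_dist2 p (xi, 0)) as Hy. rewrite Hd in Hx, Hy. cbn [fst snd] in Hx, Hy.
 apply Rabs_le_between in Hx. apply Rabs_le_between in Hy. unfold Sigma in Hp.
 assert (Har : forall t y, Rabs (t - xi) <= 2 * r -> r / 4 <= y <= r -> u (xi, r) / K <= u (t, y)).
 { intros t y Ht Hy'. apply (proj2 (Rle_div_l _ (u (t, y)) K HK)). assert (Hu1 : 0 <= u (t, y)) by (apply Hu0; unfold Sigma; simpl; lra).
  note (harnack_high u (r / 4) t y xi r Hu Hu0 ltac:(lra) ltac:(lra) ltac:(lra)) as H. eapply Rle_trans; [exact H|].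
  rewrite <- Rmult_assoc, (Rmult_comm (u (t, y)) K). apply Rmult_le_compat_r; auto. rewrite Rabs_minus_sym in Ht.
  assert (E : forall s k, 0 <= s <= k * r -> 32 / (r / 4) * s <= 128 * k).
  { intros s k Hs. apply Rle_trans with (32 / (r / 4) * (k * r)); [apply Rmult_le_compat_l; [pos|lra]|right; field; lra]. }
  assert (Hy2 : Rabs (r - y) <= 1 * r) by (apply Rabs_le; lra). note (E _ 2 (conj (Rabs_pos _) Ht)). note (E _ 1 (conj (Rabs_pos _) Hy2)).
  apply Rmult_le_compat; try (left; apply exp_pos); apply exp_le; lra. }
 set (m := u (xi, r) / K) in *. note (sinh32_pos _ Hp) as S1. note (sinh32_pos r ltac:(lra)) as S2. note (sinh32_le (snd p) r ltac:(lra)) as S3.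
 assert (HA0 : 0 < A) by (apply green_avg_pos; simpl; try lra; intros C; injection C; lra).
 assert (Hm : sinh32 r * A <= 2 * K * m) by (unfold m; replace (2 * K * (u (xi, r) / K)) with (2 * u (xi, r)) by (field; lra); exact Htop).
 assert (Hm0 : 0 <= m) by (apply Rmult_le_pos; [apply Hu0; unfold Sigma; simpl; lra|pos]).
 rewrite Rmult_comm. apply (proj2 (Rle_div_l _ (u p) (64 * K) ltac:(lra))).
 apply Rle_trans with (sinh32 (snd p) * (16 * A)); [apply Rmult_le_compat_l; lra|]. destruct (Rle_lt_dec (r / 4) (snd p)) as [Hh|Hh].
 - assert (Hup : m <= u p) by (rewrite (surjective_pairing p); apply Har; [apply Rabs_le; lra|lra]).
  assert (sinh32 (snd p) * A <= sinh32 r * A) by (apply Rmult_le_compat_r; lra). assert (K * m <= K * u p) by (apply Rmult_le_compat_l; lra). assert (0 <= K * m) by (apply Rmult_le_pos; lra). lra.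
 - assert (Hb : m * sinh32 (snd p) <= 2 * sinh32 (r / 4) * u p).
  { rewrite (surjective_pairing p) at 2. apply (boundary_lower u (fst p) (r / 4) m); auto; [lra|]. intros t Ht. apply Har; [|lra].
   note (sinh_le_lin (r / 4) ltac:(lra)). note cosh_1_le. apply Rabs_le_between in Ht. apply Rabs_le. nra. }
  assert (Hup : 0 <= u p) by auto. note (sinh32_le (r / 4) r ltac:(lra)).
  assert (sinh32 (r / 4) * u p <= sinh32 r * u p) by (apply Rmult_le_compat_r; auto). apply (Rmult_le_reg_l (sinh32 r)); auto.
  assert (sinh32 (snd p) * (sinh32 r * A) <= sinh32 (snd p) * (2 * K * m)) by (apply Rmult_le_compat_l; lra).
  assert (K * (m * sinh32 (snd p)) <= K * (2 * (sinh32 r * u p))) by (apply Rmult_le_compat_l; lra). lra.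
Qed.

(* Subtracting from [v] and [M - v] their largest minorants proportional to [M] leaves remainders, one of which is comparable with
  [M] above the pole at arbitrarily small scales, hence everywhere. *)
Lemma segment_minimal_aux (xi : R) (v : pt -> R) : Lharmonic_on Sigma v -> (forall p, Sigma p -> 0 <= v p <= green_U (xi, 0) p) ->
 exists c, forall p, Sigma p -> v p = c * green_U (xi, 0) p.
Proof.
 intros Hv Hb. note (segment_U_harmonic xi) as HM. note (segment_U_pos xi) as Mpos. destruct (segment_circle_lower xi) as [dl [Hdl HC]].
 assert (Hsup : forall w, Lharmonic_on Sigma w -> (forall p, Sigma p -> 0 <= w p <= green_U (xi, 0) p) -> exists m,
  (forall p, Sigma p -> m * green_U (xi, 0) p <= w p) /\ forall k, (forall p, Sigma p -> k * green_U (xi, 0) p <= w p) -> k <= m).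
 { intros w Hw Hwb. destruct (completeness (fun k => forall p, Sigma p -> k * green_U (xi, 0) p <= w p)) as [m [Hm1 Hm2]].
  - exists 1. intros k Hk. specialize (Hk (0, 1) ltac:(unfold Sigma; simpl; lra)). specialize (Hwb (0, 1) ltac:(unfold Sigma; simpl; lra)).
   note (Mpos (0, 1) ltac:(unfold Sigma; simpl; lra)). nra.
  - exists 0. intros p Hp. specialize (Hwb p Hp). lra.
  - exists m. split; [|exact Hm1]. intros p Hp. apply (proj2 (Rle_div_r m (w p) _ (Mpos p Hp))). apply Hm2. intros k Hk.
   apply (proj1 (Rle_div_r k (w p) _ (Mpos p Hp))). auto. }
 assert (HM' : Lharmonic_on Sigma (fun p => 1 * green_U (xi, 0) p + - (1) * v p)) by (apply Lharmonic_lin; auto).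
 destruct (Hsup v Hv Hb) as [m1 [A1 B1]]. destruct (Hsup _ HM') as [m2 [A2 B2]]; [intros p Hp; specialize (Hb p Hp); lra|].
 (* The two remainders add up to [s] times the kernel. If [s <= 0] both vanish and [v] is a multiple
    of the kernel. *)
 set (s := 1 - m1 - m2). set (p1 := (0, 1) : pt). assert (Sp1 : Sigma p1) by (unfold Sigma, p1; simpl; lra).
 destruct (Rle_lt_dec s 0) as [Hs|Hs].
 { exists m1. intros p Hp. specialize (A1 p Hp). specialize (A2 p Hp). note (Mpos p Hp). unfold s in Hs. cbv beta in A2. nra. }
 (* Comparability with the kernel on one half circle below [p] propagates outwards by
    [green_outside], and then [m + s * dl] would be admissible, against the maximality of [m]. *)
 exfalso. assert (Key : forall w m, Lharmonic_on Sigma w -> (forall p, Sigma p -> m * green_U (xi, 0) p <= w p) ->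
  (forall k, (forall p, Sigma p -> k * green_U (xi, 0) p <= w p) -> k <= m) ->
  (forall r0, 0 < r0 -> exists r, 0 < r < r0 /\ s * green_U (xi, 0) (xi, r) <= 2 * (w (xi, r) - m * green_U (xi, 0) (xi, r))) -> False).
 { intros w m Hw Hm1 Hm2 Hr. assert (m + s * dl <= m); [|nra]. apply Hm2. intros p Hp.
  set (u := fun p => / s * w p + - (m / s) * green_U (xi, 0) p).
  assert (Eu : forall z, s * u z = w z - m * green_U (xi, 0) z) by (intros z; unfold u; field; lra).
  assert (Hu : Lharmonic_on Sigma u) by (apply Lharmonic_lin; auto).
  assert (Hu0 : forall z, Sigma z -> 0 <= u z) by (intros z Hz; specialize (Hm1 z Hz); specialize (Eu z); nra).
  assert (Hd : 0 < dist2 p (xi, 0)) by (apply dist2_gt0; intros ->; unfold Sigma in Hp; simpl in Hp; lra).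
  destruct (Hr (Rmin 1 (dist2 p (xi, 0))) ltac:(apply Rmin_pos; lra)) as [r [Hr0 Hr1]].
  note (Rmin_l 1 (dist2 p (xi, 0))). note (Rmin_r 1 (dist2 p (xi, 0))). assert (dl * green_U (xi, 0) p <= u p).
  { apply (green_outside (xi, 0) u dl r); auto; try (simpl; lra).
   - eapply Lharmonic_on_subset; [|exact Hu]. tauto.
   - intros z Hz Hzd. apply (HC r u); auto; [lra|]. rewrite <- Eu in Hr1. apply (Rmult_le_reg_l s); auto. lra. }
  apply (Rmult_le_compat_l s) in H1; [|lra]. rewrite Eu in H1. lra. }
 (* At every height at least one of the remainders is half of their sum or more. If the first one
    fails at all small scales, the second one succeeds there. *)
 destruct (classic (forall r0, 0 < r0 -> exists r, 0 < r < r0 /\ s * green_U (xi, 0) (xi, r) <= 2 * (v (xi, r) - m1 * green_U (xi, 0) (xi, r)))) as [H|H].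
 - exact (Key v m1 Hv A1 B1 H).
 - apply (Key _ m2 HM' A2 B2). intros r0 Hr0. apply NNPP. intros HN. apply H. intros r1 Hr1. exists (Rmin r0 r1 / 2).
  assert (0 < Rmin r0 r1) by (apply Rmin_pos; auto). note (Rmin_l r0 r1). note (Rmin_r r0 r1). split; [lra|].
  apply Rnot_lt_le. intros C. apply HN. exists (Rmin r0 r1 / 2). split; [lra|]. unfold s in *. lra.
Qed.

Lemma minimal_scale (u : pt -> R) (k : R) : 0 < k -> (forall p, Sigma p -> 0 < u p) -> Lharmonic_on Sigma u ->
 (forall v, Lharmonic_on Sigma v -> (forall p, Sigma p -> 0 <= v p <= u p) -> exists c, forall p, Sigma p -> v p = c * u p) ->
 minimal_pos_Lharmonic (fun p => u p / k).
Proof.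
 intros Hk Hu HL Hmin. assert (Hs : forall w, Lharmonic_on Sigma w -> forall b, Lharmonic_on Sigma (fun p => b * w p)).
 { intros w Hw b. replace (fun p => b * w p) with (fun p => b * w p + 0 * w p) by (apply functional_extensionality; intros; ring).
  apply Lharmonic_lin; auto. }
 split; [|split].
 - intros p Hp. apply Rdiv_lt_0_compat; auto.
 - replace (fun p => u p / k) with (fun p => / k * u p) by (apply functional_extensionality; intros; unfold Rdiv; ring). apply Hs; auto.
 - intros v Hv Hb. destruct (Hmin (fun p => k * v p)) as [c Hc]; [apply Hs; auto| |].
  + intros p Hp. specialize (Hb p Hp). split; [apply Rmult_le_pos; lra|]. replace (u p) with (k * (u p / k)) by (field; lra). apply Rmult_le_compat_l; lra.
  + exists c. intros p Hp. specialize (Hc p Hp). cbv beta in Hc. replace (v p) with (k * v p / k) by (field; lra). rewrite Hc. unfold Rdiv. ring.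
Qed.

(** * The half-disk model *)

(** Central projection of the plane at height 1 onto the unit hemisphere followed by vertical
    projection: rays end at their directions, and the boundary line goes to the segment. *)
Definition compress (p : pt) : pt := (fst p / sqrt (1 + fst p ^ 2 + snd p ^ 2), snd p / sqrt (1 + fst p ^ 2 + snd p ^ 2)).
Definition expand (z : pt) : pt := (fst z / sqrt (1 - fst z ^ 2 - snd z ^ 2), snd z / sqrt (1 - fst z ^ 2 - snd z ^ 2)).

Lemma compress_den_pos (p : pt) : 0 < sqrt (1 + fst p ^ 2 + snd p ^ 2) /\ sqrt (1 + fst p ^ 2 + snd p ^ 2) ^ 2 = 1 + fst p ^ 2 + snd p ^ 2.
Proof. note (pow2_ge_0 (fst p)). note (pow2_ge_0 (snd p)). split; [pos|apply pow2_sqrt; lra]. Qed.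

Lemma expand_den_pos (z : pt) : fst z ^ 2 + snd z ^ 2 < 1 ->
 0 < sqrt (1 - fst z ^ 2 - snd z ^ 2) /\ sqrt (1 - fst z ^ 2 - snd z ^ 2) ^ 2 = 1 - fst z ^ 2 - snd z ^ 2.
Proof. intros H. split; [pos|apply pow2_sqrt; lra]. Qed.

Lemma compress_norm (p : pt) : fst (compress p) ^ 2 + snd (compress p) ^ 2 < 1.
Proof.
 destruct (compress_den_pos p) as [H1 H2]. unfold compress. cbn [fst snd]. set (N := sqrt (1 + fst p ^ 2 + snd p ^ 2)) in *.
 replace ((fst p / N) ^ 2 + (snd p / N) ^ 2) with ((fst p ^ 2 + snd p ^ 2) / N ^ 2) by fld.
 assert (HN : 0 < N ^ 2) by pos. apply (proj2 (Rlt_div_l _ 1 _ HN)). lra.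
Qed.

Lemma expand_compress (p : pt) : expand (compress p) = p.
Proof.
 note (compress_norm p) as Hn. destruct (compress_den_pos p) as [H1 H2]. unfold expand, compress in *. cbn [fst snd] in *. set (N := sqrt (1 + fst p ^ 2 + snd p ^ 2)) in *.
 replace (1 - (fst p / N) ^ 2 - (snd p / N) ^ 2) with ((/ N) ^ 2).
 - rewrite sqrt_pow2 by pos. destruct p as [x y]. cbn [fst snd] in *. f_equal; field; lra.
 - replace (1 - (fst p / N) ^ 2 - (snd p / N) ^ 2) with ((N ^ 2 - fst p ^ 2 - snd p ^ 2) / N ^ 2) by fld. rewrite H2 at 1. field. lra.
Qed.

Lemma compress_expand (z : pt) : fst z ^ 2 + snd z ^ 2 < 1 -> compress (expand z) = z.
Proof.
 intros Hz. destruct (expand_den_pos z Hz) as [H1 H2]. unfold expand, compress. cbn [fst snd]. set (m := sqrt (1 - fst z ^ 2 - snd z ^ 2)) in *.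
 replace (1 + (fst z / m) ^ 2 + (snd z / m) ^ 2) with ((/ m) ^ 2).
 - rewrite sqrt_pow2 by pos. destruct z as [x y]. cbn [fst snd] in *. f_equal; field; lra.
 - replace (1 + (fst z / m) ^ 2 + (snd z / m) ^ 2) with ((m ^ 2 + fst z ^ 2 + snd z ^ 2) / m ^ 2) by fld. replace (m ^ 2 + fst z ^ 2 + snd z ^ 2) with 1 by lra. field. lra.
Qed.

Lemma lim2_components (S : pt -> Prop) (f : pt -> pt) (a l : pt) :
 filterlim (fun z => fst (f z)) (within S (locally (a : R * R))) (locally (fst l)) ->
 filterlim (fun z => snd (f z)) (within S (locally (a : R * R))) (locally (snd l)) -> lim2 S f a l.
Proof.
 intros H1 H2 eps He. apply lim2R_filterlim in H1. apply lim2R_filterlim in H2.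
 destruct (H1 (eps / 2) ltac:(lra)) as [d1 [Hd1 K1]]. destruct (H2 (eps / 2) ltac:(lra)) as [d2 [Hd2 K2]].
 exists (Rmin d1 d2). split; [pos|]. intros z Hz Hd. note (Rmin_l d1 d2). note (Rmin_r d1 d2).
 specialize (K1 z Hz ltac:(lra)). specialize (K2 z Hz ltac:(lra)). eapply Rle_lt_trans; [apply dist2_le_Rabs|]. lra.
Qed.

Lemma continuous_sqrt_pos (x : R) : 0 <= x -> continuous sqrt x.
Proof. intros H. apply continuity_pt_filterlim, continuity_pt_sqrt. auto. Qed.

Lemma flim_coords (S : pt -> Prop) (a : pt) :
 filterlim (fun z : R * R => fst z) (within S (locally (a : R * R))) (locally (fst a)) /\
 filterlim (fun z : R * R => snd z) (within S (locally (a : R * R))) (locally (snd a)).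
Proof. split; apply flim_within; destruct a; [apply continuous_fst|apply continuous_snd]. Qed.

Lemma compress_lim (S : pt -> Prop) (a : pt) : lim2 S compress a (compress a).
Proof.
 destruct (flim_coords S a) as [F1 F2]. destruct (compress_den_pos a) as [H1 H2].
 assert (F3 : filterlim (fun z : R * R => sqrt (1 + fst z ^ 2 + snd z ^ 2)) (within S (locally (a : R * R))) (locally (sqrt (1 + fst a ^ 2 + snd a ^ 2)))).
 { apply (flim_cont sqrt); [flim|]. apply continuous_sqrt_pos. note (pow2_ge_0 (fst a)). note (pow2_ge_0 (snd a)). lra. }
 apply lim2_components; unfold compress; cbn [fst snd]; flim; lra.
Qed.

Lemma expand_flim (S : pt -> Prop) (a : pt) : fst a ^ 2 + snd a ^ 2 < 1 ->
 filterlim (fun z : R * R => fst (expand z)) (within S (locally (a : R * R))) (locally (fst (expand a))) /\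
 filterlim (fun z : R * R => snd (expand z)) (within S (locally (a : R * R))) (locally (snd (expand a))).
Proof.
 intros Ha. destruct (flim_coords S a) as [F1 F2]. destruct (expand_den_pos a Ha) as [H1 H2].
 assert (F3 : filterlim (fun z : R * R => sqrt (1 - fst z ^ 2 - snd z ^ 2)) (within S (locally (a : R * R))) (locally (sqrt (1 - fst a ^ 2 - snd a ^ 2)))).
 { apply (flim_cont sqrt); [flim|]. apply continuous_sqrt_pos. lra. }
 split; unfold expand; cbn [fst snd]; flim; lra.
Qed.

(** One statement for the vertical rays, the inclined rays and both ends of the boundary line: the
    limit depends on the direction [v] alone. *)
Lemma compress_ray (b v : pt) (f : R -> pt) : fst v ^ 2 + snd v ^ 2 = 1 -> (forall t, f t = compress (fst b + t * fst v, snd b + t * snd v)) -> lim_pinf f v.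
Proof.
 intros Hv Hf. set (F := Rbar_locally p_infty). assert (FF : Filter F) by apply Rbar_locally_filter.
 assert (HI : forall M, F (fun t => M < t)) by (intros M; exists M; auto). note (flim_inv_infty (F := F) (fun t => t) HI) as Hi.
 assert (Ls : filterlim (fun t => sqrt ((1 + fst b ^ 2 + snd b ^ 2) * / t * / t + 2 * (fst b * fst v + snd b * snd v) * / t + 1)) F (locally 1)).
 { apply flim_eq with (sqrt 1); [|apply sqrt_1]. apply (flim_cont sqrt); [|apply continuous_sqrt_pos; lra].
  apply flim_eq with ((1 + fst b ^ 2 + snd b ^ 2) * 0 * 0 + 2 * (fst b * fst v + snd b * snd v) * 0 + 1); [flim|ring]. }
 assert (Q : forall bi vi, filterlim (fun t => (bi + t * vi) / sqrt (1 + (fst b + t * fst v) ^ 2 + (snd b + t * snd v) ^ 2)) F (locally vi)).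
 { intros bi vi. apply (filterlim_ext_loc (fun t => (bi * / t + vi) / sqrt ((1 + fst b ^ 2 + snd b ^ 2) * / t * / t + 2 * (fst b * fst v + snd b * snd v) * / t + 1))).
  - weaken (HI 0). intros t Ht.
   replace (1 + (fst b + t * fst v) ^ 2 + (snd b + t * snd v) ^ 2) with (((1 + fst b ^ 2 + snd b ^ 2) * / t * / t + 2 * (fst b * fst v + snd b * snd v) * / t + 1) * t ^ 2).
   + set (A := (1 + fst b ^ 2 + snd b ^ 2) * / t * / t + 2 * (fst b * fst v + snd b * snd v) * / t + 1). assert (HA : 0 < A * t ^ 2).
    { replace (A * t ^ 2) with (1 + (fst b + t * fst v) ^ 2 + (snd b + t * snd v) ^ 2).
     - note (pow2_ge_0 (fst b + t * fst v)). note (pow2_ge_0 (snd b + t * snd v)). lra.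
     - unfold A. rewrite <- Hv. field. lra. }
    assert (HA0 : 0 < A) by nra. rewrite sqrt_mult by pos. rewrite sqrt_pow2 by lra. note (sqrt_lt_R0 A HA0). field. lra.
   + rewrite <- Hv. field. lra.
  - apply flim_eq with ((bi * 0 + vi) / 1); [|field]. flim. lra. }
 intros eps He. note (proj1 (filterlim_locally _ _) (Q (fst b) (fst v)) (mkposreal (eps / 2) ltac:(lra))) as Q1.
 note (proj1 (filterlim_locally _ _) (Q (snd b) (snd v)) (mkposreal (eps / 2) ltac:(lra))) as Q2.
 destruct (filter_and _ _ Q1 Q2) as [M HM]. exists M. intros t Ht. destruct (HM t Ht) as [B1 B2]. rewrite Hf.
 eapply Rle_lt_trans; [apply dist2_le_Rabs|]. unfold compress. cbn [fst snd].
 change (Rabs ((fst b + t * fst v) / sqrt (1 + (fst b + t * fst v) ^ 2 + (snd b + t * snd v) ^ 2) - fst v) < eps / 2) in B1.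
 change (Rabs ((snd b + t * snd v) / sqrt (1 + (fst b + t * fst v) ^ 2 + (snd b + t * snd v) ^ 2) - snd v) < eps / 2) in B2. lra.
Qed.

(** * The extended kernel and its continuity *)

(** One formula serves the interior and the open segment because [green_U] accepts poles of height
    0; only the semicircle needs the limiting solutions. *)
Definition martin_kernel (p0 p z : pt) : R :=
 if Rlt_dec (fst z ^ 2 + snd z ^ 2) 1 then green_U (expand z) p / green_U (expand z) p0 else theta_U z p / theta_U z p0.

Lemma expand_snd_ge0 (z : pt) : fst z ^ 2 + snd z ^ 2 < 1 -> 0 <= snd z -> 0 <= snd (expand z).
Proof. intros H1 H2. destruct (expand_den_pos z H1). unfold expand. cbn [snd]. apply Rmult_le_pos; [auto|pos]. Qed.

Lemma martin_kernel_inner_continuous (p0 p a : pt) (S : pt -> Prop) : Sigma p0 -> Sigma p -> fst a ^ 2 + snd a ^ 2 < 1 -> 0 <= snd a ->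
 a <> compress p -> a <> compress p0 -> (forall z, S z -> Dset z) -> lim2R S (martin_kernel p0 p) a (martin_kernel p0 p a).
Proof.
 intros Hp0 Hp Ha Ha2 Hne Hne0 HS. apply lim2R_filterlim. set (F := within S (locally (a : R * R))).
 assert (FF : Filter F) by apply within_filter, locally_filter.
 destruct (flim_coords S a) as [F1 F2]. destruct (expand_flim S a Ha) as [E1 E2]. fold F in F1, F2, E1, E2.
 assert (Fn : F (fun z => fst z ^ 2 + snd z ^ 2 < 1)).
 { assert (L : filterlim (fun z : R * R => fst z ^ 2 + snd z ^ 2) F (locally (fst a ^ 2 + snd a ^ 2))) by flim. exact (L _ (locally_lt _ _ Ha)). }
 assert (FS : F (fun z => S z)) by (unfold F, within; apply filter_forall; auto).
 assert (LE : filterlim expand F (within (fun u : R * R => 0 <= snd u) (locally (expand a : R * R)))).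
 { intros Q HQ. unfold within in HQ. note (flim_pair _ _ _ _ E1 E2) as LP. change (fst (expand a), snd (expand a)) with (expand a) in LP. specialize (LP _ HQ).
  unfold filtermap in LP |- *. weaken (filter_and _ _ LP (filter_and _ _ Fn FS)). intros z [H1 [H2 H3]].
  apply H1. apply expand_snd_ge0; auto. apply (HS z H3). }
 note (expand_snd_ge0 a Ha Ha2) as Hq. assert (Hqp : p <> expand a) by (intros E; apply Hne; rewrite E, compress_expand; auto).
 assert (Hqp0 : p0 <> expand a) by (intros E; apply Hne0; rewrite E, compress_expand; auto). unfold Sigma in Hp, Hp0.
 assert (L : forall q, 0 < snd q -> q <> expand a -> filterlim (fun z => green_U (expand z) q) F (locally (green_U (expand a) q))).
 { intros q Hq1 Hq2. unfold green_U. apply (flim_mult (fun _ : R * R => sinh32 (snd q)) (fun z => green_avg (expand z) q)); [apply flim_const|].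
  exact (filterlim_comp _ _ _ _ _ _ _ _ LE (green_avg_continuous (expand a) q Hq ltac:(lra) Hq2)). }
 assert (Ea : martin_kernel p0 p a = green_U (expand a) p / green_U (expand a) p0) by (unfold martin_kernel; destruct (Rlt_dec _ 1); [reflexivity|contradiction]).
 rewrite Ea. apply (filterlim_ext_loc (fun z => green_U (expand z) p / green_U (expand z) p0)).
 - weaken Fn. intros z Hz. unfold martin_kernel. destruct (Rlt_dec _ 1); [lra|lra].
 - apply (flim_div (fun z => green_U (expand z) p) (fun z => green_U (expand z) p0)); [|auto|auto]. apply Rgt_not_eq, green_U_pos; auto.
Qed.

Lemma expand_towards (a : pt) (M dl : R) : fst a ^ 2 + snd a ^ 2 = 1 -> 0 < dl ->
 exists d, 0 < d /\ forall z, 0 <= snd z -> fst z ^ 2 + snd z ^ 2 < 1 -> dist2 z a < d -> towards a M dl (expand z).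
Proof.
 intros Ha Hdl. destruct (flim_coords (fun _ => True) a) as [F1 F2]. set (F := within (fun _ => True) (locally (a : R * R))) in *.
 assert (FF : Filter F) by apply within_filter, locally_filter. set (N := fun z : R * R => fst z ^ 2 + snd z ^ 2).
 assert (LN : filterlim N F (locally 1)) by (apply flim_eq with (fst a ^ 2 + snd a ^ 2); [unfold N; flim|auto]).
 assert (Ln : filterlim (fun z => sqrt (N z)) F (locally 1)) by (rewrite <- sqrt_1; apply (flim_cont sqrt); [exact LN|apply continuous_sqrt_pos; lra]).
 assert (L1 : filterlim (fun z : R * R => fst z / sqrt (N z)) F (locally (fst a))) by (apply flim_eq with (fst a / 1); [flim; lra|field]).
 assert (L2 : filterlim (fun z : R * R => snd z / sqrt (N z)) F (locally (snd a))) by (apply flim_eq with (snd a / 1); [flim; lra|field]).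
 set (M' := Rabs M + 1). assert (HM' : 1 <= M') by (note (Rabs_pos M); unfold M'; lra).
 assert (E1 : F (fun z => Rabs (fst z / sqrt (N z) - fst a) < dl)) by exact (proj1 (filterlim_locally _ _) L1 (mkposreal dl Hdl)).
 assert (E2 : F (fun z => Rabs (snd z / sqrt (N z) - snd a) < dl)) by exact (proj1 (filterlim_locally _ _) L2 (mkposreal dl Hdl)).
 (* The squared norm of [expand z] is [N z / (1 - N z)], which exceeds [M'^2] exactly when [N z]
    exceeds this bound. *)
 assert (E3 : F (fun z => M' ^ 2 / (1 + M' ^ 2) < N z)).
 { apply (LN (fun y => M' ^ 2 / (1 + M' ^ 2) < y)). apply locally_gt. apply (proj2 (Rlt_div_l (M' ^ 2) 1 (1 + M' ^ 2) ltac:(note (pow2_ge_0 M'); lra))). lra. }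
 note (filter_and _ _ E1 (filter_and _ _ E2 E3)) as E. unfold F, within in E. apply locally_dist2 in E. destruct E as [d [Hd KE]].
 exists d. split; auto. intros z Hz Hlt Hzd.
 destruct (KE z Hzd I) as [B1 [B2 B3]]. destruct (expand_den_pos z Hlt) as [D1 D2]. set (m := sqrt (1 - fst z ^ 2 - snd z ^ 2)) in *.
 assert (HN : 0 < N z) by (assert (0 <= M' ^ 2 / (1 + M' ^ 2)) by (apply Rmult_le_pos; [nra|left; apply Rinv_0_lt_compat; nra]); lra).
 note (sqrt_lt_R0 _ HN) as Hsn. assert (En : norm2 (expand z) = sqrt (N z) / m).
 { unfold norm2, expand. cbn [fst snd]. fold m. replace ((fst z / m) ^ 2 + (snd z / m) ^ 2) with (N z / m ^ 2) by (unfold N; field; lra).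
  rewrite sqrt_div_alt by lra. rewrite sqrt_pow2 by lra. reflexivity. }
 split; [apply expand_snd_ge0; auto|]. rewrite En. unfold expand. cbn [fst snd]. fold m.
 replace (fst z / m / (sqrt (N z) / m)) with (fst z / sqrt (N z)) by fld. replace (snd z / m / (sqrt (N z) / m)) with (snd z / sqrt (N z)) by fld.
 split; [|split; assumption]. apply Rle_lt_trans with M'; [note (Rle_abs M); unfold M'; lra|].
 apply (proj1 (Rlt_div_r M' (sqrt (N z)) m D1)). rewrite <- (sqrt_pow2 (M' * m)) by pos. apply sqrt_lt_1_alt. split; [pos|].
 rewrite Rpow_mult_distr, D2. replace (1 - fst z ^ 2 - snd z ^ 2) with (1 - N z) by (unfold N; ring).
 apply (Rmult_lt_compat_r (1 + M' ^ 2)) in B3; [|nra]. replace (M' ^ 2 / (1 + M' ^ 2) * (1 + M' ^ 2)) with (M' ^ 2) in B3 by fld. lra.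
Qed.

(** The asymptotics of the Green function give the limit only through points inside the disc.
    Continuity along the semicircle itself follows by passing from each of its points to an interior
    one nearby. *)
Lemma martin_kernel_outer_continuous (p0 p a : pt) (S : pt -> Prop) : Sigma p0 -> Sigma p -> fst a ^ 2 + snd a ^ 2 = 1 -> 0 <= snd a ->
 (forall z, S z -> Dset z) -> lim2R S (martin_kernel p0 p) a (martin_kernel p0 p a).
Proof.
 intros Hp0 Hp Ha Ha2 HS eps He.
 assert (Q : forall b e, fst b ^ 2 + snd b ^ 2 = 1 -> 0 <= snd b -> 0 < e -> exists d, 0 < d /\ forall z, 0 <= snd z -> fst z ^ 2 + snd z ^ 2 < 1 ->
  dist2 z b < d -> Rabs (martin_kernel p0 p z - martin_kernel p0 p b) < e).
 { intros b e Hb Hb2 He'. destruct (green_ratio_direction b p p0 Hb2 Hb Hp Hp0 e He') as [M [dl [Hdl K]]].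
  destruct (expand_towards b M dl Hb Hdl) as [d [Hd H]]. exists d. split; auto. intros z Hz Hlt Hzd. specialize (K _ (H z Hz Hlt Hzd)).
  unfold martin_kernel. destruct (Rlt_dec _ 1); [|contradiction]. destruct (Rlt_dec _ 1); [lra|exact K]. }
 destruct (Q a (eps / 2) Ha Ha2 ltac:(lra)) as [d [Hd H]]. exists d. split; auto. intros z Hz Hzd. destruct (HS z Hz) as [[Hlt|Hz1] Hz2].
 { specialize (H z Hz2 Hlt Hzd). lra. }
 destruct (Q z (eps / 2) Hz1 Hz2 ltac:(lra)) as [d' [Hd' H']].
 (* The radius is shortened by so little that [z'] is within [d'] of [z] and still within [d] of
    [a]; both estimates then hold at [z']. *)
 set (t := Rmin (1 / 2) (Rmin (d' / 2) ((d - dist2 z a) / 2))). set (z' := ((1 - t) * fst z, (1 - t) * snd z)).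
 assert (Ht : 0 < t /\ t <= 1 / 2 /\ t <= d' / 2 /\ t <= (d - dist2 z a) / 2).
 { unfold t. note (Rmin_l (1 / 2) (Rmin (d' / 2) ((d - dist2 z a) / 2))). note (Rmin_r (1 / 2) (Rmin (d' / 2) ((d - dist2 z a) / 2))).
  note (Rmin_l (d' / 2) ((d - dist2 z a) / 2)). note (Rmin_r (d' / 2) ((d - dist2 z a) / 2)). split; [repeat apply Rmin_pos; lra|lra]. }
 assert (Ez : dist2 z' z = t).
 { unfold dist2, z'. cbn [fst snd]. replace (((1 - t) * fst z - fst z) ^ 2 + ((1 - t) * snd z - snd z) ^ 2) with (t ^ 2 * (fst z ^ 2 + snd z ^ 2)) by ring.
  rewrite Hz1, Rmult_1_r. apply sqrt_pow2. lra. }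
 assert (Hz' : 0 <= snd z' /\ fst z' ^ 2 + snd z' ^ 2 < 1).
 { unfold z'. cbn [fst snd]. split; [apply Rmult_le_pos; lra|].
  replace (((1 - t) * fst z) ^ 2 + ((1 - t) * snd z) ^ 2) with ((1 - t) ^ 2 * (fst z ^ 2 + snd z ^ 2)) by ring. rewrite Hz1. nra. }
 note (dist2_triang z' z a). specialize (H z' (proj1 Hz') (proj2 Hz') ltac:(lra)). specialize (H' z' (proj1 Hz') (proj2 Hz') ltac:(lra)).
 apply Rabs_def2 in H. apply Rabs_def2 in H'. apply Rabs_def1; lra.
Qed.

(** * Minimality and separation of the boundary points *)

Lemma no_vanishing_solution (u : pt -> R) : Lharmonic_on Sigma u -> (forall p, Sigma p -> 0 < u p) ->
 (forall eps, 0 < eps -> exists M, forall p, Sigma p -> M < Rabs (fst p) + Rabs (snd p) -> u p < eps) ->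
 (forall x eps, 0 < eps -> exists d, 0 < d /\ forall p, Sigma p -> dist2 p (x, 0) < d -> u p < eps) -> False.
Proof.
 intros HL Hpos Hinf Hbd. assert (Sg : Sigma (0, 1)) by (unfold Sigma; simpl; lra). assert (u (0, 1) <= 0); [|specialize (Hpos _ Sg); lra].
 apply (comparison Sigma u); auto; [apply open2_Sigma|apply Lharmonic_Lsub; auto|].
 intros eta He z Hz. unfold Sigma in Hz. destruct (Rlt_le_dec (snd z) 0) as [Hn|Hn].
 - exists (- snd z). split; [lra|]. intros q Hq Hd. exfalso. unfold Sigma in Hq. note (Rabs_snd_dist2 q z) as T. apply Rabs_le_between in T. lra.
 - assert (Ez : z = (fst z, 0)) by (destruct z; simpl in *; f_equal; lra). rewrite Ez. apply Hbd; auto.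
Qed.

Lemma green_U_at_boundary (xi x eps : R) : x <> xi -> 0 < eps -> exists d, 0 < d /\ forall p, Sigma p -> dist2 p (x, 0) < d -> green_U (xi, 0) p < eps.
Proof.
 intros Hx He. set (X := Rabs (x - xi)). assert (HX : 0 < X) by (apply Rabs_pos_lt; lra).
 destruct (green_U_at_edge (xi, 0) (X / 2) eps ltac:(simpl; lra) ltac:(lra) He) as [h [Hh H]].
 exists (Rmin h (X / 2)). split; [pos|]. intros p Hp Hd. note (Rmin_l h (X / 2)). note (Rmin_r h (X / 2)). apply H; auto.
 - note (Rabs_snd_dist2 p (x, 0)) as T. cbn [snd] in T. rewrite Rminus_0_r in T. note (Rle_abs (snd p)). lra.
 - note (dist2_triang (x, 0) p (xi, 0)) as T. rewrite (dist2_sym (x, 0) p) in T. note (Rabs_fst_dist2 (x, 0) (xi, 0)) as T2. cbn [fst] in T2. fold X in T2. lra.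
Qed.

Lemma theta_U_at_boundary (om : pt) (x eps : R) : 0 <= snd om -> fst om ^ 2 + snd om ^ 2 = 1 -> 0 < eps ->
 exists d, 0 < d /\ forall p, Sigma p -> dist2 p (x, 0) < d -> theta_U om p < eps.
Proof.
 intros Hom Hn He. destruct (theta_profile_sqr om Hom) as [C [HC HCs]].
 set (K := exp (Rabs x + 1) * C). assert (HK : 0 < K) by (apply Rmult_lt_0_compat; [apply exp_pos|lra]).
 exists (Rmin 1 (eps / K)). split; [pos|]. intros p Hp Hd. unfold Sigma in Hp. note (Rmin_l 1 (eps / K)). note (Rmin_r 1 (eps / K)).
 note (Rabs_fst_dist2 p (x, 0)) as T1. note (Rabs_snd_dist2 p (x, 0)) as T2. cbn [fst snd] in T1, T2. rewrite Rminus_0_r, (Rabs_right (snd p)) in T2 by lra.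
 rewrite theta_U_exp by auto. assert (Hphi : theta_U om (0, snd p) <= C * snd p).
 { specialize (HCs (snd p) ltac:(lra)). note (theta_U_pos om (0, snd p) Hom Hp). apply Rsqr_incr_0_var; [|nra]. unfold Rsqr.
  assert (snd p ^ 3 <= snd p ^ 2) by nra. assert (C * snd p ^ 3 <= C * snd p ^ 2) by nra.
  assert (C * snd p ^ 2 <= C * C * snd p ^ 2) by nra. simpl in *. lra. }
 apply Rle_lt_trans with (K * snd p).
 - unfold K. rewrite Rmult_assoc. apply Rmult_le_compat; [pos|left; apply theta_U_pos; auto| |auto]. apply exp_le.
  assert (Hc : Rabs (fst om / 2) <= 1) by (apply Rabs_le; note (pow2_ge_0 (snd om)); nra).
  note (Rle_abs (fst om / 2 * fst p)) as T. rewrite Rabs_mult in T. note (Rabs_triang (fst p - x) x) as T3. replace (fst p - x + x) with (fst p) in T3 by ring.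
  note (Rabs_pos (fst p)). note (Rabs_pos (fst om / 2)). nra.
 - replace eps with (K * (eps / K)) by fld. apply Rmult_lt_compat_l; auto. lra.
Qed.

Lemma Dbd_cases (z : pt) : Dbd z -> (fst z ^ 2 + snd z ^ 2 = 1 /\ 0 <= snd z) \/ exists xi, z = compress (xi, 0).
Proof.
 intros [[H1 H2] H3]. destruct (Rlt_le_dec (fst z ^ 2 + snd z ^ 2) 1) as [Hl|Hl]; [|lra]. right.
 assert (E : snd z = 0) by (apply Rle_antisym; auto; apply Rnot_lt_le; intros C; apply H3; split; auto).
 exists (fst (expand z)). rewrite <- (compress_expand z) at 1 by auto. f_equal.
 assert (E2 : snd (expand z) = 0) by (unfold expand; cbn [snd]; rewrite E; unfold Rdiv; ring). rewrite <- E2. destruct (expand z); reflexivity.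
Qed.

Lemma martin_kernel_segment (p0 p : pt) (xi : R) : martin_kernel p0 p (compress (xi, 0)) = green_U (xi, 0) p / green_U (xi, 0) p0.
Proof.
 unfold martin_kernel. destruct (Rlt_dec _ 1) as [_|H]; [rewrite expand_compress; reflexivity|]. exfalso. apply H. apply compress_norm.
Qed.

Lemma martin_kernel_circle (p0 p z : pt) : fst z ^ 2 + snd z ^ 2 = 1 -> martin_kernel p0 p z = theta_U z p / theta_U z p0.
Proof. intros H. unfold martin_kernel. destruct (Rlt_dec _ 1); [lra|lra]. Qed.

Lemma martin_kernel_minimal (p0 om : pt) : Sigma p0 -> Dbd om -> minimal_pos_Lharmonic (fun p => martin_kernel p0 p om).
Proof.
 intros Hp0 Hom. destruct (Dbd_cases om Hom) as [[H1 H2]|[xi ->]].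
 - replace (fun p => martin_kernel p0 p om) with (fun p => theta_U om p / theta_U om p0)
   by (apply functional_extensionality; intros p; rewrite martin_kernel_circle; auto).
  apply minimal_scale; [apply theta_U_pos; auto|intros; apply theta_U_pos; auto|apply theta_U_harmonic; auto|].
  intros v Hv Hb. apply (theta_minimal_aux om H2 H1 v Hv Hb).
 - replace (fun p => martin_kernel p0 p (compress (xi, 0))) with (fun p => green_U (xi, 0) p / green_U (xi, 0) p0)
   by (apply functional_extensionality; intros p; rewrite martin_kernel_segment; auto).
  apply minimal_scale; [apply segment_U_pos; auto|intros; apply segment_U_pos; auto|apply segment_U_harmonic|].
  intros v Hv Hb. apply (segment_minimal_aux xi v Hv Hb).
Qed.

(** [green_U (xi, 0)] already vanishes at infinity and at every other point of the boundary line.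
    Proportionality to a function vanishing at [(xi, 0)] too would make it vanish on the whole
    boundary, hence identically. *)
Lemma segment_kernel_separated (xi k : R) (w : pt -> R) : 0 < k ->
 (forall eps, 0 < eps -> exists d, 0 < d /\ forall p, Sigma p -> dist2 p (xi, 0) < d -> w p < eps) ->
 (forall p, Sigma p -> green_U (xi, 0) p = k * w p) -> False.
Proof.
 intros Hk Hw E. apply (no_vanishing_solution (green_U (xi, 0))).
 - apply segment_U_harmonic.
 - apply segment_U_pos.
 - intros eps He. apply green_U_at_infinity; auto. simpl; lra.
 - intros x eps He. destruct (Req_dec x xi) as [-> |Hx]; [|apply green_U_at_boundary; auto].
  destruct (Hw (eps / k)) as [d [Hd H]]; [pos|]. exists d. split; auto. intros p Hp Hpd. rewrite E by auto.
  replace eps with (k * (eps / k)) by fld. apply Rmult_lt_compat_l; auto.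
Qed.

Lemma martin_kernel_separates (p0 w1 w2 : pt) : Sigma p0 -> Dbd w1 -> Dbd w2 -> w1 <> w2 ->
 exists p, Sigma p /\ martin_kernel p0 p w1 <> martin_kernel p0 p w2.
Proof.
 intros Hp0 H1 H2 Hne. apply NNPP. intros HN. assert (E : forall p, Sigma p -> martin_kernel p0 p w1 = martin_kernel p0 p w2).
 { intros p Hp. apply NNPP. intros C. apply HN. exists p. auto. }
 clear HN. assert (Seg_circle : forall xi z, fst z ^ 2 + snd z ^ 2 = 1 -> 0 <= snd z ->
  (forall p, Sigma p -> green_U (xi, 0) p / green_U (xi, 0) p0 = theta_U z p / theta_U z p0) -> False).
 { intros xi z Hz1 Hz2 Eq. note (theta_U_pos z p0 Hz2 Hp0). note (segment_U_pos xi p0 Hp0).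
  apply (segment_kernel_separated xi (green_U (xi, 0) p0 / theta_U z p0) (theta_U z)); [pos|intros; apply theta_U_at_boundary; auto|].
  intros p Hp. replace (green_U (xi, 0) p) with (green_U (xi, 0) p / green_U (xi, 0) p0 * green_U (xi, 0) p0) by fld. rewrite Eq by auto. field. lra. }
 destruct (Dbd_cases w1 H1) as [[A1 A2]|[xi1 ->]]; destruct (Dbd_cases w2 H2) as [[B1 B2]|[xi2 ->]].
 (* A unit horizontal shift multiplies [theta_U z] by [exp (fst z / 2)]. This recovers [fst z], and
    [snd z >= 0] is then determined by the circle. *)
 - apply Hne. set (p := (fst p0 + 1, snd p0)). specialize (E p Hp0). rewrite !martin_kernel_circle in E by auto.
  assert (Q : forall z, 0 <= snd z -> theta_U z p / theta_U z p0 = exp (fst z / 2)).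
  { intros z Hz. rewrite (theta_U_exp z p), (theta_U_exp z p0) by auto. unfold p. cbn [fst snd]. note (theta_U_pos z (0, snd p0) Hz Hp0).
   replace (fst z / 2 * (fst p0 + 1)) with (fst z / 2 * fst p0 + fst z / 2) by ring. rewrite exp_plus. note (exp_pos (fst z / 2 * fst p0)). field. lra. }
  rewrite !Q in E by auto. apply exp_inv in E. assert (E1 : fst w1 = fst w2) by lra. assert (E2 : snd w1 = snd w2) by nra.
  destruct w1, w2. simpl in *. subst. reflexivity.
 - apply (Seg_circle xi2 w1 A1 A2). intros p Hp. rewrite <- martin_kernel_segment, <- martin_kernel_circle by auto. symmetry. auto.
 - apply (Seg_circle xi1 w2 B1 B2). intros p Hp. rewrite <- martin_kernel_segment, <- martin_kernel_circle by auto. auto.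
 - note (segment_U_pos xi1 p0 Hp0). note (segment_U_pos xi2 p0 Hp0).
  apply (segment_kernel_separated xi1 (green_U (xi1, 0) p0 / green_U (xi2, 0) p0) (green_U (xi2, 0))); [pos| |].
  + intros eps He. apply green_U_at_boundary; auto. intros ->. apply Hne. reflexivity.
  + intros p Hp. specialize (E p Hp). rewrite !martin_kernel_segment in E.
   replace (green_U (xi1, 0) p) with (green_U (xi1, 0) p / green_U (xi1, 0) p0 * green_U (xi1, 0) p0) by fld. rewrite E. field. lra.
Qed.

Lemma compress_Dint (p : pt) : Sigma p -> Dint (compress p).
Proof. intros Hp. split; [apply compress_norm|]. destruct (compress_den_pos p). unfold compress. cbn [snd]. apply Rdiv_lt_0_compat; auto. Qed.

Lemma expand_Sigma (z : pt) : Dint z -> Sigma (expand z).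
Proof. intros [H1 H2]. destruct (expand_den_pos z H1). unfold expand, Sigma. cbn [snd]. apply Rdiv_lt_0_compat; auto. Qed.

Lemma martin_model_holds (G : pt -> pt -> R) (p0 : pt) : is_min_Green G -> Sigma p0 -> martin_model G p0 compress expand (martin_kernel p0).
Proof.
 intros HG Hp0. split; [apply compress_Dint|]. split; [apply expand_Sigma|]. split; [intros; apply expand_compress|].
 split; [intros z [Hz _]; apply compress_expand; auto|]. split; [intros a _; apply compress_lim|].
 split; [intros a [Ha _]; destruct (expand_flim Dint a Ha); apply lim2_components; auto|]. split; [|split].
 (* The factor [lam] depends on the pole only and cancels in the quotient. *)
 - intros p Hp z Hz Hzp Hzp0. note (expand_Sigma z Hz) as Hq. destruct (green_identification G (expand z) HG Hq) as [lam [Hlam Hid]].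
  assert (Hne : forall q, z <> compress q -> q <> expand z) by (intros q Hn ->; apply Hn; rewrite compress_expand; auto; apply Hz).
  note (green_U_pos _ p0 (Rlt_le _ _ Hq) Hp0 (Hne p0 Hzp0)).
  unfold martin_kernel, Kmartin. destruct (Rlt_dec _ 1) as [_|C]; [|exfalso; apply C; apply Hz]. rewrite !Hid by auto. field. lra.
 - intros p Hp a [[Ha1 Ha2] [Hap Hap0]]. assert (HS : forall z, Dset z /\ z <> compress p /\ z <> compress p0 -> Dset z) by tauto.
  destruct Ha1 as [Ha|Ha]; [apply martin_kernel_inner_continuous; auto|apply martin_kernel_outer_continuous; auto].
 - intros w1 w2 H1 H2 Hne. apply martin_kernel_separates; auto.
Qed.

Lemma segment_kernel_vanishes (p0 om : pt) (xi : R) : Sigma p0 -> Dbd om -> om <> compress (xi, 0) ->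
 lim2R Dint (fun z => martin_kernel p0 (expand z) (compress (xi, 0))) om 0.
Proof.
 intros Hp0 Hom Hne eps He. note (segment_U_pos xi p0 Hp0) as H0. set (g := green_U (xi, 0) p0) in *. assert (Heg : 0 < eps * g) by pos.
 assert (Q : exists d, 0 < d /\ forall z, Dint z -> dist2 z om < d -> green_U (xi, 0) (expand z) < eps * g).
 { destruct (Dbd_cases om Hom) as [[H1 H2]|[x ->]].
  - destruct (green_U_at_infinity (xi, 0) (eps * g) ltac:(simpl; lra) Heg) as [M HM]. destruct (expand_towards om M 1 H1 Rlt_0_1) as [d [Hd H]].
   exists d. split; auto. intros z Hz Hzd. apply HM; [apply expand_Sigma; auto|]. destruct (H z (Rlt_le _ _ (proj2 Hz)) (proj1 Hz) Hzd) as [_ [HM' _]].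
   eapply Rlt_le_trans; [exact HM'|]. note (dist2_le_Rabs (expand z) (0, 0)) as T. unfold dist2 in T. cbn [fst snd] in T. rewrite !Rminus_0_r in T. exact T.
  - assert (Hx : x <> xi) by (intros ->; apply Hne; reflexivity). destruct (green_U_at_boundary xi x (eps * g) Hx Heg) as [d [Hd H]].
   destruct (expand_flim Dint (compress (x, 0)) (compress_norm _)) as [E1 E2].
   destruct (lim2_components Dint expand (compress (x, 0)) (expand (compress (x, 0))) E1 E2 d Hd) as [d' [Hd' H']].
   exists d'. split; auto. intros z Hz Hzd. specialize (H' z Hz Hzd). rewrite expand_compress in H'. apply H; auto. apply expand_Sigma; auto. }
 destruct Q as [d [Hd H]]. exists d. split; auto. intros z Hz Hzd. specialize (H z Hz Hzd). rewrite martin_kernel_segment, Rminus_0_r. fold g.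
 note (segment_U_pos xi (expand z) (expand_Sigma z Hz)). rewrite Rabs_right by pos. apply (proj2 (Rlt_div_l _ eps g H0)). auto.
Qed.

Theorem theorem6p3 :
  forall (G : pt -> pt -> R) (p0 : pt),
    is_min_Green G -> Sigma p0 ->
    exists (h hinv : pt -> pt) (Kext : pt -> pt -> R) (w : R -> pt),
      martin_model G p0 h hinv Kext /\
      (* every Martin boundary point is minimal *)
      (forall om, Dbd om -> minimal_pos_Lharmonic (fun p => Kext p om)) /\
      (* (1) *)
      (forall xi, lim2 Sigma h (xi, 0) (w xi)) /\
      (forall xi, Seg (w xi)) /\
      (forall z, Seg z -> exists xi, w xi = z) /\
      (forall xi1 xi2, w xi1 = w xi2 -> xi1 = xi2) /\
      cont12_on (fun _ => True) w /\
      (exists winv : pt -> R, (forall xi, winv (w xi) = xi) /\ cont2R_on Seg winv) /\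
      (* (2) *)
      (forall xi0, 0 < xi0 ->
         lim_pinf (fun eta => h (xi0, eta)) (0, 1)) /\
      (* (3) *)
      (forall theta, (0 < theta < PI / 2 \/ PI / 2 < theta < PI) ->
         lim_pinf (fun t => h (t / tan theta, t)) (cos theta, sin theta)) /\
      lim_pinf w (1, 0) /\ lim_minf w (-1, 0) /\
      (* (4) *)
      (forall xi om, Dbd om -> om <> w xi ->
         lim2R Dint (fun z => Kext (hinv z) (w xi)) om 0).
Proof.
 intros G p0 HG Hp0. exists compress, expand, (martin_kernel p0), (fun xi => compress (xi, 0)).
 assert (Hw0 : forall xi, snd (compress (xi, 0)) = 0) by (intros; unfold compress; cbn [fst snd]; unfold Rdiv; ring).
 assert (Hnorm : forall z, Seg z -> fst z ^ 2 + snd z ^ 2 < 1) by (intros z [Hz1 Hz2]; rewrite Hz2; nra).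
 split; [apply martin_model_holds; auto|]. split; [intros; apply martin_kernel_minimal; auto|]. split; [intros; apply compress_lim|].
 split.
 { intros xi. note (compress_norm (xi, 0)) as H. rewrite Hw0 in H. split; [|auto]. nra. }
 split.
 { intros z Hz. exists (fst (expand z)). rewrite <- (compress_expand z) at 2 by auto. f_equal.
  assert (E2 : snd (expand z) = 0) by (unfold expand; cbn [snd]; rewrite (proj2 Hz); unfold Rdiv; ring). rewrite <- E2. destruct (expand z); reflexivity. }
 split.
 { intros x1 x2 E. apply (f_equal expand) in E. rewrite !expand_compress in E. injection E. auto. }
 split.
 { intros a _ eps He. destruct (compress_lim (fun _ => True) (a, 0) eps He) as [d [Hd H]]. exists d. split; auto. intros t _ Ht. apply H; auto.
  eapply Rle_lt_trans; [apply dist2_le_Rabs|]. cbn [fst snd]. rewrite Rminus_diag, Rabs_R0. lra. }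
 split.
 { exists (fun z => fst (expand z)). split; [intros; rewrite expand_compress; reflexivity|].
  intros a Ha. apply lim2R_filterlim. apply (expand_flim Seg a); auto. }
 split.
 { intros xi0 _. apply (compress_ray (xi0, 0) (0, 1)); [simpl; ring|]. intros t. cbn [fst snd]. f_equal. f_equal; ring. }
 split.
 { intros theta Ht. assert (Hs : 0 < sin theta) by (apply sin_gt_0; lra). assert (Hc : cos theta <> 0).
  { destruct Ht; [apply Rgt_not_eq, cos_gt_0; lra|]. apply Rlt_not_eq, cos_lt_0; lra. }
  assert (R : lim_pinf (fun t => compress (fst (0, 0) + t * fst (cos theta, sin theta), snd (0, 0) + t * snd (cos theta, sin theta))) (cos theta, sin theta)).
  { apply (compress_ray (0, 0) (cos theta, sin theta)); [|auto]. cbn [fst snd]. note (sin2_cos2 theta) as E. unfold Rsqr in E. simpl. lra. }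
  intros eps He. destruct (R eps He) as [M HM]. exists (Rabs M). intros t Ht'. cbn [fst snd] in HM.
  (* The point lies on the ray of direction [theta] at parameter [t / sin theta], which is at least
     [t]. *)
  replace (t / tan theta, t) with (0 + t / sin theta * cos theta, 0 + t / sin theta * sin theta) by (f_equal; unfold tan; field; auto; lra).
  apply HM. note (Rle_abs M). note (Rabs_pos M). note (SIN_bound theta). apply Rlt_le_trans with t; [lra|]. apply (proj1 (Rle_div_r t t _ Hs)). nra. }
 split.
 { apply (compress_ray (0, 0) (1, 0)); [simpl; ring|]. intros t. cbn [fst snd]. f_equal. f_equal; ring. }
 split.
 { assert (R : lim_pinf (fun t => compress (- t, 0)) (-1, 0)).
  { apply (compress_ray (0, 0) (-1, 0)); [simpl; ring|]. intros t. cbn [fst snd]. f_equal. f_equal; ring. }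
  intros eps He. destruct (R eps He) as [M HM]. exists (- M). intros t Ht. specialize (HM (- t) ltac:(lra)). rewrite Ropp_involutive in HM. exact HM. }
 intros xi om Hom Hne. apply segment_kernel_vanishes; auto.
Qed.
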